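(* Assume that $\mathrm{A}-\mathrm{A}_+:\mathbb{H}(\Omega)\to\mathbb{H}(\Omega)'$ and $\mathrm{T}-\mathrm{T}_+:\mathbb{H}(\Sigma)\to\mathbb{H}(\Sigma)'$ belong to the Schatten $p$-class for some $p\ge1$. Let $\mathrm{S}_r=i\,\mathrm{Id}+\mathrm{K}_r$, where $\mathrm{K}_r:\mathbb{H}(\Sigma)'\to\mathbb{H}(\Sigma)'$ is a bounded linear operator of finite rank $r$, and assume $\sigma_1(\mathrm{S}-\mathrm{S}_r)<\gamma_\star$. Let $\mathbf{p}_n\in\mathbb{H}(\Sigma)'$ ($n\ge1$) be the $n$-th iterate obtained by applying GMRes (with respect to the norm $\|\cdot\|_{\mathrm{T}^{-1}}$) to the preconditioned equation $$(\mathrm{Id}+\Pi\mathrm{S}_r)^{-1}(\mathrm{Id}+\Pi\mathrm{S})\mathbf{p}=(\mathrm{Id}+\Pi\mathrm{S}_r)^{-1}\mathbf{f},$$ and set $\mathbf{r}_n=\mathbf{f}-(\mathrm{Id}+\Pi\mathrm{S})\mathbf{p}_n$. Then $$\frac{\|\mathbf{r}_n\|_{\mathrm{T}^{-1}}}{\|\mathbf{r}_0\|_{\mathrm{T}^{-1}}}\leq\Big(\frac{2+\sigma_1(\mathrm{S}-\mathrm{S}_r)}{\gamma_\star-\sigma_1(\mathrm{S}-\mathrm{S}_r)}\Big)\left(\frac{\|\mathrm{S}-\mathrm{S}_r\|_{\mathcal{C}_p}}{\gamma_\star\,n^{1/p}}+\Big(\frac{\|\mathrm{S}-\mathrm{S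}_r\|_{\mathcal{C}_p}}{\gamma_\star\,n^{1/p}}\Big)^{2}\right)^{n}\Big(1-\frac{\sigma_1(\mathrm{S}-\mathrm{S}_r)}{\gamma_\star}\Big)^{-n}.$$
   Context: Setting: $\Omega\subset\mathbb{R}^d$ is a bounded Lipschitz open set, $\kappa>0$, $\kappa_*\ge 0$, $f\in L^2(\Omega)$, and $\Omega_1,\dots,\Omega_J\subset\Omega$ are pairwise disjoint Lipschitz open subdomains with $\overline{\Omega}=\overline{\Omega}_1\cup\dots\cup\overline{\Omega}_J$; $\Sigma=\partial\Omega_1\cup\dots\cup\partial\Omega_J$. All spaces are complex Hilbert spaces; $\langle\cdot,\cdot\rangle$ is the duality pairing without complex conjugation; for $L:H\to V$ bounded, $L^*:V'\to H'$ is defined by $\langle L(u),p\rangle=\langle u,L^*(p)\rangle$. $H^1(\omega)$ carries the norm $\|v\|_{H^1(\omega)}^2=\|\nabla v\|_{L^2(\omega)}^2+\kappa^2\|v\|_{L^2(\omega)}^2$. Well-posedness (standing assumption): with $a(u,v)=\int_\Omega\nabla u\cdot\nabla\overline v-\kappa^2u\overline v\,dx-i\kappa_*\int_{\partial\Omega}u\overline v\,ds$, one has $\alpha:=\inf_{u\in H^1(\Omega)\setminus\{0\}}\sup_{v\in H^1(\Omega)\setminus\{0\}}\frac{|a(u,v)|}{\|u\|_{H^1(\Omega)}\|v\|_{H^1(\Omega)}}>0$. $\mathbb{H}(\Omega):=H^1(\Omega_1)\times\dots\times H^1(\Omega_J)$ and $\mathbb{H}(\Sigma):=H^{1/2}(\partial\Omega_1)\times\dots\times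 H^{1/2}(\partial\Omega_J)$, with duals $\mathbb{H}(\Omega)'$, $\mathbb{H}(\Sigma)'$. $\mathrm{B}=\mathrm{diag}(\mathrm{B}_{\Omega_j}):\mathbb{H}(\Omega)\to\mathbb{H}(\Sigma)$ with $\mathrm{B}_{\Omega_j}$ the Dirichlet trace on $\partial\Omega_j$. $\mathrm{A}=\mathrm{diag}(\mathrm{A}_{\Omega_j})$, $\mathrm{A}_+=\mathrm{diag}(\mathrm{A}_{\Omega_j,+}):\mathbb{H}(\Omega)\to\mathbb{H}(\Omega)'$ with $\langle \mathrm{A}_{\Omega_j}(u),v\rangle=\int_{\Omega_j}\nabla u\cdot\nabla v-\kappa^2uv\,dx-i\kappa_*\int_{\partial\Omega\cap\partial\Omega_j}uv\,ds$ and $\langle \mathrm{A}_{\Omega_j,+}(u),v\rangle=\int_{\Omega_j}\nabla u\cdot\nabla v+\kappa^2uv\,dx$. The norm of $\mathbb{H}(\Omega)$ is $\langle \mathrm{A}_+(u),\overline u\rangle^{1/2}$. $\mathrm{T}_+=\mathrm{diag}(\mathrm{T}_{\Omega_j,+}):\mathbb{H}(\Sigma)\to\mathbb{H}(\Sigma)'$, where $\mathrm{T}_{\Omega_j,+}(\phi|_{\partial\Omega_j})=\mathbf{n}_{\Omega_j}\cdot\nabla\phi|_{\partial\Omega_j}$ for every $\phi\in H^1(\Omega_j)$ with $-\Delta\phi+\kappa^2\phi=0$ in $\Omega_j$ ($\mathbf{n}_{\Omega_j}$ exterior unit normal). The reference norm of $\mathbb{H}(\Sigma)$ is $\langle\mathrm{T}_+(p),\overline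 p\rangle^{1/2}$. Impedance operator: $\mathrm{T}=\mathrm{diag}(\mathrm{T}_{\Omega_j}):\mathbb{H}(\Sigma)\to\mathbb{H}(\Sigma)'$ is bounded, block-diagonal, self-adjoint positive definite (i.e. $\langle\mathrm{T}(p),\overline q\rangle$ is a Hermitian scalar product), with $\mathrm{T}-\mathrm{T}_+$ compact; its norm is then equivalent to the reference norm. On $\mathbb{H}(\Sigma)'$ set $\|p\|_{\mathrm{T}^{-1}}^2=\langle\mathrm{T}^{-1}(p),\overline p\rangle$. $H^{1/2}(\Sigma):=\{u|_\Sigma:\ u\in H^1(\Omega)\}$ with the quotient norm, and $\mathrm{R}:H^{1/2}(\Sigma)\to\mathbb{H}(\Sigma)$, $\mathrm{R}(v)=(v|_{\partial\Omega_1},\dots,v|_{\partial\Omega_J})$. Exchange operator $\Pi=2\mathrm{T}\mathrm{R}(\mathrm{R}^*\mathrm{T}\mathrm{R})^{-1}\mathrm{R}^*-\mathrm{Id}$ and scattering operator $\mathrm{S}=2i\mathrm{T}\mathrm{B}(\mathrm{A}-i\mathrm{B}^*\mathrm{T}\mathrm{B})^{-1}\mathrm{B}^*+\mathrm{Id}$, both bounded on $\mathbb{H}(\Sigma)'$ ($\mathrm{A}-i\mathrm{B}^*\mathrm{T}\mathrm{B}$ is boundedly invertible). Right-hand side: $\mathbf{f}=-2i\Pi\mathrm{T}\mathrm{B}(\mathrm{A}-i\mathrm{B}^*\mathrm{T}\mathrm{B})^{-1}\boldsymbol{\ell}$, with $\boldsymbol\ell=(\ell_1,\dots,\ell_J)$,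 $\langle\ell_j,v\rangle=\int_{\Omega_j}fv\,dx$. Known facts: $\|\Pi\mathbf p\|_{\mathrm{T}^{-1}}=\|\mathbf p\|_{\mathrm{T}^{-1}}$, $\Pi^2=\mathrm{Id}$, $\|\mathrm S\mathbf p\|_{\mathrm{T}^{-1}}\le\|\mathbf p\|_{\mathrm{T}^{-1}}$, and $\mathrm{Id}+\Pi\mathrm{S}$ is invertible with $\gamma_\star:=\inf_{\mathbf{p}\ne0}\|(\mathrm{Id}+\Pi\mathrm{S})\mathbf p\|_{\mathrm{T}^{-1}}/\|\mathbf p\|_{\mathrm{T}^{-1}}=\|(\mathrm{Id}+\Pi\mathrm{S})^{-1}\|^{-1}>0$. The condition $\sigma_1(\mathrm{S}-\mathrm{S}_r)<\gamma_\star$ ensures that $\mathrm{Id}+\Pi\mathrm{S}_r$ is invertible. GMRes for $M\mathbf p=\mathbf g$ with initial guess $\mathbf p_0\in\mathbb{H}(\Sigma)'$: the $n$-th iterate $\mathbf p_n$ minimizes $\|\mathbf g-M\mathbf z\|_{\mathrm{T}^{-1}}$ over $\mathbf z\in\mathbf p_0+\mathrm{span}\{M^k(\mathbf g-M\mathbf p_0):0\le k\le n-1\}$. It is assumed that $\mathbf r_0\neq0$. Singular values: $\sigma_j(L)=\inf\{\|L-L_j\|:\mathrm{rank}(L_j)<j\}$, $j\ge1$ (so $\sigma_1(L)=\|L\|$). Schatten class: $\mathcal{C}_p$ is the set of compact $\mathrm{K}$ with $\|\mathrm{K}\|_{\mathcal{C}_p}=(\sum_{j\ge1}\sigma_j(\mathrm{K})^p)^{1/p}<\infty$.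 For operators on $\mathbb{H}(\Sigma)'$, operator norms, singular values and Schatten norms are taken with respect to $\|\cdot\|_{\mathrm{T}^{-1}}$. *)

(* Defs.v *)
From HB Require Import structures.
From mathcomp Require Import all_boot all_order all_algebra.
From mathcomp Require Import complex.
From mathcomp Require Import all_classical all_reals all_analysis.

Set Implicit Arguments.
Unset Strict Implicit.
Unset Printing Implicit Defensive.

Import numFieldNormedType.Exports.
Import Order.TTheory GRing.Theory Num.Theory.
Local Open Scope classical_set_scope.
Local Open Scope ring_scope.

(* [mu_ext] takes covers by measurable sets; on this copy of T, where every set
   is measurable, it yields the outer measure built from covers by arbitrary
   sets. *)
Definition allsets (T : Type) : Type := T.

HB.instance Definition _ (T : pointedType) := Pointed.on (allsets T).
HB.instance Definition _ (T : pointedType) :=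
  @isMeasurable.Build default_measure_display (allsets T)
    discrete_measurable (@discrete_measurable0 T) (@discrete_measurableC T)
    (@discrete_measurableU T).

Section euclidean_measures.
Context {R : realType}.
Local Open Scope ereal_scope.

Definition enorm m (x : 'rV[R]_m) : R := Num.sqrt (\sum_i x ord0 i ^+ 2)%R.

(* The volume of the smallest closed box containing A. *)
Definition box_gauge m (A : set (allsets 'rV[R]_m)) : \bar R :=
  if `[< A = set0 >] then 0 else
  ereal_inf [set (\prod_i (c.2 ord0 i - c.1 ord0 i))%R%:E | c in
    [set c : 'rV[R]_m * 'rV[R]_m | forall x, A x -> forall i,
       (c.1 ord0 i <= x ord0 i <= c.2 ord0 i)%R]].

Lemma box_gauge0 m : @box_gauge m set0 = 0.
Proof. by rewrite /box_gauge asboolT. Qed.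

Lemma box_gauge_ge0 m A : 0 <= @box_gauge m A.
Proof.
rewrite /box_gauge; case: asboolP => // A0.
apply: le_ereal_inf_tmp => _ [c Ac <-].
have /set0P[x Ax] : A != set0 by apply/eqP.
rewrite lee_fin prodr_ge0// => i _; rewrite subr_ge0.
by have /andP[] := Ac _ Ax i; exact: le_trans.
Qed.

Definition lebesgue_outer m (A : set 'rV[R]_m) : \bar R :=
  mu_ext (@box_gauge m) A.

HB.instance Definition _ m := isOuterMeasure.Build R 'rV[R]_m
  (@lebesgue_outer m)
  (mu_ext0 (@box_gauge0 m) (@box_gauge_ge0 m))
  (mu_ext_ge0 (@box_gauge_ge0 m))
  (le_mu_ext (@box_gauge m))
  (mu_ext_sigma_subadditive (@box_gauge_ge0 m)).

Definition diam m (A : set 'rV[R]_m) : \bar R :=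
  ereal_sup [set (enorm (x - y))%:E | x in A & y in A].

(* The volume of a k-ball of diameter 1: the factor for which the Hausdorff
   measure of dimension k is the k-dimensional surface measure. *)
Definition half_ball_volume k : \bar R :=
  lebesgue_outer [set x : 'rV[R]_k | enorm x <= 2^-1]%R.

Definition diam_gauge m k (delta : R) (A : set (allsets 'rV[R]_m)) : \bar R :=
  if `[< A = set0 >] then 0 else
  if diam A <= delta%:E then half_ball_volume k * (fine (diam A) ^+ k)%:E
  else +oo.

Lemma diam_gauge0 m k delta : @diam_gauge m k delta set0 = 0.
Proof. by rewrite /diam_gauge asboolT. Qed.

Lemma diam_gauge_ge0 m k delta A : 0 <= @diam_gauge m k delta A.
Proof.
rewrite /diam_gauge; case: asboolP => // A0; case: ifP => // _.
apply: mule_ge0; first exact: outer_measure_ge0.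
rewrite lee_fin exprn_ge0// fine_ge0//.
have /set0P[x Ax] : A != set0 by apply/eqP.
apply: (@le_trans _ _ (enorm (x - x))%:E); first by rewrite lee_fin sqrtr_ge0.
by apply: ereal_sup_ubound; exists x => //; exists x.
Qed.

Definition hausdorff_outer m k (A : set 'rV[R]_m) : \bar R :=
  ereal_sup [set mu_ext (@diam_gauge m k delta) A | delta in [set e | 0 < e]%R].

Section hausdorff_outer_measure.
Variables m k : nat.

Let hausdorff0 : hausdorff_outer k (set0 : set 'rV[R]_m) = 0.
Proof.
rewrite /hausdorff_outer (_ : image _ _ = [set 0]) ?ereal_sup1//.
apply/seteqP; split => [_ [e _ <-]|_ ->] /=.
  exact: (mu_ext0 (@diam_gauge0 m k e) (@diam_gauge_ge0 m k e)).
by exists 1%R => //=; exact: (mu_ext0 (@diam_gauge0 m k _) (@diam_gauge_ge0 m k _)).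
Qed.

Let hausdorff_ge0 (A : set 'rV[R]_m) : 0 <= hausdorff_outer k A.
Proof.
apply: (@le_trans _ _ (mu_ext (@diam_gauge m k 1) A)).
  exact: (mu_ext_ge0 (@diam_gauge_ge0 m k 1)).
by apply: ereal_sup_ubound; exists 1%R => //=.
Qed.

Let le_hausdorff :
  {homo @hausdorff_outer m k : A B / A `<=` B >-> A <= B}.
Proof.
move=> A B AB; apply: ge_ereal_sup => _ [e e0 <-].
apply: (le_trans (le_mu_ext (@diam_gauge m k e) AB)).
by apply: ereal_sup_ubound; exists e.
Qed.

Let hausdorff_subadditive : sigma_subadditive (@hausdorff_outer m k).
Proof.
move=> F; apply: ge_ereal_sup => _ [e e0 <-].
apply: (le_trans (mu_ext_sigma_subadditive (@diam_gauge_ge0 m k e) F)).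
apply: lee_nneseries => [i *|i *]; first exact: (mu_ext_ge0 (@diam_gauge_ge0 m k e)).
by apply: ereal_sup_ubound; exists e.
Qed.

HB.instance Definition _ := isOuterMeasure.Build R 'rV[R]_m
  (@hausdorff_outer m k) hausdorff0 hausdorff_ge0 le_hausdorff
  hausdorff_subadditive.

End hausdorff_outer_measure.

Definition cara (T : pointedType) (mu : {outer_measure set T -> \bar R}) :
    {measure set (caratheodory_type mu) -> \bar R} :=
  (mu : set (caratheodory_type mu) -> \bar R).

Definition leb m := cara (@lebesgue_outer m : {outer_measure set 'rV[R]_m -> \bar R}).

Definition surf d :=
  cara (@hausdorff_outer d.+1 d : {outer_measure set 'rV[R]_d.+1 -> \bar R}).

End euclidean_measures.

Local Open Scope complex_scope.

(* A complex normed space is a linear subspace [ndom] of an ambient module with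
   a norm [nnrm] that is meaningful on [ndom] only. Spaces of functions are not
   quotiented by almost everywhere equality: elements at distance 0 represent
   the same vector. Operators are functions between the ambient modules, and
   only their values on [ndom] matter. *)
Record nspace (R : realType) := NSpace {
  ncar :> lmodType R[i];
  ndom : set ncar;
  nnrm : ncar -> R }.

Section operators.
Context {R : realType}.
Local Notation C := R[i].
Implicit Types X Y : nspace R.

Definition ext0 (T : Type) (D : set T) (f : T -> C) : T -> C :=
  fun x => if x \in D then f x else 0.

(* Bounded linear functionals on X, normalized to vanish off [ndom X], so that
   equality of functionals is equality of functions. *)
Definition dual X : nspace R :=
  @NSpace R (X -> C)
    [set l | [/\ forall a u v, ndom u -> ndom v ->
                   l (a *: u + v) = a * l u + l v,
                 exists c : R, forall u, ndom u -> Normc.normc (l u) <= c * nnrm u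
               & forall u, ~ ndom u -> l u = 0]]
    (fun l => inf [set c : R | 0 <= c /\
       forall u, ndom u -> Normc.normc (l u) <= c * nnrm u]).

Definition bounded_op X Y (L : X -> Y) : Prop :=
  [/\ forall u, ndom u -> ndom (L u),
      forall a u v, ndom u -> ndom v -> L (a *: u + v) = a *: L u + L v
    & exists c : R, forall u, ndom u -> nnrm (L u) <= c * nnrm u].

Definition opnorm X Y (L : X -> Y) : R :=
  inf [set c : R | 0 <= c /\ forall u, ndom u -> nnrm (L u) <= c * nnrm u].

Definition rank_le X Y (L : X -> Y) (m : nat) : Prop :=
  exists w : 'I_m -> Y, forall u, ndom u ->
    exists c : 'I_m -> C, L u = \sum_i c i *: w i.

Definition has_rank X Y (L : X -> Y) (r : nat) : Prop :=
  rank_le L r /\ forall m, rank_le L m -> (r <= m)%N.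

(* Numbered from j = 1. *)
Definition singular_value X Y (L : X -> Y) (j : nat) : R :=
  inf [set opnorm (fun u => L u - F u) | F in
        [set F : X -> Y | bounded_op F /\ exists2 m, (m < j)%N & rank_le F m]].

Definition compact_op X Y (L : X -> Y) : Prop :=
  bounded_op L /\
  forall u : nat -> X,
    (forall k, ndom (u k)) -> (exists c : R, forall k, nnrm (u k) <= c) ->
    exists (s : nat -> nat) (y : Y), [/\ forall k, (s k < s k.+1)%N, ndom y &
      (fun k => nnrm (L (u (s k)) - y)) @ \oo --> (0 : R)].

Definition schatten_sum X Y (p : R) (L : X -> Y) : \bar R :=
  (\sum_(1 <= j <oo) (singular_value L j `^ p)%:E)%E.

Definition schatten X Y (p : R) (L : X -> Y) : Prop :=
  compact_op L /\ (schatten_sum p L < +oo)%E.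

Definition schatten_norm X Y (p : R) (L : X -> Y) : R :=
  fine (schatten_sum p L) `^ p^-1.

(* L^* : q |-> (u |-> <L u, q>), from functionals on Y to functionals on X. *)
Definition adjoint X Y (L : X -> Y) (q : Y -> C) : X -> C :=
  ext0 (@ndom R X) (fun u => q (L u)).

Definition inverse X (W : Type) (L : X -> W) (y : W) : X :=
  xget 0 [set u | ndom u /\ L u = y].

Definition boundedly_invertible X Y (L : X -> Y) : Prop :=
  [/\ bounded_op L,
      forall y, ndom y -> exists2 u, ndom u & L u = y
    & exists c : R, forall u, ndom u -> nnrm u <= c * nnrm (L u)].

Definition krylov X (M : X -> X) (g p0 : X) (n : nat) : set X :=
  [set z | exists c : 'I_n -> C, z = p0 + \sum_k c k *: iter k M (g - M p0)].

Definition gmres_iterate X (M : X -> X) (g p0 : X) (n : nat) (z : X) : Prop :=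
  krylov M g p0 n z /\
  forall z', krylov M g p0 n z' -> nnrm (g - M z) <= nnrm (g - M z').

End operators.

(* An element of H^1 is given together with its gradient. *)
Notation gradfun R d :=
  (('rV[R]_d.+1 -> R[i]) * ('rV[R]_d.+1 -> 'rV[R[i]]_d.+1))%type.

Section sobolev.
Context {R : realType} {d : nat}.
Local Notation C := R[i].
Local Notation E := 'rV[R]_d.+1.

Definition bd (om : set E) : set E := closure om `\` interior om.

(* Locally, up to a rotation, the strict epigraph of a Lipschitz function. *)
Definition lipschitz_open (om : set E) : Prop :=
  open om /\ forall x, bd om x ->
  exists (r : R) (Q : 'M[R]_d.+1) (g : 'rV[R]_d -> R) (c : R),
    [/\ 0 < r, Q *m Q^T = 1%:M,
        forall a b, `|g a - g b| <= c * enorm (a - b)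
      & forall y, enorm (y - x) < r ->
          (om y <-> g (\row_i (y *m Q) ord0 (lift ord0 i)) < (y *m Q) ord0 ord0)].

Definition partial (i : 'I_d.+1) (f : E -> R) : E -> R :=
  fun x => 'D_(delta_mx ord0 i) f x.

Definition smooth (f : E -> R) : Prop :=
  forall s : seq 'I_d.+1, let g := foldr partial f s in
    continuous g /\ forall x i, derivable g x (delta_mx ord0 i).

Definition test_function (om : set E) (f : E -> R) : Prop :=
  [/\ smooth f, compact (closure [set x | f x != 0])
    & closure [set x | f x != 0] `<=` om].

Definition cintegral dT (T : measurableType dT) (mu : {measure set T -> \bar R})
    (D : set T) (f : T -> C) : C :=
  (\int[mu]_(x in D) complex.Re (f x))%R +i* (\int[mu]_(x in D) complex.Im (f x))%R.

Definition L2normsq dT (T : measurableType dT) (mu : {measure set T -> \bar R})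
    (D : set T) (f : T -> C) : \bar R :=
  (\int[mu]_(x in D) (Normc.normc (f x) ^+ 2)%:E)%E.

Definition L2 dT (T : measurableType dT) (mu : {measure set T -> \bar R})
    (D : set T) : set (T -> C) :=
  [set f | [/\ measurable_fun D (fun x => complex.Re (f x)),
               measurable_fun D (fun x => complex.Im (f x))
             & (L2normsq mu D f < +oo)%E]].

Definition conj_gradfun (u : gradfun R d) : gradfun R d :=
  (fun x => conjc (u.1 x), fun x => map_mx (@conjc R) (u.2 x)).

Definition is_gradient (om : set E) (u : gradfun R d) : Prop :=
  forall f i, test_function om f ->
    cintegral (leb d.+1) om (fun x : E => u.1 x * (partial i f x)%:C) =
    - cintegral (leb d.+1) om (fun x : E => u.2 x ord0 i * (f x)%:C).

Definition H1dom (om : set E) : set (gradfun R d) :=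
  [set u : gradfun R d | [/\ L2 (leb d.+1) om u.1,
               forall i, L2 (leb d.+1) om (fun x : E => u.2 x ord0 i)
             & is_gradient om u]].

Definition grad_form (om : set E) (u v : gradfun R d) : C :=
  cintegral (leb d.+1) om (fun x : E => \sum_i u.2 x ord0 i * v.2 x ord0 i).

Definition mass_form (om : set E) (u v : gradfun R d) : C :=
  cintegral (leb d.+1) om (fun x : E => u.1 x * v.1 x).

Definition H1norm (kappa : R) (om : set E) (u : gradfun R d) : R :=
  Num.sqrt (complex.Re (grad_form om u (conj_gradfun u) +
                (kappa ^+ 2)%:C * mass_form om u (conj_gradfun u))).

Definition smooth_field (f g : E -> R) : gradfun R d :=
  (fun x : E => f x +i* g x, fun x => \row_i (partial i f x +i* partial i g x)).

(* tr is the Dirichlet trace H^1(om) -> L^2(G), G a subset of the closure of om: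
   the continuous extension of the restriction to G of smooth functions, which
   are dense in H^1(om). *)
Definition dirichlet_trace (kappa : R) (om G : set E)
    (tr : gradfun R d -> E -> C) : Prop :=
  [/\ forall u, H1dom om u -> L2 (surf d) G (tr u),
      forall a u v, H1dom om u -> H1dom om v ->
        ae_eq (surf d) G (tr (a *: u + v)) (fun x : E => a * tr u x + tr v x),
      exists c : R, forall u, H1dom om u ->
        (L2normsq (surf d) G (tr u) <= (c * H1norm kappa om u ^+ 2)%:E)%E,
      forall f g, test_function setT f -> test_function setT g ->
        ae_eq (surf d) G (tr (smooth_field f g)) (fun x : E => f x +i* g x)
    & forall u (e : R), H1dom om u -> 0 < e ->
        exists f g, [/\ test_function setT f, test_function setT g,
          H1dom om (smooth_field f g) &
          H1norm kappa om (u - smooth_field f g) < e]].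

(* The range of tr with the quotient norm: for tr the trace of H^1(om) on G,
   this is H^{1/2}(G). *)
Definition trace_space (kappa : R) (om G : set E) (tr : gradfun R d -> E -> C) :
    nspace R :=
  @NSpace R (E -> C)
    [set g | exists2 u, H1dom om u & ae_eq (surf d) G g (tr u)]
    (fun g => inf [set H1norm kappa om u | u in
       [set u | H1dom om u /\ ae_eq (surf d) G g (tr u)]]).

Definition is_laplacian (om : set E) (u : gradfun R d) (h : E -> C) : Prop :=
  forall f, test_function om f ->
    cintegral (leb d.+1) om
      (fun x : E => \sum_i u.2 x ord0 i * (partial i f x)%:C) =
    - cintegral (leb d.+1) om (fun x : E => h x * (f x)%:C).

(* For Delta u = h in L^2(om), n . grad u is the functional on the traces given
   by Green's formula. *)
Definition is_normal_derivative (om : set E) (tr : gradfun R d -> E -> C) (u : gradfun R d)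
    (h : E -> C) (q : (E -> C) -> C) : Prop :=
  forall v, H1dom om v ->
    q (tr v) = grad_form om u v +
               cintegral (leb d.+1) om (fun x : E => h x * v.1 x).

End sobolev.

(* Omega, the subdomains, and the source f; the traces B_{Omega_j} and
   u |-> u|_Sigma for u in H^1(Omega); T_{Omega_j} and T_{Omega_j,+}. *)
Record helmholtz (R : realType) (d J : nat) := Helmholtz {
  kappa : R;
  kappas : R;
  Om : set 'rV[R]_d.+1;
  Omj : 'I_J -> set 'rV[R]_d.+1;
  source : 'rV[R]_d.+1 -> R[i];
  Bj : 'I_J -> gradfun R d -> 'rV[R]_d.+1 -> R[i];
  trSigma : gradfun R d -> 'rV[R]_d.+1 -> R[i];
  Tj : 'I_J -> ('rV[R]_d.+1 -> R[i]) -> ('rV[R]_d.+1 -> R[i]) -> R[i];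
  Tplusj : 'I_J -> ('rV[R]_d.+1 -> R[i]) -> ('rV[R]_d.+1 -> R[i]) -> R[i] }.

Section substructuring.
Context {R : realType} {d J : nat} (P : helmholtz R d J).
Local Notation C := R[i].
Local Notation E := 'rV[R]_d.+1.
Local Notation k2 := ((kappa P ^+ 2)%:C).

Definition Sigma : set E := \bigcup_j bd (Omj P j).

Definition form_a (u v : gradfun R d) : C :=
  grad_form (Om P) u (conj_gradfun v) - k2 * mass_form (Om P) u (conj_gradfun v)
  - 'i%C * (kappas P)%:C * cintegral (surf d) (bd (Om P))
      (fun x : E => trSigma P u x * conjc (trSigma P v x)).

Definition inf_sup_constant : \bar R :=
  let nz := [set u | H1dom (Om P) u /\ H1norm (kappa P) (Om P) u != 0] in
  ereal_inf [set ereal_sup [set (Normc.normc (form_a u v) /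
      (H1norm (kappa P) (Om P) u * H1norm (kappa P) (Om P) v))%:E | v in nz]
    | u in nz].

Definition HOmega_dom : set ('I_J -> gradfun R d) :=
  [set u | forall j, H1dom (Omj P j) (u j)].

Definition Aop : ('I_J -> gradfun R d) -> ('I_J -> gradfun R d) -> C :=
  fun u => ext0 HOmega_dom (fun v => \sum_j
    (grad_form (Omj P j) (u j) (v j) - k2 * mass_form (Omj P j) (u j) (v j)
     - 'i%C * (kappas P)%:C * cintegral (surf d) (bd (Om P) `&` bd (Omj P j))
         (fun x : E => Bj P j (u j) x * Bj P j (v j) x))).

Definition Aplus : ('I_J -> gradfun R d) -> ('I_J -> gradfun R d) -> C :=
  fun u => ext0 HOmega_dom (fun v => \sum_j
    (grad_form (Omj P j) (u j) (v j) + k2 * mass_form (Omj P j) (u j) (v j))).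

Definition HOmega : nspace R :=
  @NSpace R ('I_J -> gradfun R d) HOmega_dom
    (fun u => Num.sqrt (complex.Re (Aplus u (fun j => conj_gradfun (u j))))).

(* H^{1/2}(bd Omega_j) *)
Definition Hhalf (j : 'I_J) : nspace R :=
  trace_space (kappa P) (Omj P j) (bd (Omj P j)) (Bj P j).

Definition HSigma_dom : set ('I_J -> E -> C) :=
  [set p | forall j, @ndom R (Hhalf j) (p j)].

Definition conj_trace (p : 'I_J -> E -> C) : 'I_J -> E -> C :=
  fun j x => conjc (p j x).

Definition Top : ('I_J -> E -> C) -> ('I_J -> E -> C) -> C :=
  fun p => ext0 HSigma_dom (fun q => \sum_j Tj P j (p j) (q j)).

Definition Tplus : ('I_J -> E -> C) -> ('I_J -> E -> C) -> C :=
  fun p => ext0 HSigma_dom (fun q => \sum_j Tplusj P j (p j) (q j)).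

Definition HSigma : nspace R :=
  @NSpace R ('I_J -> E -> C) HSigma_dom
    (fun p => Num.sqrt (complex.Re (Tplus p (conj_trace p)))).

(* T_{Omega_j,+} maps the trace of phi to its normal derivative, for every phi
   in H^1(Omega_j) with Delta phi = kappa^2 phi. *)
Definition dirichlet_to_neumann (j : 'I_J) : Prop :=
  bounded_op (Tplusj P j : Hhalf j -> dual (Hhalf j)) /\
  forall phi, H1dom (Omj P j) phi ->
    let h := fun x => k2 * phi.1 x in
    is_laplacian (Omj P j) phi h ->
    is_normal_derivative (Omj P j) (Bj P j) phi h (Tplusj P j (Bj P j phi)).

Definition hermitian_positive : Prop :=
  (forall p q, HSigma_dom p -> HSigma_dom q ->
     Top p (conj_trace q) = conjc (Top q (conj_trace p))) /\
  (forall p, HSigma_dom p ->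
     ~ (forall j, ae_eq (surf d) (bd (Omj P j)) (p j) (cst 0)) ->
     0 < Top p (conj_trace p)).

Definition Bop : HOmega -> HSigma := fun u j => Bj P j (u j).

(* H^{1/2}(Sigma) *)
Definition HhalfSigma : nspace R :=
  trace_space (kappa P) (Om P) Sigma (trSigma P).

Definition Rop : HhalfSigma -> HSigma :=
  fun v j => ext0 (bd (Omj P j)) v.

Definition AT : HOmega -> dual HOmega :=
  fun u => Aop u - 'i%C *: adjoint Bop (Top (Bop u)).

Definition RTR : HhalfSigma -> dual HhalfSigma :=
  fun v => adjoint Rop (Top (Rop v)).

(* <T^{-1} q, conj q> ^ {1/2}, where <x, conj q> is conj <conj x, q>. *)
Definition Tinv_norm (q : dual HSigma) : R :=
  Num.sqrt (complex.Re (conjc (q (conj_trace (inverse (Top : HSigma -> dual HSigma) q))))).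

(* H(Sigma)' with the norm of T^{-1}. *)
Definition HSigma' : nspace R :=
  @NSpace R (dual HSigma) (@ndom R (dual HSigma)) Tinv_norm.

Definition Piop : HSigma' -> HSigma' :=
  fun q => 2%:R *: Top (Rop (inverse RTR (adjoint Rop q))) - q.

Definition Sop : HSigma' -> HSigma' :=
  fun q => (2%:R * 'i%C) *: Top (Bop (inverse AT (adjoint Bop q))) + q.

Definition ell : dual HOmega :=
  ext0 HOmega_dom (fun v => \sum_j
    cintegral (leb d.+1) (Omj P j) (fun x : E => source P x * (v j).1 x)).

Definition rhs : HSigma' := - (2%:R * 'i%C) *: Piop (Top (Bop (inverse AT ell))).

Definition Id_plus_Pi (L : HSigma' -> HSigma') : HSigma' -> HSigma' :=
  fun q => q + Piop (L q).

Definition gamma_star : R :=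
  inf [set Tinv_norm (Id_plus_Pi Sop q) / Tinv_norm q | q in
        [set q | @ndom R HSigma' q /\ q != 0]].

End substructuring.
Arguments Bop {R d J} P.
Arguments Rop {R d J} P.
Arguments AT {R d J} P.
Arguments RTR {R d J} P.
Arguments Piop {R d J} P.
Arguments Sop {R d J} P.
Arguments ell {R d J} P.
Arguments rhs {R d J} P.

(* Main.v *)
Require Import Defs.
From mathcomp Require Import all_boot all_order all_algebra.
From mathcomp Require Import complex.
From mathcomp Require Import all_classical all_reals all_analysis.
From mathcomp Require Import measurable_realfun.
From mathcomp Require Import ring lra.

Set Implicit Arguments.
Unset Strict Implicit.
Unset Printing Implicit Defensive.

Import numFieldNormedType.Exports.
Import Order.TTheory GRing.Theory Num.Theory.
Local Open Scope classical_set_scope.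
Local Open Scope ring_scope.
Local Open Scope complex_scope.

Local Notation Re := complex.Re.
Local Notation Im := complex.Im.
Local Notation normc := Normc.normc.

(** The convergence bound is a statement about volumes. Let [M] be the
    preconditioned operator [(Id + Pi S_r)^-1 (Id + Pi S)] and [r] its initial
    residual. The distance of [r] to the span of [M r, .., M^n r] is the quotient
    of the volumes of [r, M r, .., M^n r] and of [M r, .., M^n r]. Subtracting from
    each vector its predecessor turns the first volume into that of
    [r, K r, .., K M^(n-1) r] with [K = M - Id], at most the norm of [r] times the
    product of the first [n] singular values of [K] times the volume of
    [r, M r, .., M^(n-1) r]; and this last volume is at most that of
    [M r, .., M^n r] times the product of the first [n] singular values of [M^-1]
    ([gram_contraction], [minimal_residual_bound]). Now

      [K = (Id + Pi S_r)^-1 Pi (S - S_r)],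
      [M^-1 = Id - (Id + Pi S)^-1 Pi (S - S_r)],

    so with [s_j] the singular values of [S - S_r] the residual of the
    preconditioned equation is reduced by the product of the
    [s_j / (gamma - s_1) (1 + s_j / gamma)]. Comparing with the residual of the
    original equation through [Id + Pi S_r] costs the quotient of the bounds
    [2 + s_1] and [gamma - s_1] ([preconditioned_residual]), and the inequalities
    between means turn the product into the Schatten norm
    ([singular_product_bound]). Approximation numbers stand for the singular values
    throughout: all that is used of the [j]-th one is that the operator contracts
    accordingly on a subspace of codimension less than [j].

    What remains is to establish the properties of the operators in this argument:
    [T^-1] is a scalar product, [Pi] an isometric involution, [S] a contraction, and
    the Schatten sum of [S - S_r] is finite. All of this is read off fields [u] on
    the subdomains, for which [theta u = T (B u)] is an element of the dual of the
    traces, its norm being the square root of [<T (B u), conj (B u)>].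

    The energy space is complete, since [A - i B^* T B] is an isomorphism of it onto
    a dual ([complete_of_dual_iso]), so orthogonal projections exist. The fields
    orthogonal in energy to the traceless ones are the harmonic ones, on which the
    Dirichlet-to-Neumann property identifies [T_+] with the energy
    ([traceless_orthogonal_DtN]); as [T - T_+] is compact and [T] definite, the
    impedance product is coercive on them ([impedance_coercive]). Riesz
    representation then makes [theta] onto ([theta_surj]), which gives the scalar
    product of [T^-1].

    [Pi] is the reflection across the image of the fields that come from one
    function on the whole domain ([Piop_exists]); these are a closed space because
    the weak gradient is defined by integrals against test functions, and they
    glue, because the boundaries of the subdomains are null sets
    ([lipschitz_boundary_null], [glued_extension]). [S] is a contraction because
    energy is only lost through the absorbing boundary ([Aop_dissipative]). Finally,
    with [w = (A - i B^* T B)^-1 B^* q], one finds for harmonic [v] that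

      [<(S - i) q, B v> = (1 - i) (<(A - A_+) w, v> - <(T - T_+) (B w), B v>)]

    ([scattering_defect]), so approximations of finite rank of [A - A_+] and
    [T - T_+] provide those of [S - i], and the singular values of [S - S_r] are
    dominated by those of the two differences at half the index
    ([truncation_error_singular]). *)

(** * Complex numbers *)
Section complex_facts.
Context {R : realType}.
Implicit Types x y : R[i].

Lemma cReD x y : Re (x + y) = Re x + Re y. Proof. by case: x; case: y. Qed.
Lemma cImD x y : Im (x + y) = Im x + Im y. Proof. by case: x; case: y. Qed.
Lemma cReN x : Re (- x) = - Re x. Proof. by case: x. Qed.
Lemma cImN x : Im (- x) = - Im x. Proof. by case: x. Qed.
Lemma cReM x y : Re (x * y) = Re x * Re y - Im x * Im y.
Proof. by case: x; case: y. Qed.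
Lemma cImM x y : Im (x * y) = Re x * Im y + Im x * Re y.
Proof. by case: x; case: y. Qed.
Lemma cReJ x : Re (conjc x) = Re x. Proof. by case: x. Qed.
Lemma cImJ x : Im (conjc x) = - Im x. Proof. by case: x. Qed.
Lemma cReC (a : R) : Re (a%:C) = a. Proof. by []. Qed.
Lemma cImC (a : R) : Im (a%:C) = 0. Proof. by []. Qed.

Lemma complex_eqP x y : Re x = Re y -> Im x = Im y -> x = y.
Proof. by case: x => a b; case: y => c d /= -> ->. Qed.

Lemma normc_ge0 x : 0 <= normc x.
Proof. by case: x => a b; rewrite sqrtr_ge0. Qed.

Lemma normc_sqr x : normc x ^+ 2 = Re x ^+ 2 + Im x ^+ 2.
Proof. by case: x => a b /=; rewrite sqr_sqrtr// addr_ge0 ?sqr_ge0. Qed.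

Lemma mulcJ x : x * conjc x = (normc x ^+ 2)%:C.
Proof.
rewrite normc_sqr; apply: complex_eqP; rewrite ?cReM ?cImM cReJ cImJ ?cReC ?cImC; ring.
Qed.

Lemma normcJ x : normc (conjc x) = normc x.
Proof. by case: x => a b /=; rewrite sqrrN. Qed.

Lemma normcC (a : R) : normc (a%:C) = `|a|.
Proof. by rewrite /= expr0n /= addr0 sqrtr_sqr. Qed.

Lemma Re_le_normc x : Re x <= normc x.
Proof.
apply: le_trans (ler_norm _) _; rewrite -sqrtr_sqr; case: x => a b /=.
by rewrite ler_wsqrtr// lerDl sqr_ge0.
Qed.

Lemma normRe_le x : `|Re x| <= normc x.
Proof.
rewrite -sqrtr_sqr; case: x => a b /=; by rewrite ler_wsqrtr// lerDl sqr_ge0.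
Qed.

Lemma normIm_le x : `|Im x| <= normc x.
Proof.
rewrite -sqrtr_sqr; case: x => a b /=; by rewrite ler_wsqrtr// lerDr sqr_ge0.
Qed.

Lemma normc_le_ReIm x : normc x <= `|Re x| + `|Im x|.
Proof.
rewrite -(@ler_pXn2r _ 2) ?nnegrE ?normc_ge0 ?addr_ge0//.
rewrite normc_sqr sqrrD !real_normK ?num_real//.
have := mulr_ge0 (normr_ge0 (Re x)) (normr_ge0 (Im x)); lra.
Qed.

Lemma normci : normc ('i : R[i]) = 1.
Proof. by rewrite /= expr0n expr1n add0r sqrtr1. Qed.

Lemma conjcD x y : conjc (x + y) = conjc x + conjc y.
Proof. exact: (rmorphD (@conjc R)). Qed.
Lemma conjcM x y : conjc (x * y) = conjc x * conjc y.
Proof. exact: (rmorphM (@conjc R)). Qed.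
Lemma conjcN x : conjc (- x) = - conjc x.
Proof. exact: (rmorphN (@conjc R)). Qed.

Lemma normcD x y : normc (x + y) <= normc x + normc y.
Proof.
rewrite -(@ler_pXn2r _ 2) ?nnegrE ?normc_ge0 ?addr_ge0 ?normc_ge0//.
have := Re_le_normc (x * conjc y); rewrite Normc.normcM normcJ cReM cReJ cImJ.
rewrite sqrrD !normc_sqr cReD cImD; lra.
Qed.

End complex_facts.

(** * Semi-inner products *)
Section semi_inner_product.
Context {R : realType} (V : lmodType R[i]).
Implicit Types (D W : set V) (ip : V -> V -> R[i]).

Record subspace W : Prop := Subspace {
  subspace0 : W 0;
  subspace_comb : forall a u v, W u -> W v -> W (a *: u + v) }.

Record semi_ip D ip : Prop := SemiIp {
  sip_sub : subspace D;
  sip_lin : forall a u v w, D u -> D v -> D w ->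
    ip (a *: u + v) w = a * ip u w + ip v w;
  sip_herm : forall u v, D u -> D v -> ip v u = conjc (ip u v);
  sip_ge0 : forall u, D u -> 0 <= Re (ip u u) }.

Definition seminorm_of ip (u : V) : R := Num.sqrt (Re (ip u u)).

Section subspaces.
Variable W : set V.
Hypothesis sW : subspace W.

Lemma subspaceD u v : W u -> W v -> W (u + v).
Proof. by move=> Wu Wv; rewrite -[u]scale1r; exact: (subspace_comb sW). Qed.
Lemma subspaceZ a u : W u -> W (a *: u).
Proof.
by move=> Wu; rewrite -[_ *: _]addr0; apply: (subspace_comb sW) => //; exact: subspace0.
Qed.
Lemma subspaceN u : W u -> W (- u).
Proof. by move=> Wu; rewrite -scaleN1r; exact: subspaceZ. Qed.
Lemma subspaceB u v : W u -> W v -> W (u - v).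
Proof. by move=> Wu Wv; apply: subspaceD => //; exact: subspaceN. Qed.
Lemma subspace_sum (I : Type) (r : seq I) (P : pred I) (F : I -> V) :
  (forall i, P i -> W (F i)) -> W (\sum_(i <- r | P i) F i).
Proof. by move=> h; apply: big_ind => //; [exact: subspace0|exact: subspaceD]. Qed.
End subspaces.

Section theory.
Variables (D : set V) (ip : V -> V -> R[i]).
Hypothesis sip : semi_ip D ip.
Let sD := sip_sub sip.
Let D0 := subspace0 sD.
Local Notation sn := (seminorm_of ip).

Lemma sip0l v : D v -> ip 0 v = 0.
Proof.
move=> Dv; have := sip_lin sip 1 D0 D0 Dv.
by rewrite scaler0 addr0 mul1r => /eqP; rewrite -subr_eq0 opprD addNKr oppr_eq0 => /eqP.
Qed.

Lemma sipZl a u v : D u -> D v -> ip (a *: u) v = a * ip u v.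
Proof.
by move=> Du Dv; rewrite -[a *: u]addr0 (sip_lin sip)// sip0l// addr0.
Qed.

Lemma sipDl u v w : D u -> D v -> D w -> ip (u + v) w = ip u w + ip v w.
Proof. by move=> Du Dv Dw; rewrite -[u]scale1r (sip_lin sip)// mul1r scale1r. Qed.

Lemma sipNl u v : D u -> D v -> ip (- u) v = - ip u v.
Proof. by move=> Du Dv; rewrite -scaleN1r sipZl// mulN1r. Qed.

Lemma sipBl u v w : D u -> D v -> D w -> ip (u - v) w = ip u w - ip v w.
Proof. by move=> Du Dv Dw; rewrite sipDl ?sipNl//; exact: subspaceN. Qed.

Lemma sip_suml (I : Type) (r : seq I) (F : I -> V) w : (forall i, D (F i)) -> D w ->
  ip (\sum_(i <- r) F i) w = \sum_(i <- r) ip (F i) w.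
Proof.
move=> DF Dw; elim: r => [|i r IH]; first by rewrite !big_nil sip0l.
by rewrite !big_cons sipDl ?IH//; exact: subspace_sum.
Qed.

Lemma sip0r v : D v -> ip v 0 = 0.
Proof. by move=> Dv; rewrite (sip_herm sip D0 Dv) sip0l// conjc0. Qed.

Lemma sip_linr a u v w : D u -> D v -> D w ->
  ip w (a *: u + v) = conjc a * ip w u + ip w v.
Proof.
move=> Du Dv Dw; rewrite (sip_herm sip _ Dw); last exact: (subspace_comb sD).
by rewrite (sip_lin sip)// conjcD conjcM -!(sip_herm sip).
Qed.

Lemma sipZr a u v : D u -> D v -> ip v (a *: u) = conjc a * ip v u.
Proof. by move=> Du Dv; rewrite -[a *: u]addr0 sip_linr// sip0r// addr0. Qed.

Lemma sipDr u v w : D u -> D v -> D w -> ip w (u + v) = ip w u + ip w v.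
Proof. by move=> Du Dv Dw; rewrite -[u]scale1r sip_linr// conjc1 mul1r scale1r. Qed.

Lemma sipNr u v : D u -> D v -> ip v (- u) = - ip v u.
Proof. by move=> Du Dv; rewrite -scaleN1r sipZr// conjcN conjc1 mulN1r. Qed.

Lemma sipBr u v w : D u -> D v -> D w -> ip w (u - v) = ip w u - ip w v.
Proof. by move=> Du Dv Dw; rewrite sipDr ?sipNr//; exact: subspaceN. Qed.

Lemma sip_sumr (I : Type) (r : seq I) (F : I -> V) w : (forall i, D (F i)) -> D w ->
  ip w (\sum_(i <- r) F i) = \sum_(i <- r) ip w (F i).
Proof.
move=> DF Dw; elim: r => [|i r IH]; first by rewrite !big_nil sip0r.
by rewrite !big_cons sipDr ?IH//; exact: subspace_sum.
Qed.

Lemma sn_ge0 u : 0 <= sn u. Proof. exact: sqrtr_ge0. Qed.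

Lemma sn_sqr u : D u -> sn u ^+ 2 = Re (ip u u).
Proof. by move=> Du; rewrite sqr_sqrtr// (sip_ge0 sip). Qed.

Lemma sip_self u : D u -> ip u u = (sn u ^+ 2)%:C.
Proof.
move=> Du; rewrite sn_sqr//; apply: complex_eqP => //=.
have /(congr1 (@complex.Im R)) := sip_herm sip Du Du; rewrite cImJ => h; lra.
Qed.

Lemma sn_expand a u v : D u -> D v ->
  sn (a *: u + v) ^+ 2 = normc a ^+ 2 * sn u ^+ 2 + 2 * Re (a * ip u v) + sn v ^+ 2.
Proof.
move=> Du Dv.
have Dauv : D (a *: u + v) by exact: (subspace_comb sD).
rewrite sn_sqr// (sip_lin sip)// !sip_linr// (sip_herm sip Du Dv) !sip_self//.
rewrite !(cReM, cImM, cReD, cImD, cReJ, cImJ, cReC, cImC) normc_sqr; ring.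
Qed.

Lemma sn0 : sn 0 = 0.
Proof. by rewrite /seminorm_of sip0l// sqrtr0. Qed.

Lemma snZ a u : D u -> sn (a *: u) = normc a * sn u.
Proof.
move=> Du; rewrite -[a *: u]addr0.
have := sn_expand a Du D0; rewrite sip0r// mulr0 sn0 expr0n /= mulr0 !addr0 -exprMn => h.
apply/eqP; rewrite -(@eqrXn2 _ 2) ?sn_ge0 ?mulr_ge0 ?normc_ge0 ?sn_ge0//.
exact/eqP.
Qed.

Lemma snN u : D u -> sn (- u) = sn u.
Proof. by move=> Du; rewrite -scaleN1r snZ// normcN Normc.normc1 mul1r. Qed.

Lemma snB_sym u v : D u -> D v -> sn (u - v) = sn (v - u).
Proof. by move=> Du Dv; rewrite -opprB snN//; exact: subspaceB. Qed.

Lemma cauchy_schwarz u v : D u -> D v -> normc (ip u v) <= sn u * sn v.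
Proof.
move=> Du Dv; rewrite -(@ler_pXn2r _ 2) ?nnegrE ?normc_ge0 ?mulr_ge0 ?sn_ge0//.
rewrite exprMn; set s := sn v ^+ 2; set t := sn u ^+ 2; set N := normc _ ^+ 2.
have key l : 0 <= t - 2 * l * N + l ^+ 2 * N * s.
  have := sqr_ge0 (sn ((- (l%:C * ip u v)) *: v + u)).
  rewrite sn_expand// -/s -/t normcN Normc.normcM exprMn -/N normcC real_normK ?num_real//.
  rewrite (sip_herm sip Du Dv).
  have -> : - (l%:C * ip u v) * conjc (ip u v) = (- (l * N))%:C.
    by rewrite mulNr -mulrA mulcJ -/N -rmorphM -rmorphN.
  rewrite cReC; lra.
have s0 : 0 <= s by exact: sqr_ge0.
have N0 : 0 <= N by exact: sqr_ge0.
have t0 : 0 <= t by exact: sqr_ge0.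
have [sz|sz] := eqVneq s 0.
  rewrite sz mulr0; case: (ltrP 0 N) => // Np.
  have := key ((t + 1) / (2 * N)); rewrite sz mulr0 addr0.
  have -> : 2 * ((t + 1) / (2 * N)) * N = t + 1 by field; rewrite gt_eqF.
  lra.
have sp : 0 < s by rewrite lt_neqAle eq_sym sz.
have := key s^-1.
have -> : t - 2 * s^-1 * N + s^-1 ^+ 2 * N * s = (t * s - N) / s by field.
by rewrite pmulr_lge0 ?invr_gt0// subr_ge0.
Qed.

Lemma snD u v : D u -> D v -> sn (u + v) <= sn u + sn v.
Proof.
move=> Du Dv; rewrite -(@ler_pXn2r _ 2) ?nnegrE ?sn_ge0 ?addr_ge0 ?sn_ge0//.
rewrite -{1}[u]scale1r sn_expand// Normc.normc1 mul1r.
have := le_trans (Re_le_normc _) (cauchy_schwarz Du Dv).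
rewrite expr1n !mul1r sqrrD; lra.
Qed.

Lemma snB u v : D u -> D v -> sn (u - v) <= sn u + sn v.
Proof. by move=> Du Dv; rewrite -[sn v]snN//; apply: snD => //; exact: subspaceN. Qed.

Lemma sn_dist u v w : D u -> D v -> D w -> sn (u - w) <= sn (u - v) + sn (v - w).
Proof.
move=> Du Dv Dw; have -> : u - w = (u - v) + (v - w) by rewrite addrA subrK.
by apply: snD; exact: subspaceB.
Qed.

Lemma sn_le_dist u v : D u -> D v -> sn u <= sn (u - v) + sn v.
Proof.
by move=> Du Dv; rewrite -{1}[u](subrK v); apply: snD => //; exact: subspaceB.
Qed.

Lemma sip_null u v : D u -> D v -> sn u = 0 -> ip u v = 0.
Proof.
move=> Du Dv u0; apply: Normc.eq0_normc; apply/eqP; rewrite eq_le normc_ge0 andbT.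
by have := cauchy_schwarz Du Dv; rewrite u0 mul0r.
Qed.

Lemma sip_nullr u v : D u -> D v -> sn v = 0 -> ip u v = 0.
Proof. by move=> Du Dv v0; rewrite (sip_herm sip Dv Du) sip_null// conjc0. Qed.

Lemma sn_pythagoras u v : D u -> D v -> ip u v = 0 ->
  sn (u + v) ^+ 2 = sn u ^+ 2 + sn v ^+ 2.
Proof.
move=> Du Dv uv; rewrite -{1}[u]scale1r sn_expand// uv mulr0 Normc.normc1.
by rewrite expr1n mul1r /= mulr0 addr0.
Qed.

(** * Orthogonal projections and the Riesz representation *)

Definition adherent W u := forall e, 0 < e -> exists2 w, W w & sn (u - w) < e.

Definition sn_cauchy (u : nat -> V) := forall e, 0 < e ->
  exists N, forall k m, (N <= k)%N -> (N <= m)%N -> sn (u k - u m) < e.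

Definition sn_cvg (u : nat -> V) l := forall e, 0 < e ->
  exists N, forall k, (N <= k)%N -> sn (u k - l) < e.

Definition sn_complete := forall u : nat -> V, (forall k, D (u k)) ->
  sn_cauchy u -> exists2 l, D l & sn_cvg u l.

Record closed_subspace W : Prop := ClosedSubspace {
  csub_sub : W `<=` D;
  csub_subspace : subspace W;
  csub_closed : forall u, D u -> adherent W u -> W u }.

Lemma sn_small u : (forall e, 0 < e -> sn u < e) -> sn u = 0.
Proof.
move=> h; apply/eqP; rewrite eq_le sn_ge0 andbT leNgt; apply/negP => u0.
by have := h _ u0; rewrite ltxx.
Qed.

(** Moving [w] along [z] by the optimal multiple lowers the squared distance by
    the square of [ip (u - w) z] over that of the norm of [z], so this vanishes. *)
Lemma closest_orthogonal W u w : subspace W -> W `<=` D -> D u -> W w ->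
  (forall z, W z -> sn (u - w) <= sn (u - z)) ->
  forall z, W z -> ip (u - w) z = 0.
Proof.
move=> sW WD Du Ww hmin z Wz.
have Dw := WD _ Ww; have Dz := WD _ Wz.
have Duw : D (u - w) by exact: subspaceB.
have [z0|z0] := eqVneq (sn z) 0; first exact: sip_nullr.
set a := ip (u - w) z.
pose b : R[i] := - (a * ((sn z ^+ 2)^-1)%:C).
have := hmin (w - b *: z) (subspaceB sW Ww (subspaceZ sW _ Wz)).
rewrite opprB addrCA -(@ler_pXn2r _ 2) ?nnegrE ?sn_ge0//.
rewrite sn_expand// (sip_herm sip Duw Dz) -/a /b.
rewrite normcN Normc.normcM exprMn normcC real_normK ?num_real//.
have -> : - (a * (sn z ^- 2)%:C) * conjc a = (- (normc a ^+ 2 / sn z ^+ 2))%:C.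
  by rewrite mulNr mulrAC mulcJ -rmorphM -rmorphN.
rewrite cReC.
have sp : sn z ^+ 2 != 0 by rewrite expf_eq0.
have -> : normc a ^+ 2 * (sn z ^+ 2)^-1 ^+ 2 * sn z ^+ 2 = normc a ^+ 2 / sn z ^+ 2.
  by field.
rewrite mulrN => h.
have : normc a ^+ 2 / sn z ^+ 2 <= 0 by lra.
rewrite pmulr_lle0 ?invr_gt0 ?exprn_gt0 ?lt_neqAle ?sn_ge0 1?eq_sym ?z0//.
move=> h2; have : normc a ^+ 2 = 0 by apply/eqP; rewrite eq_le h2 sqr_ge0.
by move/eqP; rewrite expf_eq0 /= => /eqP /Normc.eq0_normc.
Qed.

Lemma parallelogram u v w : D u -> D v -> D w ->
  sn (v - w) ^+ 2 = 2 * sn (u - v) ^+ 2 + 2 * sn (u - w) ^+ 2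
    - 4 * sn (u - (2^-1)%:C *: (v + w)) ^+ 2.
Proof.
move=> Du Dv Dw.
have Da : D (u - v) by exact: subspaceB.
have Db : D (u - w) by exact: subspaceB.
have -> : v - w = (-1) *: (u - v) + (u - w).
  by rewrite scaleN1r opprB addrA subrK.
have -> : u - (2^-1)%:C *: (v + w) = (2^-1)%:C *: (1 *: (u - v) + (u - w)).
  rewrite scale1r addrACA -opprD scalerBr; congr (_ - _).
  rewrite -[u in u + u]scale1r -scalerDl scalerA.
  have -> : (2^-1)%:C * (1 + 1) = 1 :> R[i] by apply: complex_eqP => /=; field.
  by rewrite scale1r.
have Dc : D (1 *: (u - v) + (u - w)) by exact: (subspace_comb sD).
rewrite snZ// exprMn normcC !sn_expand// normcN Normc.normc1 real_normK ?num_real//.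
by rewrite mulN1r mul1r cReN; field.
Qed.

(** A minimizing sequence is Cauchy by the parallelogram law; its limit is adherent
    to [W], hence in [W]. *)
Lemma orthogonal_projection W u : sn_complete -> closed_subspace W -> D u ->
  exists2 w, W w & forall z, W z -> ip (u - w) z = 0.
Proof.
move=> cD [WD sW cW] Du.
pose S := [set sn (u - z) ^+ 2 | z in W].
have S0 : S !=set0 by exists (sn (u - 0) ^+ 2); exists 0 => //; exact: subspace0.
have lbS : has_inf S by split=> //; exists 0 => _ [z _ <-]; exact: sqr_ge0.
pose m := inf S.
have mle z : W z -> m <= sn (u - z) ^+ 2 by move=> Wz; apply: ge_inf; [case: lbS|exists z].
have /choice[w ww] : forall k, exists z, W z /\ sn (u - z) ^+ 2 < m + k.+1%:R^-1.
  move=> k; have k0 : 0 < k.+1%:R^-1 :> R by rewrite invr_gt0.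
  have [_ [z Wz <-] hz] := inf_adherent k0 lbS.
  by exists z.
have Dw k : D (w k) by apply: WD; case: (ww k).
have [k|l Dl hl] := cD w Dw.
  move=> e0; have e4 : 0 < k ^+ 2 / 4 by rewrite divr_gt0 ?exprn_gt0.
  have [N hN] : exists N, forall j, (N <= j)%N -> j.+1%:R^-1 < k ^+ 2 / 4.
    exists (Num.truncn ((k ^+ 2 / 4)^-1)) => j Nj.
    rewrite -[ltRHS]invrK ltf_pV2 ?posrE ?invr_gt0//.
    apply: lt_le_trans (Num.Theory.truncnS_gt _) _; by rewrite ler_nat.
  exists N => i j /hN hi /hN hj.
  rewrite -(@ltr_pXn2r _ 2) ?nnegrE ?sn_ge0 ?(ltW e0)// (parallelogram Du)//.
  have [W1 h1] := ww i; have [W2 h2] := ww j.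
  have := mle ((2^-1)%:C *: (w i + w j)) (subspaceZ sW _ (subspaceD sW W1 W2)).
  move: h1 h2 hi hj; set a := sn _ ^+ 2; set b := sn _ ^+ 2; set c := sn _ ^+ 2.
  set x := _^-1; set y := _^-1; lra.
have Wl : W l.
  apply: cW => // e /hl[N hN]; exists (w N); first by case: (ww N).
  by rewrite snB_sym//; exact: hN.
exists l => //; apply: closest_orthogonal => // z Wz.
rewrite -(@ler_pXn2r _ 2) ?nnegrE ?sn_ge0//.
have hm : sn (u - l) ^+ 2 <= m.
  rewrite leNgt; apply/negP => mlt.
  have m0 : 0 <= m by apply: lb_le_inf => // _ [z' _ <-]; exact: sqr_ge0.
  pose s := Num.sqrt m.
  have sm : s ^+ 2 = m by rewrite sqr_sqrtr.
  have slt : s < sn (u - l).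
    by rewrite -(@ltr_pXn2r _ 2) ?nnegrE ?sn_ge0 ?sqrtr_ge0// sm.
  pose e := (sn (u - l) - s) / 2.
  have e0 : 0 < e by rewrite divr_gt0// subr_gt0.
  have [N hN] := hl _ e0.
  pose f := (s + e) ^+ 2 - m.
  have s0 : 0 <= s by exact: sqrtr_ge0.
  have f0 : 0 < f by rewrite /f sqrrD sm; nra.
  pose k := maxn N (Num.truncn f^-1).
  have hk : k.+1%:R^-1 < f.
    rewrite -[ltRHS]invrK ltf_pV2 ?posrE ?invr_gt0//.
    by apply: lt_le_trans (Num.Theory.truncnS_gt _) _; rewrite ler_nat ltnS leq_maxr.
  have [_ h2] := ww k.
  have h3 : sn (u - w k) < s + e.
    rewrite -(@ltr_pXn2r _ 2) ?nnegrE ?sn_ge0 ?addr_ge0 ?(ltW e0)//.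
    by apply: lt_trans h2 _; rewrite -ltrBrDl.
  have h4 := hN k (leq_maxl _ _).
  have := sn_dist Du (Dw k) Dl; rewrite /e in h3 h4; lra.
exact: le_trans hm (mle _ Wz).
Qed.

(** The representative is a multiple of [v], the component orthogonal to the kernel
    of [l] of some vector outside this kernel. *)
Lemma riesz_representation (l : V -> R[i]) (c : R) : sn_complete ->
  (forall a u v, D u -> D v -> l (a *: u + v) = a * l u + l v) ->
  (forall u, D u -> normc (l u) <= c * sn u) ->
  exists2 w, D w & forall u, D u -> l u = ip u w.
Proof.
move=> cD ll lc.
have l0 : l 0 = 0.
  by apply: Normc.eq0_normc; apply/eqP; rewrite eq_le normc_ge0 andbT (le_trans (lc _ D0))// sn0 mulr0.
have lZ a u : D u -> l (a *: u) = a * l u by move=> Du; rewrite -[_ *: _]addr0 ll// l0 addr0.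
have lB u v : D u -> D v -> l (u - v) = l u - l v.
  by move=> Du Dv; rewrite addrC -scaleN1r ll// mulN1r addrC.
pose W := [set u | D u /\ l u = 0].
have [[u0 Du0 lu0]|nz] := pselect (exists2 u0, D u0 & l u0 != 0); last first.
  exists 0 => // u Du; rewrite sip0r//; apply: contra_notP nz => lu.
  by exists u => //; apply/eqP.
have cW : closed_subspace W.
  split; first by move=> u [].
    split; first by split.
    by move=> a u v [Du lu] [Dv lv]; split; [exact: (subspace_comb sD)|rewrite ll// lu lv mulr0 addr0].
  move=> u Du ad; split=> //; apply: Normc.eq0_normc; apply/eqP.
  rewrite eq_le normc_ge0 andbT leNgt; apply/negP => lp.
  have c1 : 0 < `|c| + 1 by rewrite ltr_wpDl.
  have [w [Dw lw] hw] := ad (normc (l u) / (`|c| + 1)) (divr_gt0 lp c1).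
  have := lc _ (subspaceB sD Du Dw); rewrite lB// lw subr0.
  have : c * sn (u - w) <= (`|c| + 1) * sn (u - w).
    by rewrite ler_wpM2r ?sn_ge0// (le_trans (ler_norm _))// lerDl.
  have : (`|c| + 1) * sn (u - w) < normc (l u).
    by rewrite mulrC -ltr_pdivlMr.
  lra.
have [k [Dk lk] ok] := orthogonal_projection cD cW Du0.
set v := u0 - k in ok; have Dv : D v by exact: subspaceB.
have lv : l v != 0 by rewrite lB// lk subr0.
have nv : sn v != 0.
  apply/eqP => v0; move/eqP: lv; apply; apply: Normc.eq0_normc; apply/eqP.
  by rewrite eq_le normc_ge0 andbT (le_trans (lc _ Dv))// v0 mulr0.
exists (conjc (l v / (sn v ^+ 2)%:C) *: v); first exact: subspaceZ.
move=> u Du; rewrite sipZr// conjcK.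
have Wz : W (u - (l u / l v) *: v).
  split; first by apply: subspaceB => //; exact: subspaceZ.
  by rewrite lB ?lZ ?divfK ?subrr//; exact: subspaceZ.
have := ok _ Wz; rewrite sipBr ?sipZr//; last exact: subspaceZ.
move/eqP; rewrite subr_eq0 => /eqP /(congr1 (@conjc R)).
rewrite [X in _ = X -> _]conjcM conjcK -!(sip_herm sip)// sip_self// => ->.
have sv : (sn v ^+ 2)%:C != 0 :> R[i].
  by rewrite -[0](rmorph0 (real_complex R)) (inj_eq (@complexI R)) expf_eq0.
by move: sv; move: ((sn v ^+ 2)%:C) => q q0; field; rewrite ?lv ?q0.
Qed.

End theory.
End semi_inner_product.

(** * Gram determinants *)
Section gram_determinants.
Context {R : realType} (V : lmodType R[i]).
Variables (D : set V) (ip : V -> V -> R[i]).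
Hypothesis sip : semi_ip D ip.
Let sD := sip_sub sip.
Local Notation C := R[i].
Local Notation sn := (seminorm_of ip).

Definition lincomb m n (A : 'M[C]_(m, n)) (x : 'I_n -> V) : 'I_m -> V :=
  fun i => \sum_j A i j *: x j.

Definition gram n (x : 'I_n -> V) : 'M[C]_n := \matrix_(i, j) ip (x i) (x j).

Definition fcons n (u : V) (x : 'I_n -> V) : 'I_n.+1 -> V :=
  fun i => if unlift ord0 i is Some j then x j else u.

Lemma fcons0 n u (x : 'I_n -> V) : fcons u x ord0 = u.
Proof. by rewrite /fcons unlift_none. Qed.

Lemma fconsS n u (x : 'I_n -> V) j : fcons u x (lift ord0 j) = x j.
Proof. by rewrite /fcons liftK. Qed.

Lemma lincombM m n k (A : 'M[C]_(m, n)) (B : 'M[C]_(n, k)) (x : 'I_k -> V) :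
  lincomb A (lincomb B x) = lincomb (A *m B) x.
Proof.
apply/funext => i; rewrite /lincomb.
under eq_bigr do rewrite scaler_sumr.
rewrite exchange_big /=; apply: eq_bigr => j _.
rewrite mxE scaler_suml; apply: eq_bigr => l _; by rewrite scalerA.
Qed.

Lemma lincomb_dom m n (A : 'M[C]_(m, n)) (x : 'I_n -> V) :
  (forall i, D (x i)) -> forall i, D (lincomb A x i).
Proof. by move=> Dx i; apply: (subspace_sum sD) => j _; apply: (subspaceZ sD). Qed.

Lemma gram_lincomb m n (A : 'M[C]_(m, n)) (x : 'I_n -> V) : (forall i, D (x i)) ->
  gram (lincomb A x) = A *m gram x *m (map_mx (@conjc R) A)^T.
Proof.
move=> Dx; apply/matrixP => i j; rewrite !mxE.
rewrite (sip_suml sip); [|by move=> k; apply: (subspaceZ sD)|exact: lincomb_dom].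
under [RHS]eq_bigr do rewrite !mxE big_distrl /=.
rewrite exchange_big /=; apply: eq_bigr => k _.
rewrite (sip_sumr sip) => [|l|]; [|by apply: (subspaceZ sD)|exact: (subspaceZ sD)].
apply: eq_bigr => l _.
rewrite (sipZl sip)//; last exact: (subspaceZ sD).
by rewrite (sipZr sip)// mxE mulrA mulrAC.
Qed.

Lemma det_gram_lincomb n (A : 'M[C]_n) (x : 'I_n -> V) : (forall i, D (x i)) ->
  \det (gram (lincomb A x)) = (normc (\det A) ^+ 2)%:C * \det (gram x).
Proof.
move=> Dx; rewrite gram_lincomb// !det_mulmx det_tr det_map_mx -mulcJ; ring.
Qed.

Lemma gram_orthogonal n (x : 'I_n.+1 -> V) : (forall i, D (x i)) ->
  (forall j, ip (x ord0) (x (lift ord0 j)) = 0) ->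
  \det (gram x) = (sn (x ord0) ^+ 2)%:C * \det (gram (x \o lift ord0)).
Proof.
move=> Dx ox; rewrite (expand_det_row _ ord0) big_ord_recl big1 ?addr0 => [|j _]; last first.
  by rewrite !mxE ox mul0r.
rewrite mxE (sip_self sip)//; congr (_ * _).
rewrite /cofactor /= expr0 mul1r; congr (\det _).
by apply/matrixP => i j; rewrite !mxE.
Qed.

Definition spanned n (x : 'I_n -> V) : set V := [set p | exists c, p = \sum_j c j *: x j].

Lemma spanned_dom n (x : 'I_n -> V) p : (forall i, D (x i)) -> spanned x p -> D p.
Proof.
by move=> Dx [c ->]; apply: (subspace_sum sD) => j _; exact: (subspaceZ sD).
Qed.

Lemma spanned_sub n (x : 'I_n -> V) : subspace (spanned x).
Proof.
split; first by exists (fun=> 0); rewrite big1// => i _; rewrite scale0r.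
move=> a _ _ [c ->] [c' ->]; exists (fun j => a * c j + c' j).
rewrite scaler_sumr -big_split /=; apply: eq_bigr => j _.
by rewrite scalerA scalerDl.
Qed.

Lemma spannedS n (x : 'I_n.+1 -> V) p : spanned (x \o lift ord0) p -> spanned x p.
Proof.
move=> [c ->]; exists (fun i => if unlift ord0 i is Some j then c j else 0).
rewrite big_ord_recl unlift_none scale0r add0r; apply: eq_bigr => j _.
by rewrite liftK.
Qed.

Lemma spanned_gen n (x : 'I_n -> V) i : spanned x (x i).
Proof.
exists (fun j => (j == i)%:R); rewrite (bigD1 i)//= eqxx scale1r big1 ?addr0//.
by move=> j /negbTE ->; rewrite scale0r.
Qed.

Lemma spanned_orthogonal n (x : 'I_n -> V) v p : (forall i, D (x i)) -> D v ->
  (forall i, ip v (x i) = 0) -> spanned x p -> ip v p = 0.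
Proof.
move=> Dx Dv ov [c ->]; rewrite (sip_sumr sip)// => [|j]; last exact: (subspaceZ sD).
by rewrite big1// => j _; rewrite (sipZr sip)// ov mulr0.
Qed.

Lemma finite_projection n (x : 'I_n -> V) u : (forall i, D (x i)) -> D u ->
  exists2 p, spanned x p & forall i, ip (u - p) (x i) = 0.
Proof.
elim: n x u => [|n IH] x u Dx Du.
  by exists 0 => [|[]//]; exists (fun=> 0); rewrite big_ord0.
have Dt i : D ((x \o lift ord0) i) by exact: Dx.
have [p sp op] := IH _ _ Dt Du; have [q sq oq] := IH _ _ Dt (Dx ord0).
have Dp := spanned_dom Dt sp; have Dq := spanned_dom Dt sq.
have Dup := subspaceB sD Du Dp; have Dxq := subspaceB sD (Dx ord0) Dq.
set e := x ord0 - q.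
have De : D e by [].
pose a : C := if sn e == 0 then 0 else ip (u - p) e / (sn e ^+ 2)%:C.
have oe : ip (u - p - a *: e) e = 0.
  rewrite (sipBl sip)//; last exact: (subspaceZ sD).
  rewrite (sipZl sip)// /a; case: eqVneq => [e0|e0].
    by rewrite mul0r subr0 (sip_nullr sip).
  rewrite (sip_self sip)// divfK ?subrr//.
  by rewrite -[0](rmorph0 (real_complex R)) (inj_eq (@complexI R)) expf_eq0.
have Da : D (u - p - a *: e) by apply: (subspaceB sD) => //; exact: (subspaceZ sD).
have ot j : ip (u - p - a *: e) (x (lift ord0 j)) = 0.
  rewrite (sipBl sip) ?(sipZl sip)//; last exact: (subspaceZ sD).
  by rewrite (op j) (oq j) mulr0 subr0.
exists (p + a *: e).
  apply: (subspaceD (spanned_sub x)); first exact: spannedS.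
  apply: (subspaceZ (spanned_sub x)); apply: (subspaceB (spanned_sub x)).
    exact: spanned_gen.
  exact: spannedS.
have -> : u - (p + a *: e) = u - p - a *: e by rewrite opprD addrA.
move=> i; case: (unliftP ord0 i) => [j ->|->]; first exact: ot.
have -> : x ord0 = e + q by rewrite subrK.
by rewrite (sipDr sip)// oe add0r; exact: (spanned_orthogonal Dt) ot sq.
Qed.

(** Subtracting from the first vector a combination of the others is a column
    operation of determinant 1. *)
Lemma gram_shift n (x : 'I_n -> V) u p : (forall i, D (x i)) -> D u -> spanned x p ->
  \det (gram (fcons u x)) = \det (gram (fcons (u - p) x)).
Proof.
move=> Dx Du [c cp].
have Dc i : D (fcons u x i).
  by case: (unliftP ord0 i) => [j ->|->]; rewrite ?fcons0 ?fconsS.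
pose A : 'M[C]_n.+1 := \matrix_(i, j)
  (if j == i then 1 else if unlift ord0 i is Some _ then 0
   else if unlift ord0 j is Some k then - c k else 0).
have -> : fcons (u - p) x = lincomb A (fcons u x).
  apply/funext => i; rewrite /lincomb; case: (unliftP ord0 i) => [j ->|->].
    rewrite fconsS (bigD1 (lift ord0 j))//= mxE eqxx scale1r fconsS big1 ?addr0//.
    by move=> k /negbTE kj; rewrite mxE kj liftK scale0r.
  rewrite fcons0 big_ord_recl mxE eqxx scale1r fcons0; congr (_ + _).
  rewrite cp -sumrN; apply: eq_bigr => j _.
  by rewrite mxE fconsS unlift_none liftK /= scaleNr.
rewrite det_gram_lincomb// -(det_tr A) det_trig.
  by rewrite big1 ?Normc.normc1 ?expr1n ?mul1r// => i _; rewrite !mxE eqxx.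
apply/is_trig_mxP => i j ij; rewrite !mxE ifF; last first.
  by apply: contraTF ij => /eqP ->; rewrite ltnn.
case: (unliftP ord0 j) => [//|j0]; by rewrite j0 in ij.
Qed.

(** The squared volume of a parallelepiped is that of a base times the squared
    height over this base. *)
Lemma gram_dist n (x : 'I_n -> V) u p : (forall i, D (x i)) -> D u -> spanned x p ->
  (forall i, ip (u - p) (x i) = 0) ->
  \det (gram (fcons u x)) = (sn (u - p) ^+ 2)%:C * \det (gram x).
Proof.
move=> Dx Du sp op; rewrite (gram_shift Dx Du sp) gram_orthogonal.
- rewrite fcons0; congr (_ * \det (gram _)); apply/funext => j /=; by rewrite fconsS.
- move=> i; have Dp := spanned_dom Dx sp.
  case: (unliftP ord0 i) => [j ->|->]; rewrite ?fcons0 ?fconsS//; exact: (subspaceB sD).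
- by move=> j; rewrite fcons0 fconsS.
Qed.

Lemma fcons_eta n (x : 'I_n.+1 -> V) : fcons (x ord0) (x \o lift ord0) = x.
Proof.
by apply/funext => i; case: (unliftP ord0 i) => [j ->|->]; rewrite ?fcons0 ?fconsS.
Qed.

Lemma det_gram_ge0 n (x : 'I_n -> V) : (forall i, D (x i)) -> 0 <= \det (gram x).
Proof.
elim: n x => [|n IH] x Dx; first by rewrite det_mx00 ler01.
have [p sp op] := @finite_projection _ (x \o lift ord0) _ (fun i => Dx (lift ord0 i)) (Dx ord0).
have Dt j : D ((x \o lift ord0) j) by exact: Dx.
rewrite -(fcons_eta x) (gram_dist Dt (Dx ord0) sp op).
by rewrite mulr_ge0 ?IH// ler0c sqr_ge0.
Qed.

Lemma sn_le_orthogonal u p : D u -> D p -> ip (u - p) p = 0 -> sn (u - p) <= sn u.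
Proof.
move=> Du Dp o; rewrite -(@ler_pXn2r _ 2) ?nnegrE ?sn_ge0//.
have := sn_pythagoras sip (subspaceB sD Du Dp) Dp o.
by rewrite subrK => ->; rewrite lerDl sqr_ge0.
Qed.

(** Fischer's inequality for a single vector against the others. *)
Lemma gram_fischer n (x : 'I_n -> V) u : (forall i, D (x i)) -> D u ->
  \det (gram (fcons u x)) <= (sn u ^+ 2)%:C * \det (gram x).
Proof.
move=> Dx Du; have [p sp op] := finite_projection Dx Du.
have Dp := spanned_dom Dx sp.
rewrite (gram_dist Dx Du sp op) ler_wpM2r ?det_gram_ge0// lecR.
rewrite ler_pXn2r ?nnegrE ?sn_ge0// sn_le_orthogonal//.
by apply: (spanned_orthogonal Dx) op _ => //; exact: (subspaceB sD).
Qed.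

(** If a linear map contracts by [b j] on a subspace of codimension at most [j],
    for each [j], it contracts volumes by the product of the [b j]: this is the
    Weyl-Horn bound by singular values, with approximation numbers in their
    place. The map is given by the family [y] of images of [x]. By induction, a
    nonzero vector [w] of the span of [x] on which the map contracts by [b n] is
    split off: the rest of [x] is made orthogonal to [w], so that the volume
    factors exactly on the side of [x], and at least as an upper bound, by
    Fischer's inequality, on the side of [y]. *)
Lemma gram_contraction n (x y : 'I_n -> V) (b : nat -> R) :
  (forall i, D (x i)) -> (forall i, D (y i)) -> (forall j, 0 <= b j) ->
  (forall j, (j < n)%N -> exists m (a : 'M[C]_(n, m)), (m <= j)%N /\
    forall c : 'rV[C]_n, c *m a = 0 ->
      sn (lincomb c y ord0) <= b j * sn (lincomb c x ord0)) ->
  \det (gram y) <= (\prod_(j < n) b j ^+ 2)%:C * \det (gram x).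
Proof.
move=> Dx Dy b0; elim: n x y Dx Dy => [|n IH] x y Dx Dy hb.
  by rewrite !det_mx00 big_ord0 mul1r.
have [m [a [mn ha]]] := hb n (ltnSn n).
(* [m <= n] linear conditions on [n + 1] coefficients have a common solution *)
have [c c0 ca] : exists2 c : 'rV[C]_n.+1, c != 0 & c *m a = 0.
  have : kermx a != 0.
    rewrite -mxrank_eq0 mxrank_ker subn_eq0 -ltnNge.
    by apply: leq_ltn_trans (rank_leq_col a) _; rewrite ltnS.
  case/rowV0Pn => v /sub_kermxP va v0; by exists v.
(* an invertible matrix with first row proportional to [c] *)
set U := row_ebase c.
have Uu : U \in unitmx by exact: row_ebase_unit.
have [s cs] : exists s, row ord0 U = s *: c.
  have rc : \rank c = 1%N by rewrite rank_rV c0.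
  have := mulmx_ebase c; rewrite rc [col_ebase c]mx11_scalar mul_scalar_mx.
  set t := col_ebase c _ _ => ct.
  have t0 : t != 0.
    by apply: contra_neq c0 => tz; rewrite -ct tz scale0r mul0mx.
  exists t^-1; rewrite -ct -scalemxAl scalerA mulVf// scale1r.
  apply/rowP => j; rewrite !mxE (bigD1 ord0)//= !mxE mul1r big1 ?addr0// => k k0.
  have /negbTE k1 : nat_of_ord k != 0%N by apply: contra_neq k0 => ?; exact: val_inj.
  by rewrite !mxE eq_sym k1 mul0r.
set w := lincomb U x ord0; set v := lincomb U y ord0.
have Dw : D w by exact: lincomb_dom.
have Dv : D v by exact: lincomb_dom.
have vw : sn v <= b n * sn w.
  have e (z : 'I_n.+1 -> V) : lincomb U z ord0 = lincomb (s *: c) z ord0.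
    by rewrite -cs /lincomb; apply: eq_bigr => j _; rewrite mxE.
  rewrite /v /w !e; apply: ha; by rewrite -scalemxAl ca scaler0.
(* [T] subtracts from the other vectors their components along [w]; when [w] has
   norm 0 it is orthogonal to everything already *)
pose lam i : C := if sn w == 0 then 0 else
  ip (lincomb U x (lift ord0 i)) w / (sn w ^+ 2)%:C.
pose T : 'M[C]_n.+1 := \matrix_(i, j) (if j == i then 1 else
  if unlift ord0 i is Some i' then if j == ord0 then - lam i' else 0 else 0).
have detT : \det T = 1.
  rewrite det_trig ?big1// => [i _|]; first by rewrite mxE eqxx.
  apply/is_trig_mxP => i j ij; rewrite mxE ifF; last first.
    by apply: contraTF ij => /eqP ->; rewrite ltnn.
  case: unliftP => // i' _; case: eqP => // j0; by rewrite j0 in ij.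
pose Z := T *m U.
have Z0 : \det Z != 0.
  by rewrite det_mulmx detT mul1r; rewrite unitmxE unitfE in Uu.
have Zx (z : 'I_n.+1 -> V) i : lincomb Z z (lift ord0 i) =
    lincomb U z (lift ord0 i) - lam i *: lincomb U z ord0.
  rewrite -lincombM {1}/lincomb (bigD1 (lift ord0 i))//= mxE eqxx scale1r; congr (_ + _).
  rewrite (bigD1 ord0)//= mxE (_ : (ord0 == lift ord0 i) = false)// liftK eqxx scaleNr.
  rewrite big1 ?addr0// => k /andP[ki k0].
  by rewrite mxE (negbTE ki) liftK (negbTE k0) scale0r.
have Zx0 (z : 'I_n.+1 -> V) : lincomb Z z ord0 = lincomb U z ord0.
  rewrite -lincombM {1}/lincomb (bigD1 ord0)//= mxE eqxx scale1r.
  by rewrite big1 ?addr0// => k k0; rewrite mxE (negbTE k0) unlift_none scale0r.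
have Dlx := lincomb_dom Z Dx; have Dly := lincomb_dom Z Dy.
have step : \det (gram (lincomb Z y)) <=
    (\prod_(j < n.+1) b j ^+ 2)%:C * \det (gram (lincomb Z x)).
  rewrite -(fcons_eta (lincomb Z y)).
  apply: le_trans (gram_fischer (fun i => Dly _) (Dly ord0)) _.
  have -> : \det (gram (lincomb Z x)) =
      (sn w ^+ 2)%:C * \det (gram (lincomb Z x \o lift ord0)).
    rewrite gram_orthogonal ?Zx0// => j.
    have Dj := lincomb_dom U Dx (lift ord0 j).
    rewrite Zx (sip_herm sip); last 2 first.
    - by apply: (subspaceB sD) => //; exact: (subspaceZ sD).
    - by [].
    rewrite (sipBl sip) ?(sipZl sip)//; last exact: (subspaceZ sD).
    rewrite /lam; case: eqVneq => [e0|e0].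
      by rewrite mul0r subr0 (sip_nullr sip)// conjc0.
    rewrite (sip_self sip)// divfK ?subrr ?conjc0//.
    by rewrite -[0](rmorph0 (real_complex R)) (inj_eq (@complexI R)) expf_eq0.
  have IHd : \det (gram (lincomb Z y \o lift ord0)) <=
      (\prod_(j < n) b j ^+ 2)%:C * \det (gram (lincomb Z x \o lift ord0)).
    apply: IH => [i|i|j jn]; [exact: Dlx|exact: Dly|].
    have [m' [a' [mj ha']]] := hb j (ltnW jn).
    pose W : 'M[C]_(n, n.+1) := \matrix_(i, k) Z (lift ord0 i) k.
    have WZ (z : 'I_n.+1 -> V) : lincomb Z z \o lift ord0 = lincomb W z.
      by apply/funext => i; rewrite /= /lincomb; apply: eq_bigr => k _; rewrite [in RHS]mxE.
    exists m', (W *m a'); split=> // c' c'0.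
    by rewrite !WZ !lincombM; apply: ha'; rewrite -mulmxA.
  rewrite Zx0 -/v big_ord_recr /=.
  have sv2 : (sn v ^+ 2)%:C <= (b n ^+ 2 * sn w ^+ 2)%:C.
    by rewrite lecR -exprMn ler_pXn2r ?nnegrE ?sn_ge0 ?mulr_ge0 ?sn_ge0.
  apply: (@le_trans _ _ ((b n ^+ 2 * sn w ^+ 2)%:C * \det (gram (lincomb Z y \o lift ord0)))).
    by rewrite ler_wpM2r// det_gram_ge0// => i; exact: Dly.
  have -> : (\prod_(i < n) b i ^+ 2 * b n ^+ 2)%:C *
      ((sn w ^+ 2)%:C * \det (gram (lincomb Z x \o lift ord0))) =
      (b n ^+ 2 * sn w ^+ 2)%:C * ((\prod_(i < n) b i ^+ 2)%:C *
        \det (gram (lincomb Z x \o lift ord0))).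
    rewrite !(rmorphM (real_complex R)) /=; ring.
  by rewrite ler_wpM2l// ler0c mulr_ge0 ?sqr_ge0.
move: step; rewrite !det_gram_lincomb// mulrCA ler_pM2l//.
rewrite -[0](rmorph0 (real_complex R)) ltcR exprn_gt0// lt_neqAle normc_ge0 andbT eq_sym.
by apply: contra_neq Z0 => /Normc.eq0_normc.
Qed.

(** * Minimal residuals *)

Section minimal_residual.
Variable M : V -> V.
Hypothesis definite : forall u, D u -> sn u = 0 -> u = 0.
Hypothesis MD : forall u, D u -> D (M u).
Hypothesis Mlin : forall a u v, D u -> D v -> M (a *: u + v) = a *: M u + M v.
Hypothesis Minj : forall u, D u -> M u = 0 -> u = 0.

Lemma lin_sum n (L : V -> V) (c : 'I_n -> C) (x : 'I_n -> V) : 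
  (forall a u v, D u -> D v -> L (a *: u + v) = a *: L u + L v) ->
  (forall i, D (x i)) -> L (\sum_i c i *: x i) = \sum_i c i *: L (x i).
Proof.
move=> LL; have L0 : L 0 = 0.
  have := LL 1 0 0 (subspace0 sD) (subspace0 sD).
  by rewrite !scale1r addr0 => /eqP; rewrite -subr_eq0 opprD addNKr oppr_eq0 => /eqP.
elim: n c x => [|n IH] c x Dx; first by rewrite !big_ord0.
rewrite !big_ord_recl LL//; first by rewrite IH.
by apply: (subspace_sum sD) => i _; exact: (subspaceZ sD).
Qed.

Lemma iterD r k : D r -> D (iter k M r).
Proof. by move=> Dr; elim: k => //= k IH; exact: MD. Qed.

(** A dependence among the iterates, divided by the highest power of [M] that it
    allows, exhibits [r] as the image of a Krylov vector. *)
Lemma krylov_dependent r n (c : nat -> C) : D r ->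
  \sum_(k < n) c k *: iter k M r = 0 -> (exists2 k, (k < n)%N & c k != 0) ->
  exists d : 'I_n -> C, r = M (\sum_k d k *: iter k M r).
Proof.
move=> Dr; elim: n c => [|n IH] c; first by move=> _ [].
rewrite big_ord_recl /= => e.
have Di k : D (iter k M r) by exact: iterD.
have e' : c 0 *: r + M (\sum_(k < n) c k.+1 *: iter k M r) = 0.
  rewrite -[RHS]e; congr (_ + _).
  by rewrite (lin_sum (fun k : 'I_n => c k.+1))//.
have [c0|c0] := eqVneq (c 0%N) 0; last first.
  move=> _; exists (fun k : 'I_n.+1 => if (k < n)%N then - (c 0%N)^-1 * c k.+1 else 0).
  rewrite big_ord_recr /= ltnn scale0r addr0.
  have -> : \sum_(i < n) (if (i < n)%N then - (c 0%N)^-1 * c i.+1 else 0) *: iter i M r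
     = - (c 0%N)^-1 *: \sum_(k < n) c k.+1 *: iter k M r.
    by rewrite scaler_sumr; apply: eq_bigr => i _; rewrite ltn_ord scalerA.
  set z := \sum_(k < n) _ in e' *.
  have Dz : D z by apply: (subspace_sum sD) => i _; exact: (subspaceZ sD).
  have -> : M (- (c 0%N)^-1 *: z) = - (c 0%N)^-1 *: M z.
    rewrite -[_ *: z]addr0 Mlin//; last exact: subspace0.
    have := @lin_sum 0 M (fun=> 0) (fun=> 0) Mlin (fun=> subspace0 sD).
    by rewrite !big_ord0 => ->; rewrite addr0.
  move/eqP: e'; rewrite addrC addr_eq0 => /eqP ->.
  by rewrite scaleNr scalerN opprK scalerA mulVf// scale1r.
move=> [[|k] kn ck]; first by rewrite c0 eqxx in ck.
have Dz : D (\sum_(k < n) c k.+1 *: iter k M r).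
  by apply: (subspace_sum sD) => i _; exact: (subspaceZ sD).
rewrite c0 scale0r add0r in e'.
have [|d hd] := IH (fun k => c k.+1) (Minj Dz e'); first by exists k.
exists (fun k : 'I_n.+1 => if unlift ord_max k is Some j then d j else 0).
rewrite {1}hd big_ord_recr /= unlift_none scale0r addr0; congr M.
apply: eq_bigr => i _; congr (_ *: _).
have -> : widen_ord (leqnSn n) i = lift ord_max i.
  by apply: val_inj; rewrite /= /bump leqNgt ltn_ord.
by rewrite liftK.
Qed.

(** Moret's bound. With [K = M - Id], the volume of [r, M r, .., M^n r] is that
    of [r, K r, .., K M^(n-1) r], and dividing it by the volume of
    [M r, .., M^n r] gives the distance of [r] to the space those span. Hence
    the product of the rates [b] at which [K] contracts volumes and the rates
    [b'] at which the inverse of [M] does. The maps [F] of rank at most [j] have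
    the subspaces of small codimension as kernels. *)
Lemma minimal_residual_bound n r (b b' : nat -> R) : D r ->
  (forall j, 0 <= b j) -> (forall j, 0 <= b' j) ->
  (forall j, (j < n)%N -> exists F : V -> V, [/\
     forall a u v, D u -> D v -> F (a *: u + v) = a *: F u + F v,
     exists m (w : 'I_m -> V), (m <= j)%N /\
       forall u, D u -> exists c : 'I_m -> C, F u = \sum_i c i *: w i,
     forall u, D u -> F u = 0 -> sn (M u - u) <= b j * sn u
   & forall u, D u -> F (M u) = 0 -> sn u <= b' j * sn (M u)]) ->
  exists d : 'I_n -> C,
    sn (r - M (\sum_k d k *: iter k M r)) <= (\prod_(j < n) (b j * b' j)) * sn r.
Proof.
move=> Dr b0 b'0 hF.
pose x := fun k : 'I_n => iter k M r.
pose Mx := fun k : 'I_n => iter k.+1 M r.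
pose Kx := fun k : 'I_n => Mx k - x k.
have Dx i : D (x i) by exact: iterD.
have DMx i : D (Mx i) by exact: iterD.
have DKx i : D (Kx i) by exact: (subspaceB sD).
have prod0 : 0 <= \prod_(j < n) (b j * b' j) by apply: prodr_ge0 => j _; exact: mulr_ge0.
have lincM (c : 'rV[C]_n) : lincomb c Mx ord0 = M (lincomb c x ord0).
  by rewrite /lincomb (lin_sum (fun j => c ord0 j)).
have lincK (c : 'rV[C]_n) : lincomb c Kx ord0 = M (lincomb c x ord0) - lincomb c x ord0.
  rewrite -lincM /lincomb -sumrB; apply: eq_bigr => j _; by rewrite scalerBr.
have Dlin (c : 'rV[C]_n) : D (lincomb c x ord0) by exact: lincomb_dom.
have coeff (F : V -> V) (m : nat) (w : 'I_m -> V) (z : 'I_n -> V) :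
    (forall a u v, D u -> D v -> F (a *: u + v) = a *: F u + F v) ->
    (forall u, D u -> exists c : 'I_m -> C, F u = \sum_i c i *: w i) ->
    (forall i, D (z i)) ->
    exists a : 'M[C]_(n, m), forall c : 'rV[C]_n, c *m a = 0 -> F (lincomb c z ord0) = 0.
  move=> FL Fw Dz; have /choice[c hc] : forall i, exists c : 'I_m -> C, F (z i) = \sum_k c k *: w k.
    by move=> i; apply: Fw.
  exists (\matrix_(i, k) c i k) => c' hc'.
  rewrite /lincomb (lin_sum (fun j => c' ord0 j))//.
  under eq_bigr do rewrite hc scaler_sumr.
  rewrite exchange_big big1//= => k _.
  under eq_bigr do rewrite scalerA.
  rewrite -scaler_suml.
  rewrite (_ : \sum_(i < n) _ = \sum_j c' ord0 j * (\matrix_(i, k) c i k) j k); last first.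
    by apply: eq_bigr => j _; rewrite mxE.
  by have /rowP/(_ k) := hc'; rewrite !mxE => ->; rewrite scale0r.
have volK : \det (gram Kx) <= (\prod_(j < n) b j ^+ 2)%:C * \det (gram x).
  apply: gram_contraction => // j jn.
  have [F [FL [m [w [mj Fw]]] hK _]] := hF j jn.
  have [a ha] := coeff F m w x FL Fw Dx.
  by exists m, a; split=> // c /ha Fc; rewrite lincK; exact: hK.
have volM : \det (gram x) <= (\prod_(j < n) b' j ^+ 2)%:C * \det (gram Mx).
  apply: gram_contraction => // j jn.
  have [F [FL [m [w [mj Fw]]] _ hM]] := hF j jn.
  have [a ha] := coeff F m w Mx FL Fw DMx.
  by exists m, a; split=> // c /ha; rewrite lincM; exact: hM.
(* subtracting from each vector its predecessor is unipotent *)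
have vol : \det (gram (fcons r Mx)) = \det (gram (fcons r Kx)).
  pose A : 'M[C]_n.+1 := \matrix_(i, j) (if j == i then 1 else
     if (i == j.+1 :> nat) then -1 else 0).
  have -> : fcons r Kx = lincomb A (fcons r Mx).
    apply/funext => i; rewrite /lincomb (bigD1 i)//= mxE eqxx scale1r.
    case: (unliftP ord0 i) => [k ->|->]; last first.
      rewrite !fcons0 big1 ?addr0// => j /negbTE j0.
      by rewrite mxE j0 /= scale0r.
    rewrite !fconsS (bigD1 (widen_ord (leqnSn n) k)) /=; last first.
      by apply/eqP => /(congr1 val) /=; rewrite /bump /= => /eqP; rewrite add1n ltn_eqF.
    rewrite mxE ifF; last first.
      by apply/eqP => /(congr1 val) /=; rewrite /bump /= => /eqP; rewrite add1n ltn_eqF.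
    rewrite /= /bump /= add1n eqxx scaleN1r big1 ?addr0 => [|j /andP[j1 j2]]; last first.
      rewrite mxE (negbTE j1) /= /bump /= add1n eqSS ifF ?scale0r//.
      by apply: contra_neqF j2 => /eqP kj; apply: val_inj.
    congr (_ - _); case: (unliftP ord0 (widen_ord (leqnSn n) k)) => [l e|e].
      rewrite e fconsS /Mx /x; have /(congr1 val) /= := e.
      by rewrite /bump /= add1n => ->.
    by rewrite e fcons0 /x; have /(congr1 val) /= := e => ->.
  rewrite det_gram_lincomb; last first.
    by move=> i; case: (unliftP ord0 i) => [k ->|->]; rewrite ?fcons0 ?fconsS.
  rewrite (@det_trig _ _ A) ?big1 ?Normc.normc1 ?expr1n ?mul1r// => [i _|]; first by rewrite mxE eqxx.
  apply/is_trig_mxP => i j ij; rewrite mxE ifF; last first.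
    by apply: contraTF ij => /eqP ->; rewrite ltnn.
  by rewrite ifF//; apply/negbTE; rewrite ltn_eqF// (ltn_trans ij).
(* if [M r, .., M^n r] are dependent, the Krylov space contains the solution *)
have [dM|dM] := eqVneq (\det (gram Mx)) 0.
  have /det0P[c c0 cg] : \det (gram Mx) == 0 by rewrite dM.
  have /definite : D (lincomb c Mx ord0) by exact: lincomb_dom.
  have -> : sn (lincomb c Mx ord0) = 0.
    have := gram_lincomb c DMx; rewrite cg mul0mx => /matrixP/(_ ord0 ord0).
    rewrite !mxE => e; by rewrite /seminorm_of e sqrtr0.
  move=> /(_ erefl); rewrite lincM => /(Minj (Dlin c)) e.
  have [||d hd] := @krylov_dependent r n (fun k => if insub k is Some j then c ord0 j else 0) Dr.
  - by rewrite -[RHS]e; apply: eq_bigr => i _; rewrite valK.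
  - have /rV0Pn[k ck] := c0; exists (nat_of_ord k); first exact: ltn_ord.
    have -> : insub (nat_of_ord k) = Some k by exact: valK.
    by [].
  by exists d; rewrite -hd subrr (sn0 sip) mulr_ge0 ?sn_ge0.
have [p sp op] := finite_projection DMx Dr.
have [d pd] := sp.
exists d; rewrite (lin_sum d)// -pd.
rewrite -(@ler_pXn2r _ 2) ?nnegrE ?sn_ge0 ?mulr_ge0 ?sn_ge0// exprMn.
have dMp : 0 < \det (gram Mx) by rewrite lt_neqAle eq_sym dM det_gram_ge0.
rewrite -lecR -(ler_pM2r dMp) -(gram_dist DMx Dr sp op) vol.
apply: le_trans (gram_fischer DKx Dr) _.
have q0 (f : nat -> R) : 0 <= (\prod_(j < n) f j ^+ 2)%:C.
  by rewrite ler0c; apply: prodr_ge0 => j _; exact: sqr_ge0.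
apply: (@le_trans _ _ ((sn r ^+ 2)%:C * ((\prod_(j < n) b j ^+ 2)%:C *
   ((\prod_(j < n) b' j ^+ 2)%:C * \det (gram Mx))))).
  rewrite ler_wpM2l ?ler0c ?sqr_ge0//; apply: le_trans volK _.
  by rewrite ler_wpM2l.
have -> : (\prod_(j < n) (b j * b' j)) ^+ 2 =
    (\prod_(j < n) b j ^+ 2) * (\prod_(j < n) b' j ^+ 2).
  by rewrite -prodrXl -big_split; apply: eq_bigr => j _; rewrite exprMn.
by rewrite !rmorphM /= le_eqVlt; apply/orP; left; apply/eqP; ring.
Qed.
End minimal_residual.
End gram_determinants.

(** * Power means *)
Section power_means.
Context {R : realType}.

(** With [x] the right-hand side, Young's inequality bounds [s j / x] by
    [(s j / x)^p / p + 1 - 1 / p]; the sum of these bounds is at most [n]. *)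
Lemma mean_le_power_mean (n : nat) (s : nat -> R) (p T : R) : (0 < n)%N -> 1 <= p ->
  (forall j, 0 <= s j) -> \sum_(j < n) s j `^ p <= T ->
  (\sum_(j < n) s j) / n%:R <= T `^ p^-1 / n%:R `^ p^-1.
Proof.
move=> n0 p1 s0 hT.
have p0 : 0 < p by exact: lt_le_trans p1.
have nR : 0 < n%:R :> R by rewrite ltr0n.
have S0 : 0 <= \sum_(j < n) s j `^ p by apply: sumr_ge0 => j _; exact: powR_ge0.
have T0 : 0 <= T by exact: le_trans hT.
set x := T `^ p^-1 / n%:R `^ p^-1.
have xp : x `^ p = T / n%:R.
  rewrite /x powRM ?powR_ge0 ?invr_ge0 ?powR_ge0//.
  rewrite -powRN -!powRrM mulNr !mulVf ?gt_eqF// powRr1// powR_inv1// ltW.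
have x0 : 0 <= x by rewrite divr_ge0// powR_ge0.
have [xz|xz] := eqVneq x 0.
  have S00 : \sum_(j < n) s j `^ p = 0.
    apply/eqP; rewrite eq_le S0 andbT; apply: le_trans hT _.
    move: xp; rewrite xz powR0 ?gt_eqF// => /esym/eqP.
    by rewrite mulf_eq0 invr_eq0 (gt_eqF nR) orbF => /eqP ->.
  rewrite xz big1 ?mul0r// => j _.
  have /eqP := S00; rewrite psumr_eq0 => [/allP/(_ j (mem_index_enum j)) /=|i _]; last exact: powR_ge0.
  by rewrite powR_eq0 => /andP[/eqP].
have xpos : 0 < x by rewrite lt_neqAle eq_sym xz.
have term j : s j <= x * ((s j `^ p / x `^ p) / p + (1 - p^-1)).
  have [p1'|p1'] := eqVneq p 1.
    by rewrite p1' invr1 subrr addr0 mulr1 !powRr1// mulrC divfK.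
  have pgt1 : 1 < p by rewrite lt_neqAle eq_sym p1'.
  have ip : 0 < 1 - p^-1 by rewrite subr_gt0 invf_lt1.
  have := @conjugate_powR R (s j / x) 1 p (1 - p^-1)^-1 (divr_ge0 (s0 j) x0) ler01 p0.
  rewrite invr_gt0 ip invrK addrC subrK => /(_ isT erefl).
  rewrite powR1 mulr1 mul1r powRM ?invr_ge0//.
  have -> : x^-1 `^ p = (x `^ p)^-1 by rewrite -powR_inv1// -powRrM mulN1r powRN.
  by rewrite ler_pdivrMr// mulrC.
have : \sum_(j < n) s j <= \sum_(j < n) x * ((s j `^ p / x `^ p) / p + (1 - p^-1)).
  by apply: ler_sum => j _.
rewrite -mulr_sumr big_split /= sumr_const card_ord -!mulr_suml.
have xpp : 0 < x `^ p by exact: powR_gt0.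
move=> /le_trans h; rewrite ler_pdivrMr// [leRHS](_ : _ = x * (n%:R / p + (1 - p^-1) *+ n)).
  apply: h; rewrite ler_pM2l// lerD2r ler_pM2r ?invr_gt0// ler_pdivrMr//.
  by rewrite xp mulrC divfK ?gt_eqF.
by rewrite -mulr_natr; field; rewrite gt_eqF.
Qed.

Lemma prod_le_mean (n : nat) (s : nat -> R) : (0 < n)%N -> (forall j, 0 <= s j) ->
  \prod_(j < n) s j <= ((\sum_(j < n) s j) / n%:R) ^+ n.
Proof.
move=> n0 s0; have := @leif_AGM _ 'I_n predT (fun j => s j) (fun j _ => s0 j).
by rewrite card_ord => -[].
Qed.

Lemma prod_limit (n : nat) (g : nat -> R -> R) (a : R) :
  (forall j, {for 0, continuous (g j)}) ->
  (forall e, 0 < e -> a <= \prod_(j < n) g j e) -> a <= \prod_(j < n) g j 0.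
Proof.
move=> gc h.
have c : (fun e => \prod_(j < n) g j e) @ (0 : R) --> \prod_(j < n) g j 0.
  elim: n {h} => [|n IH].
    under eq_fun do rewrite big_ord0; rewrite big_ord0; exact: cvg_cst.
  under eq_fun do rewrite big_ord_recr /=; rewrite big_ord_recr /=.
  by apply: cvgM => //; exact: gc.
have c' : (fun e => \prod_(j < n) g j e) @ (0 : R)^'+ --> \prod_(j < n) g j 0.
  exact: cvg_at_right_filter.
rewrite -(cvg_lim _ c')//; apply: limr_ge; first by apply/cvg_ex; exists (\prod_(j < n) g j 0).
near=> e; apply: h; near: e; exact: nbhs_right_gt.
Unshelve. all: by end_near.
Qed.

(** By the inequality of arithmetic and geometric means the products of the
    [s j / g] and of the [1 + s j / g] are at most the [n]-th powers of the means
    of their factors, and by the inequality between means these means are at most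
    [x] and [1 + x]. *)
Lemma singular_product_bound (n : nat) (s : nat -> R) (p T g : R) :
  (0 < n)%N -> 1 <= p -> 0 < g ->
  (forall j, 0 <= s j) -> \sum_(j < n) s j `^ p <= T ->
  forall x, x = T `^ p^-1 / (g * n%:R `^ p^-1) ->
  \prod_(j < n) (s j / g * (1 + s j / g)) <= (x + x ^+ 2) ^+ n.
Proof.
move=> n0 p1 g0 s0 hT x xE.
pose y j := s j / g.
have y0 j : 0 <= y j by rewrite divr_ge0// ltW.
pose m := (\sum_(j < n) y j) / n%:R.
have nR : 0 < n%:R :> R by rewrite ltr0n.
have m0 : 0 <= m by rewrite divr_ge0// ?ler0n// sumr_ge0.
have mx : m <= x.
  have := mean_le_power_mean n0 p1 s0 hT.
  rewrite -(ler_pM2r (_ : 0 < g^-1)) ?invr_gt0// => h.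
  have -> : m = (\sum_(j < n) s j) / n%:R / g by rewrite /m -mulr_suml mulrAC.
  by apply: le_trans h _; rewrite xE invfM mulrA mulrAC.
have h1 := prod_le_mean n0 y0.
have h2 := @prod_le_mean n (fun j => 1 + y j) n0 (fun j => addr_ge0 ler01 (y0 j)).
rewrite big_split /=.
have -> : x + x ^+ 2 = x * (1 + x) by ring.
rewrite exprMn ler_pM//.
- by apply: prodr_ge0 => j _; exact: y0.
- by apply: prodr_ge0 => j _; exact: addr_ge0 ler01 (y0 j).
- by apply: le_trans h1 _; rewrite lerXn2r ?nnegrE// (le_trans m0).
- apply: le_trans h2 _; rewrite big_split /= sumr_const card_ord mulrDl divff ?gt_eqF//.
  apply: lerXn2r; rewrite ?nnegrE ?lerD2l//.
    exact: addr_ge0 ler01 m0.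
  exact: addr_ge0 ler01 (le_trans m0 mx).
Qed.

End power_means.

(** * The Fredholm alternative for operators of finite rank *)
Section fredholm.
Context {R : realType} (V : lmodType R[i]) (D : set V).
Hypothesis sD : subspace D.
Local Notation C := R[i].

Definition linear_on (L : V -> V) := forall a u v, D u -> D v ->
  L (a *: u + v) = a *: L u + L v.

Lemma linear_on0 L : linear_on L -> L 0 = 0.
Proof.
move=> /(_ 1 0 0 (subspace0 sD) (subspace0 sD)).
by rewrite !scale1r addr0 => /eqP; rewrite -subr_eq0 opprD addNKr oppr_eq0 => /eqP.
Qed.

Lemma linear_onD L u v : linear_on L -> D u -> D v -> L (u + v) = L u + L v.
Proof. by move=> LL Du Dv; rewrite -[u]scale1r LL// !scale1r. Qed.

Lemma linear_onZ L a u : linear_on L -> D u -> L (a *: u) = a *: L u.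
Proof.
move=> LL Du; rewrite -[_ *: _]addr0 LL//; last exact: subspace0.
by rewrite (linear_on0 LL) addr0.
Qed.

Lemma linear_onB L u v : linear_on L -> D u -> D v -> L (u - v) = L u - L v.
Proof. by move=> LL Du Dv; rewrite addrC -scaleN1r LL// scaleN1r addrC. Qed.

Lemma linear_on_sum L n (c : 'I_n -> C) (x : 'I_n -> V) : linear_on L ->
  (forall i, D (x i)) -> L (\sum_i c i *: x i) = \sum_i c i *: L (x i).
Proof.
move=> LL; elim: n c x => [|n IH] c x Dx; first by rewrite !big_ord0 linear_on0.
rewrite !big_ord_recl LL//; first by rewrite IH.
by apply: (subspace_sum sD) => i _; exact: (subspaceZ sD).
Qed.

(** The equation reduces to a square linear system on a basis of the range of [F],
    whose matrix is injective because [Id + F] is. That [F] has rank less than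
    [m] is expressed by the dependence of any [m] of its values. *)
Lemma finite_rank_surjective (F : V -> V) m : (forall u, D u -> D (F u)) -> linear_on F ->
  (forall v : 'I_m -> V, (forall i, D (v i)) ->
    exists2 c : 'rV[C]_m, c != 0 & \sum_i c ord0 i *: F (v i) = 0) ->
  (forall u, D u -> u + F u = 0 -> u = 0) ->
  forall y, D y -> exists2 u, D u & u + F u = y.
Proof.
move=> FD FL.
elim: m => [|k IH] dep inj.
  have [i|c] := dep (fun=> 0); first exact: subspace0.
  by move/eqP; case; apply/rowP => -[].
(* lower the bound on the rank until it is attained *)
have [|ndep] := pselect (forall v : 'I_k -> V, (forall i, D (v i)) ->
    exists2 c : 'rV[C]_k, c != 0 & \sum_i c ord0 i *: F (v i) = 0).
  by move=> /IH/(_ inj).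
have [v [Dv free]] : exists v : 'I_k -> V, (forall i, D (v i)) /\
    forall c : 'rV[C]_k, \sum_i c ord0 i *: F (v i) = 0 -> c = 0.
  apply: contra_notP ndep => h v Dv; apply: contra_notP h => h2.
  exists v; split=> // c hc; apply: contra_notP h2 => /eqP c0; by exists c.
have span u : D u -> exists b : 'rV[C]_k, F u = \sum_i b ord0 i *: F (v i).
  move=> Du; have [|c c0] := dep (fcons u v).
    by move=> i; case: (unliftP ord0 i) => [j ->|->]; rewrite ?fcons0 ?fconsS.
  rewrite big_ord_recl fcons0; under eq_bigr do rewrite fconsS.
  move=> e; have [cz|cz] := eqVneq (c ord0 ord0) 0.
    have c'0 : (\row_i c ord0 (lift ord0 i)) = 0.
      apply: free; rewrite -[RHS]e cz scale0r add0r.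
      by apply: eq_bigr => i _; rewrite mxE.
    case/eqP: c0; apply/rowP => i; rewrite mxE; case: (unliftP ord0 i) => [j ->|->] //.
    by have /rowP/(_ j) := c'0; rewrite !mxE.
  exists (\row_i (- (c ord0 ord0)^-1 * c ord0 (lift ord0 i))).
  apply: (scalerI cz); move/eqP: e; rewrite addr_eq0 => /eqP ->.
  rewrite scaler_sumr -sumrN; apply: eq_bigr => i _.
  by rewrite mxE scalerA mulrA mulrN divff// mulN1r scaleNr.
have DF i : D (F (v i)) by exact: FD.
have /choice[phi hphi] : forall i, exists b : 'rV[C]_k, F (F (v i)) = \sum_j b ord0 j *: F (v j).
  by move=> i; exact: span.
pose Phi : 'M[C]_k := \matrix_(i, j) phi i ord0 j.
have DFs (a : 'rV[C]_k) : D (\sum_i a ord0 i *: F (v i)).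
  by apply: (subspace_sum sD) => i _; exact: (subspaceZ sD).
have FPhi (a : 'rV[C]_k) : F (\sum_i a ord0 i *: F (v i)) =
    \sum_j (a *m Phi) ord0 j *: F (v j).
  rewrite (linear_on_sum (fun i => a ord0 i) FL)//.
  under eq_bigr do rewrite hphi scaler_sumr.
  rewrite exchange_big; apply: eq_bigr => j _.
  by rewrite mxE scaler_suml; apply: eq_bigr => i _; rewrite scalerA mxE.
have unit : (1%:M + Phi) \in unitmx.
  rewrite -row_free_unit; apply: inj_row_free => a.
  rewrite mulmxDr mulmx1 => /eqP; rewrite addrC addr_eq0 => /eqP aPhi.
  apply: free; apply: inj; first exact: DFs.
  rewrite FPhi aPhi -big_split big1//= => i _; by rewrite mxE scaleNr subrr.
move=> y Dy; have [b hb] := span _ Dy.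
pose a := b *m invmx (1%:M + Phi).
exists (y - \sum_i a ord0 i *: F (v i)); first exact: (subspaceB sD).
rewrite (linear_onB FL)// FPhi hb -addrA -[RHS]addr0; congr (_ + _).
have ab : b = a + a *m Phi by rewrite -[X in X + _]mulmx1 -mulmxDr mulmxKV.
rewrite addrCA -opprD -big_split /= [X in _ - X](_ : _ = \sum_i b ord0 i *: F (v i)).
  by rewrite subrr.
by apply: eq_bigr => i _; rewrite -scalerDl [in RHS]ab [in RHS]mxE.
Qed.

End fredholm.

(** * The residual of the preconditioned iteration *)
Section preconditioned_residual.
Context {R : realType} (V : lmodType R[i]) (D : set V) (ip : V -> V -> R[i]).
Hypothesis sip : semi_ip D ip.
Let sD := sip_sub sip.
Local Notation C := R[i].
Local Notation sn := (seminorm_of ip).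
Hypothesis definite : forall u, D u -> sn u = 0 -> u = 0.
Variables (Pi S Kr : V -> V) (m : nat) (g s1 : R).
Hypothesis PiD : forall u, D u -> D (Pi u).
Hypothesis PiL : linear_on D Pi.
Hypothesis Pi_iso : forall u, D u -> sn (Pi u) = sn u.
Hypothesis PiK : forall u, D u -> Pi (Pi u) = u.
Hypothesis SD : forall u, D u -> D (S u).
Hypothesis SL : linear_on D S.
Hypothesis S_contr : forall u, D u -> sn (S u) <= sn u.
Hypothesis KrD : forall u, D u -> D (Kr u).
Hypothesis KrL : linear_on D Kr.
Hypothesis Kr_rank : exists w : 'I_m -> V, forall u, D u ->
  exists c : 'I_m -> C, Kr u = \sum_i c i *: w i.
Let dS u := S u - ('i *: u + Kr u).
Let L u := u + Pi (S u).
Let Lr u := u + Pi ('i *: u + Kr u).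
Hypothesis g_le : forall u, D u -> g * sn u <= sn (L u).
Hypothesis dS_le : forall u, D u -> sn (dS u) <= s1 * sn u.
Hypothesis s1g : s1 < g.
Hypothesis s1_ge0 : 0 <= s1.

Let SrD u : D u -> D ('i *: u + Kr u).
Proof. by move=> Du; apply: (subspace_comb sD) => //; exact: KrD. Qed.

Let dSD u : D u -> D (dS u).
Proof. by move=> Du; apply: (subspaceB sD); [exact: SD|exact: SrD]. Qed.

Let LD u : D u -> D (L u).
Proof. by move=> Du; apply: (subspaceD sD) => //; apply: PiD; exact: SD. Qed.

Let LrD u : D u -> D (Lr u).
Proof. by move=> Du; apply: (subspaceD sD) => //; apply: PiD; exact: SrD. Qed.

Let L_split u : D u -> L u = Lr u + Pi (dS u).
Proof.
move=> Du; rewrite /L /Lr -addrA -(linear_onD PiL) ?addrA; last 2 first.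
- exact: SrD.
- exact: dSD.
by rewrite /dS; congr (u + Pi _); rewrite addrAC subrr add0r.
Qed.

Let LrL : linear_on D Lr.
Proof.
move=> a u v Du Dv; rewrite /Lr KrL//.
have -> : 'i *: (a *: u + v) + (a *: Kr u + Kr v) = a *: ('i *: u + Kr u) + ('i *: v + Kr v).
  by rewrite !scalerDr !scalerA mulrC addrACA.
rewrite PiL; [|exact: SrD|exact: SrD].
by rewrite scalerDr addrACA.
Qed.

Let LL : linear_on D L.
Proof.
move=> a u v Du Dv; rewrite /L SL// PiL; [|exact: SD|exact: SD].
by rewrite scalerDr addrACA.
Qed.

Let Lr_ge u : D u -> (g - s1) * sn u <= sn (Lr u).
Proof.
move=> Du; have := g_le Du; rewrite L_split//.
have := snD sip (LrD Du) (PiD (dSD Du)); rewrite Pi_iso; last exact: dSD.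
have := dS_le Du; rewrite mulrBl; lra.
Qed.

Let Lr_inj u : D u -> Lr u = 0 -> u = 0.
Proof.
move=> Du Lu; apply: definite => //; apply/eqP; rewrite eq_le sn_ge0 andbT.
have := Lr_ge Du; rewrite Lu (sn0 sip) pmulr_rle0//; by rewrite subr_gt0.
Qed.

(** [Lr = (Id + i Pi)(Id + F)] with [F = (Id + i Pi)^-1 Pi Kr] of finite rank, and
    [Lr] is injective since it is closer than [g] to [L]. *)
Lemma truncated_operator_surjective y : D y -> exists2 u, D u & Lr u = y.
Proof.
move=> Dy.
(* [Id + i Pi] has inverse [A], because [Pi] is an involution *)
pose A u := (2^-1 : C) *: (u - 'i *: Pi u).
have two : (2 : C) != 0 by rewrite pnatr_eq0.
have AD u : D u -> D (A u).
  move=> Du; apply: (subspaceZ sD); apply: (subspaceB sD) => //.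
  by apply: (subspaceZ sD); exact: PiD.
have AL : linear_on D A.
  move=> a u v Du Dv; rewrite /A PiL// [a *: (_ *: _)]scalerA [a * _]mulrC -scalerA -scalerDr; congr (_ *: _).
  by rewrite scalerBr scalerDr opprD addrACA !scalerA ['i * a]mulrC.
have AK u : D u -> A u + 'i *: Pi (A u) = u.
  move=> Du; have DPu := PiD Du.
  rewrite /A (linear_onZ sD _ PiL); last first.
    by apply: (subspaceB sD) => //; exact: (subspaceZ sD).
  rewrite (linear_onB PiL) ?(linear_onZ sD _ PiL) ?PiK//; last exact: (subspaceZ sD).
  rewrite scalerA ['i * _]mulrC -scalerA -scalerDr scalerBr scalerA -expr2 sqr_i.
  rewrite scaleN1r opprK addrA subrK.
  have -> : u + u = (2 : C) *: u by rewrite scaler_nat mulr2n.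
  rewrite scalerA.
  by rewrite mulVf// scale1r.
have [w hw] := Kr_rank.
pose F u := A (Pi (Kr u)).
have FD u : D u -> D (F u) by move=> Du; apply: AD; apply: PiD; exact: KrD.
have FL : linear_on D F.
  move=> a u v Du Dv; rewrite /F KrL// PiL ?AL//; first [exact: PiD (KrD _)|exact: KrD].
have split u : D u -> Lr u = (u + F u) + 'i *: Pi (u + F u).
  move=> Du; have DF := FD _ Du; have DK := KrD Du.
  have DiP : D ('i *: u) by exact: (subspaceZ sD).
  rewrite (linear_onD PiL)// scalerDr addrACA AK; last exact: PiD.
  by rewrite /Lr (linear_onD PiL)// (linear_onZ sD _ PiL)// addrA.
have [||u Du e] := @finite_rank_surjective _ _ _ sD F m.+1 FD FL _ _ (A y) (AD _ Dy).
- move=> v Dv; have /choice[c hc] : forall i, exists c : 'I_m -> C, Kr (v i) = \sum_k c k *: w k.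
    by move=> i; exact: hw.
  pose a : 'M[C]_(m.+1, m) := \matrix_(i, k) c i k.
  have : kermx a != 0.
    by rewrite -mxrank_eq0 mxrank_ker subn_eq0 -ltnNge ltnS rank_leq_col.
  case/rowV0Pn => b /sub_kermxP ba b0; exists b => //.
  rewrite -(linear_on_sum sD (fun i => b ord0 i) FL)// /F.
  rewrite (linear_on_sum sD (fun i => b ord0 i) KrL)//.
  rewrite [\sum_i _](_ : _ = 0) ?(linear_on0 sD PiL) ?(linear_on0 sD AL)//.
  under eq_bigr do rewrite hc scaler_sumr.
  rewrite exchange_big big1//= => k _; under eq_bigr do rewrite scalerA.
  rewrite -scaler_suml; have /rowP/(_ k) := ba; rewrite !mxE => e.
  rewrite (_ : \sum_(i < m.+1) _ = 0) ?scale0r// -[RHS]e.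
  by apply: eq_bigr => i _; rewrite mxE.
- by move=> u Du e; apply: Lr_inj => //; rewrite split// e (linear_on0 sD PiL) scaler0 addr0.
exists u => //; by rewrite split// e AK.
Qed.

Variable f : V.
Hypothesis fD : D f.
Variables (p0 pn : V) (n : nat).
Hypothesis p0D : D p0.
Variable inv : V -> V.
Hypothesis invP : forall y, D y -> D (inv y) /\ Lr (inv y) = y.
Let M u := inv (L u).
Hypothesis pnK : exists c : 'I_n -> C,
  pn = p0 + \sum_k c k *: iter k M (inv f - M p0).
Hypothesis pn_min : forall c : 'I_n -> C,
  sn (inv f - M pn) <= sn (inv f - M (p0 + \sum_k c k *: iter k M (inv f - M p0))).
(* [s j] is the approximation number of index [j + 1] *)
Variable s : nat -> R.
Hypothesis s_ge0 : forall j, 0 <= s j.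
Hypothesis sP : forall j e, 0 < e -> exists F : V -> V, [/\ linear_on D F,
  exists k (w : 'I_k -> V), (k <= j)%N /\
    forall u, D u -> exists c : 'I_k -> C, F u = \sum_i c i *: w i
  & forall u, D u -> sn (dS u - F u) <= (s j + e) * sn u].

Let invD y : D y -> D (inv y). Proof. by case/invP. Qed.
Let invK y : D y -> Lr (inv y) = y. Proof. by case/invP. Qed.

Let Lr_injB u v : D u -> D v -> Lr u = Lr v -> u = v.
Proof.
move=> Du Dv e; apply/eqP; rewrite -subr_eq0; apply/eqP; apply: Lr_inj.
  exact: (subspaceB sD).
by rewrite (linear_onB LrL)// e subrr.
Qed.

Let invL : linear_on D inv.
Proof.
move=> a u v Du Dv; apply: Lr_injB.
- by apply: invD; exact: (subspace_comb sD).
- by apply: (subspace_comb sD); exact: invD.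
- by rewrite LrL ?invK//; [exact: (subspace_comb sD)|exact: invD|exact: invD].
Qed.

Let MD u : D u -> D (M u). Proof. by move=> Du; apply: invD; exact: LD. Qed.
Let ML : linear_on D M.
Proof. by move=> a u v Du Dv; rewrite /M LL// invL//; exact: LD. Qed.

(** With [M = Lr^-1 L], the differences of [M] and of its inverse to the identity
    are [M - Id = Lr^-1 Pi dS] and [M^-1 - Id = - L^-1 Pi dS]. As [Pi] is an
    isometry, on the kernel of a map [F] that approximates [dS] to within [s j]
    they contract by [s j / (g - s1)] and [s j / g], so that [M - Id] and [M^-1]
    have the rates [s j / (g - s1)] and [1 + s j / g]. The residuals of the
    preconditioned equation are turned into those of the original one by [Lr],
    which expands by [2 + s1] at most and by [g - s1] at least. *)
Lemma preconditioned_residual :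
  sn (f - L pn) <= ((2 + s1) / (g - s1)) *
    (\prod_(j < n) (s j / g * (1 + s j / g))) * (1 - s1 / g) ^- n * sn (f - L p0).
Proof.
have gs : 0 < g - s1 by rewrite subr_gt0.
have g0 : 0 < g by exact: le_lt_trans s1g.
pose r := inv f - M p0.
have Dr : D r by apply: (subspaceB sD); [exact: invD|exact: MD].
have Minj u : D u -> M u = 0 -> u = 0.
  move=> Du Mu; have Lu : L u = 0.
    by rewrite -(invK (LD Du)) -/(M u) Mu (linear_on0 sD LrL).
  apply: definite => //; apply/eqP; rewrite eq_le sn_ge0 andbT.
  by have := g_le Du; rewrite Lu (sn0 sip) pmulr_rle0.
have Lrr q : D q -> Lr (inv f - M q) = f - L q.
  move=> Dq; rewrite (linear_onB LrL) ?invK//; last 2 first.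
  - exact: invD.
  - exact: MD.
  exact: LD.
have Lr_le u : D u -> sn (Lr u) <= (2 + s1) * sn u.
  move=> Du; have -> : Lr u = L u - Pi (dS u) by rewrite L_split// addrK.
  apply: le_trans (snB sip (LD Du) (PiD (dSD Du))) _.
  rewrite Pi_iso; last exact: dSD.
  have := snD sip Du (PiD (SD Du)); rewrite Pi_iso; last exact: SD.
  by have := S_contr Du; have := dS_le Du; rewrite mulrDl /L; lra.
have Dkry (c : 'I_n -> C) : D (\sum_k c k *: iter k M r).
  apply: (subspace_sum sD) => i _; apply: (subspaceZ sD).
  by elim: (nat_of_ord i) => //= k; exact: MD.
have Dpn : D pn by have [c ->] := pnK; apply: (subspaceD sD) => //; exact: Dkry.
have bound e : 0 < e -> sn (inv f - M pn) <=
    (\prod_(j < n) ((s j + e) / (g - s1) * (1 + (s j + e) / g))) * sn r.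
  move=> e0.
  have se j : 0 <= s j + e by rewrite addr_ge0// ltW.
  have [|||d hd] := @minimal_residual_bound R V D ip sip M definite MD ML Minj n r
     (fun j => (s j + e) / (g - s1)) (fun j => 1 + (s j + e) / g) Dr.
  - by move=> j; rewrite divr_ge0// ltW.
  - by move=> j; rewrite addr_ge0 ?divr_ge0// ltW.
  - move=> j jn; have [F [FL Frank hF]] := sP j e0; exists F; split=> //.
      move=> u Du Fu; have := hF u Du; rewrite Fu subr0 => h.
      rewrite mulrAC ler_pdivlMr// mulrC; apply: le_trans h.
      rewrite -(Pi_iso (dSD Du)).
      have -> : Pi (dS u) = Lr (M u - u).
        rewrite (linear_onB LrL)//; last exact: MD.
        by rewrite (invK (LD Du)) L_split// addrAC subrr add0r.
      by apply: Lr_ge; apply: (subspaceB sD) => //; exact: MD.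
    move=> u Du Fu; have DMu := MD Du; have := hF _ DMu; rewrite Fu subr0 => h.
    rewrite mulrDl mul1r; apply: le_trans (sn_le_dist sip Du DMu) _.
    rewrite addrC lerD2l mulrAC ler_pdivlMr// mulrC; apply: le_trans h.
    have DB : D (u - M u) by exact: (subspaceB sD).
    apply: le_trans (g_le DB) _.
    have -> : L (u - M u) = - Pi (dS (M u)).
      rewrite (linear_onB LL)// (L_split DMu) invK; last exact: LD.
      by rewrite opprD addrA subrr sub0r.
    rewrite (snN sip) ?Pi_iso//; [exact: dSD|by apply: PiD; exact: dSD].
  apply: le_trans hd; have := pn_min d.
  have := Dkry d; rewrite -/r; set z := \sum_k _ => Dz.
  by rewrite (linear_onD ML p0D Dz) opprD addrA.
have lim : sn (inv f - M pn) <=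
    \prod_(j < n) (s j / (g - s1) * (1 + s j / g)) * sn r.
  have [r0|r0] := eqVneq (sn r) 0.
    by have := bound 1 ltr01; rewrite r0 !mulr0.
  have rp : 0 < sn r by rewrite lt_neqAle eq_sym r0 sn_ge0.
  rewrite -ler_pdivrMr//.
  have := @prod_limit R n (fun j e => (s j + e) / (g - s1) * (1 + (s j + e) / g))
    (sn (inv f - M pn) / sn r).
  under eq_bigr do rewrite addr0; apply.
  - move=> j; have c : (fun e : R => s j + e) @ (0 : R) --> s j + 0.
      by apply: cvgD; [exact: cvg_cst|exact: cvg_id].
    apply: cvgM; first by apply: cvgM => //; exact: cvg_cst.
    apply: cvgD; [exact: cvg_cst|apply: cvgM => //; exact: cvg_cst].
  - by move=> e e0; rewrite ler_pdivrMr//; exact: bound.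
rewrite -(Lrr _ Dpn); apply: le_trans (Lr_le _ _) _.
  by apply: (subspaceB sD); [exact: invD|exact: MD].
have rr : sn r <= sn (f - L p0) / (g - s1).
  by rewrite ler_pdivlMr// mulrC -(Lrr _ p0D); exact: Lr_ge.
rewrite -(mulrA ((2 + s1) / (g - s1))).
have -> : (\prod_(j < n) (s j / g * (1 + s j / g))) * (1 - s1 / g) ^- n =
    \prod_(j < n) (s j / (g - s1) * (1 + s j / g)).
  rewrite -exprVn -[X in _ * _ ^+ X]card_ord -prodr_const -big_split /=.
  apply: eq_bigr => j _; field; by rewrite !gt_eqF.
set p := \prod_(j < n) _ in lim *.
have p_ge0 : 0 <= p.
  by apply: prodr_ge0 => j _; rewrite mulr_ge0 ?addr_ge0 ?divr_ge0// ltW.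
apply: (@le_trans _ _ ((2 + s1) * (p * (sn (f - L p0) / (g - s1))))).
  rewrite ler_wpM2l ?addr_ge0//; apply: le_trans lim _; exact: ler_wpM2l.
rewrite le_eqVlt; apply/orP; left; apply/eqP; field; by rewrite gt_eqF.
Qed.

End preconditioned_residual.

(** * Measurability of open and closed sets *)
Section outer_measures.
Context {R : realType}.
Local Open Scope ereal_scope.

(** Cutting each set of a cover along [U] and [W] does not raise its total gauge,
    so a cover of the union yields covers of both parts at no extra cost. *)
Lemma gauge_split (T : pointedType) (g : set (allsets T) -> \bar R) (U W : set T) :
  (forall B, 0 <= g B) ->
  (forall B : set T, g (B `&` U) + g (B `&` W) <= g B) ->
  mu_ext g U + mu_ext g W <= mu_ext g (U `|` W).
Proof.
move=> g0 hg; apply: le_ereal_inf_tmp => _ [F [mF cF] <-].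
apply: (@le_trans _ _ (\sum_(0 <= k <oo) (g (F k `&` U) + g (F k `&` W)))); last first.
  apply: lee_nneseries => // k _ _; exact: adde_ge0.
rewrite nneseriesD//; apply: leeD.
- apply: ereal_inf_lbound; exists (fun k => F k `&` U) => //; split=> // x Ux.
  by have [|k _ Fx] := cF x; [left|exists k].
- apply: ereal_inf_lbound; exists (fun k => F k `&` W) => //; split=> // x Wx.
  by have [|k _ Fx] := cF x; [right|exists k].
Qed.

Definition halfspace m (i : 'I_m) (c : R) : set 'rV[R]_m := [set x | x ord0 i < c]%R.

Section halfspaces_generate.
Variables (m : nat) (mu : {outer_measure set 'rV[R]_m -> \bar R}).
Hypothesis mhalf : forall i c, mu.-cara.-measurable (halfspace i c).

Let rbox (q : 'rV[rat]_m * rat) : set 'rV[R]_m :=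
  [set y | forall i, (ratr (q.1 ord0 i) - ratr q.2 <= y ord0 i < ratr (q.1 ord0 i) + ratr q.2)%R].

Let measurable_rbox q : mu.-cara.-measurable (rbox q).
Proof.
have -> : rbox q = \bigcap_(i in [set: 'I_m])
    (halfspace i (ratr (q.1 ord0 i) + ratr q.2) `\` halfspace i (ratr (q.1 ord0 i) - ratr q.2)).
  apply/seteqP; split=> [y hy i _|y hy i].
    by have /andP[h1 h2] := hy i; split => //; apply/negP; rewrite -leNgt.
  by have [//|h1 /negP] := hy i; rewrite -leNgt => h2; apply/andP.
apply: fin_bigcap_measurable => // i _; apply: measurableD; exact: mhalf.
Qed.

(** An open set is a countable union of boxes with rational center and radius, and
    a box is cut out by halfspaces. *)
Lemma open_caratheodory (U : set 'rV[R]_m) : open U -> mu.-cara.-measurable U.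
Proof.
move=> oU.
have -> : U = \bigcup_q (if `[< rbox q `<=` U >] then rbox q else set0).
  apply/seteqP; split=> [x Ux|x [q _]]; last first.
    by case: asboolP => // sub; exact: sub.
  have /nbhs_ballP[e /= e0 he] : nbhs x U by exact: open_nbhs_nbhs.
  have [r] := @rat_in_itvoo R 0 (e / 2) (divr_gt0 e0 (ltr0Sn R 1)).
  rewrite in_itv /= => /andP[r0 re].
  have /choice[q hq] : forall i : 'I_m, exists q : rat, (ratr q \in `]x ord0 i - ratr r, x ord0 i + ratr r[)%R.
    by move=> i; apply: rat_in_itvoo; rewrite ltrD2l gtrN.
  exists (\row_i q i, r) => //.
  have sub : rbox (\row_i q i, r) `<=` U.
    move=> y hy; apply: he; split=> // i j; rewrite !ord1 => {i}.
    have := hy j; have := hq j; rewrite in_itv /= mxE => /andP[h1 h2] /andP[h3 h4].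
    by rewrite /ball /= ltr_norml; apply/andP; split; lra.
  case: asboolP => // _ i; rewrite mxE /=.
  have := hq i; rewrite in_itv /= => /andP[h1 h2].
  by apply/andP; split; lra.
apply: countable_bigcupT_measurable; first exact: countableP.
by move=> q; case: ifP => _; [exact: measurable_rbox|exact: measurable0].
Qed.

Lemma closed_caratheodory (F : set 'rV[R]_m) : closed F -> mu.-cara.-measurable F.
Proof.
by move=> cF; rewrite -[F]setCK; apply: measurableC; apply: open_caratheodory; rewrite openC.
Qed.

End halfspaces_generate.

Lemma box_gauge_le m (A B : set 'rV[R]_m) : A `<=` B -> box_gauge A <= box_gauge B.
Proof.
move=> AB; rewrite {1}/box_gauge; case: asboolP => A0; first exact: box_gauge_ge0.
rewrite /box_gauge; case: asboolP => B0.
  by exfalso; apply: A0; apply/seteqP; split=> // x /AB; rewrite B0.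
by apply: le_ereal_inf => _ [c hc <-]; exists c => // x /AB; exact: hc.
Qed.

(** A hyperplane cuts a box into two boxes whose volumes add up to its volume. *)
Lemma box_gauge_split m i c (B : set 'rV[R]_m) :
  box_gauge (B `&` halfspace i c) + box_gauge (B `&` ~` halfspace i c) <= box_gauge B.
Proof.
have [B1|/set0P[x [Bx xc]]] := eqVneq (B `&` halfspace i c) set0.
  by rewrite B1 box_gauge0 add0e box_gauge_le// => x [].
have [B2|/set0P[y [By yc]]] := eqVneq (B `&` ~` halfspace i c) set0.
  by rewrite B2 box_gauge0 adde0 box_gauge_le// => ? [].
have {}yc : (c <= y ord0 i)%R by rewrite leNgt; apply/negP.
rewrite {3}/box_gauge; case: asboolP => B0; first by rewrite B0 in Bx.
apply: le_ereal_inf_tmp => _ [b hb <-].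
pose b1 : 'rV[R]_m * 'rV[R]_m := (b.1, \row_j (if j == i then c else b.2 ord0 j)%R).
pose b2 : 'rV[R]_m * 'rV[R]_m := (\row_j (if j == i then c else b.1 ord0 j)%R, b.2).
have -> : (\prod_j (b.2 ord0 j - b.1 ord0 j))%R%:E =
    (\prod_j (b1.2 ord0 j - b1.1 ord0 j))%R%:E + (\prod_j (b2.2 ord0 j - b2.1 ord0 j))%R%:E.
  rewrite -EFinD; congr (_%:E).
  rewrite (bigD1 i)//= [X in (_ = X + _)%R](bigD1 i)//= [X in (_ = _ + X)%R](bigD1 i)//=.
  rewrite !mxE eqxx.
  set p := (\prod_(_ | _) _)%R; have -> : (\prod_(j | j != i) ((\row_j0 (if j0 == i then c else b.2 ord0 j0)) ord0 j - b.1 ord0 j) = p)%R.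
    by apply: eq_bigr => j /negbTE ji; rewrite mxE ji.
  have -> : (\prod_(j | j != i) (b.2 ord0 j - (\row_j0 (if j0 == i then c else b.1 ord0 j0)) ord0 j) = p)%R.
    by apply: eq_bigr => j /negbTE ji; rewrite mxE ji.
  ring.
apply: leeD.
- rewrite /box_gauge; case: asboolP => e.
    by exfalso; have : (B `&` halfspace i c) x by []; rewrite e.
  apply: ereal_inf_lbound; exists b1 => // z [Bz zc] j; rewrite /b1 /= mxE.
  have /andP[z1 z2] := hb z Bz j; rewrite z1 /=; case: eqP => [->|//].
  exact: ltW.
- rewrite /box_gauge; case: asboolP => e.
    exfalso; have : (B `&` ~` halfspace i c) y by split=> //; apply/negP; rewrite -leNgt.
    by rewrite e.
  apply: ereal_inf_lbound; exists b2 => // z [Bz zc] j; rewrite /b2 /= mxE.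
  have /andP[z1 z2] := hb z Bz j; rewrite z2 andbT; case: eqP => [->|//].
  by rewrite leNgt; apply/negP.
Qed.

Lemma open_leb m (U : set 'rV[R]_m) : open U ->
  measurable (U : set (caratheodory_type (@lebesgue_outer R m))).
Proof.
apply: (@open_caratheodory m (@lebesgue_outer R m)) => i c.
apply: le_caratheodory_measurable => X.
rewrite [in leRHS](_ : X = (X `&` halfspace i c) `|` (X `&` ~` halfspace i c)); last first.
  by rewrite -setIUr setUCr setIT.
apply: (@gauge_split _ (@box_gauge R m)) => B; first exact: box_gauge_ge0.
apply: le_trans (box_gauge_split i c B); apply: leeD; apply: box_gauge_le.
- by move=> z [Bz [_ zc]].
- by move=> z [Bz [_ zc]].
Qed.

Lemma closed_leb m (F : set 'rV[R]_m) : closed F ->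
  measurable (F : set (caratheodory_type (@lebesgue_outer R m))).
Proof.
move=> cF; rewrite -[F]setCK; apply: measurableC; apply: open_leb; by rewrite openC.
Qed.

(** An outer measure that is additive on sets separated in the [i]-th coordinate
    makes the halfspaces of that coordinate measurable: the layers at distance
    between [1/(j+2)] and [1/(j+1)] of the boundary have summable measures. *)
Section separated_additive.
Variables (m : nat) (mu : {outer_measure set 'rV[R]_m -> \bar R}) (i : 'I_m).
Hypothesis sep : forall (U W : set 'rV[R]_m) (s : R), (0 < s)%R ->
  (forall x y, U x -> W y -> x ord0 i + s <= y ord0 i)%R -> mu U + mu W <= mu (U `|` W).

Lemma halfspace_separated c : mu.-cara.-measurable (halfspace i c).
Proof.
apply: le_caratheodory_measurable => X.
have [->|Xfin] := eqVneq (mu X) +oo; first by rewrite leey.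
pose t (x : 'rV[R]_m) : R := (c - x ord0 i)%R.
pose Rj j := X `&` [set x | (j.+2%:R^-1 < t x <= j.+1%:R^-1)%R].
pose An n := X `&` [set x | (n.+1%:R^-1 < t x)%R].
have inv_lt (a b : nat) : (a < b)%N -> (b.+1%:R^-1 < a.+1%:R^-1 :> R)%R.
  by move=> ab; rewrite ltf_pV2 ?posrE// ltr_nat.
have mu0 (A : set 'rV[R]_m) : 0 <= mu A by exact: outer_measure_ge0.
(* layers of the same parity are separated by the layers between them *)
have skip (e : bool) N : \sum_(0 <= j < N) mu (Rj (e + j.*2)%N) <=
    mu (\bigcup_(j in [set j | (j < N)%N]) Rj (e + j.*2)%N).
  elim: N => [|N IH]; first by rewrite big_geq.
  rewrite big_nat_recr//=; apply: le_trans (leeD2r _ IH) _.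
  have s0 : (0 < (e + N.*2)%N.+1%:R^-1 - (e + N.*2)%N.+2%:R^-1 :> R)%R.
    by rewrite subr_gt0 inv_lt.
  rewrite addeC; case: N IH s0 => [|N] IH s0.
    rewrite (_ : \bigcup_(_ in _) _ = set0) ?outer_measure0 ?adde0; last first.
      by apply/seteqP; split=> x // [].
    by apply: le_outer_measure => x hx; exists 0%N.
  have s1 : (0 < (e + N.*2)%N.+2%:R^-1 - (e + N.*2)%N.+3%:R^-1 :> R)%R.
    by rewrite subr_gt0 inv_lt.
  rewrite addeC; apply: le_trans (sep s1 _) _.
    move=> x y [j /= jN [_ /andP[h1 h2]]] [_ /andP[h3 h4]].
    rewrite doubleS !addnS in h4.
    have : ((e + N.*2)%N.+2%:R^-1 <= (e + j.*2)%N.+2%:R^-1 :> R)%R.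
      by rewrite lef_pV2 ?posrE// ler_nat !ltnS leq_add2l leq_double -ltnS.
    have aux (a b a' xx yy : R) : (a <= a' -> a' < c - xx -> c - yy <= b -> xx + (a - b) <= yy)%R by lra.
    by move=> h; exact: aux h h1 h4.
  apply: le_outer_measure => x [[j /= jN Rx]|Rx].
    by exists j => //=; exact: leqW.
  by exists N.+1 => /=.
have half (e : bool) N : \sum_(0 <= j < N) mu (Rj (e + j.*2)%N) <= mu X.
  by apply: le_trans (skip e N) _; apply: le_outer_measure => x [j _ []].
have sumR N : \sum_(0 <= j < N) mu (Rj j) <= mu X + mu X.
  apply: (@le_trans _ _ (\sum_(0 <= j < N.*2) mu (Rj j))).
    rewrite -addnn [leRHS](@big_cat_nat _ _ _ N)//=; last exact: leq_addr.
    by rewrite leeDl// sume_ge0.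
  have -> : \sum_(0 <= j < N.*2) mu (Rj j) =
      \sum_(0 <= j < N) mu (Rj (false + j.*2)%N) + \sum_(0 <= j < N) mu (Rj (true + j.*2)%N).
    elim: N => [|N IH]; first by rewrite !big_geq// adde0.
    by rewrite doubleS !big_nat_recr//= IH -addeA addeACA.
  by apply: leeD; exact: half.
have sumRoo : \sum_(0 <= j <oo) mu (Rj j) < +oo.
  apply: (@le_lt_trans _ _ (mu X + mu X)).
    apply: lime_le; first by apply: is_cvg_nneseries.
    by apply: nearW => N; exact: sumR.
  by rewrite lte_add_pinfty// ltey.
have tail := nneseries_tail_cvg sumRoo (fun k _ => mu0 (Rj k)).
have main N : mu (X `&` halfspace i c) + mu (X `&` ~` halfspace i c) <=
    mu X + \sum_(N <= j <oo) mu (Rj j).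
  have hA : mu (X `&` halfspace i c) <= mu (An N) + \sum_(N <= j <oo) mu (Rj j).
    apply: (@le_trans _ _ (mu (An N `|` \bigcup_j Rj (N + j)%N))).
      apply: le_outer_measure => x [Xx xc].
      have tx : (0 < t x)%R by rewrite subr_gt0.
      have [h|h] := ltP (N.+1%:R^-1)%R (t x); first by left.
      right; have ex : exists k, (k.+2%:R^-1 < t x)%R.
        exists (Num.truncn (t x)^-1); rewrite -[ltRHS]invrK ltf_pV2 ?posrE ?invr_gt0//.
        by apply: lt_trans (Num.Theory.truncnS_gt _) _; rewrite ltr_nat.
      pose k := ex_minn ex.
      have kx : (k.+2%:R^-1 < t x)%R by rewrite /k; case: ex_minnP.
      have xk : (t x <= k.+1%:R^-1)%R.
        rewrite /k; case: ex_minnP => -[|k'] _ kmin.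
          by rewrite invr1; apply: le_trans h _; rewrite invf_le1// ler1n.
        by rewrite leNgt; apply/negP => /kmin; rewrite ltnn.
      have Nk : (N <= k)%N.
        rewrite leqNgt; apply/negP => kN; move: kx; apply/negP; rewrite -leNgt.
        by apply: le_trans h _; rewrite lef_pV2 ?posrE// ler_nat ltnS.
      by exists (k - N)%N => //; rewrite subnKC//; split=> //; apply/andP.
    apply: le_trans (outer_measureU2 _ _ _) _; rewrite leeD2l//.
    apply: le_trans (outer_measure_sigma_subadditive _ _) _.
    rewrite -[leRHS]nneseries_addn// le_eqVlt; apply/orP; left; apply/eqP.
    by apply: eq_eseriesr => k _; rewrite addnC.
  have hs : mu (An N) + mu (X `&` ~` halfspace i c) <= mu X.
    apply: le_trans (@sep _ _ (N.+1%:R^-1)%R _ _) _.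
    - by rewrite invr_gt0.
    - move=> x y [_ hx] [_ /negP]; rewrite -leNgt => hy.
      by apply: le_trans hy; move: hx; rewrite /= /t ltrBrDr addrC => /ltW.
    - by apply: le_outer_measure => x [[]|[]].
  apply: le_trans (leeD2r _ hA) _.
  by rewrite addeAC leeD2r.
apply/lee_addgt0Pr => e e0.
have [N _ /(_ N (leqnn N)) h] := tail _ (@nbhs_open_ereal_lt R 0 (fun=> e) e0).
 apply: le_trans (main N) _.
by rewrite leeD2l// ltW.
Qed.
End separated_additive.

Lemma enorm_ge_coord m (x : 'rV[R]_m) (i : 'I_m) : (`|x ord0 i| <= enorm x)%R.
Proof.
rewrite /enorm -sqrtr_sqr; apply: ler_wsqrtr.
by rewrite (bigD1 i)//= lerDl sumr_ge0// => j _; exact: sqr_ge0.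
Qed.

Lemma diam_le m (A B : set 'rV[R]_m) : A `<=` B -> diam A <= diam B.
Proof.
move=> AB; apply: ge_ereal_sup => _ [x Ax [y Ay <-]].
by apply: ereal_sup_ubound; exists x; [exact: AB|exists y => //; exact: AB].
Qed.

Lemma diam_ge0 m (A : set 'rV[R]_m) : A !=set0 -> 0 <= diam A.
Proof.
move=> [x Ax]; apply: (@le_trans _ _ (enorm (x - x))%:E); first by rewrite lee_fin sqrtr_ge0.
by apply: ereal_sup_ubound; exists x => //; exists x.
Qed.

Lemma diam_gauge_le m k (dl : R) (A B : set 'rV[R]_m) : A `<=` B ->
  diam_gauge k dl A <= diam_gauge k dl B.
Proof.
move=> AB; rewrite {1}/diam_gauge; case: asboolP => [_|A0]; first exact: diam_gauge_ge0.
have /set0P nA : A != set0 by apply/eqP.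
have nB : B !=set0 by have [x /AB] := nA; exists x.
rewrite /diam_gauge asboolF; last by apply/eqP; exact/set0P.
case: (leP (diam B)) => [dB|_]; last by rewrite leey.
have dA := le_trans (diam_le AB) dB; rewrite dA.
have fin (D : set 'rV[R]_m) : D !=set0 -> diam D <= dl%:E -> diam D \is a fin_num.
  by move=> /diam_ge0 d0 d1; rewrite ge0_fin_numE// (le_lt_trans d1) ?ltry.
apply: lee_wpmul2l; first exact: outer_measure_ge0.
rewrite lee_fin lerXn2r ?nnegrE ?fine_ge0 ?diam_ge0//.
by apply: fine_le; rewrite ?fin ?diam_le.
Qed.

(** A set of diameter less than [s] cannot meet both parts, so every cover by such
    sets splits into covers of the parts; passing to smaller bounds on the
    diameters changes neither outer measure. *)
Lemma hausdorff_separated m k (i : 'I_m) (U W : set 'rV[R]_m) (s : R) : (0 < s)%R ->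
  (forall x y, U x -> W y -> x ord0 i + s <= y ord0 i)%R ->
  hausdorff_outer k U + hausdorff_outer k W <= hausdorff_outer k (U `|` W).
Proof.
move=> s0 sep; set T := hausdorff_outer k (U `|` W).
have T0 : 0 <= T by exact: outer_measure_ge0.
have [->|Tfin] := eqVneq T +oo; first by rewrite leey.
have fT : T \is a fin_num by rewrite ge0_fin_numE// ltey.
pose h (dl : R) (A : set 'rV[R]_m) := mu_ext (@diam_gauge R m k dl) A.
have h0 dl A : 0 <= h dl A by exact: (mu_ext_ge0 (@diam_gauge_ge0 R m k dl)).
have hmono d1 d2 A : (d1 <= d2)%R -> h d2 A <= h d1 A.
  move=> d12; apply: le_ereal_inf_tmp => _ [F cF <-].
  apply: (@le_trans _ _ (\sum_(0 <= j <oo) diam_gauge k d2 (F j))).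
    by apply: ereal_inf_lbound; exists F.
  apply: lee_nneseries => [j _ _|j _]; first exact: diam_gauge_ge0.
  rewrite /diam_gauge; case: asboolP => // _.
  case: (leP (diam (F j)) d1%:E) => [h1|_]; last by rewrite leey.
  by rewrite (le_trans h1)// lee_fin.
have hsplit dl : (dl < s)%R -> h dl U + h dl W <= h dl (U `|` W).
  move=> ds; apply: (@gauge_split _ (@diam_gauge R m k dl)) => B; first exact: diam_gauge_ge0.
  have [B1|/set0P[x [Bx Ux]]] := eqVneq (B `&` U) set0.
    by rewrite B1 diam_gauge0 add0e diam_gauge_le// => x [].
  have [B2|/set0P[y [By Wy]]] := eqVneq (B `&` W) set0.
    by rewrite B2 diam_gauge0 adde0 diam_gauge_le// => ? [].
  rewrite {3}/diam_gauge asboolF; last by move=> B0; rewrite B0 in Bx.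
  rewrite ifF ?leey//; apply/negbTE; rewrite -ltNge.
  apply: (@lt_le_trans _ _ s%:E); first by rewrite lte_fin.
  apply: (@le_trans _ _ (enorm (y - x))%:E); last first.
    by apply: ereal_sup_ubound; exists y => //; exists x.
  rewrite lee_fin; apply: le_trans (enorm_ge_coord (y - x) i).
  by apply: le_trans (ler_norm _); rewrite !mxE; have := sep _ _ Ux Wy; lra.
have both d1 d2 : (0 < d1)%R -> (0 < d2)%R -> h d1 U + h d2 W <= T.
  move=> d10 d20; pose dl := (Num.min (s / 2) (Num.min d1 d2))%R.
  have dl0 : (0 < dl)%R by rewrite !lt_min d10 d20 divr_gt0.
  have [e1 [e2 e3]] : (dl <= d1 /\ dl <= d2 /\ dl < s)%R.
    rewrite /dl !ge_min !lexx !orbT; split=> //; split=> //.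
    by rewrite gt_min ltr_pdivrMr// mulr_natr mulr2n ltrDl s0.
  apply: (@le_trans _ _ (h dl U + h dl W)); first by apply: leeD; exact: hmono.
  apply: le_trans (hsplit _ e3) _.
  by apply: ereal_sup_ubound; exists dl.
have finh dl A : h dl A <= T -> h dl A \is a fin_num.
  by move=> hT; rewrite ge0_fin_numE// (le_lt_trans hT)// ltey.
have hU d1 : (0 < d1)%R -> h d1 U \is a fin_num.
  move=> d10; apply: finh; apply: le_trans (both d1 d1 d10 d10).
  by rewrite leeDl.
have step d1 : (0 < d1)%R -> h d1 U + hausdorff_outer k W <= T.
  move=> d10; rewrite addeC -leeBrDr ?hU//; apply: ge_ereal_sup => _ [d2 d20 <-].
  by rewrite leeBrDr ?hU// addeC; exact: both.
have fW : hausdorff_outer k W \is a fin_num.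
  rewrite ge0_fin_numE ?outer_measure_ge0//; apply: (@le_lt_trans _ _ T); last by rewrite ltey.
  by apply: le_trans (step 1%R ltr01); rewrite leeDr.
rewrite -leeBrDr//; apply: ge_ereal_sup => _ [d1 d10 <-].
by rewrite leeBrDr//; exact: step.
Qed.

Lemma closed_surf d (F : set 'rV[R]_d.+1) : closed F ->
  measurable (F : set (caratheodory_type (@hausdorff_outer R d.+1 d))).
Proof.
apply: (@closed_caratheodory d.+1 (@hausdorff_outer R d.+1 d)) => i c.
by apply: halfspace_separated => U W s; exact: hausdorff_separated.
Qed.

End outer_measures.

(** * Translations and integrals of derivatives *)
Section lebesgue.
Context {R : realType} (m : nat).
Local Notation E := 'rV[R]_m.
Local Notation T := (caratheodory_type (@lebesgue_outer R m)).
Local Notation leb := (@leb R m).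

Lemma continuous_measurable_leb (D : set T) (f : E -> R) : continuous f ->
  measurable_fun D (f : T -> R).
Proof.
move=> cf; suff mT : measurable_fun setT (f : T -> R) by exact: measurable_funTS.
apply: (measurability _ (RGenOpens.measurableE R)) => _ [_ [a [b ->] <-]].
rewrite setTI; apply: open_leb.
by apply: open_comp; [move=> x _; exact: cf|exact: interval_open].
Qed.

Definition shift_set (v : E) (A : set E) : set E := [set x | A (x + v)].

Lemma box_gauge_shift v (A : set E) : (box_gauge (shift_set v A) <= box_gauge A)%E.
Proof.
rewrite {1}/box_gauge; case: asboolP => A0; first exact: box_gauge_ge0.
rewrite /box_gauge; case: asboolP => A0'.
  by exfalso; apply: A0; apply/seteqP; split=> x //; rewrite /shift_set A0'.
apply: le_ereal_inf_tmp => _ [c hc <-].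
apply: ereal_inf_lbound; exists (c.1 - v, c.2 - v).
  move=> x Ax i; have := hc _ Ax i; rewrite !mxE => /andP[h1 h2].
  by apply/andP; split; lra.
by congr (_%:E); apply: eq_bigr => i _; rewrite /= !mxE; ring.
Qed.

Lemma lebesgue_outer_shift_le v (A : set E) :
  (lebesgue_outer (shift_set v A) <= lebesgue_outer A)%E.
Proof.
apply: le_ereal_inf_tmp => _ [F [mF cF] <-].
apply: (@le_trans _ _ (\sum_(0 <= k <oo) box_gauge (shift_set v (F k)))%E).
  apply: ereal_inf_lbound; exists (fun k => shift_set v (F k)) => //; split=> // x Ax.
  by have [k _ Fx] := cF _ Ax; exists k.
by apply: lee_nneseries => [k _ _|k _]; [exact: box_gauge_ge0|exact: box_gauge_shift].
Qed.

Lemma shift_setK v A : shift_set (- v) (shift_set v A) = A.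
Proof. by apply/funext => x; rewrite /shift_set /= subrK. Qed.

Lemma lebesgue_outer_shift v (A : set E) : lebesgue_outer (shift_set v A) = lebesgue_outer A.
Proof.
apply/eqP; rewrite eq_le lebesgue_outer_shift_le /=.
by rewrite -{1}(shift_setK v A) lebesgue_outer_shift_le.
Qed.

Lemma measurable_shift v (A : set T) : measurable A -> measurable (shift_set v A : set T).
Proof.
move=> mA; apply: le_caratheodory_measurable => X /=.
have key : lebesgue_outer (shift_set (- v) X) = (lebesgue_outer (shift_set (- v) X `&` A) +
   lebesgue_outer (shift_set (- v) X `&` ~` A))%E := mA _.
rewrite -(lebesgue_outer_shift (- v) X) key.
have -> : shift_set (- v) X `&` A = shift_set (- v) (X `&` shift_set v A).
  by apply/seteqP; split=> x; rewrite /shift_set /= subrK.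
have -> : shift_set (- v) X `&` ~` A = shift_set (- v) (X `&` ~` shift_set v A).
  by apply/seteqP; split=> x; rewrite /shift_set /= subrK.
by rewrite !lebesgue_outer_shift.
Qed.

Lemma measurable_fun_shift (v : E) : measurable_fun setT ((fun x => x + v) : T -> T).
Proof. by move=> _ Y mY; rewrite setTI; exact: measurable_shift. Qed.

Lemma integral_shift (v : E) (f : T -> \bar R) :
  measurable_fun setT f -> leb.-integrable setT (fun x : T => f ((x : E) + v)) ->
  (\int[leb]_x f ((x : E) + v)%R = \int[leb]_x f x)%E.
Proof.
move=> mf intf.
transitivity (\int[pushforward leb ((fun x : E => x + v)%R : T -> T)]_y f y)%E.
  symmetry; exact: (@integral_pushforward _ _ T T R _ (measurable_fun_shift v) leb setT f mf intf measurableT).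
congr integral; apply/funext => A; exact: (lebesgue_outer_shift v A).
Qed.

Definition cube (B : R) : set E := [set x | forall i, `|x ord0 i| <= B].

Lemma cube_compact B : compact (cube B).
Proof.
have -> : cube B = [set v | forall i, `[- B, B]%classic (v ord0 i)].
  by apply/seteqP; split=> x h i; have := h i; rewrite /= in_itv /= ler_norml.
by apply: (@rV_compact _ _ (fun=> `[- B, B]%classic)) => i; exact: segment_compact.
Qed.

Lemma cube_closed B : closed (cube B).
Proof. apply: compact_closed; [exact: norm_hausdorff|exact: cube_compact]. Qed.

Lemma leb_cube_fin B : (leb (cube B) < +oo)%E.
Proof.
apply: (@le_lt_trans _ _ (box_gauge (cube B))).
  pose F (k : nat) : set E := if k == 0%N then cube B else set0.
  apply: (@le_trans _ _ (\sum_(0 <= k <oo) box_gauge (F k))%E).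
    apply: ereal_inf_lbound; exists F => //.
    by split=> // x hx; exists 0%N.
  rewrite nneseries_recl// => [|k _]; last exact: box_gauge_ge0.
  by rewrite eseries0 ?adde0// => -[//|k] _ _; exact: box_gauge0.
rewrite /box_gauge; case: asboolP => _; first by rewrite ltry.
apply: (@le_lt_trans _ _ (\prod_(i < m) (B - - B))%:E); last by rewrite ltry.
apply: ereal_inf_lbound; exists (const_mx (- B), const_mx B).
  by move=> x hx i; rewrite !mxE -ler_norml.
by congr (_%:E); apply: eq_bigr => i _; rewrite !mxE.
Qed.

Lemma cube_continuous_bounded (f : E -> R) B : continuous f ->
  exists2 M, 0 <= M & forall x, cube B x -> `|f x| <= M.
Proof.
move=> cf.
have : bounded_set (f @` cube B).
  apply: compact_bounded; apply: continuous_compact; last exact: cube_compact.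
  exact: continuous_subspaceT.
case=> M [_ hM]; exists (Num.max 0 (M + 1)); first by rewrite le_max lexx.
move=> x Bx; apply: (hM (Num.max 0 (M + 1))); last by exists x.
by rewrite lt_max ltrDl ltr01 orbT.
Qed.

Lemma integrable_cube_supported (f : E -> R) B M : continuous f ->
  (forall x, ~ cube B x -> f x = 0) -> (forall x, `|f x| <= M) ->
  leb.-integrable setT (EFin \o (f : T -> R)).
Proof.
move=> cf f0 fM.
have mB : measurable (cube B : set T) by apply: closed_leb; exact: cube_closed.
have int : leb.-integrable (cube B : set T) (EFin \o (f : T -> R)).
  apply: measurable_bounded_integrable => //; first exact: leb_cube_fin.
    exact: continuous_measurable_leb.
  exists M; split; first by rewrite num_real.
  by move=> y My x _; apply: le_trans (fM x) (ltW My).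
rewrite (_ : EFin \o (f : T -> R) = (EFin \o (f : T -> R)) \_ (cube B : set T)).
  by apply/(integrable_mkcond _ mB).
apply/funext => x; rewrite patchE; case: ifPn => // /negP xB /=.
by rewrite f0// => ?; apply: xB; rewrite inE.
Qed.

(** The integral of a partial derivative is the limit of those of difference
    quotients, which vanish by translation invariance. *)
Lemma integral_partial0 (h : E -> R) (i : 'I_m) B : continuous h ->
  (forall x, derivable h x (delta_mx ord0 i)) ->
  continuous (fun x => 'D_(delta_mx ord0 i) h x) ->
  (forall x, ~ cube B x -> h x = 0) ->
  leb.-integrable setT (EFin \o ((fun x => 'D_(delta_mx ord0 i) h x) : T -> R)) /\
  (\int[leb]_x ('D_(delta_mx ord0 i) h x)%:E = 0)%E.
Proof.
move=> ch dh cdh h0; set e : E := delta_mx ord0 i; set dhx := fun x => 'D_e h x.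
have dh0 x : ~ cube B x -> dhx x = 0.
  move=> Bx; rewrite /dhx (@near_eq_derive _ _ _ _ (cst 0)) ?derive_cst//.
  have : nbhs x (~` cube B) by apply: open_nbhs_nbhs; split => //; apply: closed_openC; exact: cube_closed.
  by apply: filterS => y; exact: h0.
have [M M0 hM] := cube_continuous_bounded B cdh.
have dhM x : `|dhx x| <= M.
  by have [/hM//|/dh0 ->] := pselect (cube B x); rewrite normr0.
have [Mh Mh0 hMh] := cube_continuous_bounded B ch.
have hMb x : `|h x| <= Mh.
  by have [/hMh//|/h0 ->] := pselect (cube B x); rewrite normr0.
have int_h := integrable_cube_supported ch h0 hMb.
pose t n : R := n.+1%:R^-1.
have t0 n : 0 < t n by rewrite invr_gt0.
(* the difference quotients, dominated by [M] on a cube by the mean value theorem *)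
pose g n x := (t n)^-1 * (h (x + t n *: e) - h x).
have shift_cont (v : E) : continuous (fun x : E => h (x + v)).
  move=> x; apply: (@continuous_comp E E R (fun x : E => x + v)); last exact: ch.
  by apply: continuousD => //; exact: cst_continuous.
have gM n x : `|g n x| <= M.
  have [||c _ hc] := @MVT R (fun s => h (x + s *: e)) (fun s => dhx (x + s *: e)) 0 (t n) (t0 n) _ _.
  - move=> s _.
    have quot : (fun k : R => k^-1 *: (((fun s => h (x + s *: e)) \o shift s) (k *: (1 : R)) - h (x + s *: e))) =
        (fun k : R => k^-1 *: ((h \o shift (x + s *: e)) (k *: e) - h (x + s *: e))).
      apply/funext => k /=; congr (_ *: (h _ - _)).
      by rewrite scalerDl addrCA [k *: (1 : R)]mulr1.
    apply: DeriveDef; first by rewrite /derivable quot; exact: dh.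
    by rewrite /dhx /derive quot.
  - apply: continuous_subspaceT => s; apply: continuous_comp; last exact: ch.
    apply: cvgD; first exact: cvg_cst.
    by apply: cvgZr_tmp => //; exact: cvg_id.
  rewrite /g; move: hc; rewrite scale0r addr0 subr0 => ->.
  by rewrite mulrCA mulVf ?gt_eqF// mulr1.
have gcont n : continuous (g n).
  move=> x; apply: (@continuousM R E (cst (t n)^-1)); first exact: cst_continuous.
  by apply: continuousB; [exact: shift_cont|exact: ch].
have g0 n x : ~ cube (B + 1) x -> g n x = 0.
  move=> Bx; rewrite /g.
  have tn1 : t n <= 1 by rewrite invf_le1// ler1n.
  rewrite !h0 ?subrr ?mulr0// => hx; apply: Bx => j.
    by apply: le_trans (hx j) _; rewrite lerDl.
  have := hx j; rewrite !mxE eqxx /= => hj.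
  have -> : x ord0 j = (x ord0 j + t n * (j == i)%:R) - t n * (j == i)%:R by rewrite addrK.
  apply: le_trans (ler_normB _ _) _; apply: lerD => //.
  case: (j == i); rewrite ?mulr0 ?mulr1 ?normr0 ?ler01// ger0_norm// ltW//.
have gint n : leb.-integrable setT (EFin \o (g n : T -> R)).
  exact: integrable_cube_supported (gcont n) (g0 n) (gM n).
have int_sh n : leb.-integrable setT (fun x : T => (h ((x : E) + t n *: e))%:E).
  apply: (@integrable_cube_supported (fun x => h (x + t n *: e)) (B + 1) Mh) => //.
  move=> x Bx; rewrite h0// => hx; apply: Bx => j.
  have tn1 : t n <= 1 by rewrite invf_le1// ler1n.
  have := hx j; rewrite !mxE eqxx /= => hj.
  have -> : x ord0 j = (x ord0 j + t n * (j == i)%:R) - t n * (j == i)%:R by rewrite addrK.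
  apply: le_trans (ler_normB _ _) _; apply: lerD => //.
  case: (j == i); rewrite ?mulr0 ?mulr1 ?normr0 ?ler01// ger0_norm// ltW//.
have gz n : (\int[leb]_x (g n x)%:E = 0)%E.
  rewrite /g; under eq_integral do rewrite EFinM EFinB.
  rewrite integralZl//; last exact: integrableB.
  rewrite integralB//.
  have -> : (\int[leb]_x (h ((x : E) + t n *: e))%:E = \int[leb]_x (h x)%:E)%E.
    apply: (integral_shift (v := t n *: e) (f := EFin \o (h : T -> R))); last exact: int_sh.
    by apply/measurable_EFinP; exact: continuous_measurable_leb.
  by rewrite subee ?mule0//; apply: integrable_fin_num.
have gcvg x : g ^~ x @ \oo --> dhx x.
  have /cvg_ex[l hl] := dh x.
  have e1 : dhx x = l by apply/cvg_lim.
  rewrite e1; have /cvgr_dnbhsP/(_ t) := hl.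
  have -> : (fun n => (t n)^-1 *: ((h \o shift x) (t n *: delta_mx ord0 i) - h x)) = g ^~ x.
    by apply/funext => n; rewrite /g; congr (_ * (h _ - _)); rewrite /= addrC.
  apply; split; first by move=> n; rewrite gt_eqF.
  exact: cvg_harmonic.
have mg n : measurable_fun setT (EFin \o (g n : T -> R)).
  by apply/measurable_EFinP; exact: continuous_measurable_leb.
have mB : measurable (cube (B + 1) : set T) by apply: closed_leb; exact: cube_closed.
have intM : leb.-integrable setT ((EFin \o (cst M : T -> R)) \_ (cube (B + 1) : set T)).
  apply/(integrable_mkcond _ mB); apply: measurable_bounded_integrable => //.
    exact: leb_cube_fin.
  exists M; split; first by rewrite num_real.
  by move=> y My z _ /=; rewrite ger0_norm// ltW.
have [|||||int_dh _ lim] := @dominated_convergence _ T R leb setT measurableT (fun n => EFin \o (g n : T -> R))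
  (EFin \o (dhx : T -> R)) ((EFin \o (cst M : T -> R)) \_ (cube (B + 1) : set T)).
- exact: mg.
- by apply/measurable_EFinP; exact: continuous_measurable_leb.
- by apply: aeW => x _; apply: cvg_EFin; [exact: nearW|exact: gcvg].
- exact: intM.
- apply: aeW => x n _; rewrite patchE; case: ifPn => [_|/negP xB]; rewrite lee_fin; first exact: gM.
  by rewrite g0 ?normr0// => ?; apply: xB; rewrite inE.
split=> //.
apply/esym; move: lim => /(cvg_lim _) <- //.
rewrite [X in lim (X @ _)](_ : _ = cst 0%E) ?lim_cst//.
by apply/funext => n; exact: gz.
Qed.

End lebesgue.

(** * Test functions *)
Section test_functions.
Context {R : realType} (d : nat).
Local Notation E := 'rV[R]_d.+1.
Local Notation T := (caratheodory_type (@lebesgue_outer R d.+1)).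
Local Notation leb := (@leb R d.+1).
Implicit Types (om : set E) (f g : E -> R).

Lemma test_continuous om f : test_function om f -> continuous f.
Proof. by move=> [sf _ _]; case: (sf [::]). Qed.

Lemma test_derivable om f i x : test_function om f -> derivable f x (delta_mx ord0 i).
Proof. by move=> [sf _ _]; case: (sf [::]). Qed.

Lemma test_partial_continuous om f i : test_function om f -> continuous (partial i f).
Proof. by move=> [sf _ _]; case: (sf [:: i]). Qed.

Lemma test_sub om om' f : om `<=` om' -> test_function om f -> test_function om' f.
Proof. by move=> sub [sf cf of_]; split=> // x /of_ /sub. Qed.

Lemma test_eq0 om f x : test_function om f -> ~ om x -> f x = 0.
Proof.
move=> [_ _ sub] x0; apply: contra_notP x0 => /eqP fx; apply: sub; exact: subset_closure.
Qed.

Lemma test_partial_eq0 om f x i : test_function om f -> ~ om x -> partial i f x = 0.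
Proof.
move=> [_ _ sub] x0; rewrite /partial (@near_eq_derive _ _ _ _ (cst 0)) ?derive_cst//.
have : nbhs x (~` closure [set x | f x != 0]).
  apply: open_nbhs_nbhs; split; last by move=> /sub.
  by apply: closed_openC; exact: closed_closure.
apply: filterS => y hy; apply: contra_notP hy => hf; apply: subset_closure; exact/eqP.
Qed.

Lemma test_cube om f : test_function om f -> exists B, test_function (cube B) f.
Proof.
move=> [sf cf _]; have : forall i : 'I_d.+1, exists M, 0 <= M /\
    forall x, closure [set x | f x != 0] x -> `|x ord0 i| <= M.
  move=> i; have : bounded_set ((fun x : E => x ord0 i) @` closure [set x | f x != 0]).
    apply: compact_bounded; apply: continuous_compact => //.
    by apply: continuous_subspaceT; exact: coord_continuous.
  case=> M [_ hM]; exists (Num.max 0 (M + 1)); rewrite le_max lexx; split=> // x hx.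
  apply: (hM (Num.max 0 (M + 1))); last by exists x.
  by rewrite lt_max ltrDl ltr01 orbT.
case/choice => M hM; exists (\sum_i M i); split=> // x hx i.
apply: le_trans (proj2 (hM i) x hx) _.
by rewrite (bigD1 i)//= lerDl sumr_ge0// => j _; case: (hM j).
Qed.

Lemma cube_integrable B g : continuous g -> (forall x, ~ cube B x -> g x = 0) ->
  leb.-integrable setT (EFin \o (g : T -> R)).
Proof.
move=> cg g0; have [M M0 hM] := cube_continuous_bounded B cg.
apply: (@integrable_cube_supported _ _ g B M) => // x.
by have [/hM//|/g0 ->] := pselect (cube B x); rewrite normr0.
Qed.

Lemma test_integration_by_parts om om' f g i : open om ->
  test_function om f -> test_function om' g ->
  \int[leb]_(x in (om : set T)) (f x * partial i g x) =
  - \int[leb]_(x in (om : set T)) (partial i f x * g x).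
Proof.
move=> oom tf tg; have mom : measurable (om : set T) by exact: open_leb.
have [B tfB] := test_cube tf.
have cf := test_continuous tf; have cg := test_continuous tg.
have cdf := test_partial_continuous (i := i) tf.
have cdg := test_partial_continuous (i := i) tg.
have c1 : continuous (fun x => f x * partial i g x).
  by move=> x; apply: (@continuousM R E) => //; [exact: cf|exact: cdg].
have c2 : continuous (fun x => partial i f x * g x).
  by move=> x; apply: (@continuousM R E) => //; [exact: cdf|exact: cg].
have int1 : leb.-integrable setT (EFin \o ((fun x => f x * partial i g x) : T -> R)).
  by apply: (@cube_integrable B) => // x Bx; rewrite (test_eq0 tfB)// mul0r.
have int2 : leb.-integrable setT (EFin \o ((fun x => partial i f x * g x) : T -> R)).
  by apply: (@cube_integrable B) => // x Bx; rewrite (test_partial_eq0 i tfB)// mul0r.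
have dfg x : 'D_(delta_mx ord0 i) (f * g) x = f x * partial i g x + partial i f x * g x.
  rewrite deriveM; [|exact: test_derivable tf|exact: test_derivable tg].
  by rewrite /partial /GRing.scale /= [g x * _]mulrC.
have ext (F : E -> R) : (forall x, ~ om x -> F x = 0) ->
    \int[leb]_(x in (om : set T)) F x = \int[leb]_(x in setT) F x.
  move=> F0; rewrite Rintegral_mkcond; congr Rintegral; apply/funext => x.
  by rewrite patchE; case: ifPn => // /negP xo; rewrite F0// => ?; apply: xo; rewrite inE.
rewrite !ext; last 2 first.
- by move=> x ox; rewrite (test_partial_eq0 i tf)// mul0r.
- by move=> x ox; rewrite (test_eq0 tf)// mul0r.
apply/eqP; rewrite -addr_eq0 -RintegralD//.
have [||||_] := @integral_partial0 R d.+1 (f * g) i B.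
- by move=> x; apply: (@continuousM R E); [exact: cf|exact: cg].
- by move=> x; apply: derivableM; [exact: test_derivable tf|exact: test_derivable tg].
- rewrite (_ : (fun x => _) = fun x => f x * partial i g x + partial i f x * g x).
    by move=> x; apply: (@continuousD R R E); [exact: c1|exact: c2].
  by apply/funext => x; exact: dfg.
- by move=> x Bx; rewrite /GRing.mul /= (test_eq0 tfB)// mul0r.
move=> h; apply/eqP; rewrite /Rintegral.
rewrite (_ : (fun x => _) = fun x : T => ('D_(delta_mx ord0 i) (f * g) (x : E))%:E) ?h//.
by apply/funext => x; rewrite dfg.
Qed.

End test_functions.

(** * Boundaries of Lipschitz sets *)
Section lipschitz_boundary.
Context {R : realType} (d : nat).
Local Notation E := 'rV[R]_d.+1.
Local Notation T := (caratheodory_type (@lebesgue_outer R d.+1)).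
Local Notation leb := (@leb R d.+1).

Lemma bd_closed (om : set E) : closed (bd om).
Proof.
rewrite /bd setDE; apply: closedI; first exact: closed_closure.
by rewrite closedC; exact: open_interior.
Qed.

Lemma enorm_lip m (x : 'rV[R]_m) : enorm x <= \sum_i `|x ord0 i|.
Proof.
rewrite -(@ler_pXn2r _ 2) ?nnegrE ?sqrtr_ge0 ?sumr_ge0// /enorm sqr_sqrtr; last first.
  by apply: sumr_ge0 => i _; exact: sqr_ge0.
elim: m x => [|m IH] x; first by rewrite !big_ord0 expr0n.
rewrite !big_ord_recl sqrrD real_normK ?num_real// -addrA lerD2l.
have := IH (\row_i x ord0 (lift ord0 i)).
under eq_bigr do rewrite mxE; under [in leRHS]eq_bigr do rewrite mxE.
move=> /le_trans; apply; rewrite lerDr mulrn_wge0// mulr_ge0// sumr_ge0//.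
Qed.

(** A bounded piece of a graph has infinitely many disjoint vertical translates in
    a bounded region, all of the same measure. *)
Lemma graph_null (N : set E) (Q : 'M[R]_d.+1) (g : 'rV[R]_d -> R) B :
  Q *m Q^T = 1%:M -> measurable (N : set T) -> N `<=` cube B ->
  (forall y, N y -> (y *m Q) ord0 ord0 = g (\row_i (y *m Q) ord0 (lift ord0 i))) ->
  leb N = 0%E.
Proof.
move=> QQ mN NB graph.
have QtQ : Q^T *m Q = 1%:M by apply: mulmx1C.
pose e : E := (delta_mx ord0 ord0 : E) *m Q^T.
have eQ : e *m Q = delta_mx ord0 ord0 by rewrite -mulmxA QtQ mulmx1.
pose t k : R := k.+1%:R^-1.
have t0 k : 0 < t k by rewrite invr_gt0.
pose F k := shift_set (- (t k *: e)) N.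
have mF k : measurable (F k : set T) by exact: measurable_shift.
have Fleb k : leb (F k) = leb N by exact: (lebesgue_outer_shift _ N).
have tF : trivIset setT F.
  apply/trivIsetP => i j _ _ ij; apply/seteqP; split=> // z [].
  rewrite /F /shift_set /= => Ni Nj; case/eqP: ij.
  have key k : ((z - t k *: e) *m Q) = z *m Q - t k *: delta_mx ord0 ord0.
    by rewrite mulmxBl -scalemxAl eQ.
  have same : \row_l ((z - t i *: e) *m Q) ord0 (lift ord0 l) = \row_l ((z - t j *: e) *m Q) ord0 (lift ord0 l).
    by rewrite !key; apply/rowP => l; rewrite mxE [RHS]mxE 2!mxE [in RHS]mxE [in RHS]mxE !mxE !mulr0.
  have := graph _ Ni; have := graph _ Nj; rewrite same => <-; rewrite !key !mxE !eqxx !mulr1.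
  move=> /addrI/oppr_inj /invr_inj /eqP; rewrite eqr_nat eqSS => /eqP //.
pose C := B + \sum_l `|e ord0 l|.
have FC k : F k `<=` cube C.
  move=> z Nz l; have := NB _ Nz l; do 3 rewrite [in leLHS]mxE; move=> h.
  have -> : z ord0 l = (z ord0 l - t k * e ord0 l) + t k * e ord0 l by rewrite subrK.
  apply: le_trans (ler_normD _ _) _; apply: lerD => //.
  rewrite normrM ger0_norm ?(ltW (t0 k))// (bigD1 l)//= -[leLHS]addr0 lerD ?sumr_ge0//.
  by rewrite ler_piMl// invf_le1// ler1n.
have sum_le : (\sum_(0 <= k <oo) leb (F k) <= leb (cube C))%E.
  have <- : leb (\bigcup_k F k) = (\sum_(0 <= k <oo) leb (F k))%E.
    rewrite measure_bigcup//; apply: eq_eseriesl => k; by rewrite in_setT.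
  apply: le_outer_measure => z [k _ Fz]; exact: FC Fz.
apply/eqP; rewrite eq_le measure_ge0 andbT leNgt; apply/negP => N0.
have Cfin := @leb_cube_fin R d.+1 C.
have Nfin : leb N \is a fin_num.
  rewrite ge0_fin_numE ?measure_ge0//; apply: le_lt_trans (@leb_cube_fin R d.+1 B).
  exact: le_outer_measure.
have Cf : leb (cube C) \is a fin_num by rewrite ge0_fin_numE ?measure_ge0.
set a := fine (leb N); set M := fine (leb (cube C)).
have a0 : 0 < a by apply: fine_gt0; rewrite N0 -ge0_fin_numE// ltW.
have bound k : k%:R * a <= M.
  rewrite -lee_fin /M fineK//; apply: le_trans sum_le.
  apply: le_trans (nneseries_lim_ge k _); last by move=> *; exact: measure_ge0.
  under eq_bigr do rewrite Fleb.
  by rewrite -(fineK Nfin) sumEFin sumr_const_nat subn0 mulr_natl.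
have := bound (Num.truncn (M / a)).+1; rewrite -ler_pdivlMr// leNgt.
by rewrite Num.Theory.truncnS_gt.
Qed.

Lemma coord_le_norm (x : E) i : `|x ord0 i| <= `|x|.
Proof.
have -> : `|x| = mx_norm x by [].
rewrite mx_normrE.
exact: (le_bigmax _ (fun ij : 'I_1 * 'I_d.+1 => `|x ij.1 ij.2|) (ord0, i)).
Qed.

Lemma bounded_cube (om : set E) : bounded_set om -> exists B, closure om `<=` cube B.
Proof.
case=> M [_ hM]; exists (M + 1).
rewrite [X in _ `<=` X](proj1 (closure_id _) (@cube_closed _ _ _)).
apply: closure_subset => x ox i; apply: le_trans (coord_le_norm x i) _.
by apply: (hM (M + 1)) => //; rewrite ltrDl.
Qed.

(** By compactness it is enough to see that the boundary is a piece of a graph near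
    each of its points. A boundary point cannot lie above the graph, where the
    points belong to the set, nor below, where a ball whose radius is a multiple
    of the gap, given by the Lipschitz constant, misses the set. *)
Lemma lipschitz_boundary_null (om : set E) : lipschitz_open om -> bounded_set om ->
  leb (bd om) = 0%E.
Proof.
move=> [oom lip] bom; have [B hB] := bounded_cube bom.
have bdB : bd om `<=` cube B by move=> x [/hB].
have bdc : compact (bd om).
  by apply: subclosed_compact (cube_compact (B := B)) bdB; exact: bd_closed.
have local x : bd om x -> exists2 U : set E, open U /\ U x & leb (bd om `&` U) = 0%E.
  move=> bx; have [r [Q [g [c [r0 QQ glip hom]]]]] := lip _ bx.
  pose e := r / (2 * d.+1%:R).
  have e0 : 0 < e by rewrite divr_gt0.
  have near y : ball x e y -> enorm (y - x) < r.
    move=> [_ hy]; apply: le_lt_trans (enorm_lip _) _.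
    apply: (@le_lt_trans _ _ (\sum_(i < d.+1) e)).
      apply: ler_sum => i _; have := hy ord0 i; rewrite /ball /= !mxE distrC; exact: ltW.
    rewrite sumr_const card_ord -mulr_natr /e invfM mulrA mulfVK ?pnatr_eq0//.
    by rewrite ltr_pdivrMr// mulr_natr mulr2n ltrDl.
  exists (interior (ball x e)).
    by split; [exact: open_interior|exact: nbhsx_ballx].
  apply: (@graph_null _ Q g B) => //.
  - apply: measurableI; first by apply: closed_leb; exact: bd_closed.
    by apply: open_leb; exact: open_interior.
  - by move=> y [/bdB].
  move=> y [[cly niy] yi]; have ynx := interior_subset yi.
  have noy : ~ om y by move=> oy; apply: niy; move/interior_id: oom => ->.
  have gey : (y *m Q) ord0 ord0 <= g (\row_i (y *m Q) ord0 (lift ord0 i)).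
    by rewrite leNgt; apply/negP => /(proj2 (hom y (near _ ynx))).
  apply/eqP; rewrite eq_le gey /= leNgt; apply/negP => lty.
  pose q := \sum_k \sum_l `|Q k l|.
  have q0 : 0 <= q by apply: sumr_ge0 => k _; apply: sumr_ge0.
  pose G := 1 + q + `|c| * (d%:R * q).
  have G0 : 0 < G by rewrite /G -addrA ltr_wpDr// addr_ge0// mulr_ge0// mulr_ge0.
  pose gap := g (\row_i (y *m Q) ord0 (lift ord0 i)) - (y *m Q) ord0 ord0.
  have gap0 : 0 < gap by rewrite subr_gt0.
  pose dl := gap / G.
  have dl0 : 0 < dl by rewrite divr_gt0.
  have [z [oz [zx zy]]] : exists z, om z /\ ball x e z /\ ball y dl z.
    have : nbhs y (ball x e `&` ball y dl).
      by apply: filterI => //; exact: nbhsx_ballx.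
    by move=> /cly [z [oz [zx zy]]]; exists z.
  have := proj1 (hom z (near _ zx)) oz.
  have coord l : `|(y *m Q) ord0 l - (z *m Q) ord0 l| <= dl * q.
    rewrite -[_ - _](_ : ((y - z) *m Q) ord0 l = _); last by rewrite mulmxBl !mxE.
    rewrite mxE; apply: le_trans (ler_norm_sum _ _ _) _.
    rewrite mulr_sumr; apply: ler_sum => k _; rewrite normrM; apply: ler_pM => //.
      have [_ /(_ ord0 k)] := zy; rewrite /ball /= !mxE; exact: ltW.
    by rewrite (bigD1 l)//= lerDl sumr_ge0.
  have hg : `|g (\row_i (y *m Q) ord0 (lift ord0 i)) - g (\row_i (z *m Q) ord0 (lift ord0 i))|
      <= `|c| * (d%:R * (dl * q)).
    apply: le_trans (glip _ _) _; apply: (@le_trans _ _ (`|c| * enorm (\row_i (y *m Q) ord0 (lift ord0 i) - \row_i (z *m Q) ord0 (lift ord0 i)))).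
      by rewrite ler_wpM2r ?sqrtr_ge0// ler_norm.
    rewrite ler_wpM2l//; apply: le_trans (enorm_lip _) _.
    apply: (@le_trans _ _ (\sum_(i < d) (dl * q))); last by rewrite sumr_const card_ord [leRHS]mulr_natl.
    by apply: ler_sum => i _; have := coord (lift ord0 i); rewrite ![in leLHS]mxE /= !mxE.
  have h0 := coord ord0; apply/negP; rewrite -leNgt.
  move: hg h0; rewrite !ler_norml => /andP[_ h1] /andP[h2 _].
  have : dl * (q + `|c| * (d%:R * q)) < gap.
    rewrite /dl mulrAC ltr_pdivrMr// ltr_pM2l// /G -addrA ltrDr//.
  rewrite /gap; nra.
have /choice[f hf] : forall x, exists U : set E, bd om x -> [/\ open U, U x & leb (bd om `&` U) = 0%E].
  move=> x; have [/local[U [oU Ux] U0]|nx] := pselect (bd om x); first by exists U.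
  by exists set0.
have [D' D'sub cov] : finite_subset_cover (bd om) f (bd om).
  move: bdc; rewrite compact_cover; apply; first by move=> x /hf[].
  by move=> x bx; exists x => //; case: (hf x bx).
apply/eqP; rewrite eq_le measure_ge0 andbT.
have null (s : seq E) : {subset s <= bd om} -> leb (bd om `&` \big[setU/set0]_(x <- s) f x) = 0%E.
  elim: s => [|x s IH] sub; first by rewrite big_nil setI0 measure0.
  rewrite big_cons setIUr; apply/eqP; rewrite eq_le measure_ge0 andbT.
  apply: le_trans (@outer_measureU2 _ _ (@lebesgue_outer R d.+1) _ _) _.
  have [_ _ h1] := hf x (set_mem (sub x (mem_head _ _))).
  have h2 : leb (bd om `&` \big[setU/set0]_(y <- s) f y) = 0%E.
    by apply: IH => y ys; apply: sub; rewrite inE ys orbT.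
  by rewrite [X in (X + _)%E]h1 [X in (_ + X)%E]h2 adde0.
rewrite -(null (finmap.enum_fset D')) => [|x /D'sub //].
apply: le_outer_measure => x bx; split=> //; have [y /= yD fy] := cov x bx.
by rewrite -bigcup_seq; exists y.
Qed.
End lipschitz_boundary.

(** * Square integrable complex functions *)
Section complex_integrals.
Context {R : realType} (dT : measure_display) (T : measurableType dT).
Variables (mu : {measure set T -> \bar R}) (D : set T).
Hypothesis mD : measurable D.
Local Notation C := R[i].
Implicit Types f g h : T -> C.

Definition cintegrable f : Prop :=
  mu.-integrable D (EFin \o (fun x => Re (f x))) /\
  mu.-integrable D (EFin \o (fun x => Im (f x))).

Lemma eq_cintegral f g : (forall x, D x -> f x = g x) ->
  cintegral mu D f = cintegral mu D g.
Proof.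
move=> fg; rewrite /cintegral; congr (_ +i* _); apply: eq_Rintegral => x; rewrite inE => Dx;
  by rewrite fg.
Qed.

Lemma cintegrable_eq f g : (forall x, D x -> f x = g x) -> cintegrable f -> cintegrable g.
Proof.
move=> fg [h1 h2]; split; [apply: eq_integrable h1|apply: eq_integrable h2] => // x;
  by rewrite inE => Dx /=; rewrite fg.
Qed.

Lemma cintegrableD f g : cintegrable f -> cintegrable g -> cintegrable (fun x => f x + g x).
Proof.
move=> [f1 f2] [g1 g2]; split.
- apply: eq_integrable (integrableD mD f1 g1) => // x _ /=; by rewrite cReD.
- apply: eq_integrable (integrableD mD f2 g2) => // x _ /=; by rewrite cImD.
Qed.

Lemma cintegralD f g : cintegrable f -> cintegrable g ->
  cintegral mu D (fun x => f x + g x) = cintegral mu D f + cintegral mu D g.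
Proof.
move=> [f1 f2] [g1 g2]; rewrite /cintegral; apply: complex_eqP; rewrite ?cReD ?cImD /=.
- by rewrite -RintegralD//; apply: eq_Rintegral => x _; rewrite cReD.
- by rewrite -RintegralD//; apply: eq_Rintegral => x _; rewrite cImD.
Qed.

Let intZ (a : R) (u : T -> R) : mu.-integrable D (EFin \o u) ->
  mu.-integrable D (EFin \o (fun x => a * u x)).
Proof.
by move=> iu; apply: eq_integrable (integrableZl mD a iu) => // x _ /=; rewrite EFinM.
Qed.

Let intD (u v : T -> R) : mu.-integrable D (EFin \o u) -> mu.-integrable D (EFin \o v) ->
  mu.-integrable D (EFin \o (fun x => u x + v x)).
Proof.
by move=> iu iv; apply: eq_integrable (integrableD mD iu iv) => // x _ /=; rewrite EFinD.
Qed.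

Lemma cintegrableZ (c : C) f : cintegrable f -> cintegrable (fun x => c * f x).
Proof.
move=> [f1 f2]; split.
- apply: eq_integrable (intD (intZ (Re c) f1) (intZ (- Im c) f2)) => // x _ /=.
  by rewrite cReM mulNr.
- apply: eq_integrable (intD (intZ (Re c) f2) (intZ (Im c) f1)) => // x _ /=.
  by rewrite cImM.
Qed.

Lemma cintegralZ (c : C) f : cintegrable f ->
  cintegral mu D (fun x => c * f x) = c * cintegral mu D f.
Proof.
move=> [f1 f2]; rewrite /cintegral; apply: complex_eqP; rewrite ?cReM ?cImM /=.
- rewrite -!RintegralZl// -RintegralB//; [|exact: intZ..].
  by apply: eq_Rintegral => x _; rewrite cReM.
- rewrite -!RintegralZl// -RintegralD//; [|exact: intZ..].
  by apply: eq_Rintegral => x _; rewrite cImM.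
Qed.

Lemma cintegral0 : cintegral mu D (fun=> 0) = 0.
Proof. by rewrite /cintegral; apply: complex_eqP; rewrite /= Rintegral_cst// mul0r. Qed.

Lemma cintegrable0 : cintegrable (fun=> 0).
Proof. by split; apply: eq_integrable (integrable0 mu D). Qed.

Lemma cintegrable_sum n (F : 'I_n -> T -> C) : (forall i, cintegrable (F i)) ->
  cintegrable (fun x => \sum_i F i x).
Proof.
elim: n F => [|n IH] F iF.
  by apply: cintegrable_eq cintegrable0 => x _; rewrite big_ord0.
apply: (@cintegrable_eq (fun x => F ord0 x + \sum_i F (lift ord0 i) x)).
  by move=> x _; rewrite big_ord_recl.
by apply: cintegrableD => //; apply: IH.
Qed.

Lemma cintegral_sum n (F : 'I_n -> T -> C) : (forall i, cintegrable (F i)) ->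
  cintegral mu D (fun x => \sum_i F i x) = \sum_i cintegral mu D (F i).
Proof.
elim: n F => [|n IH] F iF.
  rewrite [RHS]big_ord0 -[RHS]cintegral0; apply: eq_cintegral => x _; exact: big_ord0.
rewrite big_ord_recl -IH// -cintegralD//; last exact: cintegrable_sum.
by apply: eq_cintegral => x _; rewrite big_ord_recl.
Qed.

Lemma cintegral_conj f : cintegrable f ->
  cintegral mu D (fun x => conjc (f x)) = conjc (cintegral mu D f).
Proof.
move=> [f1 f2]; apply: complex_eqP; rewrite ?cReJ ?cImJ /=.
- by apply: eq_Rintegral => x _; rewrite cReJ.
- rewrite -mulN1r -RintegralZl//; apply: eq_Rintegral => x _; by rewrite cImJ mulN1r.
Qed.

Lemma measurable_normc_sqr f : measurable_fun D (fun x => Re (f x)) ->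
  measurable_fun D (fun x => Im (f x)) -> measurable_fun D (fun x => normc (f x) ^+ 2).
Proof.
move=> m1 m2; under eq_fun do rewrite normc_sqr.
apply: measurable_funD; exact: measurable_funX.
Qed.

Lemma L2_normsq_integrable f : L2 mu D f ->
  mu.-integrable D (EFin \o (fun x => normc (f x) ^+ 2)).
Proof.
move=> [m1 m2 fin]; apply/integrableP; split.
  by apply/measurable_EFinP; exact: measurable_normc_sqr.
apply: le_lt_trans fin; rewrite /L2normsq le_eqVlt; apply/orP; left; apply/eqP.
by apply: eq_integral => x _ /=; rewrite ger0_norm// sqr_ge0.
Qed.

Lemma dominated_integrable (u v : T -> R) : measurable_fun D u ->
  mu.-integrable D (EFin \o v) -> (forall x, D x -> `|u x| <= v x) ->
  mu.-integrable D (EFin \o u).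
Proof.
move=> mu' iv uv; apply: (le_integrable mD _ _ iv); first exact/measurable_EFinP.
move=> x Dx /=; rewrite lee_fin; apply: le_trans (uv _ Dx) _; exact: ler_norm.
Qed.

Lemma L2_dominated f (v : T -> R) : measurable_fun D (fun x => Re (f x)) ->
  measurable_fun D (fun x => Im (f x)) -> mu.-integrable D (EFin \o v) ->
  (forall x, D x -> normc (f x) ^+ 2 <= v x) -> L2 mu D f.
Proof.
move=> m1 m2 iv fv; split=> //.
have /integrableP[_] : mu.-integrable D (EFin \o (fun x => normc (f x) ^+ 2)).
  apply: dominated_integrable iv _ => [|x Dx]; first exact: measurable_normc_sqr.
  by rewrite ger0_norm ?sqr_ge0// fv.
apply: le_lt_trans; rewrite /L2normsq le_eqVlt; apply/orP; left; apply/eqP.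
by apply: eq_integral => x _ /=; rewrite ger0_norm// sqr_ge0.
Qed.

Lemma L2_eq f g : (forall x, D x -> f x = g x) -> L2 mu D f -> L2 mu D g.
Proof.
move=> fg [m1 m2 fin]; split.
- by apply: eq_measurable_fun m1 => x; rewrite inE => Dx; rewrite fg.
- by apply: eq_measurable_fun m2 => x; rewrite inE => Dx; rewrite fg.
apply: le_lt_trans fin; rewrite le_eqVlt; apply/orP; left; apply/eqP.
by apply: eq_integral => x; rewrite inE => Dx; rewrite fg.
Qed.

Lemma L2_comb (a : C) f g : L2 mu D f -> L2 mu D g -> L2 mu D (fun x => a * f x + g x).
Proof.
move=> Lf Lg; have [f1 f2 _] := Lf; have [g1 g2 _] := Lg.
apply: (@L2_dominated _ (fun x => 2 * normc a ^+ 2 * normc (f x) ^+ 2 + 2 * normc (g x) ^+ 2)).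
- under eq_fun do rewrite cReD cReM.
  by apply: measurable_funD => //; apply: measurable_funB; exact: measurable_funM.
- under eq_fun do rewrite cImD cImM.
  by apply: measurable_funD => //; apply: measurable_funD; exact: measurable_funM.
- by apply: intD; apply: intZ; exact: L2_normsq_integrable.
move=> x _; have := normcD (a * f x) (g x); rewrite Normc.normcM.
have := normc_ge0 (a * f x + g x); have := normc_ge0 a; have := normc_ge0 (f x).
have := normc_ge0 (g x); set p := normc a; set q := normc (f x); set r := normc (g x).
set s := normc _ => r0 q0 p0 s0 h.
have : s ^+ 2 <= (p * q + r) ^+ 2 by rewrite ler_pXn2r ?nnegrE ?addr_ge0 ?mulr_ge0.
have := sqr_ge0 (p * q - r); rewrite !expr2; nra.
Qed.

Lemma L2_conj f : L2 mu D f -> L2 mu D (fun x => conjc (f x)).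
Proof.
move=> [f1 f2 fin]; split.
- by under eq_fun do rewrite cReJ.
- by under eq_fun do rewrite cImJ; exact: measurable_funN.
- by rewrite /L2normsq; under eq_integral do rewrite normcJ.
Qed.

Lemma L2_zero : L2 mu D (fun=> 0).
Proof.
apply: (@L2_dominated _ (fun=> 0)) => //.
  by apply: eq_integrable (integrable0 mu D).
by move=> x _; rewrite Normc.normc0 expr0n.
Qed.

Lemma cintegrable_mul f g : L2 mu D f -> L2 mu D g -> cintegrable (fun x => f x * g x).
Proof.
move=> Lf Lg; have [f1 f2 _] := Lf; have [g1 g2 _] := Lg.
have dom x : normc (f x * g x) <= normc (f x) ^+ 2 + normc (g x) ^+ 2.
  rewrite Normc.normcM; have := normc_ge0 (f x); have := normc_ge0 (g x).
  set p := normc (f x); set q := normc (g x) => p0 q0.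
  have := sqr_ge0 (p - q); rewrite !expr2; nra.
have iv := intD (L2_normsq_integrable Lf) (L2_normsq_integrable Lg).
split.
- apply: dominated_integrable iv _ => [|x _].
    under eq_fun do rewrite cReM; by apply: measurable_funB; exact: measurable_funM.
  exact: le_trans (normRe_le _) (dom x).
- apply: dominated_integrable iv _ => [|x _].
    under eq_fun do rewrite cImM; by apply: measurable_funD; exact: measurable_funM.
  exact: le_trans (normIm_le _) (dom x).
Qed.

Definition L2form f g : C := cintegral mu D (fun x => f x * conjc (g x)).

Lemma L2normsqE f : L2 mu D f -> L2normsq mu D f = (Re (L2form f f))%:E.
Proof.
move=> Lf; rewrite /L2form /cintegral /= /Rintegral /L2normsq fineK; last first.
  apply: integrable_fin_num => //; apply: eq_integrable (L2_normsq_integrable Lf) => // x _ /=.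
  by rewrite mulcJ.
by apply: eq_integral => x _; rewrite mulcJ.
Qed.

Lemma L2form_semi_ip : @semi_ip R (T -> C) (L2 mu D) L2form.
Proof.
split.
- split; first exact: L2_zero.
  move=> a f g; exact: L2_comb.
- move=> a f g h Lf Lg Lh; have Lh' := L2_conj Lh.
  rewrite /L2form -cintegralZ; last exact: cintegrable_mul.
  rewrite -cintegralD; [|by apply: cintegrableZ; exact: cintegrable_mul|exact: cintegrable_mul].
  by apply: eq_cintegral => x _; rewrite /= mulrDl mulrA.
- move=> f g Lf Lg; rewrite /L2form -cintegral_conj; last by apply: cintegrable_mul => //; exact: L2_conj.
  by apply: eq_cintegral => x _; rewrite conjcM conjcK mulrC.
- move=> f Lf; rewrite /L2form /=; apply: Rintegral_ge0 => x _.
  by rewrite mulcJ cReC sqr_ge0.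
Qed.

Lemma cintegral_cauchy_schwarz f g : L2 mu D f -> L2 mu D g ->
  normc (cintegral mu D (fun x => f x * g x)) <=
  seminorm_of L2form f * seminorm_of L2form g.
Proof.
move=> Lf Lg.
have -> : cintegral mu D (fun x => f x * g x) = L2form f (fun x => conjc (g x)).
  by apply: eq_cintegral => x _; rewrite conjcK.
apply: le_trans (cauchy_schwarz L2form_semi_ip Lf (L2_conj Lg)) _.
rewrite [X in _ * X <= _](_ : _ = seminorm_of L2form g)//.
rewrite /seminorm_of /L2form; congr (Num.sqrt (Re _)).
by apply: eq_cintegral => x _; rewrite conjcK mulrC.
Qed.

Lemma L2normsq0_ae f : L2 mu D f -> L2normsq mu D f = 0%E -> ae_eq mu D f (cst 0).
Proof.
move=> Lf f0; have [m1 m2 _] := Lf.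
have mn : measurable_fun D (EFin \o (fun x => normc (f x) ^+ 2)).
  by apply/measurable_EFinP; exact: measurable_normc_sqr.
have h : ae_eq mu D (EFin \o (fun x => normc (f x) ^+ 2)) (cst 0%E).
  apply/(ae_eq_integral_abs _ mD mn); rewrite -[RHS]f0.
  by apply: eq_integral => x _ /=; rewrite ger0_norm// sqr_ge0.
apply: filterS h => x h Dx; have := h Dx => -[] /eqP; rewrite expf_eq0 /= => /eqP.
exact: Normc.eq0_normc.
Qed.

Lemma L2normsq_subset (D' : set T) f : measurable D' -> D `<=` D' ->
  L2 mu D' f -> (L2normsq mu D f <= L2normsq mu D' f)%E.
Proof.
move=> mD' DD [m1 m2 fin]; rewrite /L2normsq.
apply: ge0_subset_integral => //; last by move=> x _; rewrite lee_fin sqr_ge0.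
apply/measurable_EFinP; under eq_fun do rewrite normc_sqr.
by apply: measurable_funD; exact: measurable_funX.
Qed.

Lemma L2_subset (D' : set T) f : measurable D' -> D `<=` D' ->
  L2 mu D' f -> L2 mu D f.
Proof.
move=> mD' DD Lf; have [m1 m2 fin] := Lf.
split; [exact: measurable_funS DD m1|exact: measurable_funS DD m2|].
by apply: le_lt_trans fin; exact: L2normsq_subset.
Qed.

Lemma L2normsq_comb (a : C) f g (x y : R) :
  L2 mu D f -> L2 mu D g -> (L2normsq mu D f <= x%:E)%E -> (L2normsq mu D g <= y%:E)%E ->
  (L2normsq mu D (fun z => (a * f z + g z)%R) <= (2 * normc a ^+ 2 * x + 2 * y)%:E)%E.
Proof.
move=> Lf Lg hx hy; have sip := L2form_semi_ip.
have Lc : L2 mu D (a *: f + g) by exact: (subspace_comb (sip_sub sip)).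
have -> : (fun z => a * f z + g z) = a *: f + g by [].
move: hx hy; rewrite !L2normsqE// !lee_fin -!(sn_sqr sip)// => hx hy.
have La := subspaceZ (sip_sub sip) a Lf.
have := snD sip La Lg; rewrite (snZ sip)//.
have := sn_ge0 L2form (a *: f + g).
have X0 := sn_ge0 L2form f; have Y0 := sn_ge0 L2form g.
move: X0 Y0 hx hy; set X := seminorm_of _ _; set Y := seminorm_of _ _; set Z := seminorm_of _ _.
have := normc_ge0 a; set p := normc a => p0 X0 Y0 hx hy Z0 tri.
have : Z ^+ 2 <= (p * X + Y) ^+ 2 by rewrite ler_pXn2r ?nnegrE ?addr_ge0 ?mulr_ge0.
have : (p * X + Y) ^+ 2 <= 2 * p ^+ 2 * X ^+ 2 + 2 * Y ^+ 2.
  by have := sqr_ge0 (p * X - Y); rewrite !expr2; nra.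
have : p ^+ 2 * X ^+ 2 <= p ^+ 2 * x by rewrite ler_wpM2l ?sqr_ge0.
lra.
Qed.

Lemma L2normsq_ae f g : L2 mu D f -> L2 mu D g -> ae_eq mu D f g ->
  L2normsq mu D g = L2normsq mu D f.
Proof.
move=> [m1 m2 _] [n1 n2 _] e; rewrite /L2normsq; apply: ae_eq_integral => //.
- by apply/measurable_EFinP; exact: (measurable_normc_sqr n1 n2).
- by apply/measurable_EFinP; exact: (measurable_normc_sqr m1 m2).
by apply: filterS e => z e Dz; rewrite e.
Qed.

Lemma L2normsq_small_ae0 f (c : R) : L2 mu D f ->
  (forall e, 0 < e -> (L2normsq mu D f <= (c * e)%:E)%E) -> ae_eq mu D f (cst 0).
Proof.
move=> Lh he; apply: L2normsq0_ae => //; rewrite L2normsqE//; congr (_%:E).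
have ge0 : 0 <= Re (L2form f f) by exact: (sip_ge0 L2form_semi_ip).
apply/eqP; rewrite eq_le ge0 andbT; apply/ler_addgt0Pr => e e0; rewrite add0r.
have c0 : 0 < `|c| + 1 by rewrite ltr_wpDl.
have := he (e / (`|c| + 1)) (divr_gt0 e0 c0); rewrite L2normsqE// lee_fin => /le_trans; apply.
rewrite mulrA ler_pdivrMr// mulrC ler_pM2l//; have := ler_norm c; lra.
Qed.

End complex_integrals.

(** * Sums of semi-inner products *)
Section sums_of_forms.
Context {R : realType} (V : lmodType R[i]) (D : set V).
Hypothesis sD : subspace D.

Lemma semi_ip_sum (I : finType) (W : lmodType R[i]) (DW : I -> set W) (ip : I -> W -> W -> R[i])
    (c : I -> V -> W) :
  (forall i, semi_ip (DW i) (ip i)) -> (forall i u, D u -> DW i (c i u)) ->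
  (forall i a u v, c i (a *: u + v) = a *: c i u + c i v) ->
  semi_ip D (fun u v => \sum_i ip i (c i u) (c i v)).
Proof.
move=> sip cD cl; split=> //.
- move=> a u v w Du Dv Dw; rewrite mulr_sumr -big_split; apply: eq_bigr => i _ /=.
  by rewrite cl (sip_lin (sip i))//; exact: cD.
- move=> u v Du Dv; rewrite (rmorph_sum (@conjc R)); apply: eq_bigr => i _.
  by rewrite (sip_herm (sip i))//; exact: cD.
- move=> u Du; rewrite (big_morph (@complex.Re R) (@cReD R) (erefl _)); apply: sumr_ge0 => i _.
  by apply: (sip_ge0 (sip i)); exact: cD.
Qed.

Lemma semi_ip_eq (ip1 ip2 : V -> V -> R[i]) : semi_ip D ip1 ->
  (forall u v, D u -> D v -> ip2 u v = ip1 u v) -> semi_ip D ip2.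
Proof.
move=> s1 e; split=> //.
- move=> a u v w Du Dv Dw; rewrite !e//; first exact: (sip_lin s1).
  exact: (subspace_comb sD).
- by move=> u v Du Dv; rewrite !e// (sip_herm s1).
- by move=> u Du; rewrite e//; exact: (sip_ge0 s1).
Qed.

Lemma semi_ip_add (ip1 ip2 : V -> V -> R[i]) (a : R) : 0 <= a -> semi_ip D ip1 ->
  semi_ip D ip2 -> semi_ip D (fun u v => ip1 u v + a%:C * ip2 u v).
Proof.
move=> a0 s1 s2; split=> //.
- move=> b u v w Du Dv Dw; rewrite (sip_lin s1)// (sip_lin s2)//; ring.
- by move=> u v Du Dv; rewrite conjcD conjcM (sip_herm s1)// (sip_herm s2)// conjc_real.
- move=> u Du; rewrite cReD cReM cReC cImC mul0r subr0 addr_ge0 ?mulr_ge0//.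
    exact: sip_ge0 s1 _ _.
  exact: sip_ge0 s2 _ _.
Qed.

End sums_of_forms.

(** * The space H^1 *)
Section sobolev_space.
Context {R : realType} (d : nat).
Local Notation C := R[i].
Local Notation E := 'rV[R]_d.+1.
Local Notation T := (caratheodory_type (@lebesgue_outer R d.+1)).
Local Notation leb := (@leb R d.+1).
Local Notation GF := (gradfun R d).
Implicit Types (om : set E) (f g : E -> R) (u v w : gradfun R d).

Lemma cintegral_subset (D D' : set T) (h : T -> C) : D `<=` D' ->
  (forall x, D' x -> ~ D x -> h x = 0) -> cintegral leb D h = cintegral leb D' h.
Proof.
move=> DD h0; rewrite /cintegral.
congr (_ +i* _); rewrite Rintegral_mkcond [RHS]Rintegral_mkcond; congr (Rintegral _ _ _);
  apply/funext => x; rewrite /patch; case: ifPn => xD; case: ifPn => xD' //.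
- by move: xD xD'; rewrite inE notin_setE => /DD.
- by move: xD xD'; rewrite inE notin_setE => nD /h0 -> //.
- by move: xD xD'; rewrite inE notin_setE => /DD.
- by move: xD xD'; rewrite inE notin_setE => nD /h0 -> //.
Qed.

Lemma compact_support_L2 om g B : open om -> continuous g ->
  (forall x, ~ cube B x -> g x = 0) -> L2 leb om (fun x : E => (g x)%:C).
Proof.
move=> oom cg g0; have mom : measurable (om : set T) by exact: open_leb.
apply: (@L2_dominated _ _ _ _ _ mom _ (fun x : E => g x ^+ 2)).
- exact: continuous_measurable_leb.
- exact: measurable_cst.
- apply: (@integrableS _ _ _ _ setT) => //.
  apply: (@cube_integrable _ _ B) => [|x /g0 ->]; last by rewrite expr0n.
  move=> x; rewrite (_ : (fun y => g y ^+ 2) = (fun y => g y * g y)); last by apply/funext => y; rewrite expr2.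
  by apply: continuousM; exact: cg.
- by move=> x _; rewrite normcC real_normK ?num_real.
Qed.

Lemma test_L2 om om' f : open om -> test_function om' f -> L2 leb om (fun x : E => (f x)%:C).
Proof.
move=> oom tf; have [B tB] := test_cube tf.
by apply: (compact_support_L2 (B := B) oom (test_continuous tf)) => x; exact: test_eq0.
Qed.

Lemma test_partial_L2 om om' f i : open om -> test_function om' f ->
  L2 leb om (fun x : E => (partial i f x)%:C).
Proof.
move=> oom tf; have [B tB] := test_cube tf.
apply: (@compact_support_L2 om (partial i f) B oom) => [|x].
  exact: test_partial_continuous tf.
exact: test_partial_eq0.
Qed.

(** The field is not tied to the function: the vanishing of the weak defects below
    cuts [H1dom] out of these pairs. *)
Definition L2_pairs om : set GF :=
  [set u : GF | L2 leb om u.1 /\ forall i : 'I_d.+1, L2 leb om (fun x : E => u.2 x ord0 i)].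

Definition h1_form (k : R) om u v : C :=
  grad_form om u (conj_gradfun v) + (k ^+ 2)%:C * mass_form om u (conj_gradfun v).

(** The defect of the identity that makes the second component of u the weak
    i-th derivative of the first. *)
Definition weak_defect om i f u : C :=
  cintegral leb om (fun x : E => u.1 x * (partial i f x)%:C + u.2 x ord0 i * (f x)%:C).

Section on_open_set.
Variable om : set E.
Hypothesis oom : open om.
Let mom : measurable (om : set T). Proof. exact: open_leb. Qed.
Let L2om (h : E -> C) : Prop := L2 leb om h.
Let L2mul (h g : E -> C) : L2om h -> L2om g -> cintegrable leb om (fun x : E => h x * g x).
Proof. exact: (@cintegrable_mul _ _ T leb om mom h g). Qed.
Let L2e (h g : E -> C) : (forall x, om x -> h x = g x) -> L2om h -> L2om g.
Proof. exact: (@L2_eq _ _ T leb om h g). Qed.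
Let L2c (h : E -> C) : L2om h -> L2om (fun x : E => conjc (h x)).
Proof. exact: (@L2_conj _ _ T leb om h). Qed.
Let L2sip : @semi_ip R (E -> C) (L2 leb om) (L2form leb om).
Proof. exact: (L2form_semi_ip leb mom). Qed.

Lemma L2_pairs_subspace : subspace (L2_pairs om).
Proof.
split.
- split; first exact: L2_zero.
  move=> i; apply: (L2_eq (f := fun=> 0)); last exact: L2_zero.
  by move=> x _; rewrite mxE.
- move=> a u v [u1 u2] [v1 v2]; split; first exact: L2_comb.
  move=> i; apply: (L2_eq _ (L2_comb mom a (u2 i) (v2 i))).
  by move=> x _; rewrite !mxE.
Qed.

Lemma L2_pairs_conj u : L2_pairs om u -> L2_pairs om (conj_gradfun u).
Proof.
move=> [u1 u2]; split; first exact: L2_conj.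
move=> i; apply: (L2e _ (L2c (u2 i))); by move=> x _; rewrite mxE.
Qed.

Lemma grad_form_L2form u v : L2_pairs om u -> L2_pairs om v ->
  grad_form om u (conj_gradfun v) =
  \sum_i L2form leb om (fun x : E => u.2 x ord0 i) (fun x : E => v.2 x ord0 i).
Proof.
move=> [_ u2] [_ v2]; rewrite /grad_form.
transitivity (cintegral leb om
    (fun x : E => \sum_i u.2 x ord0 i * conjc (v.2 x ord0 i))).
  by apply: eq_cintegral => x _; apply: eq_bigr => i _; rewrite /= mxE.
apply: (@cintegral_sum _ _ _ _ _ mom _ (fun i (x : E) => u.2 x ord0 i * conjc (v.2 x ord0 i))).
by move=> i; exact: L2mul (u2 i) (L2c (v2 i)).
Qed.

Lemma h1_form_semi_ip k : semi_ip (L2_pairs om) (h1_form k om).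
Proof.
have h1 : semi_ip (L2_pairs om) (fun u v =>
    \sum_i L2form leb om (fun x : E => u.2 x ord0 i) (fun x : E => v.2 x ord0 i)).
  apply: (@semi_ip_sum _ _ _ L2_pairs_subspace 'I_d.+1 (E -> C) (fun=> L2 leb om)
    (fun=> L2form leb om) (fun i (u : GF) (x : E) => u.2 x ord0 i)).
  - by move=> i; exact: L2sip.
  - by move=> i u [].
  - by move=> i a u v; apply/funext => x; rewrite /= !mxE.
have h2 : semi_ip (L2_pairs om) (fun u v : GF => \sum_(i < 1) L2form leb om u.1 v.1).
  apply: (@semi_ip_sum _ _ _ L2_pairs_subspace 'I_1 (E -> C) (fun=> L2 leb om)
    (fun=> L2form leb om) (fun i (u : GF) => u.1)).
  - by move=> i; exact: L2sip.
  - by move=> i u [].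
  - by [].
apply: (semi_ip_eq L2_pairs_subspace (semi_ip_add L2_pairs_subspace (sqr_ge0 k) h1 h2)).
by move=> u v Lu Lv; rewrite /h1_form grad_form_L2form// big_ord1.
Qed.

Lemma mass_le_h1 k u : L2_pairs om u ->
  k ^+ 2 * seminorm_of (L2form leb om) u.1 ^+ 2 <= seminorm_of (h1_form k om) u ^+ 2.
Proof.
move=> Lu; have [u1 u2] := Lu; rewrite (sn_sqr (h1_form_semi_ip k))// (sn_sqr (L2sip))//.
rewrite /h1_form grad_form_L2form// cReD cReM cReC cImC mul0r subr0 lerDr.
rewrite (big_morph (@complex.Re R) (@cReD R) (erefl _)); apply: sumr_ge0 => i _.
exact: (sip_ge0 (L2sip)).
Qed.

Lemma grad_le_h1 k i u : L2_pairs om u ->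
  seminorm_of (L2form leb om) (fun x : E => u.2 x ord0 i) ^+ 2 <= seminorm_of (h1_form k om) u ^+ 2.
Proof.
move=> Lu; have [u1 u2] := Lu; rewrite (sn_sqr (h1_form_semi_ip k))// (sn_sqr (L2sip))//.
rewrite /h1_form grad_form_L2form// cReD cReM cReC cImC mul0r subr0.
rewrite (big_morph (@complex.Re R) (@cReD R) (erefl _)) (bigD1 i)//= -addrA lerDl addr_ge0//.
  apply: sumr_ge0 => j _; exact: (sip_ge0 (L2sip)).
by rewrite mulr_ge0 ?sqr_ge0//; exact: (sip_ge0 (L2sip)).
Qed.

Lemma weak_defect_integrable om' i f u : test_function om' f -> L2_pairs om u ->
  cintegrable leb om (fun x : E => u.1 x * (partial i f x)%:C) /\
  cintegrable leb om (fun x : E => u.2 x ord0 i * (f x)%:C).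
Proof.
move=> tf [u1 u2]; split.
- exact: (L2mul u1 (test_partial_L2 i oom tf)).
- exact: (L2mul (u2 i) (test_L2 oom tf)).
Qed.

Lemma weak_defectE om' i f u : test_function om' f -> L2_pairs om u -> weak_defect om i f u =
  cintegral leb om (fun x : E => u.1 x * (partial i f x)%:C) +
  cintegral leb om (fun x : E => u.2 x ord0 i * (f x)%:C).
Proof.
by move=> tf Lu; have [i1 i2] := weak_defect_integrable i tf Lu; rewrite -cintegralD.
Qed.

Lemma weak_defect_linear om' i f a u v : test_function om' f ->
  L2_pairs om u -> L2_pairs om v ->
  weak_defect om i f (a *: u + v) = a * weak_defect om i f u + weak_defect om i f v.
Proof.
move=> tf Lu Lv; have [u1 u2] := weak_defect_integrable i tf Lu.
have [v1 v2] := weak_defect_integrable i tf Lv.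
have iu := cintegrableD mom u1 u2; have iv := cintegrableD mom v1 v2.
rewrite /weak_defect -cintegralZ// -cintegralD//; last exact: cintegrableZ.
by apply: eq_cintegral => x _; rewrite /= !mxE !mulrDl !mulrDr !mulrA addrACA.
Qed.

Lemma weak_defect_conj om' i f u : test_function om' f -> L2_pairs om u ->
  weak_defect om i f (conj_gradfun u) = conjc (weak_defect om i f u).
Proof.
move=> tf Lu; have [u1 u2] := weak_defect_integrable i tf Lu.
have iu := cintegrableD mom u1 u2.
rewrite /weak_defect -cintegral_conj//; apply: eq_cintegral => x _.
by rewrite /= mxE conjcD !conjcM !conjc_real.
Qed.

Lemma weak_defect_bounded k om' i f : 0 < k -> test_function om' f ->
  exists2 c, 0 <= c &
    forall u, L2_pairs om u -> normc (weak_defect om i f u) <= c * seminorm_of (h1_form k om) u.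
Proof.
move=> k0 tf; pose n (h : E -> C) := seminorm_of (L2form leb om) h.
pose cp := n (fun x : E => (partial i f x)%:C); pose cf := n (fun x : E => (f x)%:C).
exists (cp / k + cf).
  by rewrite addr_ge0 ?divr_ge0 ?sn_ge0// ltW.
move=> u Lu; rewrite (weak_defectE i tf Lu).
apply: le_trans (normcD _ _) _; have [u1 u2] := Lu; rewrite mulrDl lerD//.
- apply: le_trans (cintegral_cauchy_schwarz mom u1 (test_partial_L2 i oom tf)) _.
  rewrite mulrC -mulrA ler_wpM2l ?sn_ge0//.
  rewrite mulrC ler_pdivlMr// mulrC -(@ler_pXn2r _ 2) ?nnegrE ?mulr_ge0 ?sn_ge0 ?(ltW k0)//.
  by rewrite exprMn; exact: mass_le_h1.
- apply: le_trans (cintegral_cauchy_schwarz mom (u2 i) (test_L2 oom tf)) _.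
  rewrite mulrC ler_wpM2l ?sn_ge0//.
  by rewrite -(@ler_pXn2r _ 2) ?nnegrE ?sn_ge0//; exact: grad_le_h1.
Qed.

Lemma H1domP u : H1dom om u <->
  L2_pairs om u /\ forall i f, test_function om f -> weak_defect om i f u = 0.
Proof.
split=> [[u1 u2 ug]|[[u1 u2] ug]].
  split=> // i f tf; rewrite (weak_defectE i tf)//.
  by rewrite (ug _ i tf) addNr.
split=> // f i tf; apply/eqP; rewrite -subr_eq0 opprK -(weak_defectE i tf)//.
by apply/eqP; exact: ug.
Qed.

Lemma H1_pairs u : H1dom om u -> L2_pairs om u. Proof. by case/H1domP. Qed.

Lemma H1_subspace : subspace (H1dom om).
Proof.
split; first apply/H1domP.
  split; first exact: (subspace0 L2_pairs_subspace).
  move=> i f tf; rewrite /weak_defect -[RHS](cintegral0 leb mom).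
  by apply: eq_cintegral => x _; rewrite /= mxE !mul0r addr0.
move=> a u v /H1domP[Lu u0] /H1domP[Lv v0]; apply/H1domP; split.
  exact: (subspace_comb L2_pairs_subspace).
by move=> i f tf; rewrite (weak_defect_linear i a tf)// u0// v0// mulr0 addr0.
Qed.

Lemma H1_conj u : H1dom om u -> H1dom om (conj_gradfun u).
Proof.
move=> /H1domP[Lu u0]; apply/H1domP; split; first exact: L2_pairs_conj.
by move=> i f tf; rewrite (weak_defect_conj i tf)// u0// conjc0.
Qed.

Lemma h1_form_H1_semi_ip k : semi_ip (H1dom om) (h1_form k om).
Proof.
have [_ l h g] := h1_form_semi_ip k.
split; first exact: H1_subspace.
- by move=> a u v w /H1_pairs Du /H1_pairs Dv /H1_pairs Dw; exact: l.
- by move=> u v /H1_pairs Du /H1_pairs Dv; exact: h.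
- by move=> u /H1_pairs Du; exact: g.
Qed.

Lemma H1_smooth_field om' om'' f g : test_function om' f -> test_function om'' g ->
  H1dom om (smooth_field f g).
Proof.
move=> tf tg.
have key o h : test_function o h -> H1dom om
    ((fun x : E => (h x)%:C, fun x => \row_i (partial i h x)%:C) : GF).
  move=> th; apply/H1domP; split.
    split; first exact: test_L2 th.
    move=> i; apply: (@L2e (fun x : E => (partial i h x)%:C)).
      by move=> x _; rewrite mxE.
    exact: test_partial_L2 th.
  move=> i p tp; rewrite /weak_defect.
  have e : forall x : E, (h x)%:C * (partial i p x)%:C +
      (\row_j (partial j h x)%:C) ord0 i * (p x)%:C =
      (p x * partial i h x + partial i p x * h x)%:C :> C.
    by move=> x; rewrite mxE -!rmorphM -rmorphD; congr (_%:C); ring.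
  transitivity (cintegral leb om (fun x : E => (p x * partial i h x + partial i p x * h x)%:C)).
    by apply: eq_cintegral => x _; exact: e.
  have L2p := test_L2 oom tp; have L2h := test_L2 oom th.
  have L2p' := test_partial_L2 i oom tp; have L2h' := test_partial_L2 i oom th.
  have [i1 _] := L2mul L2p L2h'; have [i2 _] := L2mul L2p' L2h.
  rewrite /cintegral /=; apply: complex_eqP => /=.
    rewrite RintegralD//; last 2 first.
    - apply: eq_integrable i1 => // x _ /=; by rewrite !mul0r subr0.
    - apply: eq_integrable i2 => // x _ /=; by rewrite !mul0r subr0.
    by rewrite (test_integration_by_parts i oom tp th) addNr.
  by rewrite Rintegral_cst// mul0r.
have -> : smooth_field f g = 'i *:
    ((fun x : E => (g x)%:C, fun x => \row_i (partial i g x)%:C) : GF) +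
    ((fun x : E => (f x)%:C, fun x => \row_i (partial i f x)%:C) : GF).
  apply: injective_projections; apply/funext => x /=.
    by apply: complex_eqP; rewrite /= ?cReD ?cImD ?cReM ?cImM /=; ring.
  apply/rowP => i; rewrite !mxE.
  by apply: complex_eqP; rewrite /= ?cReD ?cImD ?cReM ?cImM /=; ring.
exact: (subspace_comb H1_subspace _ (key _ _ tg) (key _ _ tf)).
Qed.

End on_open_set.

Lemma H1_restrict om om' u : open om -> open om' -> om' `<=` om -> H1dom om u -> H1dom om' u.
Proof.
move=> oom oom' sub /(H1domP oom)[[u1 u2] u0].
have mom : measurable (om : set T) by exact: open_leb.
have mom' : measurable (om' : set T) by exact: open_leb.
apply/(H1domP oom'); split.
  by split=> [|i]; [exact: (L2_subset mom' mom sub u1)|exact: (L2_subset mom' mom sub (u2 i))].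
move=> i f tf; rewrite -[RHS](u0 i f (test_sub sub tf)).
apply: cintegral_subset => // x _ nx.
by rewrite (test_eq0 tf nx) (test_partial_eq0 i tf nx) !mulr0 addr0.
Qed.

Lemma h1_restrict_le k om om' u : open om -> open om' -> om' `<=` om -> L2_pairs om u ->
  seminorm_of (h1_form k om') u <= seminorm_of (h1_form k om) u.
Proof.
move=> oom oom' sub Lu.
have mom : measurable (om : set T) by exact: open_leb.
have mom' : measurable (om' : set T) by exact: open_leb.
have Lu' : L2_pairs om' u by case: Lu => u1 u2; split=> [|i]; [exact: (L2_subset mom' mom sub u1)|exact: (L2_subset mom' mom sub (u2 i))].
have mono (h : E -> C) : L2 leb om h -> L2 leb om' h ->
    Re (L2form leb om' h h) <= Re (L2form leb om h h).
  move=> Lh Lh'; rewrite -lee_fin -!L2normsqE//.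
  exact: L2normsq_subset.
rewrite ler_wsqrtr// /h1_form !grad_form_L2form// !cReD !cReM !cReC !cImC !mul0r !subr0.
case: Lu Lu' => u1 u2 [u1' u2'].
apply: lerD; last by rewrite ler_wpM2l ?sqr_ge0//; exact: mono.
by rewrite !(big_morph (@complex.Re R) (@cReD R) (erefl _)); apply: ler_sum => i _; exact: mono.
Qed.

End sobolev_space.

(** * Traces *)
Section traces.
Context {R : realType} (d : nat).
Local Notation C := R[i].
Local Notation E := 'rV[R]_d.+1.
Local Notation T := (caratheodory_type (@hausdorff_outer R d.+1 d)).
Local Notation surf := (@surf R d).
Local Notation GF := (gradfun R d).
Implicit Types (om G : set E) (f g : E -> R) (u v w : gradfun R d).

Section one_trace.
Variables (k : R) (om G : set E) (tr : GF -> E -> C).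
Hypotheses (oom : open om) (mG : measurable (G : set T)).
Hypothesis trace_tr : dirichlet_trace k om G tr.
Let tr_L2 u : H1dom om u -> L2 surf G (tr u). Proof. by case: trace_tr => h *; exact: h. Qed.
Let tr_lin a u v : H1dom om u -> H1dom om v ->
  ae_eq surf G (tr (a *: u + v)) (fun x : E => a * tr u x + tr v x).
Proof. by case: trace_tr => _ h *; exact: h. Qed.
Let L2c (h : E -> C) : L2 surf G h -> L2 surf G (fun x : E => conjc (h x)).
Proof. exact: (@L2_conj _ _ T surf G h). Qed.
Let sH := H1_subspace oom.

Lemma trace_linear a u v : H1dom om u -> H1dom om v ->
  ae_eq surf G (tr (a *: u + v)) (fun x : E => a * tr u x + tr v x).
Proof. exact: tr_lin. Qed.

Lemma trace0 : ae_eq surf G (tr 0) (cst 0).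
Proof.
have := tr_lin 1 (subspace0 sH) (subspace0 sH); rewrite scaler0 addr0.
apply: filterS => x e Gx; have := e Gx; rewrite mul1r => /eqP.
by rewrite -subr_eq0 opprD addNKr oppr_eq0 => /eqP.
Qed.

Lemma trace_null u : H1dom om u -> H1norm k om u = 0 -> ae_eq surf G (tr u) (cst 0).
Proof.
move=> Hu u0; apply: (L2normsq_small_ae0 mG (tr_L2 Hu) (c := 0)).
case: trace_tr => _ _ [c hc] _ _ e e0; have := hc _ Hu.
by rewrite u0 expr0n mulr0 mul0r.
Qed.

(** The smooth fields are dense, so it is enough that the bounded additive map [F]
    kills them. *)
Lemma trace_density (F : GF -> E -> C) (c : R) :
  (forall u, H1dom om u -> L2 surf G (F u)) ->
  (forall u v, H1dom om u -> H1dom om v ->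
     ae_eq surf G (F (u - v)) (fun x : E => F u x - F v x)) ->
  (forall u, H1dom om u -> (L2normsq surf G (F u) <= (c * H1norm k om u ^+ 2)%:E)%E) ->
  (forall f g, test_function setT f -> test_function setT g ->
     ae_eq surf G (F (smooth_field f g)) (cst 0)) ->
  forall u, H1dom om u -> ae_eq surf G (F u) (cst 0).
Proof.
move=> FL FB Fc F0 u Hu; apply: (L2normsq_small_ae0 mG (FL _ Hu) (c := `|c|)) => e e0.
case: trace_tr => _ _ _ _ dens.
have se0 : 0 < Num.sqrt e by rewrite sqrtr_gt0.
have [f [g [tf tg Hfg small]]] := dens u _ Hu se0.
have Hd : H1dom om (u - smooth_field f g) by exact: subspaceB.
have e1 : ae_eq surf G (F u) (F (u - smooth_field f g)).
  apply: filterS2 (FB _ _ Hu Hfg) (F0 f g tf tg) => x h1 h2 Gx.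
  by rewrite h1// h2// subr0.
rewrite -(L2normsq_ae mG (FL _ Hu) (FL _ Hd) e1).
apply: le_trans (Fc _ Hd) _; rewrite lee_fin.
have : H1norm k om (u - smooth_field f g) ^+ 2 <= e.
  by rewrite -[leRHS](sqr_sqrtr (ltW e0)) ler_pXn2r ?nnegrE ?sqrtr_ge0 ?ltW.
have := sqr_ge0 (H1norm k om (u - smooth_field f g)).
set n := _ ^+ 2 => n0 ne; apply: (@le_trans _ _ (`|c| * n)).
  by rewrite ler_wpM2r// ler_norm.
by rewrite ler_wpM2l.
Qed.

Lemma traceB u v : H1dom om u -> H1dom om v ->
  ae_eq surf G (tr (u - v)) (fun x : E => tr u x - tr v x).
Proof.
move=> Hu Hv; have := tr_lin (-1) Hv Hu; rewrite scaleN1r addrC.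
by apply: filterS => x e Gx; rewrite e// mulN1r addrC.
Qed.

(** Both sides depend continuously on [u] and agree on smooth fields. The difference
    of the two sides is additive but only real-linear. *)
Lemma trace_conj u : H1dom om u ->
  ae_eq surf G (tr (conj_gradfun u)) (fun x : E => conjc (tr u x)).
Proof.
move=> Hu; case: (trace_tr) => _ _ [c hc] trs _.
have conjB v w : conj_gradfun (v - w) = conj_gradfun v - conj_gradfun w.
  apply: injective_projections; apply/funext => x /=; first by rewrite rmorphB.
  by apply/rowP => i; rewrite !mxE rmorphB.
have normJ v : H1dom om v -> H1norm k om (conj_gradfun v) = H1norm k om v.
  move=> Hv; rewrite /H1norm /grad_form /mass_form; congr (Num.sqrt (Re (_ + _ * _))).
    apply: eq_cintegral => x _; apply: eq_bigr => i _.
    by rewrite /= !mxE conjcK mulrC.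
  by apply: eq_cintegral => x _; rewrite /= conjcK mulrC.
pose F v := fun x : E => -1 * conjc (tr v x) + tr (conj_gradfun v) x.
suff : ae_eq surf G (F u) (cst 0).
  apply: filterS => x h Gx; have /eqP := h Gx.
  by rewrite /F mulN1r addrC subr_eq0 => /eqP.
have LJ v : H1dom om v -> L2 surf G (fun x : E => conjc (tr v x)).
  by move=> Hv; apply: L2c; exact: tr_L2.
apply: (@trace_density F (2 * normc (-1 : C) ^+ 2 * `|c| + 2 * `|c|)) u Hu.
- move=> v Hv; exact: (L2_comb mG (-1) (LJ _ Hv) (tr_L2 (H1_conj oom Hv))).
- move=> v w Hv Hw; have := traceB (H1_conj oom Hv) (H1_conj oom Hw).
  rewrite -conjB; apply: filterS2 (traceB Hv Hw) => x h1 h2 Gx.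
  rewrite /F h1// h2// rmorphB; ring.
- move=> v Hv.
  have bnd w : H1dom om w -> (L2normsq surf G (tr w) <= (`|c| * H1norm k om w ^+ 2)%:E)%E.
    move=> Hw; apply: le_trans (hc _ Hw) _; rewrite lee_fin ler_wpM2r ?sqr_ge0//; exact: ler_norm.
  have b1 : (L2normsq surf G (fun x : E => conjc (tr v x)) <= (`|c| * H1norm k om v ^+ 2)%:E)%E.
    rewrite /L2normsq (_ : (fun x : T => (normc (conjc (tr v x)) ^+ 2)%:E) = (fun x : T => (normc (tr v x) ^+ 2)%:E)).
      exact: bnd.
    by apply/funext => x; rewrite normcJ.
  have := bnd _ (H1_conj oom Hv); rewrite normJ// => b2.
  apply: le_trans (L2normsq_comb mG (-1) (LJ _ Hv) (tr_L2 (H1_conj oom Hv)) b1 b2) _.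
  by rewrite lee_fin le_eqVlt; apply/orP; left; apply/eqP; ring.
- move=> f g tf tg.
  have tNg : test_function setT (fun x => - g x).
    have key s : foldr (@partial R d) (fun x => - g x) s = (fun x => - foldr (@partial R d) g s x).
      elim: s => //= i s ->; apply/funext => x; rewrite /partial -deriveN//.
      by case: tg => sg _ _; have [_ ds] := sg s; exact: ds.
    have suppN : [set x | - g x != 0] = [set x | g x != 0].
      by apply/seteqP; split=> x /=; rewrite oppr_eq0.
    case: tg => sg cg _; split=> //; last by rewrite suppN.
    move=> s; have [cs ds] := sg s; split; rewrite /= key.
      move=> x; exact: continuousN (cs x).
    by move=> x i; exact: derivableN.
  have -> : F (smooth_field f g) = fun x : E => -1 * conjc (tr (smooth_field f g) x) +
      tr (smooth_field f (fun x => - g x)) x.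
    apply/funext => x; rewrite /F; congr (_ + tr _ x).
    apply: injective_projections; apply/funext => y //=.
    apply/rowP => i; rewrite !mxE /=; apply: complex_eqP => //=.
    rewrite /partial deriveN//; case: tg => sg _ _; have [_ ds] := sg [::]; exact: ds.
  apply: filterS2 (trs _ _ tf tg) (trs _ _ tf tNg) => x h1 h2 Gx.
  rewrite h1// h2//; apply: complex_eqP; rewrite /= ?cReD ?cImD ?cReM ?cImM /=; ring.
Qed.

End one_trace.

(** The restrictions of smooth fields to the subdomain are smooth, so that both
    traces are the restriction to [G'] for them; density does the rest. *)
Lemma trace_restrict k om om' G G' tr tr' : open om -> open om' -> om' `<=` om ->
  measurable (G : set T) -> measurable (G' : set T) -> G' `<=` G ->
  dirichlet_trace k om G tr -> dirichlet_trace k om' G' tr' ->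
  forall u, H1dom om u -> ae_eq surf G' (tr' u) (tr u).
Proof.
move=> oom oom' sub mG mG' subG htr htr' u Hu.
have [trL trl [c hc] trs dens] := htr; have [trL' trl' [c' hc'] trs' _] := htr'.
have toom' v : H1dom om v -> H1dom om' v by exact: H1_restrict.
have aeS (h h' : E -> C) : ae_eq surf G h h' -> ae_eq surf G' h h'.
  by apply: filterS => x e /subG.
have LG v : H1dom om v -> L2 surf G' (tr v).
  by move=> Hv; exact: (L2_subset mG' mG subG (trL _ Hv)).
pose F v := fun x : E => -1 * tr v x + tr' v x.
suff : ae_eq surf G' (F u) (cst 0).
  apply: filterS => x h Gx; have /eqP := h Gx.
  by rewrite /F mulN1r addrC subr_eq0 => /eqP.
have htr1 : dirichlet_trace k om G' tr.
  split=> //.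
  - by move=> a v w Hv Hw; apply: aeS; exact: trl.
  - exists c => v Hv; apply: le_trans (hc _ Hv).
    exact: (L2normsq_subset mG' mG subG (trL _ Hv)).
  - by move=> f g tf tg; apply: aeS; exact: trs.
apply: (@trace_density k om G' tr oom mG' htr1 F (2 * normc (-1 : C) ^+ 2 * `|c| + 2 * `|c'|)) u Hu.
- move=> v Hv; exact: (L2_comb mG' (-1) (LG _ Hv) (trL' _ (toom' _ Hv))).
- move=> v w Hv Hw.
  apply: filterS2 (traceB htr1 Hv Hw) (traceB htr' (toom' _ Hv) (toom' _ Hw)) => x h1 h2 Gx.
  rewrite /F h1// h2//; ring.
- move=> v Hv.
  have b1 : (L2normsq surf G' (tr v) <= (`|c| * H1norm k om v ^+ 2)%:E)%E.
    have [_ _ [c1 hc1] _ _] := htr1.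
    apply: le_trans (_ : _ <= (c * H1norm k om v ^+ 2)%:E)%E _.
      apply: le_trans (hc _ Hv).
      exact: (L2normsq_subset mG' mG subG (trL _ Hv)).
    by rewrite lee_fin ler_wpM2r ?sqr_ge0// ler_norm.
  have b2 : (L2normsq surf G' (tr' v) <= (`|c'| * H1norm k om v ^+ 2)%:E)%E.
    apply: le_trans (hc' _ (toom' _ Hv)) _; rewrite lee_fin.
    apply: (@le_trans _ _ (`|c'| * H1norm k om' v ^+ 2)).
      by rewrite ler_wpM2r ?sqr_ge0// ler_norm.
    rewrite ler_wpM2l// ler_pXn2r ?nnegrE ?sqrtr_ge0//.
    exact: (@h1_restrict_le _ _ k om om' v oom oom' sub (H1_pairs oom Hv)).
  apply: le_trans (L2normsq_comb mG' (-1) (LG _ Hv) (trL' _ (toom' _ Hv)) b1 b2) _.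
  by rewrite lee_fin le_eqVlt; apply/orP; left; apply/eqP; ring.
- move=> f g tf tg.
  apply: filterS2 (aeS _ _ (trs _ _ tf tg)) (trs' _ _ tf tg) => x h1 h2 Gx.
  by rewrite /F h1// h2//= mulN1r addNr.
Qed.

End traces.

(** * Dual spaces *)
Section dual_spaces.
Context {R : realType}.
Local Notation C := R[i].

Lemma inf_ge0 (A : set R) : (forall x, A x -> 0 <= x) -> 0 <= inf A.
Proof.
move=> A0; have [ne|/set0P] := pselect (A !=set0); first exact: lb_le_inf.
by move/negP; rewrite negbK => /eqP ->; rewrite inf0.
Qed.

Section bounds.
Variable X : nspace R.
Hypothesis nrm_ge0 : forall u : X, ndom u -> 0 <= nnrm u.

Lemma dual_nrm_has_inf (l : X -> C) : ndom (l : dual X) ->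
  has_inf [set c : R | 0 <= c /\ forall u : X, ndom u -> normc (l u) <= c * nnrm u].
Proof.
move=> [_ [c hc] _]; split; last by exists 0 => x [].
exists `|c|; split=> // u Du; apply: le_trans (hc u Du) _.
by rewrite ler_wpM2r ?nrm_ge0// ler_norm.
Qed.

Lemma dual_nrm_ge0 (l : X -> C) : 0 <= nnrm (l : dual X).
Proof. by apply: inf_ge0 => x []. Qed.

Lemma dual_bound (l : X -> C) (u : X) : ndom (l : dual X) -> ndom u ->
  normc (l u) <= nnrm (l : dual X) * nnrm u.
Proof.
move=> Dl Du; have [ne lb] := dual_nrm_has_inf Dl.
have := nrm_ge0 Du; rewrite le_eqVlt => /orP[/eqP u0|u0].
  by case: ne => c [c0 hc]; have := hc _ Du; rewrite -u0 !mulr0.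
rewrite -ler_pdivrMr//; apply: lb_le_inf => // c [c0 hc].
by rewrite ler_pdivrMr//; exact: hc.
Qed.

Lemma dual_nrm_le (l : X -> C) (c : R) : 0 <= c ->
  (forall u : X, ndom u -> normc (l u) <= c * nnrm u) -> nnrm (l : dual X) <= c.
Proof. by move=> c0 hc; apply: ge_inf; [exists 0 => x []|]. Qed.

Lemma dual_nrm_eq0 (l : X -> C) : ndom (l : dual X) -> nnrm (l : dual X) = 0 -> l = 0.
Proof.
move=> Dl l0; apply/funext => u; have [Du|nDu] := pselect (ndom u); last by case: Dl => _ _ ->.
apply: Normc.eq0_normc; apply/eqP; rewrite eq_le normc_ge0 andbT.
by rewrite (le_trans (dual_bound Dl Du))// l0 mul0r.
Qed.

Hypothesis sX : subspace (@ndom R X).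

Lemma dual_subspace : subspace (@ndom R (dual X)).
Proof.
split; first split.
- by move=> a u v _ _; rewrite /= mulr0 addr0.
- by exists 0 => u Du; rewrite Normc.normc0 mul0r.
- by [].
move=> a l m Dl Dm; have [ll _ l0] := Dl; have [ml _ m0] := Dm.
have E u : (a *: l + m : dual X) u = a * l u + m u by [].
split.
- by move=> b u v Du Dv; rewrite !E ll// ml//; ring.
- exists (normc a * nnrm (l : dual X) + nnrm (m : dual X)) => u Du.
  apply: le_trans (normcD _ _) _; rewrite mulrDl lerD//; last exact: dual_bound.
  by rewrite Normc.normcM -mulrA ler_wpM2l ?normc_ge0//; exact: dual_bound.
- by move=> u nD; rewrite E l0// m0// mulr0 addr0.
Qed.

Lemma ext0_dual (l : X -> C) (c : R) :
  (forall a u v, ndom u -> ndom v -> l (a *: u + v) = a * l u + l v) ->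
  (forall u, ndom u -> normc (l u) <= c * nnrm u) ->
  ndom (ext0 (@ndom R X) l : dual X).
Proof.
have e u : ndom u -> ext0 (@ndom R X) l u = l u by rewrite /ext0 => Du; rewrite mem_set.
move=> ll lc; split.
- move=> a u v Du Dv; rewrite !e ?ll//; exact: (subspace_comb sX).
- by exists c => u Du; rewrite e// lc.
- by move=> u nD; rewrite /ext0 memNset.
Qed.

Lemma complex_cauchy_cvg (z : nat -> C) :
  (forall e, 0 < e -> exists N, forall k m, (N <= k)%N -> (N <= m)%N -> normc (z k - z m) < e) ->
  exists l : C, forall e, 0 < e -> exists N, forall k, (N <= k)%N -> normc (z k - l) < e.
Proof.
move=> zc.
have key (r : nat -> R) : (forall e, 0 < e -> exists N, forall k m, (N <= k)%N -> (N <= m)%N ->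
    `|r k - r m| < e) -> exists l, forall e, 0 < e -> exists N, forall k, (N <= k)%N -> `|r k - l| < e.
  move=> rc; have cr : cvgn r.
    apply/cauchy_cvgP; apply/cauchyP => e e0; have [N hN] := rc e e0.
    by exists (r N); exists N => // k /= Nk; rewrite -ball_normE /=; exact: hN.
  exists (limn r) => e e0; have /cvgrPdist_lt/(_ e e0) [N _ hN] := cr.
  by exists N => k Nk; rewrite distrC; exact: hN.
have [a ha] : exists l, forall e, 0 < e -> exists N, forall k, (N <= k)%N -> `|Re (z k) - l| < e.
  apply: key => e /zc[N hN]; exists N => k m Nk Nm; apply: le_lt_trans (hN k m Nk Nm).
  by rewrite -cReN -cReD normRe_le.
have [b hb] : exists l, forall e, 0 < e -> exists N, forall k, (N <= k)%N -> `|Im (z k) - l| < e.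
  apply: key => e /zc[N hN]; exists N => k m Nk Nm; apply: le_lt_trans (hN k m Nk Nm).
  by rewrite -cImN -cImD normIm_le.
exists (a +i* b) => e e0; have e2 : 0 < e / 2 by rewrite divr_gt0.
have [N hN] := ha _ e2; have [M hM] := hb _ e2; exists (maxn N M) => k.
rewrite geq_max => /andP[/hN h1 /hM h2]; apply: le_lt_trans (normc_le_ReIm _) _.
by rewrite cReD cImD cReN cImN /= [ltRHS](splitr e) ltrD.
Qed.

(** The pointwise limit is linear and bounded; it is cut off outside the domain,
    where the members of the dual vanish. *)
Lemma dual_complete (l : nat -> X -> C) : (forall k, ndom (l k : dual X)) ->
  (forall e, 0 < e -> exists N, forall k m, (N <= k)%N -> (N <= m)%N ->
    nnrm (l k - l m : dual X) < e) ->
  exists2 l' : X -> C, ndom (l' : dual X) & forall e, 0 < e -> exists N, forall k, (N <= k)%N ->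
    nnrm (l k - l' : dual X) <= e.
Proof.
move=> Dl lc; have sD := dual_subspace.
have Dd k m : ndom (l k - l m : dual X) by exact: (subspaceB sD).
have ptw u : exists z : C, ndom u -> forall e, 0 < e ->
    exists N, forall k, (N <= k)%N -> normc (l k u - z) < e.
  have [Du|nD] := pselect (ndom u); last by exists 0.
  have [z hz] : exists z : C, forall e, 0 < e -> exists N, forall k, (N <= k)%N -> normc (l k u - z) < e.
    apply: complex_cauchy_cvg => e e0.
    have n1 : 0 < nnrm u + 1 by rewrite ltr_wpDl// nrm_ge0.
    have [N hN] := lc _ (divr_gt0 e0 n1); exists N => k m Nk Nm.
    apply: le_lt_trans (dual_bound (Dd k m) Du) _.
    have := hN k m Nk Nm; rewrite ltr_pdivlMr//; apply: le_lt_trans.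
    by rewrite ler_wpM2l ?dual_nrm_ge0// lerDl.
  by exists z.
have [g hg] := choice ptw.
have close e : 0 < e -> exists N, forall k, (N <= k)%N ->
    forall u, ndom u -> normc (l k u - g u) <= e * nnrm u.
  move=> e0; have [N hN] := lc e e0; exists N => k Nk u Du.
  apply/ler_addgt0Pr => d d0; have [M hM] := hg u Du d d0.
  have := hM (maxn N M) (leq_maxr _ _).
  have h2 := dual_bound (Dd k (maxn N M)) Du.
  have h3 := ltW (hN k (maxn N M) Nk (leq_maxl _ _)).
  have -> : l k u - g u = (l k u - l (maxn N M) u) + (l (maxn N M) u - g u) by rewrite addrA subrK.
  move=> h1; apply: le_trans (normcD _ _) _; apply: lerD; last exact: ltW.
  by apply: le_trans h2 _; rewrite ler_wpM2r ?nrm_ge0.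
have glin a u v : ndom u -> ndom v -> g (a *: u + v) = a * g u + g v.
  move=> Du Dv; have Dc := subspace_comb sX a Du Dv.
  apply/eqP; rewrite -subr_eq0; apply/eqP; apply: Normc.eq0_normc; apply/eqP.
  rewrite eq_le normc_ge0 andbT; apply/ler_addgt0Pr => e e0; rewrite add0r.
  pose B := nnrm (a *: u + v) + normc a * nnrm u + nnrm v + 1.
  have B0 : 0 < B by rewrite ltr_wpDl// !addr_ge0 ?mulr_ge0 ?nrm_ge0 ?normc_ge0.
  have [N hN] := close _ (divr_gt0 e0 B0); have {}hN := hN N (leqnn _).
  have [ll _ _] := Dl N.
  have -> : g (a *: u + v) - (a * g u + g v) =
      - (l N (a *: u + v) - g (a *: u + v)) + (a * (l N u - g u) + (l N v - g v)).
    by rewrite ll//; ring.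
  apply: le_trans (normcD _ _) _; rewrite normcN.
  apply: le_trans (lerD (hN _ Dc) (normcD _ _)) _; rewrite Normc.normcM.
  apply: le_trans (lerD (lexx _) (lerD (ler_wpM2l (normc_ge0 a) (hN _ Du)) (hN _ Dv))) _.
  rewrite [normc a * _]mulrCA -!mulrDr -mulrA ler_piMr ?(ltW e0)// mulrC ler_pdivrMr// mul1r.
  rewrite /B; lra.
have [N1 hN1] := close 1 ltr01.
have gb : exists c : R, forall u, ndom u -> normc (g u) <= c * nnrm u.
  exists (1 + nnrm (l N1 : dual X)) => u Du.
  have := hN1 _ (leqnn _) u Du; have := dual_bound (Dl N1) Du.
  have := normcD (- (l N1 u - g u)) (l N1 u); rewrite normcN opprB subrK => h h1 h2.
  by apply: le_trans h _; rewrite mulrDl; exact: lerD.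
case: gb => c gc; exists (ext0 (@ndom R X) g); first exact: ext0_dual gc.
move=> e e0; have [N hN] := close e e0; exists N => k Nk.
apply: dual_nrm_le; first exact: ltW.
move=> u Du; rewrite (_ : (_ - _ : X -> C) u = l k u - g u); first exact: hN.
by rewrite /= /ext0 /GRing.add /= /GRing.opp /= mem_set.
Qed.

End bounds.

Lemma bounded_op_pairing (X Y : nspace R) (L : X -> dual Y) :
  (forall u : X, ndom u -> 0 <= nnrm u) -> (forall u : Y, ndom u -> 0 <= nnrm u) ->
  bounded_op L -> exists2 c, 0 <= c &
    forall u v, ndom u -> ndom v -> normc (L u v) <= c * nnrm u * nnrm v.
Proof.
move=> X0 Y0 [LD _ [c hc]]; exists `|c| => // u v Du Dv.
apply: le_trans (dual_bound Y0 (LD _ Du) Dv) _; rewrite ler_wpM2r ?Y0//.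
by apply: le_trans (hc _ Du) _; rewrite ler_wpM2r ?X0// ler_norm.
Qed.

(** A space that is isomorphic to a dual is complete, because every dual is. *)
Lemma complete_of_dual_iso (X : nspace R) (ip : X -> X -> C) (L : X -> dual X) :
  semi_ip (@ndom R X) ip -> (forall u : X, ndom u -> nnrm u = seminorm_of ip u) ->
  boundedly_invertible L -> sn_complete (@ndom R X) ip.
Proof.
move=> sip nE [[LD LL [c hc]] Lsurj [c' hc']] u Du cu.
have n0 (v : X) : ndom v -> 0 <= nnrm v by move=> /nE ->; exact: sn_ge0.
have sX := sip_sub sip.
have LB v w : ndom v -> ndom w -> L (v - w) = L v - L w.
  by move=> Dv Dw; rewrite addrC -scaleN1r LL// scaleN1r addrC.
have hcB (a b : R) : 0 <= b -> a * b <= (`|a| + 1) * b.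
  by move=> b0; rewrite ler_wpM2r//; have := ler_norm a; lra.
have p1 (a : R) : 0 < `|a| + 1 by rewrite ltr_wpDl.
have [l Dl hl] : exists2 l' : X -> C, ndom (l' : dual X) & forall e, 0 < e ->
    exists N, forall k, (N <= k)%N -> nnrm (L (u k) - l' : dual X) <= e.
  apply: dual_complete => // [k|e e0]; first exact: LD.
  have [N hN] := cu _ (divr_gt0 e0 (p1 c)); exists N => k m Nk Nm.
  have Dd : ndom (u k - u m) by exact: (subspaceB sX).
  rewrite -LB//; apply: le_lt_trans (hc _ Dd) _.
  apply: le_lt_trans (hcB _ _ (n0 _ Dd)) _; rewrite nE// mulrC -ltr_pdivlMr//; exact: hN.
have [w Dw Lw] := Lsurj _ Dl; exists w => // e e0.
have [N hN] := hl _ (divr_gt0 (divr_gt0 e0 (p1 c')) (ltr0Sn R 1)).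
exists N => k Nk; have Dd : ndom (u k - w) by exact: (subspaceB sX).
rewrite -nE//; apply: le_lt_trans (hc' _ Dd) _; rewrite LB// Lw.
have nd := @dual_nrm_ge0 X (L (u k) - l).
apply: le_lt_trans (hcB c' _ nd) _; rewrite mulrC -ltr_pdivlMr//.
apply: le_lt_trans (hN k Nk) _; rewrite ltr_pdivrMr// ltr_pMr ?ltr1n//.
exact: divr_gt0.
Qed.

End dual_spaces.

(** * Fields on the subdomains *)
Section substructured_problem.
Context {R : realType} {d J : nat} (P : helmholtz R d J).
Local Notation C := R[i].
Local Notation E := 'rV[R]_d.+1.
Local Notation T := (caratheodory_type (@hausdorff_outer R d.+1 d)).
Local Notation surf := (@surf R d).
Local Notation GF := (gradfun R d).
Local Notation k := (kappa P).
Local Notation Om := (Om P).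
Local Notation Omj := (Omj P).
Local Notation D := (HOmega_dom P).
Implicit Types (u v w : 'I_J -> GF) (p q : 'I_J -> E -> C).

Record admissible : Prop := Admissible {
  adm_kappa : 0 < k;
  adm_kappas : 0 <= kappas P;
  adm_bounded : bounded_set Om;
  adm_lipschitz : lipschitz_open Om;
  adm_lipschitzj : forall j, lipschitz_open (Omj j);
  adm_sub : forall j, Omj j `<=` Om;
  adm_disjoint : trivIset setT Omj;
  adm_cover : closure Om = \bigcup_j closure (Omj j);
  adm_trace : forall j, dirichlet_trace k (Omj j) (bd (Omj j)) (Bj P j);
  adm_traceSigma : dirichlet_trace k Om (Sigma P) (trSigma P);
  adm_DtN : forall j, dirichlet_to_neumann P j;
  adm_T_bounded : forall j, bounded_op (Tj P j : Hhalf P j -> dual (Hhalf P j));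
  adm_T_positive : hermitian_positive P;
  adm_T_compact :
    compact_op ((fun q => Top P q - Tplus P q) : HSigma P -> dual (HSigma P));
  adm_AT : boundedly_invertible (AT P) }.

Hypothesis adm : admissible.

Lemma open_Om : open Om. Proof. by case: (adm_lipschitz adm). Qed.
Lemma open_Omj j : open (Omj j). Proof. by case: (adm_lipschitzj adm j). Qed.

Local Notation oj := (@open_Omj).

Lemma measurable_bd (om : set E) : measurable (bd om : set T).
Proof. by apply: closed_surf; exact: bd_closed. Qed.

Lemma measurable_Sigma : measurable (Sigma P : set T).
Proof.
apply: fin_bigcup_measurable; first exact: finite_finset.
by move=> j _; exact: measurable_bd.
Qed.

(** * The energy product *)

Definition energy u v : C := \sum_j h1_form k (Omj j) (u j) (v j).
Definition conj_field u : 'I_J -> GF := fun j => conj_gradfun (u j).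

Lemma HOmega_subspace : @subspace R ('I_J -> GF) D.
Proof.
split=> [j|a u v Du Dv j]; first exact: (subspace0 (H1_subspace (oj j))).
exact: (subspace_comb (H1_subspace (oj j)) a (Du j) (Dv j)).
Qed.

Lemma energy_semi_ip : @semi_ip R ('I_J -> GF) D energy.
Proof.
apply: (@semi_ip_sum R ('I_J -> GF) D HOmega_subspace 'I_J GF (fun j => H1dom (Omj j))
  (fun j => h1_form k (Omj j)) (fun j u => u j)).
- by move=> j; exact: (h1_form_H1_semi_ip (oj j)).
- by move=> j u Du; exact: Du.
- by [].
Qed.

Lemma conj_fieldK u : conj_field (conj_field u) = u.
Proof.
apply/funext => j; apply: injective_projections; apply/funext => x /=; first exact: conjcK.
by apply/rowP => i; rewrite !mxE; exact: conjcK.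
Qed.

Lemma conj_field_dom u : D u -> D (conj_field u).
Proof. by move=> Du j; exact: (H1_conj (oj j) (Du j)). Qed.

Lemma AplusE u v : D v -> Aplus P u v = energy u (conj_field v).
Proof.
move=> Dv; rewrite /Aplus /ext0 mem_set//; apply: eq_bigr => j _.
by rewrite /h1_form (_ : conj_gradfun _ = v j)//; exact: (congr1 (fun f => f j) (conj_fieldK v)).
Qed.

Lemma HOmega_nrm u : D u -> @nnrm R (HOmega P) u = seminorm_of energy u.
Proof.
move=> Du; rewrite /= AplusE; last exact: conj_field_dom.
by rewrite -[fun j => _]/(conj_field u) conj_fieldK.
Qed.

(** [A - i B^* T B] is an isomorphism onto a dual space. *)
Lemma HOmega_complete : @sn_complete R ('I_J -> GF) D energy.
Proof.
apply: (@complete_of_dual_iso R (HOmega P) energy (AT P)).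
- exact: energy_semi_ip.
- exact: HOmega_nrm.
- exact: adm_AT adm.
Qed.

Lemma energy_conj u v : D u -> D v ->
  energy (conj_field u) (conj_field v) = conjc (energy u v).
Proof.
move=> Du Dv; rewrite /energy (rmorph_sum (@conjc R)); apply: eq_bigr => j _.
have Lu := H1_pairs (oj j) (Du j); have Lv := H1_pairs (oj j) (Dv j).
transitivity (h1_form k (Omj j) (v j) (u j)); last exact: (sip_herm (h1_form_semi_ip (oj j) k) Lu Lv).
rewrite /h1_form; congr (_ + _ * _).
  apply: eq_cintegral => x _; apply: eq_bigr => i _.
  by rewrite /= !mxE conjcK mulrC.
by apply: eq_cintegral => x _; rewrite /= conjcK mulrC.
Qed.

Lemma component_le_energy u j : D u ->
  H1norm k (Omj j) (u j) <= seminorm_of energy u.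
Proof.
move=> Du; rewrite ler_wsqrtr// /energy (big_morph (@complex.Re R) (@cReD R) (erefl _)).
rewrite (bigD1 j)//= lerDl sumr_ge0// => i _.
exact: (sip_ge0 (h1_form_H1_semi_ip (oj i) k) (Du i)).
Qed.

(** * Traces of the fields on the subdomains *)

Definition trace_eq p q := forall j, ae_eq surf (bd (Omj j)) (p j) (q j).

Lemma trace_eq_refl p : trace_eq p p.
Proof. by move=> j; apply: filterE. Qed.

Lemma trace_eq_sym p q : trace_eq p q -> trace_eq q p.
Proof. by move=> h j; apply: filterS (h j) => x e Gx; rewrite e. Qed.

Lemma trace_eq_trans p q r : trace_eq p q -> trace_eq q r -> trace_eq p r.
Proof. by move=> h h' j; apply: filterS2 (h j) (h' j) => x e e' Gx; rewrite e// e'. Qed.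

Lemma trace_eq_comb a p q p' q' : trace_eq p p' -> trace_eq q q' ->
  trace_eq (a *: p + q) (a *: p' + q').
Proof. by move=> h h' j; apply: filterS2 (h j) (h' j) => x e e' Gx;
  rewrite -[LHS]/(a * p j x + q j x) -[RHS]/(a * p' j x + q' j x) e// e'. Qed.

Lemma trace_eq_conj p q : trace_eq p q -> trace_eq (conj_trace p) (conj_trace q).
Proof. by move=> h j; apply: filterS (h j) => x e Gx; rewrite /conj_trace e. Qed.

Lemma Bop_comb a u v : D u -> D v ->
  trace_eq (Bop P (a *: u + v)) (a *: Bop P u + Bop P v).
Proof. by move=> Du Dv j; exact: (trace_linear (adm_trace adm j) a (Du j) (Dv j)). Qed.

Lemma Bop_conj u : D u -> trace_eq (Bop P (conj_field u)) (conj_trace (Bop P u)).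
Proof.
by move=> Du j; exact: (trace_conj (oj j) (measurable_bd _) (adm_trace adm j) (Du j)).
Qed.

Lemma HSigmaP p : HSigma_dom P p <-> exists2 u, D u & trace_eq p (Bop P u).
Proof.
split=> [hp|[u Du e] j]; last by exists (u j).
have ptw j : exists v : GF, H1dom (Omj j) v /\ ae_eq surf (bd (Omj j)) (p j) (Bj P j v).
  by have [v Dv e] := hp j; exists v.
have [u hu] := choice ptw; by exists u => j; have [] := hu j.
Qed.

Lemma Bop_dom u : D u -> HSigma_dom P (Bop P u).
Proof. by move=> Du; apply/HSigmaP; exists u => //; exact: trace_eq_refl. Qed.

Lemma HSigma_subspace : @subspace R ('I_J -> E -> C) (HSigma_dom P).
Proof.
split.
- apply/HSigmaP; exists 0; first exact: (subspace0 HOmega_subspace).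
  move=> j; apply: filterS (trace0 (oj j) (adm_trace adm j)) => x e Gx.
  by rewrite /Bop e.
- move=> a p q /HSigmaP[u Du eu] /HSigmaP[v Dv ev]; apply/HSigmaP.
  exists (a *: u + v); first exact: (subspace_comb HOmega_subspace).
  apply: trace_eq_trans (trace_eq_sym (Bop_comb a Du Dv)).
  exact: trace_eq_comb.
Qed.

Lemma HSigma_conj p : HSigma_dom P p -> HSigma_dom P (conj_trace p).
Proof.
move=> /HSigmaP[u Du e]; apply/HSigmaP; exists (conj_field u); first exact: conj_field_dom.
apply: trace_eq_trans (trace_eq_sym (Bop_conj Du)); exact: trace_eq_conj.
Qed.

Lemma HSigma_eq p q : HSigma_dom P p -> trace_eq q p -> HSigma_dom P q.
Proof.
move=> /HSigmaP[u Du e] e'; apply/HSigmaP; exists u => //; exact: trace_eq_trans e.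
Qed.

Definition traceless : set ('I_J -> GF) := [set u | D u /\ trace_eq (Bop P u) 0].

(** The trace is bounded. *)
Lemma traceless_closed : @closed_subspace R ('I_J -> GF) D energy traceless.
Proof.
have sT : @subspace R ('I_J -> GF) traceless.
  split.
    split; first exact: (subspace0 HOmega_subspace).
    by move=> j; exact: (trace0 (oj j) (adm_trace adm j)).
  move=> a u v [Du u0] [Dv v0]; split; first exact: (subspace_comb HOmega_subspace).
  apply: trace_eq_trans (Bop_comb a Du Dv) _.
  have := trace_eq_comb a u0 v0; by rewrite scaler0 addr0.
apply: ClosedSubspace; [by move=> u []|exact: sT|].
move=> u Du ad; split; first exact: Du.
move=> j.
have [_ _ [c hc] _ _] := adm_trace adm j.
have [trL _ _ _ _] := adm_trace adm j.
apply: (L2normsq_small_ae0 (measurable_bd _) (trL _ (Du j)) (c := `|c|)) => e e0.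
have se0 : 0 < Num.sqrt e by rewrite sqrtr_gt0.
have [w [Dw w0] uw] := ad _ se0.
have Dd : D (u - w) by exact: (subspaceB HOmega_subspace).
have e1 : ae_eq surf (bd (Omj j)) (Bj P j (u j)) (Bj P j ((u - w) j)).
  apply: filterS2 (traceB (adm_trace adm j) (Du j) (Dw j)) (w0 j) => x h1 h2 Gx.
  by rewrite h1// (_ : Bj P j (w j) x = 0) ?subr0//; exact: h2.
rewrite -(L2normsq_ae (measurable_bd _) (trL _ (Du j)) (trL _ (Dd j)) e1).
apply: le_trans (hc _ (Dd j)) _; rewrite lee_fin.
have h1 : H1norm k (Omj j) ((u - w) j) ^+ 2 <= e.
  rewrite -[leRHS](sqr_sqrtr (ltW e0)) ler_pXn2r ?nnegrE ?sqrtr_ge0//.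
  exact: le_trans (component_le_energy j Dd) (ltW uw).
apply: (@le_trans _ _ (`|c| * H1norm k (Omj j) ((u - w) j) ^+ 2)).
  by rewrite ler_wpM2r ?sqr_ge0// ler_norm.
by rewrite ler_wpM2l.
Qed.

Lemma energy_null_traceless u : D u -> seminorm_of energy u = 0 -> traceless u.
Proof.
move=> Du u0; split=> // j.
apply: (trace_null (measurable_bd _) (adm_trace adm j) (Du j)).
by apply/eqP; rewrite eq_le sqrtr_ge0 andbT -u0 component_le_energy.
Qed.

Lemma traceless_conj u : traceless u -> traceless (conj_field u).
Proof.
move=> [Du u0]; split; first exact: conj_field_dom.
apply: trace_eq_trans (Bop_conj Du) _.
apply: trace_eq_trans (trace_eq_conj u0) _ => j; apply: filterE => x _.
exact: conjc0.
Qed.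

(** * Block diagonal operators on the traces *)

Lemma Hhalf_nrm_ge0 j (g : E -> C) : 0 <= @nnrm R (Hhalf P j) g.
Proof. by apply: inf_ge0 => _ [u _ <-]; rewrite sqrtr_ge0. Qed.

Lemma Hhalf_nrm_null j (g : E -> C) : ae_eq surf (bd (Omj j)) g (cst 0) ->
  @nnrm R (Hhalf P j) g = 0.
Proof.
move=> g0; apply/eqP; rewrite eq_le Hhalf_nrm_ge0 andbT.
apply: ge_inf; first by exists 0 => _ [u _ <-]; rewrite sqrtr_ge0.
exists 0; last exact: (sn0 (h1_form_H1_semi_ip (oj j) k)).
split; first exact: (subspace0 (H1_subspace (oj j))).
by apply: filterS2 g0 (trace0 (oj j) (adm_trace adm j)) => x h1 h2 Gx; rewrite h1// h2.
Qed.

Section block_operator.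
Variable t : 'I_J -> (E -> C) -> (E -> C) -> C.
Hypothesis t_bounded : forall j, bounded_op (t j : Hhalf P j -> dual (Hhalf P j)).

Definition block p : ('I_J -> E -> C) -> C :=
  ext0 (HSigma_dom P) (fun q => \sum_j t j (p j) (q j)).

Lemma blockE p q : HSigma_dom P q -> block p q = \sum_j t j (p j) (q j).
Proof. by move=> Dq; rewrite /block /ext0 mem_set. Qed.

Lemma block_linl a p q : HSigma_dom P p -> HSigma_dom P q ->
  block (a *: p + q) = a *: block p + block q.
Proof.
move=> Dp Dq; apply/funext => s; have [Ds|nDs] := pselect (HSigma_dom P s); last first.
  by rewrite -[RHS]/(a * block p s + block q s) /block /ext0 memNset// mulr0 addr0.
rewrite [RHS](_ : _ = a * block p s + block q s)// !blockE// mulr_sumr -big_split.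
apply: eq_bigr => j _; have [_ lin _] := t_bounded j.
exact: (congr1 (fun f => f (s j)) (lin a _ _ (Dp j) (Dq j))).
Qed.

Lemma block_linr a p q r : HSigma_dom P r -> HSigma_dom P p -> HSigma_dom P q ->
  block r (a *: p + q) = a * block r p + block r q.
Proof.
move=> Dr Dp Dq; rewrite !blockE//; last exact: (subspace_comb HSigma_subspace).
rewrite mulr_sumr -big_split; apply: eq_bigr => j _; have [tD _ _] := t_bounded j.
have [lin _ _] := tD _ (Dr j); exact: lin (Dp j) (Dq j).
Qed.

Lemma block_null_l p q : HSigma_dom P p -> HSigma_dom P q -> trace_eq p 0 -> block p q = 0.
Proof.
move=> Dp Dq p0; rewrite blockE// big1// => j _.
have [c c0 hc] := bounded_op_pairing (fun (u : Hhalf P j) _ => @Hhalf_nrm_ge0 j u) (fun (u : Hhalf P j) _ => @Hhalf_nrm_ge0 j u) (t_bounded j).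
apply: Normc.eq0_normc; apply/eqP; rewrite eq_le normc_ge0 andbT.
by rewrite (le_trans (hc _ _ (Dp j) (Dq j)))// (Hhalf_nrm_null (p0 j)) mulr0 mul0r.
Qed.

Lemma block_null_r p q : HSigma_dom P p -> HSigma_dom P q -> trace_eq q 0 -> block p q = 0.
Proof.
move=> Dp Dq q0; rewrite blockE// big1// => j _.
have [c c0 hc] := bounded_op_pairing (fun (u : Hhalf P j) _ => @Hhalf_nrm_ge0 j u) (fun (u : Hhalf P j) _ => @Hhalf_nrm_ge0 j u) (t_bounded j).
apply: Normc.eq0_normc; apply/eqP; rewrite eq_le normc_ge0 andbT.
by rewrite (le_trans (hc _ _ (Dp j) (Dq j)))// (Hhalf_nrm_null (q0 j)) mulr0.
Qed.

End block_operator.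

End substructured_problem.

Arguments open_Omj {R d J P} adm j.

(** * Extension by zero *)
Section extension_by_zero.
Context {R : realType} (dT : measure_display) (T : measurableType dT).
Variables (mu : {measure set T -> \bar R}) (D D' : set T).
Hypotheses (mD : measurable D) (mD' : measurable D') (DD : D `<=` D').
Local Notation C := R[i].
Implicit Types f : T -> C.

Lemma Re_ext0 f : (fun x => Re (ext0 D f x)) = (fun x => Re (f x)) \_ D.
Proof. by apply/funext => x; rewrite /patch /ext0; case: ifP. Qed.

Lemma Im_ext0 f : (fun x => Im (ext0 D f x)) = (fun x => Im (f x)) \_ D.
Proof. by apply/funext => x; rewrite /patch /ext0; case: ifP. Qed.

Lemma cintegrable_ext0 f : cintegrable mu D f -> cintegrable mu D' (ext0 D f).
Proof.
have key (g : T -> R) : mu.-integrable D (EFin \o g) -> mu.-integrable D' (EFin \o (g \_ D)).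
  move=> ig; apply: (@integrableS _ _ _ _ setT) => //.
  have -> : EFin \o (g \_ D) = (EFin \o g) \_ D.
    by apply/funext => x; rewrite /patch /=; case: ifP.
  exact/(integrable_mkcond _ mD).
move=> [h1 h2]; split.
- rewrite -[fun x => _]/(fun x => Re (ext0 D f x)) Re_ext0; exact: key.
- rewrite -[fun x => _]/(fun x => Im (ext0 D f x)) Im_ext0; exact: key.
Qed.

Lemma L2_ext0 f : L2 mu D f -> L2 mu D' (ext0 D f).
Proof.
move=> [m1 m2 fin]; split.
- rewrite Re_ext0; apply/(measurable_restrict _ mD mD'); rewrite setIidr//.
- rewrite Im_ext0; apply/(measurable_restrict _ mD mD'); rewrite setIidr//.
apply: le_lt_trans fin; rewrite /L2normsq integral_mkcond [leRHS]integral_mkcond.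
rewrite le_eqVlt; apply/orP; left; apply/eqP; congr integral; apply/funext => x.
rewrite /patch /ext0; case: ifPn => xD'; case: ifPn => xD //.
  by rewrite Normc.normc0 expr0n.
by move: xD xD'; rewrite inE notin_setE => /DD.
Qed.

End extension_by_zero.

Lemma closed_common_kernel (R : realType) (V : lmodType R[i]) (D : set V) (ip : V -> V -> R[i])
    (I : Type) (L : I -> V -> R[i]) : semi_ip D ip ->
  (forall i a u v, D u -> D v -> L i (a *: u + v) = a * L i u + L i v) ->
  (forall i, exists c, forall u, D u -> normc (L i u) <= c * seminorm_of ip u) ->
  closed_subspace D ip [set u | D u /\ forall i, L i u = 0].
Proof.
move=> sip lin bnd; have sD := sip_sub sip.
apply: ClosedSubspace; first by move=> u [].
  split.
    split=> [|i]; first exact: (subspace0 sD).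
    have := lin i 1 _ _ (subspace0 sD) (subspace0 sD).
    by rewrite scaler0 addr0 mul1r => /eqP; rewrite -subr_eq0 opprD addNKr oppr_eq0 => /eqP.
  move=> a u v [Du u0] [Dv v0]; split=> [|i]; first exact: (subspace_comb sD).
  by rewrite lin// u0 v0 mulr0 addr0.
move=> u Du ad; split=> // i; have [c hc] := bnd i.
apply: Normc.eq0_normc; apply/eqP; rewrite eq_le normc_ge0 andbT.
apply/ler_addgt0Pr => e e0; rewrite add0r.
have c0 : 0 < `|c| + 1 by rewrite ltr_wpDl.
have [w [Dw w0] uw] := ad _ (divr_gt0 e0 c0).
have Dd : D (u - w) by exact: (subspaceB sD).
have -> : L i u = L i (u - w).
  by rewrite addrC -scaleN1r lin// w0 mulr0 add0r.
apply: le_trans (hc _ Dd) _; apply: (@le_trans _ _ ((`|c| + 1) * seminorm_of ip (u - w))).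
  rewrite ler_wpM2r ?sn_ge0//; have := ler_norm c; lra.
by rewrite mulrC -ler_pdivlMr// ltW.
Qed.

(** * Test functions as fields *)
Section test_fields.
Context {R : realType} (d : nat).
Local Notation C := R[i].
Local Notation E := 'rV[R]_d.+1.
Local Notation GF := (gradfun R d).
Local Notation leb := (@leb R d.+1).

Lemma partial_cst0 i : partial i (fun=> 0) = (fun=> 0) :> (E -> R).
Proof. by apply/funext => x; rewrite /partial derive_cst. Qed.

Lemma test_function0 om : test_function om ((fun=> 0) : E -> R).
Proof.
have s0 : [set x : E | (0 : R) != 0] = set0.
  by apply/seteqP; split=> x //=; rewrite eqxx.
split; rewrite ?s0 ?closure0//; last exact: compact0.
move=> s; have -> : foldr (@partial R d) (fun=> 0) s = (fun=> 0).
  by elim: s => //= i s ->; exact: partial_cst0.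
split; first exact: cst_continuous.
by move=> x i; exact: derivable_cst.
Qed.

Definition real_field (f : E -> R) : GF := smooth_field f (fun=> 0).

Lemma real_field1 f x : (real_field f).1 x = (f x)%:C. Proof. by []. Qed.

Lemma real_field2 f x i : (real_field f).2 x ord0 i = (partial i f x)%:C.
Proof. by rewrite mxE partial_cst0. Qed.

Lemma real_field_H1 om om' f : open om -> test_function om' f -> H1dom om (real_field f).
Proof. by move=> oom tf; exact: (H1_smooth_field oom tf (test_function0 setT)). Qed.

(** Integration by parts is symmetric in the two functions, so it is enough that
    one of them has compact support in the domain. *)
Lemma weak_defect_real_field om om' f g i : open om -> test_function om g ->
  test_function om' f -> weak_defect om i f (real_field g) = 0.
Proof.
move=> oom tg tf; have /(H1domP oom)[_ h] := real_field_H1 oom tf.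
rewrite -[RHS](h i g tg); apply: eq_cintegral => x _.
by rewrite !real_field1 !real_field2 addrC; congr (_ + _); rewrite mulrC.
Qed.

Lemma h1_form_real_field k om u f : open om -> L2_pairs om u -> test_function om f ->
  h1_form k om u (real_field f) =
  cintegral leb om (fun x : E => \sum_i u.2 x ord0 i * (partial i f x)%:C) +
  (k ^+ 2)%:C * cintegral leb om (fun x : E => u.1 x * (f x)%:C).
Proof.
move=> oom Lu tf; rewrite /h1_form; congr (_ + _ * _).
  apply: eq_cintegral => x _; apply: eq_bigr => i _.
  by rewrite [X in _ * X]mxE real_field2 conjc_real.
apply: eq_cintegral => x _; congr (_ * _); exact: conjc_real.
Qed.

End test_fields.

(** * The Dirichlet-to-Neumann operator and the energy *)
Section harmonic_fields.
Context {R : realType} {d J : nat} (P : helmholtz R d J).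
Local Notation C := R[i].
Local Notation E := 'rV[R]_d.+1.
Local Notation T := (caratheodory_type (@lebesgue_outer R d.+1)).
Local Notation leb := (@leb R d.+1).
Local Notation surf := (@surf R d).
Local Notation GF := (gradfun R d).
Local Notation k := (kappa P).
Local Notation Om := (Om P).
Local Notation Omj := (Omj P).
Local Notation D := (HOmega_dom P).
Local Notation energy := (energy P).
Implicit Types (u v w : 'I_J -> GF) (p q : 'I_J -> E -> C).

Hypothesis adm : admissible P.
Local Notation oj := (open_Omj adm).
Let eip := energy_semi_ip adm.
Let sD := HOmega_subspace adm.

Definition test_field (j : 'I_J) (f : E -> R) : 'I_J -> GF :=
  fun i => if i == j then real_field f else 0.

Lemma test_field_dom j om f : test_function om f -> D (test_field j f).
Proof.
move=> tf i; rewrite /test_field; case: eqP => _; first exact: (real_field_H1 (oj i) tf).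
exact: (subspace0 (H1_subspace (oj i))).
Qed.

Lemma test_field_traceless j f : test_function (Omj j) f -> traceless P (test_field j f).
Proof.
move=> tf; split; first exact: test_field_dom tf.
move=> i; rewrite /Bop /test_field; case: eqP => [->|_]; last first.
  exact: (trace0 (oj i) (adm_trace adm i)).
have [_ _ _ trs _] := adm_trace adm j.
have tfT : test_function setT f by exact: test_sub tf.
apply: filterS (trs _ _ tfT (test_function0 setT)) => x h Gx; rewrite h//.
rewrite (test_eq0 tf)//; case: Gx => _; rewrite (_ : interior (Omj j) = Omj j)//.
exact/interior_id/oj.
Qed.

Lemma energy_test_field u j f : D u -> test_function (Omj j) f ->
  energy u (test_field j f) = h1_form k (Omj j) (u j) (real_field f).
Proof.
move=> Du tf; rewrite /energy (bigD1 j)//= {1}/test_field eqxx big1 ?addr0// => i ij.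
rewrite /test_field (negbTE ij).
exact: (sip0r (h1_form_H1_semi_ip (oj i) k) (Du i)).
Qed.

(** Orthogonality to the test fields is the equation [Delta u = kappa^2 u], for
    which the Dirichlet-to-Neumann property computes [T_+]. *)
Lemma test_orthogonal_DtN u v : D u ->
  (forall j f, test_function (Omj j) f -> energy u (test_field j f) = 0) -> D v ->
  Tplus P (Bop P u) (Bop P v) = Aplus P u v.
Proof.
move=> Du u0 Dv; rewrite /Tplus /Aplus /ext0 !mem_set//; last exact: Bop_dom.
apply: eq_bigr => j _; have [_ dtn] := adm_DtN adm j.
have Lu := H1_pairs (oj j) (Du j).
have lap : is_laplacian (Omj j) (u j) (fun x => (k ^+ 2)%:C * (u j).1 x).
  move=> f tf; have := u0 j f tf; rewrite energy_test_field//.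
  rewrite (h1_form_real_field k (oj j) Lu tf) => /eqP; rewrite addr_eq0 => /eqP ->.
  rewrite -cintegralZ; last 2 first.
  - exact: open_leb (oj j).
  - have mj : measurable (Omj j : set T) by exact: open_leb (oj j).
    by case: Lu => u1 _; exact: (cintegrable_mul mj u1 (test_L2 (oj j) tf)).
  by congr (- _); apply: eq_cintegral => x _; rewrite mulrA.
rewrite [LHS](dtn _ (Du j) lap _ (Dv j)); congr (_ + _).
rewrite /mass_form -cintegralZ; last 2 first.
- exact: open_leb (oj j).
- have mj : measurable (Omj j : set T) by exact: open_leb (oj j).
  have [u1 _] := Lu; have [v1 _] := H1_pairs (oj j) (Dv j).
  exact: (cintegrable_mul mj u1 v1).
by apply: eq_cintegral => x _; rewrite mulrA.
Qed.

(** The energy product of [u] with [w] is a value of [T_+] on the trace of the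
    conjugate of [w], which vanishes. *)
Lemma test_orthogonal_traceless u w : D u ->
  (forall j f, test_function (Omj j) f -> energy u (test_field j f) = 0) ->
  traceless P w -> energy u w = 0.
Proof.
move=> Du u0 tw; have [Dw' w0] := traceless_conj adm tw.
rewrite -(conj_fieldK w) -(AplusE _ Dw') -(test_orthogonal_DtN Du u0 Dw').
by apply: (block_null_r adm _ (Bop_dom Du) (Bop_dom Dw') w0) => j; case: (adm_DtN adm j).
Qed.

Lemma traceless_orthogonal_DtN u v : D u -> (forall w, traceless P w -> energy u w = 0) ->
  D v -> Tplus P (Bop P u) (Bop P v) = Aplus P u v.
Proof.
move=> Du u0; apply: test_orthogonal_DtN => // j f tf; apply: u0.
exact: test_field_traceless.
Qed.

(** * Fields that come from one function on the whole domain *)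

(** Since the subdomains fill the domain, [u] has a weak gradient across the
    interfaces when the sum of the defects vanishes. Stated in this way, the
    condition is visibly closed in energy. *)
Definition glued : set ('I_J -> GF) := [set u | D u /\
  forall c : 'I_d.+1 * {f : E -> R | test_function Om f},
    \sum_j weak_defect (Omj j) c.1 (sval c.2) (u j) = 0].

Lemma glued_closed : @closed_subspace R ('I_J -> GF) D energy glued.
Proof.
apply: (@closed_common_kernel R ('I_J -> GF) D energy _
  (fun (c : 'I_d.+1 * {f : E -> R | test_function Om f}) u =>
     \sum_j weak_defect (Omj j) c.1 (sval c.2) (u j)) eip).
- move=> [i [f tf]] a u v Du Dv; rewrite mulr_sumr -big_split; apply: eq_bigr => j _.
  exact: (weak_defect_linear (oj j) i a tf (H1_pairs (oj j) (Du j)) (H1_pairs (oj j) (Dv j))).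
- move=> [i [f tf]]; have bnd j : exists c, 0 <= c /\ forall v : GF, L2_pairs (Omj j) v ->
      normc (weak_defect (Omj j) i f v) <= c * seminorm_of (h1_form k (Omj j)) v.
    by have [c c0 hc] := weak_defect_bounded (oj j) i (adm_kappa adm) tf; exists c.
  have [c hc] := choice bnd.
  exists (\sum_j c j) => u Du; rewrite mulr_suml.
  apply: (@le_trans _ _ (\sum_j normc (weak_defect (Omj j) i f (u j)))).
    elim/big_rec2: _ => [|j a b _ ab]; first by rewrite Normc.normc0.
    by apply: le_trans (normcD _ _) _; rewrite lerD.
  apply: ler_sum => j _; have [c0 {}hc] := hc j.
  apply: le_trans (hc _ (H1_pairs (oj j) (Du j))) _.
  by rewrite ler_wpM2l//; exact: (component_le_energy adm j Du).
Qed.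

Lemma test_field_glued j f : test_function (Omj j) f -> glued (test_field j f).
Proof.
move=> tf; split; first exact: test_field_dom tf.
move=> [i [g tg]] /=; rewrite big1// => l _; rewrite /test_field; case: eqP => [->|_].
  exact: (weak_defect_real_field i (oj j) tf tg).
rewrite /weak_defect -[RHS](cintegral0 leb (open_leb (oj l))).
by apply: eq_cintegral => x _; rewrite /= mxE !mul0r addr0.
Qed.

(** The component of [u] orthogonal to the glued fields is orthogonal to the test
    fields, hence to every traceless field and in particular to [u], so that its
    norm is 0. *)
Lemma traceless_glued u : traceless P u -> glued u.
Proof.
move=> tu; have Du : D u by case: tu.
have [w gw ort] := orthogonal_projection eip (HOmega_complete adm) glued_closed Du.
have Dw : D w by case: gw.
have Dd : D (u - w) by exact: (subspaceB sD).
apply: (csub_closed glued_closed) => // e e0; exists w => //.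
suff -> : seminorm_of energy (u - w) = 0 by [].
rewrite /seminorm_of (sipBr eip Du Dw Dd) (ort _ gw) subr0.
rewrite (test_orthogonal_traceless Dd) ?sqrtr0//.
by move=> j f tf; apply: ort; exact: test_field_glued.
Qed.

(** What the subdomains miss lies in their boundaries. *)
Lemma subdomains_full (V := \bigcup_j Omj j) : leb (Om `\` V) = 0%E.
Proof.
have mbd j : measurable (bd (Omj j) : set T) by apply: closed_leb; exact: bd_closed.
have bdj j : bounded_set (Omj j).
  have [M [Mr hM]] := adm_bounded adm; exists M; split=> // y My x xj.
  exact: (hM y My x (adm_sub adm xj)).
apply/eqP; rewrite eq_le measure_ge0 andbT.
have sub : Om `\` V `<=` \bigcup_j bd (Omj j).
  move=> x [Ox nV]; have : closure Om x by exact: subset_closure.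
  rewrite (adm_cover adm) => -[j _ xj]; exists j => //; split=> //.
  by move=> /interior_subset xO; apply: nV; exists j.
have mb : measurable (\bigcup_j bd (Omj j) : set T).
  apply: fin_bigcup_measurable; first exact: finite_finset.
  by move=> j _; exact: mbd.
have -> : 0%E = leb (\bigcup_j bd (Omj j)).
  apply/esym/eqP; rewrite eq_le measure_ge0 andbT.
  have -> : \bigcup_j bd (Omj j) = \big[setU/set0]_j bd (Omj j).
    rewrite -bigcup_seq; congr bigcup; apply/seteqP; split=> j //= _.
    exact: mem_index_enum.
  have mU n (F : 'I_n -> set T) : (forall j, measurable (F j)) -> measurable (\big[setU/set0]_j F j).
    by move=> mF; exact: bigsetU_measurable.
  have nullU n (F : 'I_n -> set T) : (forall j, measurable (F j)) -> (forall j, leb (F j) = 0%E) ->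
      (leb (\big[setU/set0]_j F j) <= 0)%E.
    elim: n F => [|n IH] F mF F0; first by rewrite big_ord0 measure0.
    rewrite big_ord_recl; apply: le_trans (measureU2 _ _ _) _ => //; first exact: mU.
    rewrite -[leRHS]adde0; apply: leeD; last by apply: IH => j; [exact: mF|exact: F0].
    by rewrite le_eqVlt; apply/orP; left; apply/eqP; exact: F0.
  by apply: nullU => // j; exact: (lipschitz_boundary_null (adm_lipschitzj adm j) (bdj j)).
apply: le_measure => //; rewrite inE//.
apply: measurableD; first exact: open_leb (open_Om adm).
by apply: open_leb; apply: bigcup_open => j _; exact: oj.
Qed.

Let mO : measurable (Om : set T). Proof. exact: open_leb (open_Om adm). Qed.
Let mj j : measurable (Omj j : set T). Proof. exact: open_leb (oj j). Qed.

Lemma sum_ext0 (h : 'I_J -> E -> C) j x : Omj j x ->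
  \sum_l ext0 (Omj l) (h l) x = h j x.
Proof.
move=> xj; rewrite (bigD1 j)//= /ext0 mem_set// big1 ?addr0// => l lj.
rewrite memNset// => xl; move/eqP: lj; apply.
by apply: (adm_disjoint adm) => //; exists x.
Qed.

Lemma cintegral_pieces (h : 'I_J -> E -> C) : (forall j, cintegrable leb (Omj j) (h j)) ->
  cintegral leb Om (fun x : E => \sum_j ext0 (Omj j) (h j) x) = \sum_j cintegral leb (Omj j) (h j).
Proof.
move=> hi; rewrite (@cintegral_sum _ _ T leb Om mO J (fun j => ext0 (Omj j) (h j))); last first.
  by move=> j; exact: (@cintegrable_ext0 _ _ T leb _ _ (mj j) mO _ (hi j)).
apply: eq_bigr => j _.
transitivity (cintegral leb (Omj j) (ext0 (Omj j) (h j))).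
  apply/esym; apply: cintegral_subset; first exact: (@adm_sub _ _ _ _ adm j).
  by move=> x _ nx; rewrite /ext0 memNset.
by apply: eq_cintegral => x xj; rewrite /ext0 mem_set.
Qed.

Lemma cintegral_subdomains (h : E -> C) : cintegrable leb Om h ->
  cintegral leb Om h = \sum_j cintegral leb (Omj j) h.
Proof.
move=> hi; pose V := \bigcup_j Omj j.
have VO : V `<=` Om by move=> x [j _ /(adm_sub adm)].
have mV : measurable (V : set T).
  by apply: open_leb; apply: bigcup_open => j _; exact: oj.
have mN : measurable (Om `\` V : set T) by exact: measurableD.
have eV : Om `\` (Om `\` V) = V by rewrite setDD setIidr.
have hj j : cintegrable leb (Omj j) h.
  by case: hi => h1 h2; split; [apply: integrableS h1|apply: integrableS h2] => //;
    exact: (@adm_sub _ _ _ _ adm j).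
rewrite -(cintegral_pieces hj).
transitivity (cintegral leb V h).
  case: hi => h1 h2; rewrite /cintegral /Rintegral.
  by rewrite (negligible_integral mN mO h1 subdomains_full) (negligible_integral mN mO h2 subdomains_full) eV.
transitivity (cintegral leb V (fun x : E => \sum_j ext0 (Omj j) h x)).
  by apply: eq_cintegral => x [j _ xj]; rewrite (@sum_ext0 (fun=> h) j x xj).
apply: cintegral_subset => // x _ nV; rewrite big1// => j _.
by rewrite /ext0 memNset// => xj; apply: nV; exists j.
Qed.

Lemma restriction_dom (U : GF) : H1dom Om U -> D (fun=> U).
Proof. by move=> HU j; exact: (H1_restrict (open_Om adm) (oj j) (@adm_sub _ _ _ _ adm j) HU). Qed.

Lemma restriction_glued (U : GF) : H1dom Om U -> glued (fun=> U).
Proof.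
move=> HU; split; first exact: restriction_dom.
move=> [i [f tf]] /=; have /(H1domP (open_Om adm))[LU h] := HU.
have [i1 i2] := weak_defect_integrable (open_Om adm) i tf LU.
by rewrite -(cintegral_subdomains (cintegrableD mO i1 i2)); exact: h.
Qed.

(** Gluing the components gives a square integrable function whose weak gradient is
    glued from their gradients, and which differs from each component by a field
    of norm 0 on its subdomain. *)
Lemma glued_extension u : glued u ->
  exists2 U, H1dom Om U & trace_eq P (Bop P u) (Bop P (fun=> U)).
Proof.
move=> [Du u0].
pose U : GF := (fun x : E => \sum_j ext0 (Omj j) (u j).1 x,
  fun x : E => \row_i \sum_j ext0 (Omj j) (fun y => (u j).2 y ord0 i) x).
have Lj j : L2_pairs (Omj j) (u j) by exact: (H1_pairs (oj j) (Du j)).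
have LS (h : 'I_J -> E -> C) : (forall j, L2 leb (Omj j) (h j)) ->
    L2 leb Om (fun x : E => \sum_j ext0 (Omj j) (h j) x).
  move=> Lh; have sL := sip_sub (L2form_semi_ip leb mO).
  have -> : (fun x : E => \sum_j ext0 (Omj j) (h j) x) =
      \sum_j (ext0 (Omj j) (h j) : T -> C).
    by apply/funext => x; rewrite fct_sumE.
  apply: (subspace_sum sL) => j _.
  exact: (@L2_ext0 _ _ T leb _ _ (mj j) mO (@adm_sub _ _ _ _ adm j) _ (Lh j)).
have HU : H1dom Om U.
  apply/(H1domP (open_Om adm)); split.
    split; first by apply: LS => j; case: (Lj j).
    move=> i; rewrite (_ : (fun x : E => U.2 x ord0 i) = fun x : E =>
      \sum_j ext0 (Omj j) (fun y => (u j).2 y ord0 i) x).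
      by apply: LS => j; case: (Lj j).
    by apply/funext => x; rewrite mxE.
  move=> i f tf; rewrite -[RHS](u0 (i, exist _ f tf)) /=.
  rewrite -(cintegral_pieces (h := fun j (x : E) => (u j).1 x * (partial i f x)%:C +
     (u j).2 x ord0 i * (f x)%:C)); last first.
    move=> j; have [i1 i2] := weak_defect_integrable (oj j) i tf (Lj j).
    exact: (cintegrableD (mj j) i1 i2).
  apply: eq_cintegral => x _; rewrite mxE !mulr_suml -big_split; apply: eq_bigr => j _ /=.
  by rewrite /ext0; case: ifP => // _; rewrite !mul0r addr0.
exists U => // j; have HUj := restriction_dom HU j.
have eU x : Omj j x -> U.1 x = (u j).1 x /\ U.2 x = (u j).2 x.
  move=> xj; split; first by rewrite /= (@sum_ext0 (fun l => (u l).1) j x xj).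
  by apply/rowP => i; rewrite mxE (@sum_ext0 (fun l y => (u l).2 y ord0 i) j x xj).
have Hd : H1dom (Omj j) (u j - U) by exact: (subspaceB (H1_subspace (oj j)) (Du j) HUj).
have n0 : H1norm k (Omj j) (u j - U) = 0.
  rewrite /H1norm (_ : grad_form _ _ _ = 0); last first.
    rewrite /grad_form -[RHS](cintegral0 leb (mj j)); apply: eq_cintegral => x xj.
    by apply: big1 => i _; have [_ e] := eU x xj; rewrite [X in X * _]mxE [X in _ + X]mxE -e addrN mul0r.
  rewrite (_ : mass_form _ _ _ = 0) ?mulr0 ?addr0 ?sqrtr0//.
  rewrite /mass_form -[RHS](cintegral0 leb (mj j)); apply: eq_cintegral => x xj.
  by have [e _] := eU x xj; rewrite [X in X * _](_ : _ = (u j).1 x - U.1 x)// e subrr mul0r.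
have mb := @measurable_bd R d (Omj j).
apply: filterS2 (traceB (adm_trace adm j) (Du j) HUj) (trace_null mb (adm_trace adm j) Hd n0) => x h1 h2 Gx.
by have := h1 Gx; rewrite h2// => /esym/eqP; rewrite subr_eq0 => /eqP.
Qed.

Lemma Sigma_sub j : bd (Omj j) `<=` Sigma P.
Proof. by move=> x xj; exists j. Qed.

Lemma trace_skeleton (U : GF) j : H1dom Om U ->
  ae_eq surf (bd (Omj j)) (Bop P (fun=> U) j) (trSigma P U).
Proof.
move=> HU; apply: (trace_restrict (open_Om adm) (oj j) (@adm_sub _ _ _ _ adm j)
  (measurable_Sigma P) (measurable_bd _) (@Sigma_sub j) (adm_traceSigma adm) (adm_trace adm j) HU).
Qed.

End harmonic_fields.

Lemma inverse_spec (R : realType) (X : nspace R) (W : Type) (L : X -> W) (y : W) :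
  (exists2 u, ndom u & L u = y) -> ndom (inverse L y) /\ L (inverse L y) = y.
Proof.
move=> [u Du Lu]; have := @xgetPex _ (0 : X) [set v | ndom v /\ L v = y].
by apply; exists u.
Qed.

Lemma natSinv_small (R : realType) (e : R) : 0 < e ->
  exists N, forall n, (N <= n)%N -> n.+1%:R^-1 <= e.
Proof.
move=> e0; have [N _ hN] := near_infty_natSinv_lt (PosNum e0).
by exists N => n Nn; apply: ltW; exact: hN.
Qed.

(** * Operators on the traces as forms on the fields *)
Section trace_forms.
Context {R : realType} {d J : nat} (P : helmholtz R d J).
Local Notation C := R[i].
Local Notation E := 'rV[R]_d.+1.
Local Notation surf := (@surf R d).
Local Notation GF := (gradfun R d).
Local Notation k := (kappa P).
Local Notation Om := (Om P).
Local Notation Omj := (Omj P).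
Local Notation D := (HOmega_dom P).
Local Notation energy := (energy P).
Local Notation en := (seminorm_of energy).
Local Notation HS := (HSigma_dom P).
Local Notation trace_eq := (trace_eq P).
Local Notation traceless := (traceless P).
Implicit Types (u v w : 'I_J -> GF) (p q : 'I_J -> E -> C).

Hypothesis adm : admissible P.
Let eip := energy_semi_ip adm.
Let sD := HOmega_subspace adm.
Let sH := HSigma_subspace adm.
Let trefl p : trace_eq p p := @trace_eq_refl R d J P p.
Let TopE : Top P = block P (Tj P). Proof. by []. Qed.
Let TplusE : Tplus P = block P (Tplusj P). Proof. by []. Qed.

Section block_operator.
Variable t : 'I_J -> (E -> C) -> (E -> C) -> C.
Hypothesis t_bounded : forall j, bounded_op (t j : Hhalf P j -> dual (Hhalf P j)).
Local Notation block := (block P t).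

Lemma block_eq p q p' q' : HS p -> HS q -> trace_eq p' p -> trace_eq q' q ->
  block p' q' = block p q.
Proof.
move=> Dp Dq ep eq; have Dp' := HSigma_eq Dp ep; have Dq' := HSigma_eq Dq eq.
have sub0 r s : trace_eq r s -> trace_eq (-1 *: s + r) 0.
  by move=> e j; apply: filterS (e j) => x h Gx;
    rewrite -[LHS]/(-1 * s j x + r j x) h// mulN1r addNr.
transitivity (block p q').
  have := congr1 (fun f => f q') (block_linl t_bounded (-1) Dp Dp').
  rewrite (block_null_l adm t_bounded _ Dq' (sub0 _ _ ep)); last exact: (subspace_comb sH).
  move/esym/eqP; rewrite -[X in X == 0]/(-1 * block p q' + block p' q') mulN1r addrC subr_eq0.
  by move/eqP.
have := block_linr adm t_bounded (-1) Dp Dq Dq'.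
rewrite (block_null_r adm t_bounded Dp _ (sub0 _ _ eq)); last exact: (subspace_comb sH).
by move/esym/eqP; rewrite mulN1r addrC subr_eq0 => /eqP.
Qed.

Lemma Hhalf_nrm_trace j (u : GF) : H1dom (Omj j) u ->
  @nnrm R (Hhalf P j) (Bj P j u) <= H1norm k (Omj j) u.
Proof.
move=> Hu; apply: ge_inf; first by exists 0 => _ [v _ <-]; rewrite sqrtr_ge0.
by exists u => //; split=> //; apply: filterE.
Qed.

Lemma block_bounded : exists2 c, 0 <= c & forall u v, D u -> D v ->
  normc (block (Bop P u) (Bop P v)) <= c * en u * en v.
Proof.
have bnd j : exists c, 0 <= c /\ forall (u v : Hhalf P j), ndom u -> ndom v ->
    normc (t j u v) <= c * nnrm u * nnrm v.
  have [c c0 hc] := bounded_op_pairing (fun (u : Hhalf P j) _ => @Hhalf_nrm_ge0 R d J P j u)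
    (fun (u : Hhalf P j) _ => @Hhalf_nrm_ge0 R d J P j u) (t_bounded j).
  by exists c.
have [c hc] := choice bnd; exists (\sum_j c j).
  by apply: sumr_ge0 => j _; case: (hc j).
move=> u v Du Dv; rewrite blockE; last exact: Bop_dom.
rewrite !mulr_suml; apply: (@le_trans _ _ (\sum_j normc (t j (Bop P u j) (Bop P v j)))).
  elim/big_rec2: _ => [|j a b _ ab]; first by rewrite Normc.normc0.
  by apply: le_trans (normcD _ _) _; rewrite lerD.
apply: ler_sum => j _; have [c0 {}hc] := hc j.
apply: le_trans (hc _ _ (Bop_dom Du j) (Bop_dom Dv j)) _.
apply: ler_pM; rewrite ?mulr_ge0 ?Hhalf_nrm_ge0//.
  rewrite ler_wpM2l//; apply: le_trans (Hhalf_nrm_trace (Du j)) _.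
  exact: component_le_energy.
apply: le_trans (Hhalf_nrm_trace (Dv j)) _; exact: component_le_energy.
Qed.

Lemma block_Bop_linl a u v q : D u -> D v -> HS q ->
  block (Bop P (a *: u + v)) q = a * block (Bop P u) q + block (Bop P v) q.
Proof.
move=> Du Dv Dq.
rewrite (block_eq (subspace_comb sH a (Bop_dom Du) (Bop_dom Dv)) Dq (Bop_comb adm a Du Dv)
  (trefl q)).
by rewrite (block_linl t_bounded a (Bop_dom Du) (Bop_dom Dv)).
Qed.

End block_operator.

Let Tb := adm_T_bounded adm.
Let Tpb j : bounded_op (Tplusj P j : Hhalf P j -> dual (Hhalf P j)).
Proof. by case: (adm_DtN adm j). Qed.

(** * Fields that minimize the energy for their trace *)

Definition harmonic : set ('I_J -> GF) :=
  [set u | D u /\ forall w, traceless w -> energy u w = 0].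

Lemma harmonic_subspace : @subspace R ('I_J -> GF) harmonic.
Proof.
split; first split; first exact: (subspace0 sD).
  by move=> w [Dw _]; exact: (sip0l eip).
move=> a u v [Du u0] [Dv v0]; split; first exact: (subspace_comb sD).
by move=> w tw; have [Dw _] := tw; rewrite (sip_lin eip)// u0// v0// mulr0 addr0.
Qed.

Lemma harmonic_conj u : harmonic u -> harmonic (conj_field u).
Proof.
move=> [Du u0]; split; first exact: conj_field_dom.
move=> w tw; have tw' := traceless_conj adm tw; have [Dw' _] := tw'.
by rewrite -(conj_fieldK w) (energy_conj adm Du Dw') u0// conjc0.
Qed.

Lemma en_conj u : D u -> en (conj_field u) = en u.
Proof. by move=> Du; rewrite /seminorm_of (energy_conj adm Du Du) cReJ. Qed.

Lemma harmonic_part u : D u ->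
  exists e, [/\ harmonic e, traceless (u - e) & en e <= en u].
Proof.
move=> Du.
have [w tw ort] := orthogonal_projection eip (HOmega_complete adm) (traceless_closed adm) Du.
have Dw : D w by case: tw.
have De : D (u - w) by exact: (subspaceB sD).
exists (u - w); split; first by split.
  by rewrite opprB addrC subrK.
have := sn_pythagoras eip De Dw (ort _ tw); rewrite subrK => h.
by rewrite -(@ler_pXn2r _ 2) ?nnegrE ?sn_ge0// h lerDl sqr_ge0.
Qed.

Lemma traceless_trace_eq u v : D u -> D v -> traceless (u - v) -> trace_eq (Bop P u) (Bop P v).
Proof.
move=> Du Dv [_ h] j.
apply: filterS2 (traceB (adm_trace adm j) (Du j) (Dv j)) (h j) => x h1 h2 Gx.
by have := h1 Gx; rewrite [LHS](h2 Gx) => /esym/eqP; rewrite subr_eq0 => /eqP.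
Qed.

Lemma trace_eq_traceless u v : D u -> D v -> trace_eq (Bop P u) (Bop P v) -> traceless (u - v).
Proof.
move=> Du Dv e; split; first exact: (subspaceB sD).
move=> j; apply: filterS2 (traceB (adm_trace adm j) (Du j) (Dv j)) (e j) => x h1 h2 Gx.
by rewrite [LHS](h1 Gx) -/(Bop P u j x) -/(Bop P v j x) h2// subrr.
Qed.

Lemma harmonic_lift p : HS p -> exists2 e, harmonic e & trace_eq p (Bop P e).
Proof.
move=> /HSigmaP[u Du pu]; have [e [he tue _]] := harmonic_part Du; exists e => //.
have De : D e by case: he.
by apply: trace_eq_trans pu _; exact: traceless_trace_eq Du De tue.
Qed.

(** The reference norm of a trace is thus the energy of its harmonic extension. *)
Lemma Tplus_harmonic e v : harmonic e -> D v ->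
  Tplus P (Bop P e) (conj_trace (Bop P v)) = energy e v.
Proof.
move=> [De e0] Dv; have Dv' := conj_field_dom adm Dv.
rewrite TplusE (block_eq Tpb (Bop_dom De) (Bop_dom Dv') (trefl _) (trace_eq_sym (Bop_conj adm Dv))).
by rewrite -TplusE (traceless_orthogonal_DtN adm De e0 Dv') (AplusE _ Dv') conj_fieldK.
Qed.

Lemma HSigma_nrm_ge0 (p : HSigma P) : 0 <= nnrm p.
Proof. exact: sqrtr_ge0. Qed.
Let HS0 (p : HSigma P) : ndom p -> 0 <= nnrm p. Proof. by move=> _; exact: HSigma_nrm_ge0. Qed.

Lemma HSigma_nrm_harmonic p e : harmonic e -> trace_eq p (Bop P e) ->
  @nnrm R (HSigma P) p = en e.
Proof.
move=> he pe; have De : D e by case: he.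
rewrite /= /seminorm_of -(Tplus_harmonic he De); congr (Num.sqrt (Re _)).
apply: (block_eq Tpb (Bop_dom De) _ pe (trace_eq_conj pe)).
exact: (HSigma_conj adm (Bop_dom De)).
Qed.

Lemma HSigma_nrm_trace_le u : D u -> @nnrm R (HSigma P) (Bop P u) <= en u.
Proof.
move=> Du; have [e [he tue eu]] := harmonic_part Du.
have De : D e by case: he.
by rewrite (HSigma_nrm_harmonic he (traceless_trace_eq Du De tue)).
Qed.

Lemma dual_trace_eq (y : HSigma P -> C) p q : ndom (y : dual (HSigma P)) -> HS p ->
  trace_eq q p -> y q = y p.
Proof.
move=> Dy Dp e; have Dq := HSigma_eq Dp e; have [lin _ _] := Dy.
have e0 : trace_eq (-1 *: p + q) (Bop P 0).
  move=> j; apply: filterS2 (e j) (trace0 (open_Omj adm j) (adm_trace adm j)) => x h h0 Gx.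
  by rewrite -[LHS]/(-1 * p j x + q j x) h// mulN1r addNr [RHS]h0.
have n0 : @nnrm R (HSigma P) (-1 *: p + q) = 0.
  by rewrite (HSigma_nrm_harmonic (subspace0 harmonic_subspace) e0) (sn0 eip).
have := dual_bound HS0 Dy (subspace_comb sH (-1) Dp Dq).
rewrite n0 mulr0 lin// => h.
have /eqP : -1 * y p + y q = 0 by apply: Normc.eq0_normc; apply/eqP; rewrite eq_le h normc_ge0.
by rewrite mulN1r addrC subr_eq0 => /eqP.
Qed.

(** * The impedance product, carried to the fields *)

Definition impedance_form u v : C := Top P (Bop P u) (conj_trace (Bop P v)).
Local Notation imp := impedance_form.
Local Notation tn := (seminorm_of imp).

Lemma complex_gt0 (z : C) : 0 < z -> 0 < Re z.
Proof. by case: z => a b; rewrite ltcE /= => /andP[]. Qed.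

Lemma impedance_semi_ip : @semi_ip R ('I_J -> GF) D imp.
Proof.
have [herm pos] := adm_T_positive adm.
split; first exact: sD.
- move=> a u v w Du Dv Dw; apply: (block_Bop_linl Tb) => //.
  exact: (HSigma_conj adm (Bop_dom Dw)).
- by move=> u v Du Dv; apply: herm; exact: Bop_dom.
- move=> u Du; have [t0|nt0] := pselect (forall j, ae_eq surf (bd (Omj j)) (Bop P u j) (cst 0)).
    rewrite /impedance_form TopE (block_null_l adm Tb (Bop_dom Du) _ t0)//.
    exact: (HSigma_conj adm (Bop_dom Du)).
  by apply: ltW; apply: complex_gt0; exact: (pos _ (Bop_dom Du) nt0).
Qed.
Let tip := impedance_semi_ip.

Lemma impedance_definite u : D u -> tn u = 0 -> traceless u.
Proof.
move=> Du /eqP; rewrite -sqrf_eq0 (sn_sqr tip)// => u0; split=> //.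
apply: contrapT => nt0; have [_ pos] := adm_T_positive adm.
have := complex_gt0 (pos _ (Bop_dom Du) nt0).
by rewrite -/(imp u u) (eqP u0) ltxx.
Qed.

Lemma impedance_traceless u : traceless u -> tn u = 0.
Proof.
move=> [Du u0]; rewrite /seminorm_of /impedance_form TopE (block_null_l adm Tb (Bop_dom Du) _ u0) ?sqrtr0//.
exact: (HSigma_conj adm (Bop_dom Du)).
Qed.

Lemma impedance_bounded : exists2 c, 0 < c & forall u, D u -> tn u <= c * en u.
Proof.
have [c c0 hc] := block_bounded Tb; exists (Num.sqrt c + 1).
  by rewrite ltr_wpDl ?sqrtr_ge0.
move=> u Du; apply: (@le_trans _ _ (Num.sqrt c * en u)); last first.
  by rewrite ler_wpM2r ?sn_ge0// lerDl.
rewrite -(@ler_pXn2r _ 2) ?nnegrE ?mulr_ge0 ?sn_ge0 ?sqrtr_ge0//.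
rewrite (sn_sqr tip)// exprMn sqr_sqrtr//.
apply: le_trans (Re_le_normc _) _; have Du' := conj_field_dom adm Du.
rewrite /impedance_form TopE (block_eq Tb (Bop_dom Du) (Bop_dom Du') (trefl _) (trace_eq_sym (Bop_conj adm Du))).
by apply: le_trans (hc _ _ Du Du') _; rewrite en_conj// -mulrA -expr2.
Qed.

Lemma impedance_eq u v : D u -> D v -> traceless (u - v) -> tn u = tn v.
Proof.
move=> Du Dv t0; have Dd : D (u - v) by exact: (subspaceB sD).
have n0 := impedance_traceless t0.
apply/eqP; rewrite eq_le; apply/andP; split.
  by have := sn_le_dist tip Du Dv; rewrite n0 add0r.
by have := sn_le_dist tip Dv Du; rewrite (snB_sym tip)// n0 add0r.
Qed.

(** The difference of the two products is compact on harmonic fields: a sequence of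
    harmonic fields of unit energy whose impedance norms tend to 0 would have,
    after extraction, a limit of zero trace, to which they are all orthogonal and
    which they therefore cannot approach. *)
Lemma impedance_coercive : exists2 c, 0 < c & forall u, harmonic u -> en u <= c * tn u.
Proof.
apply: contrapT => H.
have bad (n : nat) : exists u, [/\ harmonic u, en u = 1 & tn u <= n.+1%:R^-1].
  apply: contrapT => Hn; apply: H; exists n.+1%:R; first by rewrite ltr0n.
  move=> u hu; have [Du _] := hu; rewrite leNgt; apply/negP => lt; apply: Hn.
  have u0 : 0 < en u by apply: le_lt_trans lt; rewrite mulr_ge0 ?sn_ge0 ?ler0n.
  exists (((en u)^-1)%:C *: u); split; first exact: (subspaceZ harmonic_subspace).
    by rewrite (snZ eip)// normcC ger0_norm ?invr_ge0 ?sn_ge0// mulVf// gt_eqF.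
  rewrite (snZ tip)// normcC ger0_norm ?invr_ge0 ?sn_ge0//.
  rewrite mulrC ler_pdivrMr// mulrC ler_pdivlMr ?ltr0n// mulrC ltW//.
have [v hv] := choice bad.
have Dv n : D (v n) by case: (hv n) => -[].
have [_ cpt] := adm_T_compact adm.
have [|s [y [sinc Dy ylim]]] := cpt (fun n => Bop P (v n)) (fun n => Bop_dom (Dv n)).
  exists 1 => n; have [hn e1 _] := hv n.
  by rewrite (HSigma_nrm_harmonic hn (trefl _)) e1.
have s_ge n : (n <= s n)%N by elim: n => // n IH; exact: leq_ltn_trans IH (sinc n).
pose L (q : HSigma P) : dual (HSigma P) := Top P q - Tplus P q.
have small e : 0 < e -> exists N, forall n, (N <= n)%N -> nnrm (L (Bop P (v (s n))) - y) < e.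
  move=> e0; have /cvgr0Pnorm_lt/(_ e e0)[N _ hN] := ylim; exists N => n Nn.
  by have := hN n Nn; rewrite ger0_norm// dual_nrm_ge0.
have LD n : ndom (L (Bop P (v (s n))) - y : dual (HSigma P)).
  have [[LD _ _] _] := adm_T_compact adm.
  exact: (subspaceB (@dual_subspace R (HSigma P) HS0) (LD _ (Bop_dom (Dv (s n)))) Dy).
have cau : sn_cauchy energy (fun n => v (s n)).
  move=> e e0; have e2 : 0 < e ^+ 2 / 8 by rewrite divr_gt0 ?exprn_gt0.
  have [N1 hN1] := small _ e2.
  have [N2 hN2] := natSinv_small (divr_gt0 e0 (ltr0Sn R 3)).
  exists (maxn N1 N2) => n m; rewrite !geq_max => /andP[n1 n2] /andP[m1 m2].
  have [hn en1 tn1] := hv (s n); have [hm em1 tm1] := hv (s m).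
  have hd : harmonic (v (s n) - v (s m)) by exact: (subspaceB harmonic_subspace).
  have Dd : D (v (s n) - v (s m)) by case: hd.
  have inv_small l : (N2 <= l)%N -> (s l).+1%:R^-1 <= e / 4.
    by move=> l2; apply: hN2; exact: leq_trans (s_ge l).
  have tsmall : tn (v (s n) - v (s m)) <= e / 2.
    apply: le_trans (snB tip (Dv _) (Dv _)) _.
    have := le_trans tn1 (inv_small n n2); have := le_trans tm1 (inv_small m m2); lra.
  have en2 : en (v (s n) - v (s m)) <= 2.
    by apply: le_trans (snB eip (Dv _) (Dv _)) _; rewrite en1 em1.
  set z := v (s n) - v (s m) in hd Dd tsmall en2 *.
  have Dz' : HS (conj_trace (Bop P z)) by exact: (HSigma_conj adm (Bop_dom Dd)).
  (* the energy is [T_+] on the traces, and [T_+ = T - (T - T_+)] *)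
  have split_energy : en z ^+ 2 = tn z ^+ 2 - Re (L (Bop P z) (conj_trace (Bop P z))).
    rewrite (sn_sqr eip)// (sn_sqr tip)// -(Tplus_harmonic hd Dd).
    rewrite -[L _ _]/(Top P (Bop P z) (conj_trace (Bop P z)) - Tplus P (Bop P z) (conj_trace (Bop P z))).
    rewrite cReD cReN /impedance_form; ring.
  have LE : L (Bop P z) (conj_trace (Bop P z)) =
      (L (Bop P (v (s n))) - y : HSigma P -> C) (conj_trace (Bop P z)) -
      (L (Bop P (v (s m))) - y : HSigma P -> C) (conj_trace (Bop P z)).
    rewrite -[LHS]/(Top P (Bop P z) (conj_trace (Bop P z)) - Tplus P (Bop P z) (conj_trace (Bop P z))).
    have zE : z = -1 *: v (s m) + v (s n) by rewrite scaleN1r addrC.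
    have linT q : HS q -> Top P (Bop P z) q = -1 * Top P (Bop P (v (s m))) q + Top P (Bop P (v (s n))) q.
      by move=> Dq; rewrite zE; exact: (block_Bop_linl Tb).
    have linTp q : HS q ->
        Tplus P (Bop P z) q = -1 * Tplus P (Bop P (v (s m))) q + Tplus P (Bop P (v (s n))) q.
      by move=> Dq; rewrite zE; exact: (block_Bop_linl Tpb).
    rewrite (linT _ Dz') (linTp _ Dz') /L.
    rewrite -[RHS]/((Top P (Bop P (v (s n))) (conj_trace (Bop P z)) - Tplus P (Bop P (v (s n))) (conj_trace (Bop P z)) - y (conj_trace (Bop P z))) -
      (Top P (Bop P (v (s m))) (conj_trace (Bop P z)) - Tplus P (Bop P (v (s m))) (conj_trace (Bop P z)) - y (conj_trace (Bop P z)))).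
    ring.
  have nz : @nnrm R (HSigma P) (conj_trace (Bop P z)) <= 2.
    rewrite (HSigma_nrm_harmonic (harmonic_conj hd) (trace_eq_sym (Bop_conj adm Dd))).
    by rewrite en_conj.
  have Lsmall : normc (L (Bop P z) (conj_trace (Bop P z))) <= e ^+ 2 / 2.
    rewrite LE; apply: le_trans (normcD _ _) _; rewrite normcN.
    have b1 := dual_bound HS0 (LD n) Dz'.
    have b2 := dual_bound HS0 (LD m) Dz'.
    have c1 := ler_pM (dual_nrm_ge0 _) (HSigma_nrm_ge0 _) (ltW (hN1 n n1)) nz.
    have c2 := ler_pM (dual_nrm_ge0 _) (HSigma_nrm_ge0 _) (ltW (hN1 m m1)) nz.
    apply: le_trans (lerD (le_trans b1 c1) (le_trans b2 c2)) _; lra.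
  rewrite -(@ltr_pXn2r _ 2) ?nnegrE ?sn_ge0 ?(ltW e0)// split_energy.
  have : tn z ^+ 2 <= (e / 2) ^+ 2 by rewrite ler_pXn2r ?nnegrE ?sn_ge0 ?divr_ge0 ?(ltW e0).
  rewrite exprMn; have := le_trans (normRe_le _) Lsmall; rewrite ler_norml => /andP[h1 _].
  have := exprn_gt0 2 e0; rewrite [2^-1 ^+ 2]expr2; lra.
have [l Dl vl] := HOmega_complete adm (fun n => Dv (s n)) cau.
have tl0 : traceless l.
  apply: (impedance_definite Dl); apply: sn_small => e e0.
  have [c c0 hc] := impedance_bounded.
  have [N hN] := vl _ (divr_gt0 e0 (mulr_gt0 (ltr0Sn R 1) c0)).
  have [N2 hN2] := natSinv_small (divr_gt0 e0 (ltr0Sn R 1)).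
  pose n := maxn N N2.
  have [hn _ tnn] := hv (s n).
  apply: le_lt_trans (sn_le_dist tip Dl (Dv (s n))) _; rewrite (snB_sym tip)//.
  have Dd : D (v (s n) - l) by exact: (subspaceB sD).
  have h1 : tn (v (s n) - l) < e / 2.
    apply: le_lt_trans (hc _ Dd) _; have := hN n (leq_maxl _ _).
    by rewrite ltr_pdivlMr ?mulr_gt0// => h; rewrite ltr_pdivlMr// mulrC mulrA mulrC.
  have h2 : tn (v (s n)) <= e / 2.
    by apply: le_trans tnn _; apply: hN2; apply: leq_trans (s_ge n); exact: leq_maxr.
  lra.
have [N hN] := vl 1 ltr01; have [hn e1 _] := hv (s N).
have := hN N (leqnn _); rewrite ltNge => /negP; apply.
have o : energy (v (s N)) (- l) = 0.
  by case: hn => _; apply; apply: (subspaceN (csub_subspace (traceless_closed adm))).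
have := sn_pythagoras eip (Dv (s N)) (subspaceN sD Dl) o; rewrite e1.
have := sn_ge0 energy (v (s N) - l); have := sqr_ge0 (en (- l)).
by set a := en (v (s N) - l); set b := _ ^+ 2; rewrite !expr2; nra.
Qed.

End trace_forms.

(** * The impedance operator *)
Lemma subrr_swap (V : zmodType) (a b c d : V) : (a - b) - (c - d) = (a - c) - (b - d).
Proof. by rewrite !opprD !opprK addrACA. Qed.

Lemma subrr_cancel (V : zmodType) (a b c : V) : (a - c) - (b - c) = a - b.
Proof. by rewrite subrr_swap subrr subr0. Qed.

Lemma subrr_split (V : zmodType) (a b c : V) : b + (a - b - c) = a - c.
Proof. by rewrite addrA [b + _]addrC subrK. Qed.

Section impedance_operator.
Context {R : realType} {d J : nat} (P : helmholtz R d J).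
Local Notation C := R[i].
Local Notation E := 'rV[R]_d.+1.
Local Notation surf := (@surf R d).
Local Notation GF := (gradfun R d).
Local Notation D := (HOmega_dom P).
Local Notation energy := (energy P).
Local Notation en := (seminorm_of energy).
Local Notation HS := (HSigma_dom P).
Local Notation trace_eq := (trace_eq P).
Local Notation traceless := (traceless P).
Local Notation imp := (impedance_form P).
Local Notation tn := (seminorm_of imp).
Local Notation nH := (@nnrm R (HSigma P)).
Implicit Types (u v w : 'I_J -> GF) (p q : 'I_J -> E -> C).

Hypothesis adm : admissible P.
Let tip := impedance_semi_ip adm.
Let sD := HOmega_subspace adm.
Let sH := HSigma_subspace adm.
Let Tb := adm_T_bounded adm.
Let trefl p : trace_eq p p := @trace_eq_refl R d J P p.
Let HS0 (p : HSigma P) : ndom p -> 0 <= nnrm p. Proof. by move=> _; exact: HSigma_nrm_ge0. Qed.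
Let TopE : Top P = block P (Tj P). Proof. by []. Qed.

(** On harmonic parts the impedance norm is equivalent to the energy. *)
Lemma impedance_complete : @sn_complete R ('I_J -> GF) D imp.
Proof.
move=> u Du cu.
have [e he] := choice (fun k => harmonic_part adm (Du k)).
have De k : D (e k) by case: (he k) => -[].
have he' k : harmonic P (e k) by case: (he k).
have te k : traceless (u k - e k) by case: (he k).
have [c c0 hc] := impedance_coercive adm; have [c' c0' hc'] := impedance_bounded adm.
have Ddu k m : D (u k - u m) by exact: (subspaceB sD).
have Dde k m : D (e k - e m) by exact: (subspaceB sD).
have tue k m : tn (e k - e m) = tn (u k - u m).
  apply/esym; apply: (impedance_eq adm (Ddu k m) (Dde k m)).
  rewrite subrr_swap.
  exact: (subspaceB (csub_subspace (traceless_closed adm)) (te k) (te m)).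
have ce : sn_cauchy energy e.
  move=> a a0; have [N hN] := cu _ (divr_gt0 a0 c0); exists N => k m Nk Nm.
  have hd : harmonic P (e k - e m) by exact: (subspaceB (harmonic_subspace adm)).
  apply: le_lt_trans (hc _ hd) _; rewrite tue mulrC -ltr_pdivlMr//; exact: hN.
have [l Dl hl] := HOmega_complete adm De ce; exists l => // a a0.
have [N hN] := hl _ (divr_gt0 a0 c0'); exists N => k Nk.
have Dl' : D (e k - l) by exact: (subspaceB sD).
have Dul : D (u k - l) by exact: (subspaceB sD).
have tul : traceless ((u k - l) - (e k - l)) by rewrite subrr_cancel; exact: te.
rewrite (impedance_eq adm Dul Dl' tul).
by apply: le_lt_trans (hc' _ Dl') _; rewrite mulrC -ltr_pdivlMr//; exact: hN.
Qed.

(** Up to traceless fields, which are glued, closeness in the impedance product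
    is closeness in energy. *)
Lemma glued_impedance_closed : @closed_subspace R ('I_J -> GF) D imp (glued P).
Proof.
have [sub sG cl] := glued_closed adm.
apply: ClosedSubspace; [exact: sub|exact: sG|] => u Du ad; apply: cl => // a a0.
have [c c0 hc] := impedance_coercive adm.
have [w gw uw] := ad _ (divr_gt0 a0 c0).
have Dw := sub _ gw; have Dd : D (u - w) by exact: (subspaceB sD).
have [e [he te _]] := harmonic_part adm Dd; have De : D e by case: he.
exists (u - e).
  rewrite -(subrr_split u w e); exact: (subspaceD sG gw (traceless_glued adm te)).
rewrite subKr.
apply: le_lt_trans (hc _ he) _; rewrite mulrC -ltr_pdivlMr//.
by rewrite -(impedance_eq adm Dd De te).
Qed.

(** Every element of the dual of the traces is of this form, which reduces the
    operators on the dual to statements on fields. *)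
Definition impedance_functional u : HSigma' P := Top P (Bop P u).
Local Notation theta := impedance_functional.

Lemma theta_comb a u v : D u -> D v -> theta (a *: u + v) = a *: theta u + theta v.
Proof.
move=> Du Dv; apply/funext => q; have [Dq|nDq] := pselect (HS q).
  by rewrite /theta [LHS](block_Bop_linl adm Tb a Du Dv Dq).
by rewrite -[RHS]/(a * Top P (Bop P u) q + Top P (Bop P v) q) /theta /Top /ext0 memNset// mulr0 addr0.
Qed.

Lemma Top_bounded : exists2 c, 0 <= c & forall u q, D u -> HS q ->
  normc (Top P (Bop P u) q) <= c * en u * nH q.
Proof.
have [c c0 hc] := block_bounded adm Tb; exists c => // u q Du Dq.
have [e he qe] := harmonic_lift adm Dq; have De : D e by case: he.
rewrite TopE (block_eq adm Tb (Bop_dom Du) (Bop_dom De) (trefl _) qe).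
by rewrite (HSigma_nrm_harmonic adm he qe); exact: hc.
Qed.

Lemma theta_dom u : D u -> ndom (theta u).
Proof.
move=> Du; have [c c0 hc] := Top_bounded; split.
- move=> a p q Dp Dq; exact: (block_linr adm Tb a (Bop_dom Du) Dp Dq).
- by exists (c * en u) => q Dq; exact: hc.
- by move=> q nD; rewrite /theta /Top /ext0 memNset.
Qed.

Lemma theta_conj u v : D u -> D v -> theta u (conj_trace (Bop P v)) = imp u v.
Proof. by []. Qed.

Lemma theta_Bop u v : D u -> D v -> theta u (Bop P v) = imp u (conj_field v).
Proof.
move=> Du Dv; have Dv' := conj_field_dom adm Dv.
rewrite /impedance_form.
apply: (block_eq adm Tb (Bop_dom Du) _ (trefl _)).
  exact: (HSigma_conj adm (Bop_dom Dv')).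
apply: trace_eq_sym; apply: trace_eq_trans (trace_eq_conj (Bop_conj adm Dv)) _.
by move=> j; apply: filterE => x _; exact: conjcK.
Qed.

Lemma HSigma_nrm_conj v : D v -> nH (conj_trace (Bop P v)) = nH (Bop P v).
Proof.
move=> Dv; have [e [he te _]] := harmonic_part adm Dv; have De : D e by case: he.
have eqB := traceless_trace_eq adm Dv De te.
rewrite (HSigma_nrm_harmonic adm he eqB) -(en_conj adm De).
apply: (HSigma_nrm_harmonic adm (harmonic_conj adm he)).
exact: trace_eq_trans (trace_eq_conj eqB) (trace_eq_sym (Bop_conj adm De)).
Qed.

Lemma HSigma_nrm_conj_field v : D v -> nH (Bop P (conj_field v)) = nH (Bop P v).
Proof.
move=> Dv; have [e [he te _]] := harmonic_part adm Dv; have De : D e by case: he.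
have eqB := traceless_trace_eq adm Dv De te.
rewrite (HSigma_nrm_harmonic adm he eqB) -(en_conj adm De).
apply: (HSigma_nrm_harmonic adm (harmonic_conj adm he)).
apply: trace_eq_trans (Bop_conj adm Dv) _.
exact: trace_eq_trans (trace_eq_conj eqB) (trace_eq_sym (Bop_conj adm De)).
Qed.

Lemma HSigma_nrm_le_impedance : exists2 c, 0 < c & forall v, D v -> nH (Bop P v) <= c * tn v.
Proof.
have [c c0 hc] := impedance_coercive adm; exists c => // v Dv.
have [e [he te _]] := harmonic_part adm Dv; have De : D e by case: he.
rewrite (HSigma_nrm_harmonic adm he (traceless_trace_eq adm Dv De te)).
by rewrite (impedance_eq adm Dv De te); exact: hc.
Qed.

Lemma dual_ext (y z : HSigma P -> C) : ndom (y : dual (HSigma P)) -> ndom (z : dual (HSigma P)) ->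
  (forall v, D v -> y (conj_trace (Bop P v)) = z (conj_trace (Bop P v))) -> y = z.
Proof.
move=> Dy Dz e; apply/funext => p; have [Dp|nDp] := pselect (HS p); last first.
  by case: Dy => _ _ ->//; case: Dz => _ _ ->.
have [v Dv pv] := (HSigmaP P (conj_trace p)).1 (HSigma_conj adm Dp).
have Dv' := HSigma_conj adm (Bop_dom Dv).
have pe : trace_eq p (conj_trace (Bop P v)).
  apply: trace_eq_trans (trace_eq_conj pv) => j; apply: filterE => x _.
  by rewrite /conj_trace conjcK.
by rewrite (dual_trace_eq adm Dy Dv' pe) (dual_trace_eq adm Dz Dv' pe) e.
Qed.

(** The impedance operator is onto by the Riesz representation theorem for its
    own product. *)
Lemma theta_surj (y : HSigma' P) : ndom y -> exists2 w, D w & theta w = y.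
Proof.
move=> Dy; pose l v : C := conjc (y (conj_trace (Bop P v))).
have Dc v : D v -> HS (conj_trace (Bop P v)) by move=> Dv; exact: (HSigma_conj adm (Bop_dom Dv)).
have [ylin _ _] := Dy.
have llin a u v : D u -> D v -> l (a *: u + v) = a * l u + l v.
  move=> Du Dv; rewrite /l.
  have e : trace_eq (conj_trace (Bop P (a *: u + v)))
      (conjc a *: conj_trace (Bop P u) + conj_trace (Bop P v)).
    apply: trace_eq_trans (trace_eq_conj (Bop_comb adm a Du Dv)) _ => j; apply: filterE => x _.
    by rewrite -[RHS]/(conjc a * conjc (Bop P u j x) + conjc (Bop P v j x)) -conjcM -conjcD.
  rewrite (dual_trace_eq adm Dy (subspace_comb sH _ (Dc _ Du) (Dc _ Dv)) e).
  by rewrite ylin ?conjcD ?conjcM ?conjcK//; exact: Dc.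
have [c c0 hc] := HSigma_nrm_le_impedance.
have lb u : D u -> normc (l u) <= (@nnrm R (dual (HSigma P)) y * c) * tn u.
  move=> Du; rewrite /l normcJ.
  apply: le_trans (dual_bound HS0 Dy (Dc _ Du)) _.
  rewrite HSigma_nrm_conj// -mulrA ler_wpM2l ?hc//; exact: dual_nrm_ge0.
have [w Dw hw] := riesz_representation tip impedance_complete llin lb.
exists w => //; apply: dual_ext => // [|v Dv]; first exact: theta_dom.
rewrite theta_conj// (sip_herm tip Dv Dw) -hw// /l conjcK//.
Qed.

Lemma theta_eq u v : D u -> D v -> trace_eq (Bop P u) (Bop P v) -> theta u = theta v.
Proof.
move=> Du Dv e; apply: dual_ext; [exact: theta_dom|exact: theta_dom|] => w Dw.
apply: (block_eq adm Tb (Bop_dom Dv) _ e (trefl _)).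
exact: (HSigma_conj adm (Bop_dom Dw)).
Qed.

Lemma theta_inj u v : D u -> D v -> theta u = theta v -> trace_eq (Bop P u) (Bop P v).
Proof.
move=> Du Dv e; have Dd : D (u - v) by exact: (subspaceB sD).
apply: (traceless_trace_eq adm Du Dv); apply: (impedance_definite adm Dd).
rewrite /seminorm_of (sipBl tip Du Dv Dd) -!theta_conj// e subrr//.
by rewrite raddf0 sqrtr0.
Qed.

(** * The product of the inverse impedance *)

Definition inverse_form (x y : HSigma' P) : C :=
  x (conj_trace (inverse (Top P : HSigma P -> dual (HSigma P)) y)).

Lemma inverse_formE (x : HSigma' P) v : ndom x -> D v ->
  inverse_form x (theta v) = x (conj_trace (Bop P v)).
Proof.
move=> Dx Dv.
have [Dp Tp] := @inverse_spec R (HSigma P) _ (Top P : HSigma P -> dual (HSigma P)) (theta v)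
  (ex_intro2 _ _ (Bop P v) (Bop_dom Dv) erefl).
rewrite /inverse_form; set p := inverse _ _ in Dp Tp *.
apply: (dual_trace_eq adm Dx); first exact: (HSigma_conj adm (Bop_dom Dv)).
apply: trace_eq_conj; have [w Dw pw] := (HSigmaP P p).1 Dp.
apply: (trace_eq_trans pw); apply: theta_inj => //; rewrite -Tp.
apply: dual_ext; [exact: theta_dom|rewrite Tp; exact: theta_dom|] => z Dz.
have Dz' := HSigma_conj adm (Bop_dom Dz).
exact: (block_eq adm Tb Dp Dz' (trace_eq_sym pw) (trefl _)).
Qed.

Lemma inverse_form_theta u v : D u -> D v -> inverse_form (theta u) (theta v) = imp u v.
Proof. by move=> Du Dv; rewrite inverse_formE//; exact: theta_dom. Qed.

Lemma Tinv_normE (y : HSigma' P) : Tinv_norm y = seminorm_of inverse_form y.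
Proof. by rewrite /Tinv_norm cReJ. Qed.

Lemma HSigma'_subspace : subspace (@ndom R (HSigma' P)).
Proof. exact: (@dual_subspace R (HSigma P) HS0). Qed.

Lemma inverse_form_semi_ip : semi_ip (@ndom R (HSigma' P)) inverse_form.
Proof.
split; first exact: HSigma'_subspace.
- by move=> a x y z Dx Dy Dz.
- move=> x y Dx Dy; have [u Du <-] := theta_surj Dx; have [v Dv <-] := theta_surj Dy.
  by rewrite !inverse_form_theta// (sip_herm tip).
- move=> x Dx; have [u Du <-] := theta_surj Dx.
  by rewrite inverse_form_theta//; exact: (sip_ge0 tip).
Qed.

Lemma Tinv_theta u : D u -> Tinv_norm (theta u) = tn u.
Proof. by move=> Du; rewrite Tinv_normE /seminorm_of inverse_form_theta. Qed.

Lemma inverse_form_definite (y : HSigma' P) : ndom y -> seminorm_of inverse_form y = 0 -> y = 0.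
Proof.
move=> Dy; have [u Du <-] := theta_surj Dy; rewrite -Tinv_normE Tinv_theta// => u0.
have D0 := subspace0 sD.
have t0 : traceless (u - 0) by rewrite subr0; exact: impedance_definite.
rewrite (theta_eq Du D0 (traceless_trace_eq adm Du D0 t0)).
have := theta_comb 1 D0 D0; rewrite scaler0 addr0 scale1r => /eqP.
by rewrite -subr_eq0 opprD addNKr oppr_eq0 => /eqP.
Qed.

(** With [y = T (B w)], the square of the norm of [y] is the value of [y] at the
    conjugate trace of [w]. *)
Lemma Tinv_le_dual : exists2 c, 0 < c & forall (y : HSigma' P) (M : R), ndom y -> 0 <= M ->
  (forall v, D v -> normc (y (Bop P v)) <= M * nH (Bop P v)) -> Tinv_norm y <= c * M.
Proof.
have [c c0 hc] := HSigma_nrm_le_impedance; exists c => // y M Dy M0 hM.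
have [w Dw yw] := theta_surj Dy; rewrite -yw Tinv_theta//.
have := sn_ge0 imp w; rewrite le_eqVlt => /orP[/eqP <-|w0].
  by rewrite mulr_ge0// ltW.
rewrite -(ler_pM2r w0) -expr2 (sn_sqr tip)//; apply: le_trans (Re_le_normc _) _.
rewrite -theta_conj// yw; have Dw' := conj_field_dom adm Dw.
rewrite (dual_trace_eq adm Dy (Bop_dom Dw') (trace_eq_sym (Bop_conj adm Dw))).
apply: le_trans (hM _ Dw') _; rewrite HSigma_nrm_conj_field//.
by rewrite [c * M]mulrC -mulrA ler_wpM2l//; exact: hc.
Qed.

Lemma dual_le_Tinv : exists2 c, 0 < c & forall (y : HSigma' P) v, ndom y -> D v ->
  normc (y (Bop P v)) <= c * Tinv_norm y * en v.
Proof.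
have [c c0 hc] := impedance_bounded adm; exists c => // y v Dy Dv.
have [w Dw <-] := theta_surj Dy; rewrite Tinv_theta// theta_Bop//.
have Dv' := conj_field_dom adm Dv.
apply: le_trans (cauchy_schwarz tip Dw Dv') _; rewrite mulrAC mulrC ler_wpM2r ?sn_ge0//.
by rewrite -(en_conj adm Dv); exact: hc.
Qed.

End impedance_operator.

Lemma inverse_dom (R : realType) (X : nspace R) (W : Type) (L : X -> W) (y : W) :
  ndom (0 : X) -> ndom (inverse L y).
Proof. by move=> D0; rewrite /inverse; case: xgetP => // u -> []. Qed.

Lemma cintegral_ae (R : realType) dT (T : measurableType dT) (mu : {measure set T -> \bar R})
    (D : set T) (f g : T -> R[i]) : measurable D -> cintegrable mu D f -> cintegrable mu D g ->
  ae_eq mu D f g -> cintegral mu D f = cintegral mu D g.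
Proof.
move=> mD [f1 f2] [g1 g2] e; rewrite /cintegral /Rintegral; congr (fine _ +i* fine _).
- apply: ae_eq_integral => //; [exact: measurable_int f1|exact: measurable_int g1|].
  by apply: filterS e => x h Dx; rewrite h.
- apply: ae_eq_integral => //; [exact: measurable_int f2|exact: measurable_int g2|].
  by apply: filterS e => x h Dx; rewrite h.
Qed.

(** * Reflections *)
Section reflection.
Context {R : realType} (V W : lmodType R[i]) (D : set V) (ip : V -> V -> R[i]).
Variables (W0 : set W) (ipW : W -> W -> R[i]) (th : V -> W) (G : set V) (Pi : W -> W).
Hypothesis sip : semi_ip D ip.
Hypothesis sipW : semi_ip W0 ipW.
Hypothesis th_dom : forall u, D u -> W0 (th u).
Hypothesis th_comb : forall a u v, D u -> D v -> th (a *: u + v) = a *: th u + th v.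
Hypothesis th_surj : forall x, W0 x -> exists2 u, D u & th u = x.
Hypothesis th_null : forall u, D u -> seminorm_of ip u = 0 -> th u = 0.
Hypothesis ipW_th : forall u v, D u -> D v -> ipW (th u) (th v) = ip u v.
Hypotheses (sG : subspace G) (GD : forall w, G w -> D w).
Hypothesis Pi_th : forall u, D u -> exists w, [/\ G w,
  forall z, G z -> ip (u - w) z = 0 & Pi (th u) = 2%:R *: th w - th u].
Let sD := sip_sub sip.

Lemma reflection_dom x : W0 x -> W0 (Pi x).
Proof.
move=> Dx; have [u Du <-] := th_surj Dx; have [w [gw _ ->]] := Pi_th Du.
apply: (subspaceB (sip_sub sipW)); last exact: th_dom.
by apply: (subspaceZ (sip_sub sipW)); apply: th_dom; exact: GD.
Qed.

Lemma reflection_isometry x : W0 x -> seminorm_of ipW (Pi x) = seminorm_of ipW x.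
Proof.
move=> Dx; have [u Du <-] := th_surj Dx; have [w [gw ow ->]] := Pi_th Du.
have Dw := GD gw; have Duw : D (u - w) by exact: subspaceB.
have e1 : 2%:R *: th w - th u = th (-1 *: (u - w) + w).
  have e2 : th (u - w) = th u - th w by rewrite addrC -scaleN1r th_comb// scaleN1r addrC.
  by rewrite th_comb// e2 scaleN1r opprB addrAC scaler_nat mulr2n.
rewrite e1; have h u' : D u' -> seminorm_of ipW (th u') = seminorm_of ip u'.
  by move=> Du'; rewrite /seminorm_of ipW_th.
rewrite !h//; last exact: (subspace_comb sD).
have ewu : ip w (u - w) = 0 by rewrite (sip_herm sip Duw Dw) ow// conjc0.
have h1 := sn_pythagoras sip Dw (subspaceN sD Duw).
have h2 := sn_pythagoras sip Dw Duw ewu.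
have w2 : w + (u - w) = u by rewrite addrC subrK.
apply/eqP; rewrite -(@eqrXn2 _ 2) ?sn_ge0//; apply/eqP.
rewrite scaleN1r [- _ + w]addrC h1; last by rewrite (sipNr sip)// ewu oppr0.
by rewrite (snN sip)// -h2 w2.
Qed.

Lemma reflection_unique u w : D u -> G w -> (forall z, G z -> ip (u - w) z = 0) ->
  Pi (th u) = 2%:R *: th w - th u.
Proof.
move=> Du gw ow; have [w' [gw' ow' ->]] := Pi_th Du.
have Dw := GD gw; have Dw' := GD gw'; congr (_ *: _ - _).
have gd : G (w' - w) by exact: (subspaceB sG).
have Dd := GD gd.
have w0 : seminorm_of ip (w' - w) = 0.
  have e : w' - w = (u - w) - (u - w') by rewrite subrr_swap subrr sub0r opprB.
  rewrite /seminorm_of {1}e (sipBl sip) ?ow ?ow' ?subrr ?sqrtr0//; exact: subspaceB.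
have := th_null Dd w0.
rewrite addrC -scaleN1r th_comb// scaleN1r addrC => /eqP.
by rewrite subr_eq0 => /eqP.
Qed.

Lemma reflection_linear a x y : W0 x -> W0 y -> Pi (a *: x + y) = a *: Pi x + Pi y.
Proof.
move=> Dx Dy; have [u Du <-] := th_surj Dx; have [v Dv <-] := th_surj Dy.
have [w [gw ow ->]] := Pi_th Du; have [z [gz oz ->]] := Pi_th Dv.
have Dw := GD gw; have Dz := GD gz; rewrite -th_comb//.
rewrite (@reflection_unique _ (a *: w + z)); [|exact: (subspace_comb sD)|exact: (subspace_comb sG)|].
  by rewrite !th_comb// !scalerDr scalerN !scalerA [a * _]mulrC opprD addrACA.
move=> t gt; have Dt := GD gt.
have -> : a *: u + v - (a *: w + z) = a *: (u - w) + (v - z).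
  by rewrite scalerBr opprD addrACA.
by rewrite (sip_lin sip) ?ow ?oz ?mulr0 ?addr0//; exact: subspaceB.
Qed.

Lemma reflection_involutive x : W0 x -> Pi (Pi x) = x.
Proof.
move=> Dx; have [u Du <-] := th_surj Dx; have [w [gw ow ->]] := Pi_th Du.
have Dw := GD gw.
have Dr : D (2%:R *: w + (-1) *: u).
  by apply: (subspace_comb sD) => //; exact: subspaceZ.
have e : 2%:R *: th w - th u = th (2%:R *: w + (-1) *: u).
  rewrite th_comb//; last exact: subspaceZ.
  by rewrite -[_ *: u]addr0 th_comb// ?scaleN1r; [|exact: (subspace0 sD)];
    rewrite (th_null (subspace0 sD) (sn0 sip)) addr0.
rewrite e (@reflection_unique _ w)//; first by rewrite -e opprB addrC subrK.
move=> z gz; have Dz := GD gz.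
have -> : 2%:R *: w + -1 *: u - w = - (u - w).
  by rewrite scaler_nat mulr2n scaleN1r opprB addrAC addrK.
by rewrite (sipNl sip) ?ow ?oppr0//; exact: subspaceB.
Qed.

End reflection.

Section exchange_and_scattering.
Context {R : realType} {d J : nat} (P : helmholtz R d J).
Local Notation C := R[i].
Local Notation E := 'rV[R]_d.+1.
Local Notation surf := (@surf R d).
Local Notation Ts := (caratheodory_type (@hausdorff_outer R d.+1 d)).
Local Notation GF := (gradfun R d).
Local Notation D := (HOmega_dom P).
Local Notation Om := (Om P).
Local Notation Omj := (Omj P).
Local Notation energy := (energy P).
Local Notation en := (seminorm_of energy).
Local Notation trace_eq := (trace_eq P).
Local Notation traceless := (traceless P).
Local Notation imp := (impedance_form P).
Local Notation tn := (seminorm_of imp).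
Local Notation theta := (@impedance_functional R d J P).
Local Notation glued := (glued P).
Implicit Types (u v w : 'I_J -> GF) (p q : 'I_J -> E -> C).

Hypothesis adm : admissible P.
Let tip := impedance_semi_ip adm.
Let sD := HOmega_subspace adm.
Let sH := HSigma_subspace adm.
Let Tb := adm_T_bounded adm.
Let trefl p : trace_eq p p := @trace_eq_refl R d J P p.
Let D0 : D 0 := subspace0 sD.
Let DB u v : D u -> D v -> D (u - v). Proof. exact: (subspaceB sD). Qed.
Let DC a u v : D u -> D v -> D (a *: u + v). Proof. exact: (subspace_comb sD). Qed.

Lemma theta_null u : D u -> tn u = 0 -> theta u = 0.
Proof.
move=> Du u0; have e := theta_comb adm 1 D0 D0.
have t0 : theta 0 = 0.
  move: e; rewrite scaler0 addr0 scale1r => /eqP.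
  by rewrite -subr_eq0 opprD addNKr oppr_eq0 => /eqP.
have tu := impedance_definite adm Du u0.
rewrite -t0; apply: (theta_eq adm Du D0); apply: (traceless_trace_eq adm Du D0).
by rewrite subr0.
Qed.

Lemma theta_B u v : D u -> D v -> theta (u - v) = theta u - theta v.
Proof.
by move=> Du Dv; have := theta_comb adm (-1) Dv Du; rewrite !scaleN1r addrC [RHS]addrC.
Qed.

(** * The exchange operator *)

Let sG : @subspace R ('I_J -> GF) glued. Proof. exact: (csub_subspace (glued_closed adm)). Qed.
Let GD w : glued w -> D w. Proof. by case. Qed.

Lemma Rop_lift (g : HhalfSigma P) : ndom g ->
  exists2 U, H1dom Om U & trace_eq (Rop P g) (Bop P (fun=> U)).
Proof.
move=> [U HU gU]; exists U => // j.
apply: filterS2 (gU) (trace_skeleton adm j HU) => x h1 h2 xj.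
by rewrite h2// /Rop /ext0 mem_set// h1//; exact: Sigma_sub xj.
Qed.

Lemma Rop_trSigma U : H1dom Om U ->
  ndom (trSigma P U : HhalfSigma P) /\ trace_eq (Rop P (trSigma P U)) (Bop P (fun=> U)).
Proof.
move=> HU; split; first by exists U => //; apply: filterE.
move=> j; apply: filterS (trace_skeleton adm j HU) => x h xj.
by rewrite h// /Rop /ext0 mem_set.
Qed.

Lemma RTR_theta (g h : HhalfSigma P) w : ndom g -> ndom h -> D w ->
  trace_eq (Rop P g) (Bop P w) -> RTR P g h = theta w (Rop P h).
Proof.
move=> Dg Dh Dw e; have [V HV he] := Rop_lift Dh.
have DV := Bop_dom (restriction_dom adm HV).
rewrite /RTR /adjoint /ext0 mem_set//.
rewrite (dual_trace_eq adm (theta_dom adm Dw) DV he).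
exact: (block_eq adm Tb (Bop_dom Dw) DV e he).
Qed.

Lemma glued_conj_lift z : glued z ->
  exists2 g : HhalfSigma P, ndom g & trace_eq (Rop P g) (conj_trace (Bop P z)).
Proof.
move=> gz; have [V HV ze] := glued_extension adm gz.
have HV' := H1_conj (open_Om adm) HV.
have [Dg ge] := Rop_trSigma HV'; exists (trSigma P (conj_gradfun V)) => //.
apply: trace_eq_trans ge _.
apply: (trace_eq_trans (Bop_conj adm (restriction_dom adm HV))).
exact: trace_eq_conj (trace_eq_sym ze).
Qed.

Lemma conj_glued U : H1dom Om U -> glued (conj_field (fun=> U)).
Proof. by move=> HU; exact: (restriction_glued adm (H1_conj (open_Om adm) HU)). Qed.

Lemma theta_Rop u (g : HhalfSigma P) : D u -> ndom g ->
  exists2 z, glued z & theta u (Rop P g) = imp u z.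
Proof.
move=> Du Dg; have [V HV ge] := Rop_lift Dg; exists (conj_field (fun=> V)).
  exact: conj_glued.
have DV := restriction_dom adm HV.
by rewrite (dual_trace_eq adm (theta_dom adm Du) (Bop_dom DV) ge) theta_Bop.
Qed.

(** [R (R^* T R)^-1 R^*] solves the normal equations of the projection onto the
    fields with a single trace on the skeleton, so [Pi] is the reflection across
    their image. The projection of [u], which exists by completeness, shows that
    the normal equations have a solution, and any solution will do. *)
Lemma Piop_exists u : D u -> exists w, [/\ glued w,
  forall z, glued z -> imp (u - w) z = 0 & Piop P (theta u) = 2%:R *: theta w - theta u].
Proof.
move=> Du.
have [w gw ort] := orthogonal_projection tip (impedance_complete adm) (glued_impedance_closed adm) Du.
have Dw := GD gw; have Duw := DB Du Dw.
have [U HU we] := glued_extension adm gw.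
have [Dg ge] := Rop_trSigma HU.
have ex : exists2 g : HhalfSigma P, ndom g & RTR P g = adjoint (Rop P) (theta u).
  exists (trSigma P U) => //; apply/funext => h; have [Dh|nDh] := pselect (@ndom R (HhalfSigma P) h); last first.
    by rewrite /RTR /adjoint /ext0 !memNset.
  rewrite (RTR_theta Dg Dh Dw (trace_eq_trans ge (trace_eq_sym we))) /adjoint /ext0 mem_set//.
  have [z gz e] := theta_Rop Duw Dh.
  apply/esym/eqP; rewrite -subr_eq0; apply/eqP.
  by rewrite -[LHS]/((theta u - theta w) (Rop P h)) -(theta_B Du Dw) e ort.
have [Dv Rv] := inverse_spec ex; have [V HV ve] := Rop_lift Dv.
set v := inverse _ _ in Dv Rv ve.
have gV := restriction_glued adm HV; have DV := restriction_dom adm HV.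
have DuV := DB Du DV.
exists (fun=> V); split=> //.
- move=> z gz; have [g Dg' gz'] := glued_conj_lift gz; have Dz := GD gz.
  rewrite -theta_conj// -(dual_trace_eq adm (theta_dom adm DuV) (HSigma_conj adm (Bop_dom Dz)) gz').
  rewrite (theta_B Du DV) -[LHS]/(theta u (Rop P g) - theta (fun=> V) (Rop P g)).
  rewrite -(RTR_theta Dv Dg' DV ve) Rv /adjoint /ext0 mem_set// subrr//.
rewrite /Piop -/v (_ : Top P (Rop P v) = theta (fun=> V)) //.
apply: (dual_ext adm) => [||z Dz].
- have [c c0 hc] := Top_bounded adm; have Dp := HSigma_eq (Bop_dom DV) ve; split.
  + move=> a p q Hp Hq; exact: (block_linr adm Tb a Dp Hp Hq).
  + exists (c * en (fun=> V)) => p Hp; have := hc _ _ DV Hp.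
    rewrite (_ : Top P (Bop P (fun=> V)) p = Top P (Rop P v) p)//.
    exact/esym/(block_eq adm Tb (Bop_dom DV) Hp ve (trefl _)).
  + by move=> p nD; rewrite /Top /ext0 memNset.
- exact: theta_dom.
have Dz' := HSigma_conj adm (Bop_dom Dz).
exact: (block_eq adm Tb (Bop_dom DV) Dz' ve (trefl _)).
Qed.

Let Pi_reflection := Piop_exists.
Let isip := inverse_form_semi_ip adm.

Lemma Piop_dom (x : HSigma' P) : ndom x -> ndom (Piop P x).
Proof.
exact: (reflection_dom isip (theta_dom adm) (theta_surj adm) GD Pi_reflection).
Qed.

Lemma Piop_isometry (x : HSigma' P) : ndom x -> Tinv_norm (Piop P x) = Tinv_norm x.
Proof.
rewrite !Tinv_normE; exact: (reflection_isometry tip (theta_comb adm)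
  (theta_surj adm) (inverse_form_theta adm) GD Pi_reflection).
Qed.

Lemma Piop_linear a (x y : HSigma' P) : ndom x -> ndom y ->
  Piop P (a *: x + y) = a *: Piop P x + Piop P y.
Proof.
exact: (reflection_linear tip (theta_comb adm) (theta_surj adm) theta_null sG GD Pi_reflection).
Qed.

Lemma Piop_involutive (x : HSigma' P) : ndom x -> Piop P (Piop P x) = x.
Proof.
exact: (reflection_involutive tip (theta_comb adm) (theta_surj adm) theta_null sG GD Pi_reflection).
Qed.

(** * The scattering operator *)

Definition local_solution (q : HSigma' P) : 'I_J -> GF :=
  inverse (AT P) (adjoint (Bop P) q).

Lemma adjoint_Bop_dom (q : HSigma' P) : ndom q ->
  ndom (adjoint (Bop P) q : dual (HOmega P)).
Proof.
move=> Dq; have [lin _ _] := Dq; have [c c0 hc] := dual_le_Tinv adm.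
apply: (@ext0_dual R (HOmega P) sD (fun u => q (Bop P u)) (c * Tinv_norm q)).
- move=> a u v Du Dv.
  have Dc := subspace_comb sH a (Bop_dom Du) (Bop_dom Dv).
  rewrite (dual_trace_eq adm Dq Dc (Bop_comb adm a Du Dv)).
  by rewrite lin//; exact: Bop_dom.
- by move=> u Du; rewrite (HOmega_nrm adm Du); exact: hc.
Qed.

Lemma ATE u v : D v -> AT P u v = Aop P u v - 'i * theta u (Bop P v).
Proof.
move=> Dv; rewrite -[LHS]/(Aop P u v - 'i * adjoint (Bop P) (Top P (Bop P u)) v).
by rewrite /adjoint /ext0 mem_set.
Qed.

Lemma local_solution_spec (q : HSigma' P) : ndom q -> D (local_solution q) /\
  AT P (local_solution q) = adjoint (Bop P) q.
Proof.
move=> Dq; have [_ surj _] := adm_AT adm.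
exact: inverse_spec (surj _ (adjoint_Bop_dom Dq)).
Qed.

Lemma local_solution_eq (q : HSigma' P) v : ndom q -> D v ->
  Aop P (local_solution q) v - 'i * theta (local_solution q) (Bop P v) = q (Bop P v).
Proof.
move=> Dq Dv; have [Dw e] := local_solution_spec Dq.
by rewrite -ATE// e /adjoint /ext0 mem_set.
Qed.

Lemma AT_inj_energy u v : D u -> D v -> AT P u = AT P v -> en (u - v) = 0.
Proof.
move=> Du Dv e; have [[_ lin _] _ [c hc]] := adm_AT adm.
have Dd := DB Du Dv.
have AT0 : AT P (u - v) = 0.
  by have := lin (-1) v u Dv Du; rewrite !scaleN1r addrC => ->; rewrite e addrC subrr.
have n0 : @nnrm R (dual (HOmega P)) 0 = 0.
  apply/eqP; rewrite eq_le dual_nrm_ge0 andbT; apply: dual_nrm_le => // w Dw.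
  by rewrite mul0r Normc.normc0.
have := hc _ Dd; rewrite AT0 n0 mulr0 (HOmega_nrm adm Dd) => h.
by apply/eqP; rewrite eq_le h sn_ge0.
Qed.

Lemma AT_inj u v : D u -> D v -> AT P u = AT P v -> theta u = theta v.
Proof.
move=> Du Dv e; apply: (theta_eq adm Du Dv); apply: (traceless_trace_eq adm Du Dv).
exact: (energy_null_traceless adm (DB Du Dv) (AT_inj_energy Du Dv e)).
Qed.

Lemma local_solution_linear a (x y : HSigma' P) : ndom x -> ndom y ->
  theta (local_solution (a *: x + y)) =
  a *: theta (local_solution x) + theta (local_solution y).
Proof.
move=> Dx Dy; have Dxy := subspace_comb (HSigma'_subspace P) a Dx Dy.
have [Du eu] := local_solution_spec Dx; have [Dv ev] := local_solution_spec Dy.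
have [Dw ew] := local_solution_spec Dxy; have [[_ lin _] _ _] := adm_AT adm.
rewrite -(theta_comb adm a Du Dv); apply: (AT_inj Dw (DC a Du Dv)).
rewrite ew (lin a _ _ Du Dv) eu ev; apply/funext => u.
rewrite -[RHS]/(a * adjoint (Bop P) x u + adjoint (Bop P) y u) /adjoint /ext0.
by case: ifP => // _; rewrite mulr0 addr0.
Qed.

Lemma local_solution_bounded : exists2 c, 0 < c &
  forall q : HSigma' P, ndom q -> en (local_solution q) <= c * Tinv_norm q.
Proof.
have [_ _ [c hc]] := adm_AT adm; have [c' c0' hc'] := dual_le_Tinv adm.
exists ((`|c| + 1) * c'); first by rewrite mulr_gt0// ltr_wpDl.
move=> q Dq; have [Du eu] := local_solution_spec Dq.
have T0 : 0 <= Tinv_norm q by exact: sqrtr_ge0.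
rewrite -(HOmega_nrm adm Du); apply: le_trans (hc _ Du) _; rewrite eu.
apply: (@le_trans _ _ ((`|c| + 1) * @nnrm R (dual (HOmega P)) (adjoint (Bop P) q))).
  by rewrite ler_wpM2r ?dual_nrm_ge0//; have := ler_norm c; lra.
rewrite -mulrA ler_wpM2l ?addr_ge0//; apply: dual_nrm_le.
  by rewrite mulr_ge0// ltW.
move=> u Du'; rewrite /adjoint /ext0 mem_set// (HOmega_nrm adm Du'); exact: hc'.
Qed.

Lemma SopE (q : HSigma' P) : Sop P q = (2%:R * 'i) *: theta (local_solution q) + q.
Proof. by []. Qed.

Lemma Sop_dom (q : HSigma' P) : ndom q -> ndom (Sop P q).
Proof.
move=> Dq; have [Du _] := local_solution_spec Dq.
by apply: (subspace_comb (HSigma'_subspace P)) => //; exact: theta_dom.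
Qed.

Lemma Sop_linear a (x y : HSigma' P) : ndom x -> ndom y ->
  Sop P (a *: x + y) = a *: Sop P x + Sop P y.
Proof.
move=> Dx Dy; rewrite !SopE local_solution_linear// !scalerDr !scalerA mulrC.
by rewrite addrACA.
Qed.

(** Energy is only lost, through the absorbing boundary. *)
Lemma Aop_dissipative u : D u -> Im (Aop P u (conj_field u)) <= 0.
Proof.
move=> Du; have Du' := conj_field_dom adm Du.
rewrite /Aop /ext0 mem_set// (big_morph (@complex.Im R) (@cImD R) (erefl _)).
apply: sumr_le0 => j _.
have oj := open_Omj adm j; have mj := open_leb oj.
have Lu := H1_pairs oj (Du j); have [u1 u2] := Lu.
have Ig : Im (grad_form (Omj j) (u j) (conj_field u j)) = 0.
  rewrite (grad_form_L2form oj Lu Lu) (big_morph (@complex.Im R) (@cImD R) (erefl _)).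
  by rewrite big1// => i _; rewrite (sip_self (L2form_semi_ip _ mj) (u2 i)).
have Imass : Im (mass_form (Omj j) (u j) (conj_field u j)) = 0.
  by rewrite [mass_form _ _ _](sip_self (L2form_semi_ip _ mj) u1).
pose G : set Ts := bd Om `&` bd (Omj j).
have mG : measurable G by apply: measurableI; exact: measurable_bd.
have mb : measurable (bd (Omj j) : set Ts) by exact: measurable_bd.
have [trL _ _ _ _] := adm_trace adm j.
have GB : G `<=` bd (Omj j) by move=> x [].
have L1 : L2 surf G (Bj P j (u j)) := L2_subset mG mb GB (trL _ (Du j)).
have L2' : L2 surf G (Bj P j (conj_field u j)) := L2_subset mG mb GB (trL _ (Du' j)).
have eB : cintegral surf G (fun x : E => Bj P j (u j) x * Bj P j (conj_field u j) x) =
    L2form surf G (Bj P j (u j)) (Bj P j (u j)).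
  apply: (cintegral_ae mG (cintegrable_mul mG L1 L2') (cintegrable_mul mG L1 (L2_conj L1))).
  apply: filterS (Bop_conj adm Du j) => x h /GB xj.
  by rewrite -[Bj P j _ x in LHS]/(Bop P _ j x) -[Bj P j (conj_field u j) x]/(Bop P (conj_field u) j x) h.
rewrite eB (sip_self (L2form_semi_ip surf mG) L1).
rewrite !cImD !cImN cImM cReC cImC Ig Imass /= !(mulr0, mul0r, add0r, subr0, addr0, sub0r, oppr0).
rewrite !(mul1r, mul0r, addr0, subr0, oppr0).
rewrite oppr_le0 mulr_ge0 ?sqr_ge0//; exact: adm_kappas adm.
Qed.

(** With [w] the local solution for [q = T (B u)], expanding the square of
    [2 i w + u] and testing the equation of [w] with its conjugate leave
    [4 Im <A w, conj w>] as the difference of the squared norms. *)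
Lemma Sop_contraction (q : HSigma' P) : ndom q -> Tinv_norm (Sop P q) <= Tinv_norm q.
Proof.
move=> Dq; have [Dw _] := local_solution_spec Dq; have [u Du uq] := theta_surj adm Dq.
rewrite SopE; set w := local_solution q in Dw *.
rewrite -uq -(theta_comb adm _ Dw Du) (Tinv_theta adm (DC _ Dw Du)) (Tinv_theta adm Du).
rewrite -(@ler_pXn2r _ 2) ?nnegrE ?sn_ge0// (sn_expand tip _ Dw Du) gerDr.
have Dw' := conj_field_dom adm Dw.
have := local_solution_eq Dq Dw'; rewrite -/w -uq (theta_Bop adm Dw Dw') (theta_Bop adm Du Dw') conj_fieldK => e.
have diss := Aop_dissipative Dw.
have iwu : imp w u = conjc (imp u w) := (sip_herm tip Du Dw).
rewrite iwu -e (sip_self tip Dw).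
have n2 : normc (2%:R * 'i : C) ^+ 2 = 4 by rewrite normc_sqr /=; ring.
have re2i (z : C) : Re (2%:R * 'i * z) = - 2 * Im z by case: z => a b /=; ring.
rewrite n2 re2i cImJ cImD cImN cImM cReC cImC.
move: diss; set a := Im _; set t := _ ^+ 2; rewrite /=; lra.
Qed.

End exchange_and_scattering.

(** * Singular values *)
Section singular_values.
Context {R : realType} (X Y : nspace R).
Implicit Types L F : X -> Y.
Hypothesis X0 : forall u : X, ndom u -> 0 <= nnrm u.
Hypothesis sY : subspace (@ndom R Y).
Hypothesis Y0 : @nnrm R Y 0 = 0.
Hypothesis nrmB : forall y z : Y, ndom y -> ndom z -> nnrm (y - z) <= nnrm y + nnrm z.

Lemma opnorm_ge0 L : 0 <= opnorm L.
Proof. by apply: inf_ge0 => x []. Qed.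

Lemma opnorm_le L (c : R) : 0 <= c -> (forall u, ndom u -> nnrm (L u) <= c * nnrm u) ->
  opnorm L <= c.
Proof. by move=> c0 hc; apply: ge_inf; [exists 0 => x []|]. Qed.

Lemma opnorm_bound L u : (exists c, forall v, ndom v -> nnrm (L v) <= c * nnrm v) ->
  ndom u -> nnrm (L u) <= opnorm L * nnrm u.
Proof.
move=> [c hc] Du.
have ne : [set c : R | 0 <= c /\ forall v, ndom v -> nnrm (L v) <= c * nnrm v] !=set0.
  exists `|c|; split=> // v Dv; apply: le_trans (hc v Dv) _.
  by rewrite ler_wpM2r ?X0// ler_norm.
have := X0 Du; rewrite le_eqVlt => /orP[/eqP u0|u0].
  by case: ne => b [b0 hb]; have := hb _ Du; rewrite -u0 !mulr0.
rewrite -ler_pdivrMr//; apply: lb_le_inf => // b [b0 hb].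
by rewrite ler_pdivrMr//; exact: hb.
Qed.

Lemma bounded_opB L F : bounded_op L -> bounded_op F -> bounded_op (fun u => L u - F u).
Proof.
move=> [LD LL [c hc]] [FD FL [b hb]]; split.
- by move=> u Du; apply: (subspaceB sY); [exact: LD|exact: FD].
- move=> a u v Du Dv; rewrite LL// FL// scalerBr opprD addrACA//.
exists (c + b) => u Du; apply: le_trans (nrmB (LD _ Du) (FD _ Du)) _.
by rewrite mulrDl lerD// ?hc ?hb.
Qed.

Let approximants j := [set F | bounded_op F /\ exists2 m, (m < j)%N & @rank_le R X Y F m].

Lemma singular_value_ge0 L j : 0 <= singular_value L j.
Proof. by apply: inf_ge0 => _ [F _ <-]; exact: opnorm_ge0. Qed.

Lemma singular_value_le L F j m (c : R) : bounded_op F -> rank_le F m -> (m < j)%N ->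
  0 <= c -> (forall u, ndom u -> nnrm (L u - F u) <= c * nnrm u) -> singular_value L j <= c.
Proof.
move=> bF rF mj c0 hc; apply: le_trans (opnorm_le c0 hc).
apply: ge_inf; first by exists 0 => _ [G _ <-]; exact: opnorm_ge0.
by exists F => //; split=> //; exists m.
Qed.

Lemma bounded_op0 : bounded_op ((fun=> 0) : X -> Y).
Proof.
split=> [u _|a u v _ _|]; first exact: (subspace0 sY).
  by rewrite scaler0 addr0.
by exists 0 => u _; rewrite Y0 mul0r.
Qed.

Lemma singular_value_approx L j (e : R) : bounded_op L -> (0 < j)%N -> 0 < e ->
  exists F, [/\ bounded_op F, exists2 m, (m < j)%N & rank_le F m &
    forall u, ndom u -> nnrm (L u - F u) <= (singular_value L j + e) * nnrm u].
Proof.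
move=> bL j0 e0.
have [|_ [F [bF rF] <-] lt] := @inf_adherent _ [set opnorm (fun u => L u - F u) | F in approximants j] e e0.
  split; last by exists 0 => _ [G _ <-]; exact: opnorm_ge0.
  exists (opnorm (fun u => L u - 0)); exists (fun=> 0) => //; split; first exact: bounded_op0.
  exists 0%N => //; exists (fun=> 0) => u Du; exists (fun=> 0); by rewrite big_ord0.
exists F; split=> // u Du.
have bd : exists c : R, forall v : X, ndom v -> nnrm (L v - F v) <= c * nnrm v.
  by have [_ _] := bounded_opB bL bF.
apply: le_trans (opnorm_bound bd Du) _; rewrite ler_wpM2r ?X0//; exact: ltW.
Qed.

Lemma singular_value_antitone L i j : bounded_op L -> (0 < i)%N -> (i <= j)%N ->
  singular_value L j <= singular_value L i.
Proof.
move=> bL i0 ij; apply/ler_addgt0Pr => e e0.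
have [F [bF [m mi rF] hF]] := singular_value_approx bL i0 e0.
apply: (singular_value_le bF rF (leq_trans mi ij)) => //.
by rewrite addr_ge0 ?singular_value_ge0// ltW.
Qed.

(** An operator of rank 0 vanishes, so the first singular value is the norm. *)
Lemma singular_value1 L u : bounded_op L -> ndom u -> nnrm (L u) <= singular_value L 1 * nnrm u.
Proof.
move=> bL Du.
have [n0|n0] := eqVneq (nnrm u) 0.
  by have := opnorm_bound (let: And3 _ _ h := bL in h) Du; rewrite n0 !mulr0.
have {n0} u0 : 0 < nnrm u by rewrite lt_def n0 X0.
rewrite -ler_pdivrMr//; apply/ler_addgt0Pr => e e0.
have [F [bF [m m1 rF] hF]] := singular_value_approx bL (ltnSn 0) e0.
rewrite ler_pdivrMr//; have := hF _ Du; have -> : F u = 0.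
  move: m m1 rF => [|//] _ [w hw]; have [c ->] := hw _ Du; by rewrite big_ord0.
by rewrite subr0.
Qed.

End singular_values.

(** * Schatten sums *)
Section schatten_sums.
Context {R : realType}.

Lemma schatten_partial (X Y : nspace R) (p : R) (L : X -> Y) n : (schatten_sum p L < +oo)%E ->
  \sum_(i < n) singular_value L i.+1 `^ p <= fine (schatten_sum p L).
Proof.
move=> fin; have t0 j : (0 <= (singular_value L j `^ p)%:E)%E by rewrite lee_fin powR_ge0.
have s0 : (0 <= schatten_sum p L)%E by apply: nneseries_ge0.
rewrite -lee_fin fineK ?ge0_fin_numE//.
apply: le_trans (@nneseries_lim_ge R (fun j => (singular_value L j `^ p)%:E) xpredT 1 n.+1 _) => //.
by rewrite big_add1 /= big_mkord sumEFin.
Qed.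

Lemma schatten_finite (X Y : nspace R) (p : R) (L : X -> Y) (M : R) :
  (forall n, \sum_(i < n) singular_value L i.+1 `^ p <= M) -> (schatten_sum p L < +oo)%E.
Proof.
move=> hM; apply: (@le_lt_trans _ _ M%:E); last exact: ltry.
apply: lime_le; first by apply: is_cvg_nneseries => j _ _; rewrite lee_fin powR_ge0.
apply: nearW => -[|n]; last first.
  by rewrite big_add1 /= big_mkord sumEFin lee_fin.
by rewrite big_geq// lee_fin; have := hM 0%N; rewrite big_ord0.
Qed.

(** The missing terms are at most their predecessors, because [s] is antitone. *)
Lemma power_sum_bounded (s A B : nat -> R) (p c MA MB : R) (r : nat) : 1 <= p -> 0 <= c ->
  (forall j, 0 <= s j) -> (forall j, 0 <= A j) -> (forall j, 0 <= B j) ->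
  (forall i j, (i <= j)%N -> s j <= s i) ->
  (forall m, s (r + m.*2)%N <= c * (A m + B m)) ->
  (forall n, \sum_(i < n) A i `^ p <= MA) -> (forall n, \sum_(i < n) B i `^ p <= MB) ->
  exists M, forall n, \sum_(i < n) s i `^ p <= M.
Proof.
move=> p1 c0 s0 A0 B0 anti hs hA hB.
have p0 : 0 <= p by exact: le_trans ler01 p1.
have mono (a b : R) : 0 <= a -> a <= b -> a `^ p <= b `^ p.
  by move=> a0 ab; apply: ge0_ler_powR; rewrite ?nnegrE// (le_trans a0).
pose K := c `^ p * 2 `^ p.
have K0 : 0 <= K by rewrite mulr_ge0 ?powR_ge0.
have term m : s (r + m.*2)%N `^ p <= K * (A m `^ p + B m `^ p).
  have ab : (A m + B m) `^ p <= 2 `^ p * (A m `^ p + B m `^ p).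
    have [le|/ltW le] := leP (A m) (B m).
      apply: (@le_trans _ _ ((2 * B m) `^ p)); first by apply: mono; rewrite ?addr_ge0//; lra.
      by rewrite powRM// ler_wpM2l ?powR_ge0// lerDr powR_ge0.
    apply: (@le_trans _ _ ((2 * A m) `^ p)); first by apply: mono; rewrite ?addr_ge0//; lra.
    by rewrite powRM// ler_wpM2l ?powR_ge0// lerDl powR_ge0.
  apply: le_trans (mono _ _ (s0 _) (hs m)) _; rewrite powRM ?addr_ge0// /K -mulrA.
  by rewrite ler_wpM2l ?powR_ge0.
pose M0 := \sum_(i < r) s i `^ p.
have even N : \sum_(i < r + N.*2) s i `^ p <=
    M0 + 2 * K * (\sum_(i < N) A i `^ p + \sum_(i < N) B i `^ p).
  elim: N => [|N IH]; first by rewrite double0 addn0 !big_ord0 addr0 mulr0 addr0.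
  rewrite doubleS !addnS !big_ord_recr /=.
  have h1 := term N.
  have h2 : s (r + N.*2).+1 `^ p <= K * (A N `^ p + B N `^ p).
    by apply: le_trans h1; apply: mono => //; exact: anti.
  have := lerD (lerD IH h1) h2; move=> h; apply: le_trans h _; rewrite le_eqVlt; apply/orP; left; apply/eqP; ring.
exists (M0 + 2 * K * (MA + MB)) => n.
apply: (@le_trans _ _ (\sum_(i < r + n.*2) s i `^ p)).
  have le_n : (n <= r + n.*2)%N by rewrite -addnn addnA leq_addl.
  rewrite -(subnKC le_n) big_split_ord /= lerDl sumr_ge0// => i _; exact: powR_ge0.
apply: le_trans (even n) _; rewrite lerD2l; apply: ler_wpM2l; [exact: mulr_ge0|exact: lerD].
Qed.

Lemma rank_leD (X Y : nspace R) (L F : X -> Y) m n : rank_le L m -> rank_le F n ->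
  rank_le (fun u => L u + F u) (m + n).
Proof.
move=> [w hw] [z hz]; exists (fun i : 'I_(m + n) => match fintype.split i with inl a => w a | inr b => z b end) => u Du.
have [a La] := hw _ Du; have [b Fb] := hz _ Du.
exists (fun i : 'I_(m + n) => match fintype.split i with inl k => a k | inr k => b k end).
rewrite big_split_ord La Fb; congr (_ + _); apply: eq_bigr => i _.
- by rewrite (unsplitK (inl i)).
- by rewrite (unsplitK (inr i)).
Qed.

Lemma rank_leZ (X Y : nspace R) (L : X -> Y) m (c : R[i]) : rank_le L m ->
  rank_le (fun u => c *: L u) m.
Proof.
move=> [w hw]; exists w => u Du; have [a La] := hw _ Du; exists (fun i => c * a i).
by rewrite La scaler_sumr; apply: eq_bigr => i _; rewrite scalerA.
Qed.

End schatten_sums.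

(** * Approximation of the scattering operator by finite rank *)
Lemma sum_scale_app (R : realType) (T : Type) n (c : 'I_n -> R[i]) (h : 'I_n -> T -> R[i]) x :
  (\sum_i c i *: h i) x = \sum_i c i * h i x.
Proof. by rewrite fct_sumE. Qed.

Section scattering_compactness.
Context {R : realType} {d J : nat} (P : helmholtz R d J).
Local Notation C := R[i].
Local Notation E := 'rV[R]_d.+1.
Local Notation GF := (gradfun R d).
Local Notation D := (HOmega_dom P).
Local Notation energy := (energy P).
Local Notation en := (seminorm_of energy).
Local Notation HS := (HSigma_dom P).
Local Notation trace_eq := (trace_eq P).
Local Notation traceless := (traceless P).
Local Notation nH := (@nnrm R (HSigma P)).
Local Notation theta := (@impedance_functional R d J P).
Local Notation sol := (@local_solution R d J P).
Local Notation dualO := (dual (HOmega P)).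
Local Notation dualS := (dual (HSigma P)).
Implicit Types (u v w : 'I_J -> GF) (p q : 'I_J -> E -> C).

Hypothesis adm : admissible P.
Let eip := energy_semi_ip adm.
Let sD := HOmega_subspace adm.
Let sH := HSigma_subspace adm.
Let sh := harmonic_subspace adm.
Let Tpb j : bounded_op (Tplusj P j : Hhalf P j -> dual (Hhalf P j)).
Proof. by case: (adm_DtN adm j). Qed.
Let trefl p : trace_eq p p := @trace_eq_refl R d J P p.
Let HS0 (p : HSigma P) : ndom p -> 0 <= nnrm p. Proof. by move=> _; exact: HSigma_nrm_ge0. Qed.
Let HO0 (u : HOmega P) : ndom u -> 0 <= nnrm u. Proof. by move=> _; exact: sqrtr_ge0. Qed.
Let DB u v : D u -> D v -> D (u - v). Proof. exact: (subspaceB sD). Qed.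
Let DC a u v : D u -> D v -> D (a *: u + v). Proof. exact: (subspace_comb sD). Qed.

(** The traceless part of [w] is orthogonal to [v], so that [w] can be replaced by
    its harmonic part. *)
Lemma Aplus_harmonic w v : D w -> harmonic P v -> Aplus P w v = Tplus P (Bop P w) (Bop P v).
Proof.
move=> Dw hv; have [Dv _] := hv; have Dv' := conj_field_dom adm Dv.
have [e [he te _]] := harmonic_part adm Dw; have De : D e by case: he.
have hv' := harmonic_conj adm hv; have [_ ov'] := hv'.
have Dwe := DB Dw De.
rewrite (AplusE _ Dv) -[LHS](subrK (energy e (conj_field v))) -(sipBl eip Dw De Dv').
rewrite (sip_herm eip Dv' Dwe) ov'// conjc0 add0r.
rewrite -(Tplus_harmonic adm he Dv').
apply: (block_eq adm Tpb (Bop_dom Dw) (Bop_dom Dv)).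
  exact: trace_eq_sym (traceless_trace_eq adm Dw De te).
apply: trace_eq_trans (trace_eq_conj (Bop_conj adm Dv)) _.
by move=> j; apply: filterE => x _; exact: conjcK.
Qed.

(** For [A = A_+] and [T = T_+] the scattering operator is multiplication by [i]: on
    the trace of [v] the equation of the local solution then reads
    [q = (1 - i) T (B (sol q))], so [S q] is [(2 i + 1 - i) T (B (sol q))], which
    is [i q]. *)
Lemma scattering_defect (q : HSigma' P) v : ndom q -> harmonic P v ->
  (Sop P q - 'i *: q) (Bop P v) = (1 - 'i) *
    ((Aop P (sol q) v - Aplus P (sol q) v) -
     (Top P (Bop P (sol q)) (Bop P v) - Tplus P (Bop P (sol q)) (Bop P v))).
Proof.
move=> Dq hv; have [Dv _] := hv; have [Dw _] := local_solution_spec adm Dq.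
rewrite -[LHS]/(((2%:R * 'i) * Top P (Bop P (sol q)) (Bop P v) + q (Bop P v)) - 'i * q (Bop P v)).
rewrite -(Aplus_harmonic Dw hv) -(local_solution_eq adm Dq Dv).
rewrite -[theta _ _]/(Top P (Bop P (sol q)) (Bop P v)).
set t := Top P _ _; set a := Aop P _ _; set b := Aplus P _ _.
have ii : 'i * 'i = -1 :> C by rewrite -expr2 sqr_i.
transitivity ((1 - 'i) * a + (2%:R * 'i - 'i + 'i * 'i) * t); first by ring.
rewrite ii; ring.
Qed.

Definition harmonic_field p : 'I_J -> GF :=
  xget 0 [set e | harmonic P e /\ trace_eq p (Bop P e)].

Lemma harmonic_field_spec p : HS p ->
  harmonic P (harmonic_field p) /\ trace_eq p (Bop P (harmonic_field p)).
Proof.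
move=> Dp; have [e he pe] := harmonic_lift adm Dp.
have := @xgetPex _ (0 : 'I_J -> GF) [set e | harmonic P e /\ trace_eq p (Bop P e)].
by apply; exists e.
Qed.

Lemma harmonic_field_dom p : HS p -> D (harmonic_field p).
Proof. by move=> Dp; case: (harmonic_field_spec Dp) => -[]. Qed.

Lemma harmonic_field_nrm p : HS p -> en (harmonic_field p) = nH p.
Proof.
by move=> Dp; have [he pe] := harmonic_field_spec Dp; rewrite (HSigma_nrm_harmonic adm he pe).
Qed.

Lemma harmonic_eq u v : harmonic P u -> harmonic P v -> trace_eq (Bop P u) (Bop P v) ->
  en (u - v) = 0.
Proof.
move=> hu hv e; have Du : D u by case: hu.
have Dv : D v by case: hv.
have [_ o] : harmonic P (u - v) by exact: (subspaceB sh).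
rewrite /seminorm_of (o _ (trace_eq_traceless adm Du Dv e)); exact: sqrtr0.
Qed.

Lemma dual_energy_eq (l : HOmega P -> C) u v : ndom (l : dualO) -> D u -> D v ->
  en (u - v) = 0 -> l u = l v.
Proof.
move=> Dl Du Dv e0; have [lin _ _] := Dl; have Dd := DB Du Dv.
have := dual_bound HO0 Dl Dd; rewrite (HOmega_nrm adm Dd) e0 mulr0 => h.
have z : l (u - v) = 0 by apply: Normc.eq0_normc; apply/eqP; rewrite eq_le h normc_ge0.
have := lin (-1) v u Dv Du; rewrite scaleN1r addrC z => /esym/eqP.
by rewrite mulN1r addrC subr_eq0 => /eqP.
Qed.

(** The adjoint of the harmonic extension. *)
Definition harmonic_adjoint (l : HOmega P -> C) : HSigma' P :=
  ext0 HS (fun p => l (harmonic_field p)).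

Lemma harmonic_adjointE l v : ndom (l : dualO) -> harmonic P v ->
  harmonic_adjoint l (Bop P v) = l v.
Proof.
move=> Dl hv; have Dv : D v by case: hv.
have [he ve] := harmonic_field_spec (Bop_dom Dv); have De := harmonic_field_dom (Bop_dom Dv).
rewrite /harmonic_adjoint /ext0 mem_set; last exact: Bop_dom.
apply: (dual_energy_eq Dl De Dv); apply: harmonic_eq => //; exact: trace_eq_sym.
Qed.

Lemma harmonic_adjoint_dom l : ndom (l : dualO) -> ndom (harmonic_adjoint l).
Proof.
move=> Dl; have [lin _ _] := Dl.
apply: (@ext0_dual R (HSigma P) sH (fun p => l (harmonic_field p)) (@nnrm R dualO l)).
- move=> a p q Dp Dq; have Dpq := subspace_comb sH a Dp Dq.
  have [hp pe] := harmonic_field_spec Dp; have [hq qe] := harmonic_field_spec Dq.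
  have [hpq pqe] := harmonic_field_spec Dpq.
  have Dhp := harmonic_field_dom Dp; have Dhq := harmonic_field_dom Dq.
  rewrite -(lin a _ _ Dhp Dhq).
  apply: (dual_energy_eq Dl (harmonic_field_dom Dpq) (DC a Dhp Dhq)).
  apply: (harmonic_eq hpq (subspace_comb sh a hp hq)).
  apply: trace_eq_trans (trace_eq_sym pqe) _.
  apply: trace_eq_trans (trace_eq_comb a pe qe) _.
  exact: trace_eq_sym (Bop_comb adm a Dhp Dhq).
- move=> p Dp; apply: le_trans (dual_bound HO0 Dl (harmonic_field_dom Dp)) _.
  by rewrite (HOmega_nrm adm (harmonic_field_dom Dp)) harmonic_field_nrm.
Qed.

Lemma harmonic_adjoint_comb a (l m : HOmega P -> C) :
  harmonic_adjoint (a *: l + m) = a *: harmonic_adjoint l + harmonic_adjoint m.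
Proof.
apply/funext => p; rewrite -[RHS]/(a * harmonic_adjoint l p + harmonic_adjoint m p).
by rewrite /harmonic_adjoint /ext0; case: ifP => // _; rewrite mulr0 addr0.
Qed.

Lemma bounded_op_energy_eq (F : HOmega P -> dualO) u v : bounded_op F -> D u -> D v ->
  en (u - v) = 0 -> F u = F v.
Proof.
move=> [FD lin [c hc]] Du Dv e0; have Dd := DB Du Dv.
have : F (u - v) = 0.
  apply: (dual_nrm_eq0 HO0 (FD _ Dd)); apply/eqP; rewrite eq_le dual_nrm_ge0 andbT.
  by have := hc _ Dd; rewrite (HOmega_nrm adm Dd) e0 mulr0.
have := lin (-1) v u Dv Du; rewrite scaleN1r addrC => -> /eqP.
by rewrite scaleN1r addrC subr_eq0 => /eqP.
Qed.

Lemma bounded_op_trace_eq (F : HSigma P -> dualS) p q : bounded_op F -> HS p ->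
  trace_eq q p -> F q = F p.
Proof.
move=> [FD lin [c hc]] Dp e; have Dq := HSigma_eq Dp e.
have e0 : trace_eq (-1 *: p + q) (Bop P 0).
  move=> j; apply: filterS2 (e j) (trace0 (open_Omj adm j) (adm_trace adm j)) => x h h0 Gx.
  by rewrite -[LHS]/(-1 * p j x + q j x) h// mulN1r addNr [RHS]h0.
have n0 : nH (-1 *: p + q) = 0.
  by rewrite (HSigma_nrm_harmonic adm (subspace0 sh) e0) (sn0 eip).
have Dd := subspace_comb sH (-1) Dp Dq.
have : F (-1 *: p + q) = 0.
  apply: (dual_nrm_eq0 HS0 (FD _ Dd)); apply/eqP; rewrite eq_le dual_nrm_ge0 andbT.
  by have := hc _ Dd; rewrite n0 mulr0.
rewrite lin// => /eqP; by rewrite scaleN1r addrC subr_eq0 => /eqP.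
Qed.

Lemma sol_comb a (x y : HSigma' P) : ndom x -> ndom y ->
  en (sol (a *: x + y) - (a *: sol x + sol y)) = 0.
Proof.
move=> Dx Dy; have Dxy := subspace_comb (HSigma'_subspace P) a Dx Dy.
have [Du eu] := local_solution_spec adm Dx; have [Dv ev] := local_solution_spec adm Dy.
have [Dw ew] := local_solution_spec adm Dxy; have [[_ lin _] _ _] := adm_AT adm.
have Dc := DC a Du Dv; apply: (AT_inj_energy adm Dw Dc).
rewrite ew (lin a _ _ Du Dv) eu ev; apply/funext => u.
rewrite -[RHS]/(a * adjoint (Bop P) x u + adjoint (Bop P) y u) /adjoint /ext0.
by case: ifP => // _; rewrite mulr0 addr0.
Qed.

Section approximation.
Variables (FA : HOmega P -> dualO) (FT : HSigma P -> dualS) (m n : nat) (al be : R).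
Hypotheses (FA_bounded : bounded_op FA) (FT_bounded : bounded_op FT).
Hypotheses (FA_rank : rank_le FA m) (FT_rank : rank_le FT n).
Hypotheses (al0 : 0 <= al) (be0 : 0 <= be).
Hypothesis FA_close : forall u : HOmega P, ndom u ->
  nnrm ((Aop P u - Aplus P u - FA u) : dualO) <= al * nnrm u.
Hypothesis FT_close : forall p : HSigma P, ndom p ->
  nnrm ((Top P p - Tplus P p - FT p) : dualS) <= be * nnrm p.
Hypothesis DA_dom : forall u, D u -> ndom ((Aop P u - Aplus P u) : dualO).
Hypothesis DT_dom : forall p, HS p -> ndom ((Top P p - Tplus P p) : dualS).

(** The right-hand side of the identity for [S - i], with [A - A_+] and [T - T_+]
    replaced by their approximations of finite rank. *)
Definition scattering_approximant (q : HSigma' P) : HSigma' P :=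
  (1 - 'i) *: (harmonic_adjoint (FA (sol q)) + (-1) *: FT (Bop P (sol q))).

Let sS := HSigma'_subspace P.

Lemma scattering_approximant_dom (q : HSigma' P) : ndom q -> ndom (scattering_approximant q).
Proof.
move=> Dq; have [Dw _] := local_solution_spec adm Dq.
have [FAD _ _] := FA_bounded; have [FTD _ _] := FT_bounded.
apply: (subspaceZ sS); apply: (subspaceD sS).
  by apply: harmonic_adjoint_dom; exact: FAD.
by apply: (subspaceZ sS); exact: (FTD _ (Bop_dom Dw)).
Qed.

Lemma scattering_approximant_linear a x y : ndom x -> ndom y ->
  scattering_approximant (a *: x + y) =
  a *: scattering_approximant x + scattering_approximant y.
Proof.
move=> Dx Dy; have Dxy := subspace_comb sS a Dx Dy.
have [Du _] := local_solution_spec adm Dx; have [Dv _] := local_solution_spec adm Dy.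
have [Dw _] := local_solution_spec adm Dxy; have e := sol_comb a Dx Dy.
have [_ FAL _] := FA_bounded; have [_ FTL _] := FT_bounded.
have Dc := DC a Du Dv.
rewrite /scattering_approximant (bounded_op_energy_eq FA_bounded Dw Dc e) FAL//.
rewrite (bounded_op_trace_eq FT_bounded (subspace_comb sH a (Bop_dom Du) (Bop_dom Dv))); last first.
  apply: trace_eq_trans (Bop_comb adm a Du Dv); apply: (traceless_trace_eq adm Dw Dc).
  exact: (energy_null_traceless adm (DB Dw Dc) e).
rewrite FTL; [|exact: Bop_dom|exact: Bop_dom].
rewrite harmonic_adjoint_comb.
set X := harmonic_adjoint _; set Y := harmonic_adjoint _; set Z := FT _; set T := FT _.
rewrite [-1 *: (_ + _)]scalerDr addrACA !scalerDr !scalerA.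
by congr (_ *: _ + _ *: _ + _); ring.
Qed.

Lemma scattering_approximant_rank : rank_le scattering_approximant (m + n).
Proof.
have [w hw] := FA_rank; have [z hz] := FT_rank.
apply: rank_leZ; apply: rank_leD.
- exists (fun i => harmonic_adjoint (w i)) => q Dq.
  have [Dw _] := local_solution_spec adm Dq; have [c e] := hw _ Dw; exists c.
  rewrite e; apply/funext => p; rewrite [RHS](sum_scale_app c (fun i => harmonic_adjoint (w i))).
  rewrite /harmonic_adjoint /ext0; case: ifP => _; first exact: sum_scale_app.
  by rewrite big1// => i _; rewrite mulr0.
- apply: rank_leZ; exists z => q Dq; have [Dw _] := local_solution_spec adm Dq.
  exact: hz (Bop_dom Dw).
Qed.

Lemma scattering_approximant_close c cw (q : HSigma' P) : 0 <= c ->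
  (forall (y : HSigma' P) (M : R), ndom y -> 0 <= M ->
    (forall v, D v -> normc (y (Bop P v)) <= M * nH (Bop P v)) -> Tinv_norm y <= c * M) ->
  ndom q -> en (sol q) <= cw * Tinv_norm q -> 
  Tinv_norm (Sop P q - 'i *: q - scattering_approximant q) <=
    c * (2 * (al + be) * cw) * Tinv_norm q.
Proof.
move=> c0 hc Dq hw; have [Dw _] := local_solution_spec adm Dq.
have [FAD _ _] := FA_bounded; have [FTD _ _] := FT_bounded.
have T0 : 0 <= Tinv_norm q by exact: sqrtr_ge0.
have ab0 : 0 <= 2 * (al + be) by rewrite mulr_ge0// addr_ge0.
have DA : ndom ((Aop P (sol q) - Aplus P (sol q) - FA (sol q)) : dualO).
  exact: (subspaceB (@dual_subspace R (HOmega P) HO0) (DA_dom Dw) (FAD _ Dw)).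
have DT : ndom ((Top P (Bop P (sol q)) - Tplus P (Bop P (sol q)) - FT (Bop P (sol q))) : dualS).
  exact: (subspaceB (@dual_subspace R (HSigma P) HS0) (DT_dom (Bop_dom Dw)) (FTD _ (Bop_dom Dw))).
have Dy : ndom (Sop P q - 'i *: q - scattering_approximant q).
  apply: (subspaceB sS); last exact: scattering_approximant_dom.
  by apply: (subspaceB sS); [exact: Sop_dom|exact: (subspaceZ sS)].
apply: (@le_trans _ _ (c * (2 * (al + be) * en (sol q)))); last first.
  by rewrite -[c * _ * _]mulrA ler_wpM2l// -[X in _ <= X]mulrA ler_wpM2l.
apply: hc => //; first by rewrite mulr_ge0// sn_ge0.
move=> v Dv; have [e [he te _]] := harmonic_part adm Dv; have De : D e by case: he.
have ve := traceless_trace_eq adm Dv De te.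
rewrite (dual_trace_eq adm Dy (Bop_dom De) ve) (HSigma_nrm_harmonic adm he ve).
have -> : (Sop P q - 'i *: q - scattering_approximant q) (Bop P e) =
  (1 - 'i) * ((Aop P (sol q) - Aplus P (sol q) - FA (sol q) : HOmega P -> C) e -
   (Top P (Bop P (sol q)) - Tplus P (Bop P (sol q)) - FT (Bop P (sol q)) : HSigma P -> C) (Bop P e)).
  rewrite -[LHS]/((Sop P q - 'i *: q) (Bop P e) - scattering_approximant q (Bop P e)).
  rewrite (scattering_defect Dq he).
  rewrite -[scattering_approximant q (Bop P e)]/((1 - 'i) * (harmonic_adjoint (FA (sol q)) (Bop P e) +
    (-1) * FT (Bop P (sol q)) (Bop P e))).
  rewrite (harmonic_adjointE (FAD _ Dw) he).
  rewrite -[(Aop P (sol q) - Aplus P (sol q) - FA (sol q) : HOmega P -> C) e]/(Aop P (sol q) e - Aplus P (sol q) e - FA (sol q) e).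
  rewrite -[(Top P (Bop P (sol q)) - Tplus P (Bop P (sol q)) - FT (Bop P (sol q)) : HSigma P -> C) (Bop P e)]/(Top P (Bop P (sol q)) (Bop P e) - Tplus P (Bop P (sol q)) (Bop P e) - FT (Bop P (sol q)) (Bop P e)).
  ring.
have n2 : normc (1 - 'i : C) <= 2.
  apply: le_trans (normcD _ _) _; rewrite normcN normci.
  by rewrite -[1]/((1 : R)%:C) normcC normr1.
rewrite Normc.normcM -!mulrA; apply: ler_pM; rewrite ?normc_ge0//.
apply: le_trans (normcD _ _) _; rewrite normcN mulrDl lerD//.
- apply: le_trans (dual_bound HO0 DA De) _; rewrite (HOmega_nrm adm De) mulrA ler_wpM2r ?sn_ge0//.
  by rewrite -(HOmega_nrm adm Dw); exact: FA_close.
- apply: le_trans (dual_bound HS0 DT (Bop_dom De)) _.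
  rewrite (HSigma_nrm_harmonic adm he (trefl _)) mulrA ler_wpM2r ?sn_ge0//.
  apply: le_trans (FT_close (Bop_dom Dw)) _; rewrite ler_wpM2l//.
  exact: HSigma_nrm_trace_le.
Qed.

End approximation.

End scattering_compactness.

(** * The truncated scattering operator *)
Lemma subrr_drop (V : zmodType) (a b c e : V) : a - (b + c) - (e - c) = a - b - e.
Proof. by rewrite opprD addrA opprB addrA subrK. Qed.

Section truncated_scattering.
Context {R : realType} {d J : nat} (P : helmholtz R d J).
Local Notation dualO := (dual (HOmega P)).
Local Notation dualS := (dual (HSigma P)).

Hypothesis adm : admissible P.
Let sip := inverse_form_semi_ip adm.
Let sS := HSigma'_subspace P.
Let HS0 (p : HSigma P) : ndom p -> 0 <= nnrm p. Proof. by move=> _; exact: HSigma_nrm_ge0. Qed.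
Let HO0 (u : HOmega P) : ndom u -> 0 <= nnrm u. Proof. by move=> _; exact: sqrtr_ge0. Qed.
Let T0 (q : HSigma' P) : ndom q -> 0 <= nnrm q. Proof. by move=> _; exact: sqrtr_ge0. Qed.
Let Tz : @nnrm R (HSigma' P) 0 = 0.
Proof. by rewrite [LHS]Tinv_normE (sn0 sip). Qed.
Let TB (y z : HSigma' P) : ndom y -> ndom z -> nnrm (y - z) <= nnrm y + nnrm z.
Proof.
move=> Dy Dz; rewrite -[nnrm (y - z)]/(Tinv_norm (y - z)) -[nnrm y]/(Tinv_norm y) -[nnrm z]/(Tinv_norm z).
by rewrite !Tinv_normE; exact: (snB sip).
Qed.

Lemma dual_nrm0 (X : nspace R) : @nnrm R (dual X) 0 = 0.
Proof.
apply/eqP; rewrite eq_le dual_nrm_ge0 andbT; apply: dual_nrm_le => // w Dw.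
by rewrite mul0r Normc.normc0.
Qed.

Lemma dual_nrmB (X : nspace R) (y z : dual X) : (forall u : X, ndom u -> 0 <= nnrm u) ->
  ndom y -> ndom z -> nnrm (y - z) <= nnrm y + nnrm z.
Proof.
move=> X0 Dy Dz; apply: dual_nrm_le; first by rewrite addr_ge0 ?dual_nrm_ge0.
move=> u Du; rewrite -[(y - z) u]/(y u - z u); apply: le_trans (normcD _ _) _.
by rewrite normcN mulrDl lerD//; apply: dual_bound.
Qed.

Lemma Sop_bounded : bounded_op (Sop P).
Proof.
split.
- by move=> u; exact: (Sop_dom adm).
- by move=> a u v; exact: (Sop_linear adm).
- by exists 1 => u Du; rewrite mul1r; exact: (Sop_contraction adm).
Qed.

Lemma rhs_dom : ndom (rhs P).
Proof.
apply: (subspaceZ sS); apply: (Piop_dom adm); apply: (theta_dom adm).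
exact: (@inverse_dom R (HOmega P) _ (AT P) (ell P) (subspace0 (HOmega_subspace adm))).
Qed.

Variables (r : nat) (Kr : HSigma' P -> HSigma' P).
Hypotheses (Kr_bounded : bounded_op Kr) (Kr_rank : rank_le Kr r).
Let Sr (q : HSigma' P) : HSigma' P := 'i *: q + Kr q.
Let dS (q : HSigma' P) : HSigma' P := Sop P q - Sr q.

Lemma truncated_bounded : bounded_op Sr.
Proof.
have [KD KL [c hc]] := Kr_bounded; split.
- by move=> u Du; apply: (subspace_comb sS) => //; exact: KD.
- move=> a u v Du Dv; rewrite /Sr KL// !scalerDr !scalerA ['i * a]mulrC addrACA//.
exists (1 + c) => u Du; rewrite -[nnrm (Sr u)]/(Tinv_norm (Sr u)) Tinv_normE.
apply: le_trans (snD sip (subspaceZ sS _ Du) (KD _ Du)) _.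
rewrite (snZ sip)// normci mulrDl lerD//; first by rewrite -Tinv_normE.
by rewrite -Tinv_normE; exact: hc.
Qed.

Lemma truncation_error_bounded : bounded_op dS.
Proof. by apply: (bounded_opB sS TB); [exact: Sop_bounded|exact: truncated_bounded]. Qed.

Local Notation DA := ((fun u => Aop P u - Aplus P u) : HOmega P -> dualO).
Local Notation DT := ((fun q => Top P q - Tplus P q) : HSigma P -> dualS).

(** [S - S_r = (S - i) - K_r], and approximations of rank at most [m] of [A - A_+]
    and [T - T_+] give one of [S - i] of rank at most [2 m]. *)
Lemma truncation_error_singular : bounded_op DA -> bounded_op DT ->
  exists2 c, 0 <= c & forall m,
    singular_value dS (r + m.*2).+1 <= c * (singular_value DA m.+1 + singular_value DT m.+1).
Proof.
move=> bA bT; have [c0 c00 hc0] := Tinv_le_dual adm.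
have [cw cw0 hcw] := local_solution_bounded adm.
pose c := c0 * 2 * cw.
have c_ge0 : 0 <= c by rewrite !mulr_ge0// ltW.
exists c => // m; apply/ler_addgt0Pr => e e0.
have c1 : 0 < c * 2 + 1 by rewrite ltr_wpDl// mulr_ge0.
set sA := singular_value DA m.+1; set sT := singular_value DT m.+1.
have sA0 : 0 <= sA by exact: singular_value_ge0.
have sT0 : 0 <= sT by exact: singular_value_ge0.
pose e' := e / (c * 2 + 1); have e'0 : 0 < e' by rewrite divr_gt0.
have sdO : subspace (@ndom R dualO) by exact: dual_subspace HO0.
have sdS : subspace (@ndom R dualS) by exact: dual_subspace HS0.
have [FA [bFA [mA mAm rFA] hFA]] := singular_value_approx HO0 sdO (dual_nrm0 _)
  (fun y z => dual_nrmB HO0) bA (ltn0Sn m) e'0.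
have [FT [bFT [mT mTm rFT] hFT]] := singular_value_approx HS0 sdS (dual_nrm0 _)
  (fun y z => dual_nrmB HS0) bT (ltn0Sn m) e'0.
have al0 : 0 <= sA + e' by rewrite addr_ge0// ltW.
have be0 : 0 <= sT + e' by rewrite addr_ge0// ltW.
have [ADom _ _] := bA; have [TDom _ _] := bT.
pose Phi := scattering_approximant FA FT.
have close (q : HSigma' P) : ndom q ->
    Tinv_norm (Sop P q - 'i *: q - Phi q) <= c * ((sA + e') + (sT + e')) * Tinv_norm q.
  move=> Dq.
  have := scattering_approximant_close adm bFA bFT al0 be0 hFA hFT ADom TDom (ltW c00) hc0 Dq (hcw _ Dq).
  by rewrite /c; congr (_ <= _); ring.
have PhiD q : ndom q -> ndom (Phi q) by exact: scattering_approximant_dom.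
have iD q : ndom q -> ndom (Sop P q - 'i *: q : HSigma' P).
  by move=> Dq; apply: (subspaceB sS); [exact: (Sop_dom adm)|exact: (subspaceZ sS)].
have bPhi : bounded_op Phi.
  split; [exact: PhiD|by move=> a x y; exact: (scattering_approximant_linear adm)|].
  exists (2 + c * ((sA + e') + (sT + e'))) => q Dq.
  have -> : Phi q = (Sop P q - 'i *: q) - (Sop P q - 'i *: q - Phi q).
    by rewrite opprB addrC subrK.
  apply: le_trans (TB (iD _ Dq) (subspaceB sS (iD _ Dq) (PhiD _ Dq))) _.
  rewrite mulrDl lerD//; last exact: close.
  apply: le_trans (TB (Sop_dom adm Dq) (subspaceZ sS _ Dq)) _.
  rewrite mulrDl mul1r lerD//; first exact: (Sop_contraction adm).
  rewrite -[nnrm ('i *: q)]/(Tinv_norm _) -[nnrm q]/(Tinv_norm _) !Tinv_normE (snZ sip)//.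
  by rewrite normci mul1r.
apply: (@le_trans _ _ (c * ((sA + e') + (sT + e')))).
  apply: (@singular_value_le _ _ _ _ (fun q => Phi q - Kr q) _ (mA + mT + r)).
  - by apply: (bounded_opB sS TB).
  - have -> : (fun q => Phi q - Kr q) = (fun q => Phi q + (-1) *: Kr q).
      by apply/funext => q; rewrite scaleN1r.
    apply: rank_leD; last exact: rank_leZ.
    exact: (scattering_approximant_rank adm).
  - by rewrite addnC ltnS leq_add2l -addnn leq_add// -ltnS.
  - by rewrite mulr_ge0// addr_ge0.
  move=> q Dq; have -> : dS q - (Phi q - Kr q) = Sop P q - 'i *: q - Phi q.
    exact: subrr_drop.
  exact: close.
have -> : c * (sA + e' + (sT + e')) = c * (sA + sT) + c * 2 * e' by ring.
rewrite lerD2l /e' mulrA ler_pdivrMr// [leRHS]mulrC ler_pM2r//; lra.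
Qed.

(** Only with a finite sum does the real number that stands for the Schatten norm
    bound the partial sums of powers of singular values. *)
Lemma truncation_error_summable (p : R) : 1 <= p -> schatten p DA -> schatten p DT ->
  (schatten_sum p dS < +oo)%E.
Proof.
move=> p1 [[bA _] fA] [[bT _] fT]; have [c c0 hc] := truncation_error_singular bA bT.
have anti i j : (i <= j)%N -> singular_value dS j.+1 <= singular_value dS i.+1.
  by move=> ij; apply: (singular_value_antitone T0 sS Tz TB truncation_error_bounded (ltn0Sn i)).
have [M hM] := @power_sum_bounded R (fun j => singular_value dS j.+1)
  (fun j => singular_value DA j.+1) (fun j => singular_value DT j.+1) p c _ _ r p1 c0
  (fun j => singular_value_ge0 _ _) (fun j => singular_value_ge0 _ _)
  (fun j => singular_value_ge0 _ _)
  anti hc (fun n => schatten_partial n fA) (fun n => schatten_partial n fT).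
exact: schatten_finite hM.
Qed.

Lemma gamma_star_le (q : HSigma' P) : ndom q ->
  gamma_star P * Tinv_norm q <= Tinv_norm (Id_plus_Pi (Sop P) q).
Proof.
move=> Dq; have [->|q0] := eqVneq q 0.
  rewrite -[Tinv_norm 0]/(@nnrm R (HSigma' P) 0) Tz mulr0; exact: sqrtr_ge0.
have n0 : 0 < Tinv_norm q.
  rewrite lt_def sqrtr_ge0 andbT; apply: contra_neq q0 => h.
  by apply: (inverse_form_definite adm Dq); rewrite -Tinv_normE.
rewrite -ler_pdivlMr//; apply: ge_inf; last by exists q.
by exists 0 => _ [z _ <-]; rewrite divr_ge0 ?sqrtr_ge0.
Qed.

End truncated_scattering.

(** * The convergence bound *)
Theorem corollary6p5 (R : realType) (d J : nat) (P : helmholtz R d J)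
  (kappa_gt0 : 0 < kappa P)
  (kappas_ge0 : 0 <= kappas P)
  (Om_bounded : bounded_set (Om P))
  (Om_lipschitz : lipschitz_open (Om P))
  (Omj_lipschitz : forall j, lipschitz_open (Omj P j))
  (Omj_sub : forall j, Omj P j `<=` Om P)
  (Omj_disjoint : trivIset setT (Omj P))
  (Omj_cover : closure (Om P) = \bigcup_j closure (Omj P j))
  (source_L2 : L2 (leb d.+1) (Om P) (source P))
  (Bj_trace : forall j,
     dirichlet_trace (kappa P) (Omj P j) (bd (Omj P j)) (Bj P j))
  (Sigma_trace : dirichlet_trace (kappa P) (Om P) (Sigma P) (trSigma P))
  (well_posed : (0 < inf_sup_constant P)%E)
  (Tplusj_DtN : forall j, dirichlet_to_neumann P j)
  (Tj_bounded : forall j,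
     bounded_op (Tj P j : Hhalf P j -> dual (Hhalf P j)))
  (T_positive : hermitian_positive P)
  (T_compact :
     compact_op ((fun q => Top P q - Tplus P q) : HSigma P -> dual (HSigma P)))
  (AT_invertible : boundedly_invertible (AT P))
  (p : R) (p_ge1 : 1 <= p)
  (A_schatten :
     schatten p ((fun u => Aop P u - Aplus P u) : HOmega P -> dual (HOmega P)))
  (T_schatten :
     schatten p ((fun q => Top P q - Tplus P q) : HSigma P -> dual (HSigma P)))
  (r : nat) (Kr : HSigma' P -> HSigma' P)
  (Kr_bounded : bounded_op Kr)
  (Kr_rank : has_rank Kr r) :
  let Sr : HSigma' P -> HSigma' P := fun q => 'i%C *: q + Kr q in
  let dS : HSigma' P -> HSigma' P := fun q => Sop P q - Sr q in
  let IPS : HSigma' P -> HSigma' P := Id_plus_Pi (Sop P) in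
  let IPSr : HSigma' P -> HSigma' P := Id_plus_Pi Sr in
  let sigma1 := singular_value dS 1 in
  let gamma := gamma_star P in
  forall (sigma1_lt : sigma1 < gamma)
    (p0 : HSigma' P) (p0_dom : ndom p0) (r0_neq0 : rhs P - IPS p0 != 0)
    (n : nat) (n_ge1 : (1 <= n)%N)
    (pn : HSigma' P)
    (pn_gmres : gmres_iterate (fun q => inverse IPSr (IPS q))
                  (inverse IPSr (rhs P)) p0 n pn),
  let x := schatten_norm p dS / (gamma * n%:R `^ p^-1) in
  Tinv_norm (rhs P - IPS pn) / Tinv_norm (rhs P - IPS p0) <=
    ((2 + sigma1) / (gamma - sigma1)) * (x + x ^+ 2) ^+ n *
    (1 - sigma1 / gamma) ^- n.
Proof.
move=> Sr dS IPS IPSr sigma1 gamma sigma1_lt p0 p0_dom r0_neq0 n n_ge1 pn [pn_krylov pn_min].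
cbv zeta; set x := schatten_norm p dS / (gamma * n%:R `^ p^-1).
have adm : admissible P by split.
have [Kr_r _] := Kr_rank.
have sip := inverse_form_semi_ip adm; have sS := HSigma'_subspace P.
have T0 (q : HSigma' P) : ndom q -> 0 <= nnrm q by move=> _; exact: sqrtr_ge0.
have Tz : @nnrm R (HSigma' P) 0 = 0 by rewrite [LHS]Tinv_normE (sn0 sip).
have TB (y z : HSigma' P) : ndom y -> ndom z -> nnrm (y - z) <= nnrm y + nnrm z.
  move=> Dy Dz; rewrite -[nnrm (y - z)]/(Tinv_norm (y - z)) -[nnrm y]/(Tinv_norm y) -[nnrm z]/(Tinv_norm z).
  by rewrite !Tinv_normE; exact: (snB sip).
have dS_bounded : bounded_op dS by exact: (truncation_error_bounded adm).
have [KrD KrL _] := Kr_bounded.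
have SD := Sop_dom adm; have PiD := Piop_dom adm.
have SL (a : R[i]) (u v : HSigma' P) := @Sop_linear _ _ _ _ adm a u v.
have PiL (a : R[i]) (u v : HSigma' P) := @Piop_linear _ _ _ _ adm a u v.
have Pi_iso (q : HSigma' P) : ndom q ->
    seminorm_of (@inverse_form R d J P) (Piop P q) = seminorm_of (@inverse_form R d J P) q.
  by rewrite -!Tinv_normE; exact: Piop_isometry.
have S_contr (q : HSigma' P) : ndom q ->
    seminorm_of (@inverse_form R d J P) (Sop P q) <= seminorm_of (@inverse_form R d J P) q.
  by rewrite -!Tinv_normE; exact: Sop_contraction.
have g_le (q : HSigma' P) : ndom q ->
    gamma * seminorm_of (@inverse_form R d J P) q <= seminorm_of (@inverse_form R d J P) (IPS q).
  by rewrite -!Tinv_normE; exact: (gamma_star_le adm).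
have dS_le (q : HSigma' P) : ndom q ->
    seminorm_of (@inverse_form R d J P) (dS q) <= sigma1 * seminorm_of (@inverse_form R d J P) q.
  by rewrite -!Tinv_normE; exact: (singular_value1 T0 sS Tz TB dS_bounded).
have s10 : 0 <= sigma1 by exact: singular_value_ge0.
have def := inverse_form_definite adm.
have surj := truncated_operator_surjective sip def PiD PiL Pi_iso (Piop_involutive adm) SD KrD KrL Kr_r g_le dS_le sigma1_lt.
have invP (y : HSigma' P) : ndom y -> ndom (inverse IPSr y) /\ IPSr (inverse IPSr y) = y.
  by move=> Dy; apply: inverse_spec; exact: surj.
have min' (c : 'I_n -> R[i]) :
    seminorm_of (@inverse_form R d J P) (inverse IPSr (rhs P) - inverse IPSr (IPS pn)) <=
    seminorm_of (@inverse_form R d J P) (inverse IPSr (rhs P) - inverse IPSr (IPS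
      (p0 + \sum_k c k *: iter k (fun q => inverse IPSr (IPS q)) (inverse IPSr (rhs P) - inverse IPSr (IPS p0))))).
  by rewrite -!Tinv_normE; apply: pn_min; exists c.
pose s j := singular_value dS j.+1.
have s0 j : 0 <= s j by exact: singular_value_ge0.
have sP j (e : R) : 0 < e -> exists F : HSigma' P -> HSigma' P, [/\ linear_on (@ndom R (HSigma' P)) F,
  exists k (w : 'I_k -> HSigma' P), (k <= j)%N /\
    forall u, ndom u -> exists c : 'I_k -> R[i], F u = \sum_i c i *: w i
  & forall u, ndom u -> seminorm_of (@inverse_form R d J P) (dS u - F u) <=
      (s j + e) * seminorm_of (@inverse_form R d J P) u].
  move=> e0; have [F [[FD FL _] [m mj [w hw]] hF]] := singular_value_approx T0 sS Tz TB dS_bounded (ltn0Sn j) e0.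
  exists F; split; [exact: FL|by exists m, w|].
  by move=> u Du; rewrite -!Tinv_normE; exact: hF.
have := preconditioned_residual sip def PiD PiL Pi_iso SD SL S_contr KrD KrL
  g_le dS_le sigma1_lt s10 (rhs_dom adm) p0_dom invP pn_krylov min' s0 sP.
rewrite -!Tinv_normE => bound.
have g0 : 0 < gamma by exact: le_lt_trans s10 sigma1_lt.
have IPSD (q : HSigma' P) : ndom q -> ndom (IPS q).
  by move=> Dq; apply: (subspaceD sS) => //; apply: PiD; exact: SD.
have r0 : 0 < Tinv_norm (rhs P - IPS p0).
  rewrite lt_def sqrtr_ge0 andbT; apply: contra_neq r0_neq0; rewrite Tinv_normE; apply: def.
  by apply: (subspaceB sS); [exact: rhs_dom|exact: IPSD].
rewrite ler_pdivrMr//; apply: le_trans bound _; rewrite ler_wpM2r ?(ltW r0)//.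
rewrite ler_wpM2r//.
  by rewrite invr_ge0 exprn_ge0// subr_ge0 ler_pdivrMr// mul1r ltW.
rewrite ler_wpM2l//.
  by apply: divr_ge0; [exact: addr_ge0|rewrite subr_ge0 ltW].
have fin := truncation_error_summable adm Kr_bounded Kr_r p_ge1 A_schatten T_schatten.
exact: (singular_product_bound n_ge1 p_ge1 g0 s0 (schatten_partial n fin) (erefl x)).
Qed.
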